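(* Let $\Omega$ be a bounded domain of class $C^{1,1}$ in $\mathbb{R}^N$, $N\ge2$. Then there exists $s_*=s_*(\Omega)>\frac12$ such that $$\lambda^*(s,\Omega)\ge0\quad\text{for all }s\in\left(\tfrac12,\,s_*(\Omega)\right).$$ Moreover, $$\lim_{s\to\frac12^+}\lambda^*(s,\Omega)=0.$$
   Context: The parameter $s$ ranges in $(\frac12,1)$. $\delta(x)=\mathrm{dist}(x,\partial\Omega)$; $c_{N,s}=2^{2s}\pi^{-N/2}s\,\Gamma(\frac{N+2s}{2})/\Gamma(1-s)$. Let $H^s(\Omega)$ be the space of $u\in L^2(\Omega)$ with $(u(x)-u(y))|x-y|^{-(N+2s)/2}\in L^2(\Omega\times\Omega)$, with norm given by $\|u\|_{H^s(\Omega)}^2=\|u\|_{L^2(\Omega)}^2+[u]_s$, where $[u]_s=\frac{c_{N,s}}{2}\iint_{\Omega\times\Omega}\frac{(u(x)-u(y))^2}{|x-y|^{N+2s}}\,dx\,dy$; $H^s_0(\Omega)$ is the completion of $C_c^\infty(\Omega)$ in $H^s(\Omega)$. The constant is $\mathfrak{h}_{N,s}=c_{N,s}\kappa_{N,2s}$ with $$\kappa_{N,2s}=\pi^{\frac{N-1}{2}}\frac{\Gamma(\frac{1+2s}{2})}{\Gamma(\frac{N+2s}{2})}\frac{1}{2s}\left[\frac{2^{1-2s}}{\sqrt{\pi}}\Gamma(1-s)\Gamma\Big(\frac{1+2s}{2}\Big)-1\right].$$ The number $\lambda^*(s,\Omega)$ is $$\lambda^*(s,\Omega)=\inf_{u\in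 H^s_0(\Omega)\setminus\{0\}}\frac{[u]_s-\mathfrak{h}_{N,s}\int_\Omega u^2\delta^{-2s}\,dx}{\int_\Omega u^2\,dx}.$$ *)

(* Defs.v *)
From HB Require Import structures.
From mathcomp Require Import all_boot all_order all_algebra.
From mathcomp Require Import all_classical all_reals all_analysis.

Set Implicit Arguments.
Unset Strict Implicit.
Unset Printing Implicit Defensive.
Import Order.TTheory GRing.Theory Num.Theory.
Import numFieldNormedType.Exports.
Local Open Scope classical_set_scope.
Local Open Scope ring_scope.

(* ['rV[R]_n] carries the sigma-algebra generated by its n coordinates (as the
   library does for n.-tuple), that is, the Borel sets of R^n. *)
Definition rV_display : measure_display -> measure_display.
Proof. exact. Qed.

Section measurable_rV.
Context {R : realType} (n : nat).

Definition rV_coord (i : 'I_n) (x : 'rV[R]_n) : measurableTypeR R := x ord0 i.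

Let rV_set0 : g_sigma_preimage rV_coord set0.
Proof. exact: sigma_algebra0. Qed.

Let rV_setC A : g_sigma_preimage rV_coord A -> g_sigma_preimage rV_coord (~` A).
Proof. exact: sigma_algebraC. Qed.

Let rV_bigcup (F : _^nat) : (forall i, g_sigma_preimage rV_coord (F i)) ->
  g_sigma_preimage rV_coord (\bigcup_i (F i)).
Proof. exact: sigma_algebra_bigcup. Qed.

HB.instance Definition _ := @isMeasurable.Build
  (rV_display default_measure_display) 'rV[R]_n (g_sigma_preimage rV_coord)
  rV_set0 rV_setC rV_bigcup.

Lemma measurable_rV_coord (i : 'I_n) : measurable_fun [set: 'rV[R]_n] (rV_coord i).
Proof.
move=> _ Y mY; rewrite setTI; apply: sub_sigma_algebra => /=.
rewrite -bigcup_seq/=; exists i => /=; first by rewrite mem_index_enum.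
by exists Y => //; rewrite setTI.
Qed.

Lemma measurable_fun_rVP d (T : measurableType d) (f : T -> 'rV[R]_n) :
  (forall i, measurable_fun [set: T] (rV_coord i \o f)) ->
  measurable_fun [set: T] f.
Proof.
move=> mf _ Y mY; rewrite setTI.
suff: g_sigma_preimage rV_coord `<=` [set A | measurable (f @^-1` A)] by exact.
apply: smallest_sub => /=.
  split => /= [|A mA|F mF].
  - by rewrite preimage_set0.
  - by rewrite setTD preimage_setC; exact: measurableC.
  - by rewrite preimage_bigcup; exact: bigcupT_measurable.
rewrite -bigcup_seq; apply: bigcup_sub => i _ A [B mB <-] /=.
rewrite setTI -comp_preimage -[X in measurable X]setTI; exact: mf.
Qed.

End measurable_rV.

Section lebesgue_rV.
Context {R : realType}.

Definition cons_rV n (p : measurableTypeR R * 'rV[R]_n) : 'rV[R]_n.+1 :=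
  \row_(i < n.+1) oapp (fun j => p.2 ord0 j) (p.1 : R) (unlift ord0 i).

Lemma measurable_cons_rV n : measurable_fun setT (@cons_rV n).
Proof.
apply: measurable_fun_rVP => i.
have [j ->|->] := unliftP ord0 i.
- rewrite (_ : _ \o _ = @rV_coord R n j \o snd).
    exact: (measurableT_comp (@measurable_rV_coord R n j) measurable_snd).
  by apply/funext => p /=; rewrite /rV_coord mxE liftK.
- rewrite (_ : _ \o _ = fst); first exact: measurable_fst.
  by apply/funext => p /=; rewrite /rV_coord mxE unlift_none.
Qed.

HB.instance Definition _ n :=
  isMeasurableFun.Build _ _ _ _ (@cons_rV n) (@measurable_cons_rV n).

Local Open Scope ereal_scope.

Section succ.
Variables (n : nat) (m : {sigma_finite_measure set 'rV[R]_n -> \bar R}).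

Definition lebesgue_rV_succ : set 'rV[R]_n.+1 -> \bar R :=
  pushforward (@lebesgue_measure R \x m) (@cons_rV n).

Let succ0 : lebesgue_rV_succ set0 = 0.
Proof. exact: measure0. Qed.

Let succ_ge0 A : 0 <= lebesgue_rV_succ A.
Proof. exact: measure_ge0. Qed.

Let succ_sigma_additive : semi_sigma_additive lebesgue_rV_succ.
Proof. exact: measure_semi_sigma_additive. Qed.

HB.instance Definition _ := isMeasure.Build _ _ _ lebesgue_rV_succ
  succ0 succ_ge0 succ_sigma_additive.

Let uncons (x : 'rV[R]_n.+1) : measurableTypeR R * 'rV[R]_n :=
  (x ord0 ord0, \row_j x ord0 (lift ord0 j)).

Let cons_rVK : cancel (@cons_rV n) uncons.
Proof.
move=> [t x]; rewrite /uncons /cons_rV; congr (_, _).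
  by rewrite mxE unlift_none.
by apply/rowP => j; rewrite !mxE liftK.
Qed.

Let measurable_uncons : measurable_fun setT uncons.
Proof.
apply/measurable_fun_pairP; split.
  exact: (@measurable_rV_coord R n.+1 ord0).
apply: measurable_fun_rVP => j.
rewrite (_ : _ \o _ = @rV_coord R n.+1 (lift ord0 j)).
  exact: measurable_rV_coord.
by apply/funext => x /=; rewrite /rV_coord /= mxE.
Qed.

Let succ_sigma_finite : sigma_finite setT lebesgue_rV_succ.
Proof.
have /sigma_finiteP[F [FT ndF Foo]] := sigma_finiteT (@lebesgue_measure R).
have /sigma_finiteP[G [GT ndG Goo]] := sigma_finiteT m.
exists (fun k => uncons @^-1` (F k `*` G k)).
  rewrite -preimage_bigcup (_ : \bigcup_k _ = setT) ?preimage_setT//.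
  rewrite -subTset => -[t x] _.
  have [i _ Fi] : (\bigcup_i F i) t by rewrite -FT.
  have [j _ Gj] : (\bigcup_j G j) x by rewrite -GT.
  exists (maxn i j) => //; split => /=.
  - by move: Fi; exact/subsetPset/ndF/leq_maxl.
  - by move: Gj; exact/subsetPset/ndG/leq_maxr.
move=> k; have [mF Fk] := Foo k; have [mG Gk] := Goo k; split.
  by rewrite -[X in measurable X]setTI; apply: measurable_uncons => //;
    exact: measurableX.
rewrite /lebesgue_rV_succ /pushforward -comp_preimage.
rewrite (_ : uncons \o _ = id) ?preimage_id; last exact/funext/cons_rVK.
by rewrite product_measure1E// lte_mul_pinfty// ge0_fin_numE.
Qed.

HB.instance Definition _ := Measure_isSigmaFinite.Build _ _ _ lebesgue_rV_succ
  succ_sigma_finite.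

End succ.

(* Lebesgue measure on R^n, as the n-fold product of the one-dimensional one. *)
Fixpoint lebesgue_rV n : {sigma_finite_measure set 'rV[R]_n -> \bar R} :=
  match n with
  | 0 => dirac (0%R : 'rV[R]_0)
  | n.+1 => lebesgue_rV_succ (lebesgue_rV n)
  end.

End lebesgue_rV.

Section domains.
Context {R : realType} {N : nat}.
Implicit Types (x y : 'rV[R]_N) (Omega : set 'rV[R]_N).

(* The library norm on ['rV[R]_N] is the sup norm; it induces the same topology. *)
Definition enorm n (x : 'rV[R]_n) : R := Num.sqrt (\sum_(i < n) x ord0 i ^+ 2).

Definition boundary Omega : set 'rV[R]_N := closure Omega `\` interior Omega.

Definition bdist Omega x : R := inf [set enorm (x - y) | y in boundary Omega].

Definition domain Omega := [/\ Omega !=set0, open Omega & connected Omega].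

Definition partial n (i : 'I_n) (f : 'rV[R]_n -> R) : 'rV[R]_n -> R :=
  fun y : 'rV[R]_n => 'D_(delta_mx ord0 i) f y.

Definition C11_fun n (g : 'rV[R]_n -> R) :=
  (forall y : 'rV[R]_n, differentiable g y) /\ (forall i, lipschitz (partial i g)).

(* Near each boundary point, in suitable orthonormal coordinates
   (x *m P, x *m nu) of R^(N-1) x R, Omega is the region above the graph of a
   C^{1,1} function. *)
Definition class_C11 Omega := forall x0, boundary Omega x0 ->
  exists (P : 'M[R]_(N, N.-1)) (nu : 'cV[R]_N) (g : 'rV[R]_N.-1 -> R) (r : R),
    [/\ (row_mx P nu)^T *m row_mx P nu = 1%:M, C11_fun g, 0 < r &
      forall x, enorm (x - x0) < r ->
        (Omega x <-> g (x *m P) < (x *m nu) ord0 ord0)].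

(* C^oo: every iterated partial derivative is differentiable everywhere. *)
Definition smooth (f : 'rV[R]_N -> R) :=
  forall (l : seq 'I_N) x, differentiable (foldr (@partial N) f l) x.

Definition test_fun Omega (phi : 'rV[R]_N -> R) :=
  let supp := closure [set x | phi x != 0] in
  [/\ smooth phi, compact supp & supp `<=` Omega].

End domains.

Section constants.
Context {R : realType}.

(* Euler's Gamma function, for z > 0. *)
Definition Gamma (z : R) : R :=
  \int[lebesgue_measure]_(t in `]0, +oo[%classic) (t `^ (z - 1) * expR (- t)).

Definition c_const (N : nat) (s : R) : R :=
  2 `^ (2 * s) * pi `^ (- (N%:R / 2)) * s
  * (Gamma ((N%:R + 2 * s) / 2) / Gamma (1 - s)).

(* [kappa N s] is the constant usually written kappa_{N,2s}. *)
Definition kappa (N : nat) (s : R) : R :=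
  pi `^ ((N%:R - 1) / 2) * (Gamma ((1 + 2 * s) / 2) / Gamma ((N%:R + 2 * s) / 2))
  * (2 * s)^-1
  * (2 `^ (1 - 2 * s) / Num.sqrt pi * Gamma (1 - s) * Gamma ((1 + 2 * s) / 2) - 1).

Definition hardy_const (N : nat) (s : R) : R := c_const N s * kappa N s.

End constants.

(* Elements of L^2 and H^s are represented by functions that are measurable on
   the domain; values outside the domain are irrelevant. *)
Section fractional_sobolev.
Context {R : realType} {N : nat}.
Variables (s : R) (Omega : set 'rV[R]_N).
Implicit Types u : 'rV[R]_N -> R.

Local Notation mu := (@lebesgue_rV R N).
Local Notation mu2 := (mu \x mu)%E.

Definition L2 d (T : measurableType d) (m : set T -> \bar R) (D : set T)
    (f : T -> R) :=
  measurable_fun D f /\ (\int[m]_(x in D) ((f x) ^+ 2)%:E < +oo)%E.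

Definition in_Hs u :=
  L2 mu Omega u /\
  L2 mu2 (Omega `*` Omega)
    (fun z => (u z.1 - u z.2) * enorm (z.1 - z.2) `^ (- ((N%:R + 2 * s) / 2))).

Definition sqnorm_L2 u : \bar R := \int[mu]_(x in Omega) ((u x) ^+ 2)%:E.

Definition seminorm u : \bar R :=
  ((c_const N s / 2)%:E * \int[mu2]_(z in Omega `*` Omega)
     ((u z.1 - u z.2) ^+ 2 / enorm (z.1 - z.2) `^ (N%:R + 2 * s))%:E)%E.

Definition sqnorm_Hs u : \bar R := (sqnorm_L2 u + seminorm u)%E.

(* H^s is complete, so that the completion of C_c^oo(Omega) in it is the
   closure. *)
Definition in_H0s u := in_Hs u /\
  forall eps : R, 0 < eps ->
    exists2 phi, test_fun Omega phi & (sqnorm_Hs (u \- phi)%R < (eps ^+ 2)%:E)%E.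

Definition hardy_term u : \bar R :=
  \int[mu]_(x in Omega) ((u x) ^+ 2 * bdist Omega x `^ (- (2 * s)))%:E.

Definition rayleigh u : \bar R :=
  ((seminorm u - (hardy_const N s)%:E * hardy_term u) / sqnorm_L2 u)%E.

Definition lambda_star : \bar R :=
  ereal_inf [set rayleigh u |
    u in [set u | in_H0s u /\ ~ {ae mu, forall x, Omega x -> u x = 0}]].

End fractional_sobolev.

(* Main.v *)
(* Write [s = 1/2 + t]. If a positive function [w] satisfies
    [L w >= h dist^(-1-2t) w] for the regional fractional Laplacian [L], then AM-GM
    (the ground state representation) gives the Hardy inequality with constant [h] for
    test functions, and for all of [H^s_0] by density. Near the boundary
    [w = d^t - t d^(1/4)] works, [d] being the distance truncated at a small depth:
    the profile [d^t] is the extremal of the half-space, and [- t d^(1/4)] has a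
    strictly positive [L] there, which gains a term of order [t d^(-3/4-2t)]; the error
    due to the curvature is also of order [t] but has a milder singularity, because a
    C^{1,1} boundary satisfies a two-sided uniform ball condition. Away from the boundary
    the constant [h = O(t^2)] is beaten by a mass of order [t].

    For the upper bound, average [m] smooth cutoffs living at the scales [4^-j] from the
    boundary. At [s = 1/2] each one has energy [O(1)] and they are almost orthogonal, so
    that the average has energy [O(1/m)] and norm bounded below. *)

Require Import Defs.
From HB Require Import structures.
From mathcomp Require Import all_boot all_order all_algebra.
From mathcomp Require Import all_classical all_reals all_analysis.
From mathcomp Require Import measurable_realfun ring lra.
Import Order.TTheory GRing.Theory Num.Theory.
Import numFieldNormedType.Exports.
Local Open Scope classical_set_scope.
Local Open Scope ring_scope.

Set Implicit Arguments.
Unset Strict Implicit.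
Unset Printing Implicit Defensive.

(** The constant [h] is exactly that of the half-space profile [d^t], so nothing may be lost at
    leading order: the half-space integral is computed in closed form and must reproduce [kappa].
    The obstacle is that [L w] is a principal value. The kernel is therefore regularized by adding
    [e > 0] to the squared distance, every inequality is stated with nonnegative integrals on both
    sides, and the integral that blows up as [e] tends to 0, [Qint t e 0], cancels as a finite
    number. No limit in [e] is taken: [e] is fixed after the support of the test function, and the
    regularized kernel lies below the true one.

    Smallness in [t] comes from [x^t] being nearly constant: its increments are at most [t] times a
    power of a ratio. The exponents of these ratios are chosen so that the curvature error carries
    [X^(3/4)], [X] being the squared distance. It integrates to order [t d^(-1/4 - 2t)], which the
    gain [t d^(-3/4 - 2t)] beats for small [d], uniformly in [t].

    For the upper bound the test function is fixed before [t], so that the factor [l^(-2t)] of its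
    energy stays below 2. *)

Ltac pos := lazymatch goal with
  | |- is_true (0 <= _ ^+ 2)%R => exact: sqr_ge0
  | |- is_true (0 <= _ ^+ _)%R => apply: exprn_ge0; pos
  | |- is_true (0 <= _ `^ _)%R => exact: powR_ge0
  | |- is_true (0 <= `|_|)%R => exact: normr_ge0
  | |- is_true (0 <= _%:R)%R => exact: ler0n
  | |- is_true (0 < _%:R)%R => by rewrite ltr0n
  | |- is_true (0 <= _^-1)%R => rewrite invr_ge0; pos
  | |- is_true (0 <= _ * _)%R => apply: mulr_ge0; pos
  | |- is_true (0 <= _ + _)%R => first [apply: addr_ge0; pos | lra]
  | |- is_true (0 <= _)%R => first [assumption | apply: ltW; assumption | by [] | lra]
  | |- is_true (0 < _ ^+ _)%R => apply: exprn_gt0; pos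
  | |- is_true (0 < _ `^ _)%R => apply: powR_gt0; pos
  | |- is_true (0 < _^-1)%R => rewrite invr_gt0; pos
  | |- is_true (0 < _ * _)%R => apply: mulr_gt0; pos
  | |- is_true (0 < _ + _)%R =>
      first [apply: addr_gt0; pos | apply: ltr_wpDl; pos | apply: ltr_wpDr; pos | lra]
  | |- is_true (0 < _)%R => first [assumption | by [] | lra]
  | |- is_true (_ \is _) => rewrite ?nnegrE ?posrE; pos
  end.

(** * Euclidean geometry and Lebesgue measure on row vectors *)

Section affine.
Context {R : realType}.
Local Notation leb := (@lebesgue_measure R).
Local Open Scope ereal_scope.

Lemma measurable_affine (c a : R) :
  measurable_fun [set: measurableTypeR R] (fun t : R => c * t + a : measurableTypeR R)%R.
Proof. by apply: measurable_funD => //; exact: measurable_funM. Qed.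

(** The pushforward of Lebesgue measure under [t |-> c t + a], multiplied by [c], gives each
    interval []x, y]] its length, so uniqueness applies. *)
Lemma lebesgue_measure_affine (c a : R) (A : set R) : (0 < c)%R -> measurable A ->
  leb A = c%:E * leb ((fun t => c * t + a)%R @^-1` A).
Proof.
move=> c0 mA.
pose nu0 : {measure set (measurableTypeR R) -> \bar R} :=
  pushforward leb (fun t : R => c * t + a : measurableTypeR R)%R.
pose nu : {measure set (measurableTypeR R) -> \bar R} :=
  mscale (NngNum (ltW c0)) (nu0 (measurable_affine c a)).
rewrite -[RHS]/(nu A).
apply: lebesgue_measure_unique => // _ [[x y]] _ <-.
rewrite /nu/= /mscale/= /pushforward/=.
have -> : (fun t => c * t + a)%R @^-1` `]x, y] = `]((x - a) / c)%R, ((y - a) / c)%R]%classic.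
  by apply/seteqP; split => t/=; rewrite !in_itv/= ltr_pdivrMr// ler_pdivlMr// ltrBlDr lerBrDr (mulrC t).
rewrite !lebesgue_measure_itv/= !lte_fin ltr_pM2r ?invr_gt0// ltrD2r.
case: ifPn => // _; rewrite ?mule0//.
by rewrite -!EFinB -EFinM; congr EFin; field; rewrite gt_eqF.
Qed.

Lemma ge0_integral_affine (c a : R) (D : set R) (f : R -> \bar R) : (0 < c)%R ->
  measurable D -> measurable_fun [set: R] f -> (forall t, 0 <= f t) ->
  \int[leb]_(t in D) f t =
  c%:E * \int[leb]_(t in (fun t => c * t + a)%R @^-1` D) f (c * t + a)%R.
Proof.
move=> c0 mD mf f0.
pose nu0 : {measure set (measurableTypeR R) -> \bar R} :=
  pushforward leb (fun t : R => c * t + a : measurableTypeR R)%R.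
rewrite -(@ge0_integral_pushforward _ _ _ _ _ _ (measurable_affine c a) leb D f)//; last first.
  exact: measurable_funS mf.
rewrite -[RHS](_ : \int[mscale (NngNum (ltW c0)) (nu0 (measurable_affine c a))]_(t in D) f t = _); last first.
  by rewrite ge0_integral_mscale//; exact: measurable_funS mf.
by apply: eq_measure_integral => //= A mA _; exact: lebesgue_measure_affine.
Qed.

Lemma ge0_integral_shift (a : R) (f : R -> \bar R) :
  measurable_fun [set: R] f -> (forall t, 0 <= f t) ->
  \int[leb]_t f (t + a)%R = \int[leb]_t f t.
Proof.
move=> mf f0; rewrite (@ge0_integral_affine 1 a setT f)// preimage_setT mul1e.
by under [in RHS]eq_integral do rewrite mul1r.
Qed.

Lemma ge0_integral_scale (c : R) (f : R -> \bar R) : (0 < c)%R ->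
  measurable_fun [set: R] f -> (forall t, 0 <= f t) ->
  \int[leb]_t f (c * t)%R = (c^-1)%:E * \int[leb]_t f t.
Proof.
move=> c0 mf f0; rewrite (@ge0_integral_affine c 0 setT f)// preimage_setT muleA -EFinM mulVf ?gt_eqF// mul1e.
by under [in RHS]eq_integral do rewrite addr0.
Qed.

End affine.

Section euclid.
Context {R : realType}.

Definition dotv n (x y : 'rV[R]_n) : R := \sum_(i < n) x ord0 i * y ord0 i.
(** Most estimates are made on the squared norm, which is polynomial in the coordinates and so
    accessible to [ring] and [lra]. *)
Definition sqn n (x : 'rV[R]_n) : R := dotv x x.

Lemma dotvE n (x y : 'rV[R]_n) : dotv x y = (x *m y^T) ord0 ord0.
Proof. by rewrite mxE; apply: eq_bigr => i _; rewrite mxE. Qed.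

Lemma dotvC n (x y : 'rV[R]_n) : dotv x y = dotv y x.
Proof. by apply: eq_bigr => i _; rewrite mulrC. Qed.

Lemma dotvDl n (x y z : 'rV[R]_n) : dotv (x + y) z = dotv x z + dotv y z.
Proof. by rewrite -big_split; apply: eq_bigr => i _; rewrite mxE mulrDl. Qed.

Lemma dotvNl n (x z : 'rV[R]_n) : dotv (- x) z = - dotv x z.
Proof. by rewrite -sumrN; apply: eq_bigr => i _; rewrite mxE mulNr. Qed.

Lemma dotvZl n (a : R) (x z : 'rV[R]_n) : dotv (a *: x) z = a * dotv x z.
Proof. by rewrite big_distrr/=; apply: eq_bigr => i _; rewrite mxE mulrA. Qed.

Lemma dotvDr n (x y z : 'rV[R]_n) : dotv z (x + y) = dotv z x + dotv z y.
Proof. by rewrite !(dotvC z) dotvDl. Qed.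

Lemma dotvNr n (x z : 'rV[R]_n) : dotv z (- x) = - dotv z x.
Proof. by rewrite !(dotvC z) dotvNl. Qed.

Lemma dotvZr n (a : R) (x z : 'rV[R]_n) : dotv z (a *: x) = a * dotv z x.
Proof. by rewrite !(dotvC z) dotvZl. Qed.

Definition dotv_lin := (dotvDl, dotvDr, dotvNl, dotvNr, dotvZl, dotvZr).

Lemma sqn_ge0 n (x : 'rV[R]_n) : 0 <= sqn x.
Proof. by apply: sumr_ge0 => i _; rewrite -expr2 sqr_ge0. Qed.

Lemma sqn_eq0 n (x : 'rV[R]_n) : (sqn x == 0) = (x == 0).
Proof.
apply/idP/eqP => [|->]; last by rewrite /sqn /dotv big1// => i _; rewrite mxE mul0r.
rewrite psumr_eq0 => [/allP/= h|i _]; last by rewrite -expr2 sqr_ge0.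
apply/rowP => i; rewrite mxE; apply/eqP; rewrite -sqrf_eq0 expr2.
by apply: h; rewrite mem_index_enum.
Qed.

Lemma enormE n (x : 'rV[R]_n) : enorm x = Num.sqrt (sqn x).
Proof. by congr Num.sqrt; apply: eq_bigr => i _; rewrite expr2. Qed.

Lemma enorm_ge0 n (x : 'rV[R]_n) : 0 <= enorm x.
Proof. exact: sqrtr_ge0. Qed.

Lemma enorm_sqr n (x : 'rV[R]_n) : enorm x ^+ 2 = sqn x.
Proof. by rewrite enormE sqr_sqrtr// sqn_ge0. Qed.

Lemma enorm_eq0 n (x : 'rV[R]_n) : (enorm x == 0) = (x == 0).
Proof. by rewrite -sqn_eq0 -enorm_sqr sqrf_eq0. Qed.

Lemma enorm_gt0 n (x : 'rV[R]_n) : (0 < enorm x) = (x != 0).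
Proof. by rewrite lt_def enorm_ge0 andbT enorm_eq0. Qed.

Lemma enormN n (x : 'rV[R]_n) : enorm (- x) = enorm x.
Proof. by rewrite !enormE /sqn !dotv_lin opprK. Qed.

Lemma enormB n (x y : 'rV[R]_n) : enorm (x - y) = enorm (y - x).
Proof. by rewrite -enormN opprB. Qed.

Lemma enorm0 n : enorm (0 : 'rV[R]_n) = 0.
Proof. by apply/eqP; rewrite enorm_eq0. Qed.

Lemma enormZ n (a : R) (x : 'rV[R]_n) : enorm (a *: x) = `|a| * enorm x.
Proof. by rewrite !enormE /sqn !dotv_lin mulrA -expr2 sqrtrM ?sqr_ge0// sqrtr_sqr. Qed.

(** Expand the squared norm of [enorm y *: x - enorm x *: y], which is nonnegative, and divide by
    [enorm x * enorm y]. *)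
Lemma cauchy_schwarz n (x y : 'rV[R]_n) : dotv x y <= enorm x * enorm y.
Proof.
have [->|x0] := eqVneq x 0.
  by rewrite enorm0 mul0r /dotv big1// => i _; rewrite mxE mul0r.
have [->|y0] := eqVneq y 0.
  by rewrite enorm0 mulr0 /dotv big1// => i _; rewrite mxE mulr0.
have := sqn_ge0 (enorm y *: x - enorm x *: y).
rewrite /sqn !dotv_lin -!/(sqn _) (dotvC y x) -!enorm_sqr.
have := mulr_gt0 (_ : 0 < enorm x) (_ : 0 < enorm y); rewrite !enorm_gt0 => /(_ x0 y0).
move: (enorm x) (enorm y) (dotv x y) => a b c ab h.
rewrite -(ler_pM2l ab); nra.
Qed.

Lemma enormD n (x y : 'rV[R]_n) : enorm (x + y) <= enorm x + enorm y.
Proof.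
rewrite -(@ler_pXn2r _ 2)// ?nnegrE ?addr_ge0 ?enorm_ge0//.
rewrite enorm_sqr /sqn !dotv_lin -!/(sqn _) (dotvC y x) -!enorm_sqr.
have := cauchy_schwarz x y; nra.
Qed.

Lemma enorm_trans n (y x z : 'rV[R]_n) : enorm (x - z) <= enorm (x - y) + enorm (y - z).
Proof. by rewrite -(subrKA y x (- z)); exact: enormD. Qed.

Lemma normrV_leP n (x : 'rV[R]_n) (a : R) : 0 <= a ->
  (`|x| <= a) <-> (forall i, `|x ord0 i| <= a).
Proof.
move=> a0; have -> : `|x| = \big[Num.max/0]_ij `|x ij.1 ij.2| := mx_normrE x.
split => [/bigmax_leP[_ h] i|h]; first exact: (h (ord0, i)).
by apply/bigmax_leP; split => // -[i j] _ /=; rewrite (ord1 i).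
Qed.

Lemma normrV_coord n (x : 'rV[R]_n) i : `|x ord0 i| <= `|x|.
Proof. exact: (normrV_leP x (normr_ge0 x)).1. Qed.

Lemma normrV_le_enorm n (x : 'rV[R]_n) : `|x| <= enorm x.
Proof.
apply/normrV_leP => [|j]; first exact: enorm_ge0.
rewrite -(@ler_pXn2r _ 2) ?nnegrE ?enorm_ge0// enorm_sqr /sqn /dotv.
rewrite real_normK ?num_real// (bigD1 j)//= expr2 lerDl sumr_ge0// => k _.
by rewrite -expr2 sqr_ge0.
Qed.

Lemma enorm_le_normrV n (x : 'rV[R]_n) : enorm x <= n%:R * `|x|.
Proof.
have x0 : 0 <= n%:R * `|x| by rewrite mulr_ge0.
rewrite -(@ler_pXn2r _ 2) ?nnegrE ?enorm_ge0// enorm_sqr /sqn /dotv.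
apply: (@le_trans _ _ (\sum_(i < n) `|x| ^+ 2)).
  apply: ler_sum => i _; rewrite -expr2 -(real_normK (num_real _)).
  by rewrite ler_pXn2r ?nnegrE// normrV_coord.
rewrite sumr_const card_ord exprMn -[leLHS]mulr_natl ler_wpM2r ?sqr_ge0//.
case: n {x x0} => [|n]; first by rewrite expr0n/=.
by rewrite expr2 ler_peMl// ler1n.
Qed.

End euclid.

Section rV_measure.
Context {R : realType}.
Local Notation leb := (@lebesgue_measure R).
Local Notation mu n := (@lebesgue_rV R n).

Lemma measurable_coord n (i : 'I_n) :
  measurable_fun [set: 'rV[R]_n] (fun x : 'rV[R]_n => x ord0 i).
Proof. exact: (@measurable_rV_coord R n i). Qed.

Lemma measurable_coord_comp d (T : measurableType d) n (f : T -> 'rV[R]_n) i :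
  measurable_fun [set: T] f -> measurable_fun [set: T] (fun t => f t ord0 i).
Proof. by move=> mf; apply: (measurableT_comp (measurable_coord i) mf). Qed.

Lemma measurable_fun_rV d (T : measurableType d) n (f : T -> 'rV[R]_n) :
  (forall i, measurable_fun [set: T] (fun t => f t ord0 i)) ->
  measurable_fun [set: T] f.
Proof. by move=> mf; apply: measurable_fun_rVP => i; exact: mf. Qed.

Lemma measurable_rVD d (T : measurableType d) n (f g : T -> 'rV[R]_n) :
  measurable_fun [set: T] f -> measurable_fun [set: T] g ->
  measurable_fun [set: T] (fun t => f t + g t).
Proof.
move=> mf mg; apply: measurable_fun_rV => i.
under eq_fun do rewrite mxE.
by apply: measurable_funD; exact: measurable_coord_comp.
Qed.

Lemma measurable_rVN d (T : measurableType d) n (f : T -> 'rV[R]_n) :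
  measurable_fun [set: T] f -> measurable_fun [set: T] (fun t => - f t).
Proof.
move=> mf; apply: measurable_fun_rV => i.
under eq_fun do rewrite mxE.
by apply: measurable_funN; exact: measurable_coord_comp.
Qed.

Lemma measurable_rVB d (T : measurableType d) n (f g : T -> 'rV[R]_n) :
  measurable_fun [set: T] f -> measurable_fun [set: T] g ->
  measurable_fun [set: T] (fun t => f t - g t).
Proof. by move=> mf mg; apply: measurable_rVD => //; exact: measurable_rVN. Qed.

Lemma measurable_dotv d (T : measurableType d) n (f g : T -> 'rV[R]_n) :
  measurable_fun [set: T] f -> measurable_fun [set: T] g ->
  measurable_fun [set: T] (fun t => dotv (f t) (g t)).
Proof.
move=> mf mg; rewrite /dotv; apply: measurable_sum => i.
by apply: measurable_funM; exact: measurable_coord_comp.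
Qed.

Lemma measurable_mulmx d (T : measurableType d) n m (A : 'M[R]_(n, m)) (f : T -> 'rV[R]_n) :
  measurable_fun [set: T] f -> measurable_fun [set: T] (fun t => f t *m A).
Proof.
move=> mf; apply: measurable_fun_rV => j.
under eq_fun do rewrite mxE.
apply: measurable_sum => i; apply: measurable_funM => //.
exact: measurable_coord_comp.
Qed.

Lemma measurable_enorm d (T : measurableType d) n (f : T -> 'rV[R]_n) :
  measurable_fun [set: T] f -> measurable_fun [set: T] (fun t => enorm (f t)).
Proof.
move=> mf; rewrite (_ : (fun t => _) = (fun t => Num.sqrt (sqn (f t)))); last first.
  by apply/funext => t; rewrite enormE.
apply: (measurableT_comp (f := @Num.sqrt R)); last exact: measurable_dotv.
by apply: continuous_measurable_fun; exact: sqrt_continuous.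
Qed.

Lemma cons_rV0 n (t : R) (z : 'rV[R]_n) : cons_rV (t, z) ord0 ord0 = t.
Proof. by rewrite mxE unlift_none. Qed.

Lemma cons_rVS n (t : R) (z : 'rV[R]_n) i : cons_rV (t, z) ord0 (lift ord0 i) = z ord0 i.
Proof. by rewrite mxE liftK. Qed.

Lemma sqn_cons n (t : R) (z : 'rV[R]_n) : sqn (cons_rV (t, z)) = t ^+ 2 + sqn z.
Proof.
rewrite /sqn /dotv big_ord_recl cons_rV0 expr2; congr +%R.
by apply: eq_bigr => i _; rewrite cons_rVS.
Qed.

Lemma rV0_eq (x y : 'rV[R]_0) : x = y. Proof. by apply/rowP => -[]. Qed.

Lemma measurable_cons n d (T : measurableType d) (f : T -> R) (g : T -> 'rV[R]_n) :
  measurable_fun [set: T] f -> measurable_fun [set: T] g ->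
  measurable_fun [set: T] (fun t => cons_rV (f t, g t)).
Proof.
move=> mf mg; apply: measurable_fun_rV => i.
have [j ->|->] := unliftP ord0 i.
  by under eq_fun do rewrite cons_rVS; exact: measurable_coord_comp.
by under eq_fun do rewrite cons_rV0.
Qed.

Local Open Scope ereal_scope.

Lemma integral_rV0 (f : 'rV[R]_0 -> \bar R) : (forall x, 0 <= f x) ->
  \int[mu 0]_x f x = f 0%R.
Proof.
move=> f0; rewrite (_ : f = cst (f 0%R)); last by apply/funext => x; congr f; exact: rV0_eq.
by rewrite integral_cst//= diracT mule1.
Qed.

(** The measure is by construction the pushforward of a product, so Tonelli peels off the first
    coordinate. *)
Lemma integral_rVS n (f : 'rV[R]_n.+1 -> \bar R) :
  measurable_fun [set: 'rV[R]_n.+1] f -> (forall x, 0 <= f x) ->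
  \int[mu n.+1]_x f x = \int[leb]_t \int[mu n]_z f (cons_rV (t, z)).
Proof.
move=> mf f0.
transitivity (\int[leb \x mu n]_p f (cons_rV p)).
  exact: (@ge0_integral_pushforward _ _ _ _ _ _ (@measurable_cons_rV R n) (leb \x mu n) setT f).
rewrite (@fubini_tonelli1 _ _ _ _ _ leb (mu n))//.
by apply: measurableT_comp => //; exact: measurable_cons_rV.
Qed.

Lemma measurable_integral_rV n (f : 'rV[R]_n.+1 -> \bar R) :
  measurable_fun [set: 'rV[R]_n.+1] f -> (forall x, 0 <= f x) ->
  measurable_fun [set: R] (fun t => \int[mu n]_z f (cons_rV (t, z))).
Proof.
move=> mf f0.
apply: (@measurable_fun_fubini_tonelli_F _ _ (measurableTypeR R) _ R (mu n)
  (fun tz => f (cons_rV tz))) => //.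
by apply: measurableT_comp => //; exact: measurable_cons_rV.
Qed.

Lemma integral_rV_shift n (a : 'rV[R]_n) (f : 'rV[R]_n -> \bar R) :
  measurable_fun [set: 'rV[R]_n] f -> (forall x, 0 <= f x) ->
  \int[mu n]_x f (x + a)%R = \int[mu n]_x f x.
Proof.
elim: n a f => [|n IH] a f mf f0.
  by rewrite !integral_rV0//; congr f; exact: rV0_eq.
have mfD b : measurable_fun [set: 'rV[R]_n.+1] (fun x => f (x + b)%R).
  by apply: measurableT_comp => //; exact: measurable_rVD.
have fD0 x : 0 <= f (x + a)%R by exact: f0.
rewrite (integral_rVS (mfD a) fD0) (integral_rVS mf f0).
pose a' : 'rV[R]_n := (\row_j a ord0 (lift ord0 j))%R.
transitivity (\int[leb]_t \int[mu n]_z f (cons_rV (t + a ord0 ord0, z)%R)); last first.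
  apply: (ge0_integral_shift (a ord0 ord0) (measurable_integral_rV mf f0)) => t.
  by apply: integral_ge0.
apply: eq_integral => t _.
rewrite -(IH a' (fun z => f (cons_rV (t + a ord0 ord0, z)%R)))//; last first.
  by apply: measurableT_comp => //; exact: measurable_cons.
apply: eq_integral => z _; congr f; apply/rowP => i; rewrite [LHS]mxE.
by have [j ->|->] := unliftP ord0 i; rewrite ?cons_rVS ?cons_rV0// !mxE.
Qed.

End rV_measure.

(** * Improper integrals and changes of variables *)

Section improper.
Context {R : realType}.
Local Notation leb := (@lebesgue_measure R).
Local Notation pos := (`]0%R, +oo[%classic : set R).

(** The segments [[1/(n+1), n+2]] exhaust []0, +oo[]. The fundamental theorem of calculus and the
    substitution rules are applied on each of them, and monotone convergence passes to the limit. *)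
Definition uexh (n : nat) : R := n.+1%:R^-1.
Definition vexh (n : nat) : R := n.+1%:R + 1.

Lemma uexh_gt0 n : 0 < uexh n. Proof. by rewrite invr_gt0. Qed.
Lemma uexh_lt n : uexh n < vexh n.
Proof. by rewrite /uexh /vexh (@le_lt_trans _ _ 1)// ?invf_le1 ?ler1n// ltrDr. Qed.

Lemma uexh_nincr m n : (m <= n)%N -> uexh n <= uexh m.
Proof. by move=> mn; rewrite lef_pV2 ?posrE// ler_nat. Qed.
Lemma vexh_ndecr m n : (m <= n)%N -> vexh m <= vexh n.
Proof. by move=> mn; rewrite lerD2r ler_nat. Qed.

Lemma exh_in (x : R) : 0 < x -> exists n, uexh n <= x <= vexh n.
Proof.
move=> x0; pose n := maxn (Num.truncn x) (Num.truncn x^-1); exists n.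
have h (y : R) : 0 < y -> y < (Num.truncn y).+1%:R by move=> /ltW/truncn_itv/andP[].
apply/andP; split.
  rewrite -[leRHS]invrK lef_pV2 ?posrE ?invr_gt0//.
  by apply: le_trans (ltW (h _ _)) _; rewrite ?invr_gt0// ler_nat ltnS leq_maxr.
rewrite /vexh; apply: le_trans (_ : n.+1%:R <= _); last by rewrite lerDl.
by apply: le_trans (ltW (h _ x0)) _; rewrite ler_nat ltnS leq_maxl.
Qed.

Lemma pos_exh : pos = \bigcup_n `[uexh n, vexh n]%classic.
Proof.
apply/seteqP; split => [x|x [n _]]; rewrite /= in_itv/= ?andbT.
  by move=> /exh_in[n h]; exists n.
by rewrite in_itv/= andbT => /andP[h _]; exact: lt_le_trans (uexh_gt0 n) h.
Qed.

Lemma uexh_cvg : uexh n @[n --> \oo] --> (0 : R)^'+.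
Proof.
move=> A [e/= e0 he].
have [n _ hn] : \forall n \near \oo, uexh n < e.
  have [n hn] := exh_in e0.
  exists n.+1 => // m/= nm; apply: lt_le_trans (_ : uexh n <= _); last by case/andP: hn.
  by rewrite ltf_pV2 ?posrE// ltr_nat.
exists n => // m nm/=; apply: he; last exact: uexh_gt0.
by rewrite /ball/= sub0r normrN gtr0_norm ?uexh_gt0//; exact: hn.
Qed.

Lemma vexh_cvg : vexh n @[n --> \oo] --> (+oo : set_system R).
Proof.
apply/cvgryPge => A; near=> n; rewrite /vexh.
apply: (@le_trans _ _ n%:R); last by rewrite -natr1 -addrA lerDl.
by near: n; exact: nbhs_infty_ger.
Unshelve. all: by end_near. Qed.

Lemma continuous_pos_measurable (f : R -> R) :
  (forall x : R, 0 < x -> {for x, continuous f}) -> measurable_fun pos f.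
Proof.
move=> cf; apply: open_continuous_measurable_fun; first exact: interval_open.
by move=> x; rewrite inE/= in_itv/= andbT => /cf.
Qed.

Lemma integral_exh (g : R -> R) (H : (set R)^nat) (D : set R) :
  nondecreasing_seq H -> (forall n, measurable (H n)) -> \bigcup_n H n = D ->
  measurable_fun D g -> (forall x, D x -> 0 <= g x) ->
  (\int[leb]_(x in H n) (g x)%:E @[n --> \oo] --> \int[leb]_(x in D) (g x)%:E)%E.
Proof.
move=> ndH mH HD mg g0; rewrite -HD.
have mD : measurable D by rewrite -HD; exact: bigcup_measurable.
apply: ge0_nondecreasing_set_cvg_integral => //.
- move=> n; apply/measurable_EFinP; apply: measurable_funS mg => //.
  by rewrite -HD => x h; exists n.
- by move=> n x Hx; rewrite lee_fin; apply: g0; rewrite -HD; exists n.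
Qed.

Lemma nd_exh : nondecreasing_seq (fun n => `[uexh n, vexh n]%classic : set R).
Proof.
apply/nondecreasing_seqP => n; apply/subsetPset/subset_itv; rewrite bnd_simp.
  exact: uexh_nincr.
exact: vexh_ndecr.
Qed.

(** Nonnegativity of [f] makes monotone convergence available, so integrability is a conclusion:
    only the two limits of the primitive are required. *)
Lemma ge0_FTC0y (f F : R -> R) (l0 l1 : R) :
  (forall x : R, 0 < x -> 0 <= f x) ->
  (forall x : R, 0 < x -> {for x, continuous f}) ->
  (forall x : R, 0 < x -> is_derive x 1 F (f x)) ->
  F x @[x --> 0^'+] --> l0 -> F x @[x --> +oo%R] --> l1 ->
  (\int[leb]_(x in pos) (f x)%:E = (l1 - l0)%:E)%E.
Proof.
move=> f0 cf dF F0 F1.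
have mf : measurable_fun pos f by exact: continuous_pos_measurable.
have f0' (x : R) : pos x -> 0 <= f x by rewrite /= in_itv/= andbT; exact: f0.
have /cvg_lim <- // := integral_exh nd_exh (fun n => measurable_itv _) (esym pos_exh) mf f0'.
apply/cvg_lim => //.
have -> : (fun n => \int[leb]_(x in `[uexh n, vexh n]) (f x)%:E)%E =
          (fun n => (F (vexh n) - F (uexh n))%:E).
  apply/funext => n.
  have h x : uexh n <= x -> 0 < x by exact: lt_le_trans (uexh_gt0 n).
  have cF x : uexh n <= x -> {for x, continuous F}.
    by move=> /h/dF dFx; apply/differentiable_continuous/derivable1_diffP; exact: ex_derive.
  rewrite (@continuous_FTC2 _ f F)//.
  - exact: uexh_lt.
  - apply: continuous_in_subspaceT => x; rewrite inE/= in_itv/= => /andP[/h/cf + _].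
    by [].
  - split.
    + by move=> x; rewrite in_itv/= => /andP[/ltW/h/dF dFx _]; exact: ex_derive.
    + by apply: cvg_at_right_filter; exact: cF.
    + by apply: cvg_at_left_filter; apply: cF; exact/ltW/uexh_lt.
  - move=> x; rewrite in_itv/= => /andP[/ltW/h/dF dFx _].
    by rewrite derive1E derive_val.
apply: cvg_EFin; first by near=> n.
apply: cvgB.
  exact: cvg_comp vexh_cvg F1.
exact: cvg_comp uexh_cvg F0.
Unshelve. all: by end_near. Qed.

Section change_of_variable.
Variables (F f G : R -> R) (E : set R).
Hypothesis F_derive : forall x : R, 0 < x -> is_derive x 1 F (f x).
Hypothesis f_cont : forall x : R, 0 < x -> {for x, continuous f}.
Hypothesis E_itv : is_interval E.
Hypothesis FE : forall x : R, 0 < x -> E (F x).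
Hypothesis EF : forall y, E y -> exists2 x, 0 < x & y = F x.
Hypothesis G_cont : forall y, E y -> {for y, continuous G}.
Hypothesis G_ge0 : forall y, E y -> 0 <= G y.

Let F_cont (x : R) : 0 < x -> {for x, continuous F}.
Proof.
by move=> /F_derive dFx; apply/differentiable_continuous/derivable1_diffP; exact: ex_derive.
Qed.

Let FG_cont (x : R) : 0 < x -> {for x, continuous (fun x => G (F x) * f x)}.
Proof.
move=> x0; apply: cvgM; last exact: f_cont.
by apply: continuous_comp; [exact: F_cont|exact/G_cont/FE].
Qed.

Let near_derive (x : R) : 0 < x -> \forall y \near x, f y = derive1 F y.
Proof.
move=> x0; near=> y.
have dFy : is_derive y 1 F (f y) by apply: F_derive; near: y; exact: lt_nbhsr.
by rewrite derive1E derive_val.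
Unshelve. all: by end_near. Qed.

Let derive1_cont (x : R) : 0 < x -> {for x, continuous (derive1 F)}.
Proof.
move=> x0; rewrite /prop_for /continuous_at -(nbhs_singleton (near_derive x0)).
by apply: cvg_trans (f_cont x0); apply: near_eq_cvg; exact: near_derive.
Qed.

Let exh_gt0 n x : uexh n <= x -> 0 < x.
Proof. exact: lt_le_trans (uexh_gt0 n). Qed.

Let F_LR n : derivable_oo_LRcontinuous F (uexh n) (vexh n).
Proof.
split.
- move=> x; rewrite in_itv/= => /andP[/ltW/exh_gt0/F_derive dFx _].
  exact: ex_derive.
- by apply: cvg_at_right_filter; exact/F_cont/uexh_gt0.
- by apply: cvg_at_left_filter; exact/F_cont/(exh_gt0 (ltW (uexh_lt n))).
Qed.

Let exh_le n : uexh n <= vexh n. Proof. exact/ltW/uexh_lt. Qed.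

Let mE : measurable E. Proof. exact: is_interval_measurable. Qed.

Hypothesis oE : open E.

Let mG : measurable_fun E G.
Proof.
by apply: open_continuous_measurable_fun => // y; rewrite inE; exact: G_cont.
Qed.

(** [F] maps []0, +oo[] onto [E], so the images of the exhausting segments exhaust [E]. Both sides
    are limits of the same sequence of integrals over segments. *)
Lemma ge0_change_var_incr : (forall x : R, 0 < x -> 0 <= f x) -> (forall x y : R, 0 < x -> x < y -> F x < F y) ->
  (\int[leb]_(y in E) (G y)%:E = \int[leb]_(x in pos) (G (F x) * f x)%:E)%E.
Proof.
move=> f_ge0 incrF.
have Fle x y : 0 < x -> x <= y -> F x <= F y.
  by move=> x0; rewrite le_eqVlt => /predU1P[->//|/(incrF _ _ x0)/ltW].
have h1 : (\int[leb]_(x in `[F (uexh n), F (vexh n)]) (G x)%:E @[n --> \oo] -->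
    \int[leb]_(x in E) (G x)%:E)%E.
  apply: integral_exh => //.
    apply/nondecreasing_seqP => n; apply/subsetPset/subset_itv; rewrite bnd_simp.
      by apply: Fle; [exact: uexh_gt0|exact: uexh_nincr].
    by apply: Fle; [exact: exh_gt0 (exh_le n)|exact: vexh_ndecr].
  apply/seteqP; split => [y [n _]/=|y /EF[x x0 ->]].
    rewrite in_itv/=; apply: E_itv; apply: FE; first exact: uexh_gt0.
    exact: exh_gt0 (exh_le n).
  have [n /andP[h h']] := exh_in x0; exists n => //=; rewrite in_itv/= !Fle//.
  exact: uexh_gt0.
have h2 : (\int[leb]_(x in `[uexh n, vexh n]) (G (F x) * f x)%:E @[n --> \oo] -->
    \int[leb]_(x in pos) (G (F x) * f x)%:E)%E.
  apply: (integral_exh nd_exh (fun=> measurable_itv _) (esym pos_exh)) => //.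
    exact: continuous_pos_measurable.
  move=> x; rewrite /= in_itv/= andbT => x0.
  by rewrite mulr_ge0 ?f_ge0// G_ge0//; exact: FE.
have h12 n : (\int[leb]_(x in `[F (uexh n), F (vexh n)]) (G x)%:E =
    \int[leb]_(x in `[uexh n, vexh n]) (G (F x) * f x)%:E)%E; last first.
  by move: h1; under eq_fun do rewrite h12; move=> h1; exact: cvg_unique h1 h2.
rewrite integration_by_substitution_increasing//.
- apply: eq_integral => x; rewrite inE/= in_itv/= => /andP[/exh_gt0/near_derive/nbhs_singleton + _].
  by rewrite fctE => ->.
- move=> x y; rewrite !in_itv/= => /andP[/exh_gt0 x0 _] _.
  exact: incrF.
- by move=> x; rewrite in_itv/= => /andP[/ltW/exh_gt0/derive1_cont].
- by apply: cvgP; apply: cvg_at_right_filter; exact/derive1_cont/uexh_gt0.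
- by apply: cvgP; apply: cvg_at_left_filter; exact/derive1_cont/(exh_gt0 (exh_le n)).
- apply: continuous_in_subspaceT => y; rewrite inE/= in_itv/= => h; apply: G_cont.
  by move: h; apply: E_itv; apply: FE; [exact: uexh_gt0|exact: exh_gt0 (exh_le n)].
Qed.

Lemma ge0_change_var_decr : (forall x : R, 0 < x -> f x <= 0) -> (forall x y : R, 0 < x -> x < y -> F y < F x) ->
  (\int[leb]_(y in E) (G y)%:E = \int[leb]_(x in pos) (G (F x) * - f x)%:E)%E.
Proof.
move=> f_ge0 decrF.
have Fle x y : 0 < x -> x <= y -> F y <= F x.
  by move=> x0; rewrite le_eqVlt => /predU1P[->//|/(decrF _ _ x0)/ltW].
have h1 : (\int[leb]_(x in `[F (vexh n), F (uexh n)]) (G x)%:E @[n --> \oo] -->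
    \int[leb]_(x in E) (G x)%:E)%E.
  apply: integral_exh => //.
    apply/nondecreasing_seqP => n; apply/subsetPset/subset_itv; rewrite bnd_simp.
      by apply: Fle; [exact: exh_gt0 (exh_le n)|exact: vexh_ndecr].
    by apply: Fle; [exact: uexh_gt0|exact: uexh_nincr].
  apply/seteqP; split => [y [n _]/=|y /EF[x x0 ->]].
    rewrite in_itv/=; apply: E_itv; apply: FE; last exact: uexh_gt0.
    exact: exh_gt0 (exh_le n).
  have [n /andP[h h']] := exh_in x0; exists n => //=; rewrite in_itv/= !Fle//.
  exact: uexh_gt0.
have h2 : (\int[leb]_(x in `[uexh n, vexh n]) (G (F x) * - f x)%:E @[n --> \oo] -->
    \int[leb]_(x in pos) (G (F x) * - f x)%:E)%E.
  apply: (integral_exh nd_exh (fun=> measurable_itv _) (esym pos_exh)) => //.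
    apply: continuous_pos_measurable => x x0.
    apply: cvgM; last by apply: cvgN; exact: f_cont.
    by apply: continuous_comp; [exact: F_cont|exact/G_cont/FE].
  move=> x; rewrite /= in_itv/= andbT => x0.
  by rewrite mulr_ge0 ?oppr_ge0 ?f_ge0// G_ge0//; exact: FE.
have h12 n : (\int[leb]_(x in `[F (vexh n), F (uexh n)]) (G x)%:E =
    \int[leb]_(x in `[uexh n, vexh n]) (G (F x) * - f x)%:E)%E; last first.
  by move: h1; under eq_fun do rewrite h12; move=> h1; exact: cvg_unique h1 h2.
rewrite integration_by_substitution_decreasing//.
- apply: eq_integral => x; rewrite inE/= in_itv/= => /andP[/exh_gt0/near_derive/nbhs_singleton + _].
  by rewrite fctE => ->.
- by move=> x y; rewrite !in_itv/= => _ /andP[/exh_gt0 y0 _] xy; exact: decrF.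
- by move=> x; rewrite in_itv/= => /andP[/ltW/exh_gt0/derive1_cont].
- by apply: cvgP; apply: cvg_at_right_filter; exact/derive1_cont/uexh_gt0.
- by apply: cvgP; apply: cvg_at_left_filter; exact/derive1_cont/(exh_gt0 (exh_le n)).
- apply: continuous_in_subspaceT => y; rewrite inE/= in_itv/= => h; apply: G_cont.
  by move: h; apply: E_itv; apply: FE; [exact: exh_gt0 (exh_le n)|exact: uexh_gt0].
Qed.

End change_of_variable.
End improper.

(** * Gamma and Beta integrals *)

(** The locked copy keeps unification from unfolding [Gamma] into an integral. *)
HB.lock Definition Gam {R : realType} (z : R) : R := Gamma z.

Lemma GamE {R : realType} (z : R) : Gam z = Gamma z.
Proof. by rewrite unlock. Qed.

Section gamma.
Context {R : realType}.
Local Notation leb := (@lebesgue_measure R).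
Local Notation pos := (`]0%R, +oo[%classic : set R).

Lemma powRDp (x a b : R) : 0 < x -> x `^ (a + b) = x `^ a * x `^ b.
Proof. by move=> x0; rewrite powRD// (gt_eqF x0) implybT. Qed.

Lemma powR_continuous (p x : R) : 0 < x -> {for x, continuous (fun y : R => y `^ p)}.
Proof.
move=> x0; apply/differentiable_continuous/derivable1_diffP.
exact: (@ex_derive _ _ _ _ _ _ _ (is_derive1_powR p x0)).
Qed.

Lemma is_derive_inv (f : R -> R) (x df : R) : f x != 0 -> is_derive x 1 f df ->
  is_derive x 1 (fun y => (f y)^-1) (- df / f x ^+ 2).
Proof.
move=> fx0 fdf; have dv : derivable f x 1 by exact: ex_derive.
split; first exact: derivableV.
by rewrite deriveV// derive_val /GRing.scale/= mulrC mulrN mulNr mulrC.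
Qed.

Lemma is_derive_addf (f g : R -> R) (x df dg : R) : is_derive x 1 f df ->
  is_derive x 1 g dg -> is_derive x 1 (fun y => f y + g y) (df + dg).
Proof. exact: is_deriveD. Qed.

Lemma is_derive_mulf (f g : R -> R) (x df dg : R) : is_derive x 1 f df ->
  is_derive x 1 g dg -> is_derive x 1 (fun y => f y * g y) (df * g x + f x * dg).
Proof.
move=> hf hg; apply: (is_derive_eq (is_deriveM hf hg)).
by rewrite /GRing.scale/= addrC (mulrC (g x)).
Qed.

Lemma is_derive_addc (a : R) (f : R -> R) (x df : R) : is_derive x 1 f df ->
  is_derive x 1 (fun y => a + f y) df.
Proof.
move=> hf; have := is_derive_addf (is_derive_cst (a : R) (x : R) (1 : R)) hf.
by rewrite add0r.
Qed.

Lemma is_derive_mulc (a : R) (f : R -> R) (x df : R) : is_derive x 1 f df ->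
  is_derive x 1 (fun y => a * f y) (a * df).
Proof.
move=> hf; have := is_derive_mulf (is_derive_cst (a : R) (x : R) (1 : R)) hf.
by rewrite mul0r add0r.
Qed.

Lemma is_derive_oppf (f : R -> R) (x df : R) : is_derive x 1 f df ->
  is_derive x 1 (fun y => - f y) (- df).
Proof. exact: is_deriveN. Qed.

Lemma is_derive_powRf (p : R) (f : R -> R) (x df : R) : 0 < f x -> is_derive x 1 f df ->
  is_derive x 1 (fun y => f y `^ p) (p * f x `^ (p - 1) * df).
Proof.
move=> fx0 hf; apply: is_derive_eq; first exact: (is_derive1_comp (is_derive1_powR p fx0) hf).
by rewrite /GRing.scale/= mulrC.
Qed.

Lemma le0_ler_powR (p x y : R) : p <= 0 -> 0 < x -> x <= y -> y `^ p <= x `^ p.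
Proof.
move=> p0 x0 xy; have y0 := lt_le_trans x0 xy.
rewrite -[p]opprK !(powRN _ (- p)) lef_pV2 ?posrE ?powR_gt0//.
by rewrite ge0_ler_powR ?oppr_ge0// nnegrE ltW.
Qed.

Lemma measurable_powR_comp d (T : measurableType d) (f : T -> R) (p : R) D :
  measurable_fun D f -> measurable_fun D (fun x => f x `^ p).
Proof. by move=> mf; exact: (measurableT_comp (measurable_powR p) mf). Qed.

Lemma posE (x : R) : pos x = (0 < x) :> Prop.
Proof. by rewrite /= in_itv/= andbT. Qed.

Lemma integral_pos (f : R -> \bar R) :
  (\int[leb]_(x in pos) f x = \int[leb]_x (if (0 < x)%R then f x else 0))%E.
Proof.
rewrite integral_mkcond; apply: eq_integral => x _; rewrite patchE.
by rewrite mem_setE in_itv/= andbT.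
Qed.

(** One comparison function for the improper integrals: it is of order [x^(c-1)] at 0 and [x^(-c-1)]
    at infinity, and [- 1 / (c (1 + x^c))] is an explicit primitive. *)
Definition majorant (c x : R) : R := x `^ (c - 1) / (1 + x `^ c) ^+ 2.

Lemma majorant_ge0 c x : 0 <= majorant c x.
Proof. by rewrite divr_ge0// ?sqr_ge0// powR_ge0. Qed.

Lemma measurable_majorant c : measurable_fun [set: R] (majorant c).
Proof.
apply: measurable_funM; first exact: measurable_powR.
rewrite (_ : (fun x => _) = (fun x : R => ((1 + x `^ c) ^+ 2) `^ (- 1))); last first.
  by apply/funext => x; rewrite powR_inv1// sqr_ge0.
by apply: measurable_powR_comp; apply: measurable_funX; apply: measurable_funD.
Qed.

Lemma integral_majorant (c : R) : 0 < c ->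
  (\int[leb]_(x in pos) (majorant c x)%:E = (c^-1)%:E)%E.
Proof.
move=> c0.
have p1 (x : R) : 0 < 1 + x `^ c by rewrite ltr_pwDl ?powR_ge0.
pose F (x : R) := - c^-1 * (1 + x `^ c)^-1.
have cvF0 : F x @[x --> 0^'+] --> - c^-1.
  rewrite -[X in _ --> X]mulr1; apply: cvgM; first exact: cvg_cst.
  rewrite -[X in _ --> X]invr1; apply: cvgV; rewrite ?oner_eq0//.
  by rewrite -[X in _ --> X]addr0; apply: cvgD; [exact: cvg_cst|exact: powR_cvg0].
have cvF1 : F x @[x --> +oo] --> (0 : R).
  rewrite -[X in _ --> X](mulr0 (- c^-1)); apply: cvgM; first exact: cvg_cst.
  apply/cvgrPdist_le => e e0; near=> x.
  have x0 : 0 < x by near: x; exact: nbhs_pinfty_gt.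
  have xe : e^-1 `^ c^-1 <= x by near: x; exact: nbhs_pinfty_ge.
  rewrite sub0r normrN ger0_norm ?invr_ge0 ?(ltW (p1 _))//.
  rewrite -[leRHS]invrK lef_pV2 ?posrE ?invr_gt0//.
  apply: (@le_trans _ _ (x `^ c)); last by rewrite lerDr.
  have -> : e^-1 = (e^-1 `^ c^-1) `^ c.
    by rewrite -powRrM mulVf ?gt_eqF// powRr1// invr_ge0 ltW.
  by rewrite ge0_ler_powR ?nnegrE ?powR_ge0// ltW.
have := @ge0_FTC0y R (majorant c) F (- c^-1) 0 _ _ _ cvF0 cvF1.
rewrite sub0r opprK; apply => x x0; first exact: majorant_ge0.
  apply: cvgM; first exact: powR_continuous.
  apply: cvgV; first by rewrite expf_neq0// gt_eqF.
  rewrite expr2; under eq_fun do rewrite expr2.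
  by apply: cvgM; (apply: cvgD; [exact: cvg_cst|exact: powR_continuous]).
have dx : is_derive x 1 (fun y : R => 1 + y `^ c) (c * x `^ (c - 1)).
  by apply: is_derive_addc; exact: is_derive1_powR.
apply: (is_derive_eq (is_derive_mulc (- c^-1) (@is_derive_inv (fun y : R => 1 + y `^ c) x _ (lt0r_neq0 (p1 x)) dx))).
rewrite /majorant; field.
by rewrite !gt_eqF.
Unshelve. all: by end_near. Qed.

(** The factor 4 bounds the denominator: [(1 + x^c)^2] is at most 4 for [x <= 1] and at most
    [4 x^(2c)] for [x >= 1]. *)
Lemma le_majorant (c K x y : R) : 0 < c -> 0 < x -> 0 <= K ->
  (x <= 1 -> y <= K * x `^ (c - 1)) -> (1 <= x -> y <= K * x `^ (- c - 1)) ->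
  y <= 4 * K * majorant c x.
Proof.
move=> c0 x0 K0 h1 h2.
have xc := powR_gt0 c x0; have p1 : 0 < (1 + x `^ c) ^+ 2 by rewrite exprn_gt0// addr_gt0.
rewrite /majorant mulrA ler_pdivlMr//.
have [x1|x1] := leP x 1.
  apply: le_trans (ler_wpM2r (ltW p1) (h1 x1)) _.
  rewrite (mulrC 4) -!mulrA ler_wpM2l// mulrC ler_wpM2r ?powR_ge0//.
  have : x `^ c <= 1 by rewrite -(congr1 (@^~ c) (@powR1 R)) ge0_ler_powR ?nnegrE// ltW.
  nra.
apply: le_trans (ler_wpM2r (ltW p1) (h2 (ltW x1))) _.
rewrite (mulrC 4) -!mulrA ler_wpM2l//.
have -> : x `^ (c - 1) = x `^ (- c - 1) * (x `^ c * x `^ c).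
  by rewrite -!powRDp//; congr powR; ring.
rewrite (mulrC 4) -mulrA ler_wpM2l ?powR_ge0//.
have : 1 <= x `^ c by rewrite -(congr1 (@^~ c) (@powR1 R)) ge0_ler_powR ?nnegrE// ltW.
nra.
Qed.

Lemma integral_le_majorant (c K : R) (f : R -> R) : 0 < c -> 0 <= K ->
  measurable_fun pos f -> (forall x : R, 0 < x -> 0 <= f x) ->
  (forall x : R, 0 < x -> x <= 1 -> f x <= K * x `^ (c - 1)) ->
  (forall x : R, 1 <= x -> f x <= K * x `^ (- c - 1)) ->
  (\int[leb]_(x in pos) (f x)%:E <= (4 * K / c)%:E)%E.
Proof.
move=> c0 K0 mf f0 h1 h2.
rewrite EFinM -(integral_majorant c0) -ge0_integralZl//; last 3 first.
- by apply/measurable_EFinP; apply: measurable_funTS; exact: measurable_majorant.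
- by move=> x _; rewrite lee_fin majorant_ge0.
- by rewrite lee_fin mulr_ge0.
apply: ge0_le_integral => //.
- by move=> x; rewrite posE lee_fin => /f0.
- exact/measurable_EFinP.
- apply/measurable_EFinP; apply: measurable_funTS; apply: measurable_funM => //.
  exact: measurable_majorant.
- move=> x; rewrite posE -EFinM lee_fin => x0; apply: le_majorant => //.
    exact: h1.
  exact: h2.
Qed.

(** This is [x / m <= expR (x / m)] raised to the power [m]. *)
Lemma exp_poly_bound (m : nat) (x : R) : 0 <= x -> x ^+ m <= m%:R ^+ m * expR x.
Proof.
case: m => [|m] x0; first by rewrite !expr0 mul1r -expR0 ler_expR.
have m0 : 0 < (m.+1%:R : R) by [].
have -> : expR x = expR (x / m.+1%:R) ^+ m.+1.
  by rewrite -expRM_natl mulrC divfK// gt_eqF.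
rewrite -exprMn ler_pXn2r ?nnegrE ?mulr_ge0 ?expR_ge0//.
by rewrite mulrC -ler_pdivrMr//; apply: le_trans (expR_ge1Dx _); rewrite lerDr.
Qed.

Lemma measurable_gammaf (q : R) : measurable_fun [set: R] (fun x => x `^ (q - 1) * expR (- x)).
Proof.
apply: measurable_funM; first exact: measurable_powR.
by apply: measurableT_comp => //; exact: measurable_funN.
Qed.

Lemma integral_Gamma (q : R) : 0 < q ->
  (\int[leb]_(x in pos) (x `^ (q - 1) * expR (- x))%:E = (Gam q)%:E)%E.
Proof.
(* With [m > 2q] the exponential dominates [x^(2q)], so the integrand is at most [K x^(-q-1)] for
   [x >= 1]. The integral is then finite and [fine] loses nothing. *)
move=> q0; pose m := (Num.truncn (2 * q)).+1.
have mq : 2 * q < m%:R.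
  by have /truncn_itv/andP[] : 0 <= 2 * q by rewrite mulr_ge0// ltW.
pose K : R := m%:R ^+ m + 1.
have K0 : 0 <= K by rewrite addr_ge0// exprn_ge0.
rewrite GamE /Gamma /Rintegral fineK// ge0_fin_numE; last first.
  by apply: integral_ge0 => x _; rewrite lee_fin mulr_ge0 ?powR_ge0 ?expR_ge0.
apply: le_lt_trans (_ : _ <= (4 * K / q)%:E)%E _; last exact: ltry.
apply: integral_le_majorant => //.
- by apply: measurable_funTS; exact: measurable_gammaf.
- by move=> x x0; rewrite mulr_ge0 ?powR_ge0 ?expR_ge0.
- move=> x x0 x1; rewrite mulrC ler_wpM2r ?powR_ge0//.
  apply: (@le_trans _ _ 1); first by rewrite expR_le1 oppr_le0 ltW.
  by rewrite /K lerDr exprn_ge0.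
- move=> x x1; have x0 : 0 < x by lra.
  have -> : q - 1 = 2 * q + (- q - 1) by ring.
  rewrite powRDp// mulrAC ler_wpM2r ?powR_ge0//.
  apply: (@le_trans _ _ (x ^+ m * expR (- x))).
    by rewrite ler_wpM2r ?expR_ge0// -powR_mulrn ?ler_powR// ltW.
  apply: le_trans (_ : m%:R ^+ m * expR x * expR (- x) <= _).
    by rewrite ler_wpM2r ?expR_ge0// exp_poly_bound// ltW.
  by rewrite -mulrA -expRD subrr expR0 mulr1 /K lerDl.
Qed.

Lemma Gamma_gt0 (q : R) : 0 < q -> 0 < Gam q.
Proof.
move=> q0; rewrite -lte_fin -integral_Gamma//.
(* On [[1, 2]] the integrand is at least [x^(-1) e^(-2)], hence at least [e^(-2) / 2]. *)
apply: (@lt_le_trans _ _ (expR (- 2) / 2)%:E); first by rewrite lte_fin divr_gt0// expR_gt0.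
apply: (@le_trans _ _ (\int[leb]_(x in `[1%R, 2%R]) (expR (- 2) / 2)%:E)%E).
  by rewrite integral_cst//= lebesgue_measure_itv/= lte_fin ltr1n -EFinB -EFinM lee_fin; lra.
apply: (@le_trans _ _ (\int[leb]_(x in `[1%R, 2%R]) (x `^ (q - 1) * expR (- x))%:E)%E).
  apply: ge0_le_integral => //.
  - by apply/measurable_EFinP; apply: measurable_funTS; exact: measurable_gammaf.
  move=> x; rewrite /= in_itv/= => /andP[x1 x2]; have x0 : 0 < x by lra.
  rewrite lee_fin mulrC ler_pM ?expR_ge0 ?invr_ge0// ?ler_expR; last lra.
  apply: le_trans (_ : x `^ (- 1) <= _); first by rewrite (powR_inv1 (ltW x0)) lef_pV2 ?posrE.
  by rewrite ler_powR//; lra.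
apply: ge0_subset_integral => //.
- by apply/measurable_EFinP; apply: measurable_funTS; exact: measurable_gammaf.
- by move=> x _; rewrite lee_fin mulr_ge0 ?powR_ge0 ?expR_ge0.
- by move=> x; rewrite posE /= in_itv/= => /andP[+ _]; exact: lt_le_trans.
Qed.

Lemma integral_Gamma_scale (q c : R) : 0 < q -> 0 < c ->
  (\int[leb]_(x in pos) (x `^ (q - 1) * expR (- (c * x)))%:E = (Gam q * c `^ (- q))%:E)%E.
Proof.
move=> q0 c0; rewrite EFinM -(integral_Gamma q0).
rewrite (@ge0_integral_affine _ c 0 pos (fun x => (x `^ (q - 1) * expR (- x))%:E))//; last 2 first.
- by apply/measurable_EFinP; exact: measurable_gammaf.
- by move=> x; rewrite lee_fin mulr_ge0 ?powR_ge0 ?expR_ge0.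
have -> : (fun t : R => c * t + 0) @^-1` pos = pos.
  by apply/seteqP; split => x; rewrite /preimage/= !in_itv/= !andbT addr0 pmulr_rgt0.
rewrite muleC muleA -EFinM -ge0_integralZl//; last 3 first.
- apply/measurable_EFinP; apply: measurable_funTS.
  apply: (measurableT_comp (measurable_gammaf q)).
  by apply: measurable_funD => //; exact: measurable_funM.
- by move=> x _; rewrite lee_fin mulr_ge0 ?powR_ge0 ?expR_ge0.
- by rewrite lee_fin mulr_ge0 ?powR_ge0 ?ltW.
apply: eq_integral => x; rewrite inE posE => x0; rewrite addr0 -EFinM; congr EFin.
have e : c `^ (- q) * c * c `^ (q - 1) = 1.
  rewrite -{2}(powRr1 (ltW c0)) -!powRDp//.
  by rewrite (_ : _ + _ = 0) ?powRr0//; ring.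
rewrite powRM ?(ltW c0) ?(ltW x0)//.
move: (c `^ (q - 1)) e (x `^ (q - 1)) (expR _) => B e P E.
by rewrite -[LHS]mul1r -e; ring.
Qed.

Lemma gauss_scale (t : R) : 0 < t ->
  (\int[leb]_x (expR (- (t * x ^+ 2)))%:E = ((pi / t) `^ (1 / 2))%:E)%E.
Proof.
move=> t0; have st : 0 < Num.sqrt t by rewrite sqrtr_gt0.
transitivity (\int[leb]_x (gauss_fun (Num.sqrt t * x))%:E)%E.
  by apply: eq_integral => x _; rewrite /gauss_fun exprMn sqr_sqrtr// ltW.
rewrite (@ge0_integral_scale _ _ (fun x => (gauss_fun x)%:E))//; last 2 first.
- by apply/measurable_EFinP; exact: measurable_gauss_fun.
- by move=> x; rewrite lee_fin gauss_fun_ge0.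
rewrite integralT_gauss -EFinM; congr EFin.
by rewrite mul1r powR12_sqrt ?divr_ge0 ?pi_ge0 ?ltW// sqrtrM ?pi_ge0// sqrtrV ?ltW// mulrC.
Qed.

End gamma.

Section gauss_rV.
Context {R : realType}.
Local Notation leb := (@lebesgue_measure R).
Local Notation mu n := (@lebesgue_rV R n).
Local Notation pos := (`]0%R, +oo[%classic : set R).

Lemma measurable_EFin_comp d (T : measurableType d) (D : set T) (f : T -> R) :
  measurable_fun D f -> measurable_fun D (fun x => (f x)%:E).
Proof. by move=> mf; exact/measurable_EFinP. Qed.

Lemma measurable_expR_comp d (T : measurableType d) (D : set T) (f : T -> R) :
  measurable_fun D f -> measurable_fun D (fun x => expR (f x)).
Proof. by move=> mf; exact: (measurableT_comp (@measurable_expR R) mf). Qed.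

Lemma integral_gauss_rV n (t : R) : 0 < t ->
  (\int[mu n]_x (expR (- (t * sqn x)))%:E = ((pi / t) `^ (n%:R / 2))%:E)%E.
Proof.
move=> t0.
have mexp m : measurable_fun [set: 'rV[R]_m] (fun x => (expR (- (t * sqn x)))%:E).
  apply: measurable_EFin_comp; apply: measurable_expR_comp; apply: measurable_funN.
  by apply: measurable_funM => //; exact: measurable_dotv.
elim: n => [|n IH].
  rewrite integral_rV0 => [|x]; last by rewrite lee_fin expR_ge0.
  by rewrite /sqn /dotv big_ord0 mulr0 oppr0 expR0 mul0r powRr0.
rewrite integral_rVS//.
under eq_integral => s _.
  under eq_integral do rewrite sqn_cons mulrDr opprD expRD EFinM.
  rewrite ge0_integralZl//; last exact: mexp.
  rewrite IH muleC.
  over.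
rewrite ge0_integralZl//; last 2 first.
- apply: measurable_EFin_comp; apply: measurable_expR_comp; apply: measurable_funN.
  by apply: measurable_funM => //; exact: measurable_funX.
- by rewrite lee_fin powR_ge0.
rewrite gauss_scale// -EFinM -powRDp ?divr_gt0 ?pi_gt0//; congr (_ `^ _)%:E.
by rewrite -natr1; lra.
Qed.

Lemma tonelli_swap d1 d2 (T1 : measurableType d1) (T2 : measurableType d2)
    (m1 : {sigma_finite_measure set T1 -> \bar R})
    (m2 : {sigma_finite_measure set T2 -> \bar R}) (f : T1 * T2 -> \bar R) :
  measurable_fun [set: T1 * T2] f -> (forall z, 0 <= f z)%E ->
  (\int[m1]_x \int[m2]_y f (x, y) = \int[m2]_y \int[m1]_x f (x, y))%E.
Proof. by move=> mf f0; exact: (@fubini_tonelli _ _ _ _ _ m1 m2 f mf f0). Qed.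

Lemma measurable_pos_prod d (T : measurableType d) (f : T * R -> R) :
  measurable_fun [set: T * measurableTypeR R] f ->
  measurable_fun [set: T * measurableTypeR R] (fun z => if (0 < z.2)%R then (f z)%:E else 0%E).
Proof.
move=> mf; apply: measurable_fun_ifT => //; last exact: measurable_EFin_comp.
by apply: measurable_fun_ltr => //; exact: measurable_snd.
Qed.

(** Subordination: [Gam p * h^(-p)] is the integral of [x^(p-1) e^(-h x)]. Integrals of powers
    thereby reduce to integrals of exponentials, which factor over sums. *)
Lemma Gamma_tonelli d (T : measurableType d) (m : {sigma_finite_measure set T -> \bar R})
    (g h : T -> R) (p : R) : 0 < p ->
  measurable_fun [set: T] g -> measurable_fun [set: T] h ->
  (forall z, 0 <= g z) -> (forall z, 0 < h z) ->
  ((Gam p)%:E * \int[m]_z (g z * h z `^ (- p))%:E =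
   \int[leb]_(x in pos) \int[m]_z (x `^ (p - 1) * (g z * expR (- (h z * x))))%:E)%E.
Proof.
move=> p0 mg mh g0 h0; have Gp := Gamma_gt0 p0.
rewrite -ge0_integralZl//; last 3 first.
- apply: measurable_EFin_comp; apply: measurable_funM => //; exact: measurable_powR_comp.
- by move=> z _; rewrite lee_fin mulr_ge0 ?powR_ge0.
- by rewrite lee_fin ltW.
pose F (z : T * R) := if (0 < z.2)%R then
  (z.2 `^ (p - 1) * (g z.1 * expR (- (h z.1 * z.2))))%:E else 0%E.
have mF : measurable_fun [set: T * measurableTypeR R] F.
  apply: measurable_pos_prod; apply: measurable_funM.
    by apply: measurable_powR_comp; exact: measurable_snd.
  apply: measurable_funM; first by apply: measurableT_comp => //; exact: measurable_fst.
  apply: measurable_expR_comp; apply: measurable_funN; apply: measurable_funM.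
    by apply: measurableT_comp => //; exact: measurable_fst.
  exact: measurable_snd.
have F0 z : (0 <= F z)%E.
  by rewrite /F; case: ifP => // _; rewrite lee_fin !mulr_ge0 ?powR_ge0 ?expR_ge0.
transitivity (\int[m]_z \int[leb]_x F (z, x))%E.
  apply: eq_integral => z _.
  rewrite -(integral_pos (fun x => (x `^ (p - 1) * (g z * expR (- (h z * x))))%:E)).
  under [RHS]eq_integral do rewrite mulrCA EFinM.
  rewrite ge0_integralZl//; last 3 first.
  - apply: measurable_EFin_comp; apply: measurable_funTS; apply: measurable_funM.
      exact: measurable_powR.
    by apply: measurable_expR_comp; apply: measurable_funN; apply: measurable_funM.
  - by move=> x _; rewrite lee_fin mulr_ge0 ?powR_ge0 ?expR_ge0.
  - by rewrite lee_fin.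
  by rewrite integral_Gamma_scale// -!EFinM; congr EFin; rewrite mulrCA.
rewrite (@tonelli_swap _ _ _ (measurableTypeR R) m leb F mF F0).
rewrite integral_pos; apply: eq_integral => x _; rewrite /F/=.
by case: ifPn => // _; rewrite integral0.
Qed.

(** Subordination writes the power as a mixture of Gaussians. Each integrates to [(pi / x)^(n/2)],
    and what remains is a Gamma integral with parameter [p - n/2]. *)
Lemma integral_powR_rV n (p a : R) : 0 < a -> n%:R / 2 < p ->
  (\int[mu n]_z ((a + sqn z) `^ (- p))%:E =
   (pi `^ (n%:R / 2) * Gam (p - n%:R / 2) / Gam p * a `^ (n%:R / 2 - p))%:E)%E.
Proof.
move=> a0 np; have p0 : 0 < p by apply: le_lt_trans np; rewrite divr_ge0.
have q0 : 0 < p - n%:R / 2 by rewrite subr_gt0.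
have h0 (z : 'rV[R]_n) : 0 < a + sqn z by rewrite ltr_pwDl ?sqn_ge0.
have mh : measurable_fun [set: 'rV[R]_n] (fun z => a + sqn z).
  by apply: measurable_funD => //; exact: measurable_dotv.
have := @Gamma_tonelli _ _ (mu n) (cst 1) _ p p0 (measurable_cst _) mh (fun=> ler01) h0.
under eq_integral do rewrite mul1r.
under [X in _ = X -> _]eq_integral => x.
  rewrite inE posE => x0.
  under eq_integral do rewrite mul1r mulrDl opprD expRD mulrA (mulrC (sqn _)) EFinM.
  rewrite ge0_integralZl//; last 2 first.
  - apply: measurable_EFin_comp; apply: measurable_expR_comp; apply: measurable_funN.
    by apply: measurable_funM => //; exact: measurable_dotv.
  - by rewrite lee_fin mulr_ge0 ?powR_ge0 ?expR_ge0.
  rewrite integral_gauss_rV// -EFinM.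
  rewrite [X in X%:E](_ : _ = pi `^ (n%:R / 2) * (x `^ (p - n%:R / 2 - 1) * expR (- (a * x)))); last first.
    rewrite (_ : (pi / x) `^ (n%:R / 2) = pi `^ (n%:R / 2) * x `^ (- (n%:R / 2))); last first.
      by rewrite powRM ?pi_ge0 ?invr_ge0 ?(ltW x0)// -(powR_inv1 (ltW x0)) -powRrM mulN1r.
    rewrite (_ : p - n%:R / 2 - 1 = (p - 1) + - (n%:R / 2)); last by ring.
    rewrite (powRDp (p - 1) _ x0).
    move: (x `^ _) (x `^ (p - 1)) (expR _) (pi `^ _) => A B E P; ring.
  over.
under [X in _ = X -> _]eq_integral do rewrite EFinM.
rewrite ge0_integralZl//; last 3 first.
- apply: measurable_EFin_comp; apply: measurable_funTS; apply: measurable_funM.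
    exact: measurable_powR.
  by apply: measurable_expR_comp; apply: measurable_funN; apply: measurable_funM.
- by move=> z _; rewrite lee_fin mulr_ge0 ?powR_ge0 ?expR_ge0.
- by rewrite lee_fin powR_ge0.
rewrite integral_Gamma_scale// => h.
have Gp := Gamma_gt0 p0.
have : ((Gam p)^-1%:E * ((Gam p)%:E * \int[mu n]_z ((a + sqn z) `^ (- p))%:E) =
  (Gam p)^-1%:E * ((pi `^ (n%:R / 2))%:E * (Gam (p - n%:R / 2) * a `^ (- (p - n%:R / 2)))%:E))%E.
  by rewrite h.
rewrite muleA -EFinM mulVf ?gt_eqF// mul1e => ->; rewrite -!EFinM; congr EFin.
by rewrite opprB; move: (a `^ _) (Gam (_ - _)) => A G; ring.
Qed.

Lemma Beta (a b : R) : 0 < a -> a < b ->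
  (\int[leb]_(v in pos) (v `^ (a - 1) * (1 + v) `^ (- b))%:E =
   (Gam a * Gam (b - a) / Gam b)%:E)%E.
Proof.
move=> a0 ab; have b0 : 0 < b by exact: lt_trans ab.
have c0 : 0 < b - a by rewrite subr_gt0.
have Gb := Gamma_gt0 b0.
(* [Gamma_tonelli] integrates over a whole space and wants [h > 0], so the half-line is encoded by
   [g = 0] and [h = 1] outside it. *)
pose g (v : R) := if 0 < v then v `^ (a - 1) else 0.
pose h (v : R) := if 0 < v then 1 + v else 1.
have mg : measurable_fun [set: measurableTypeR R] g.
  by apply: measurable_fun_ifT => //; exact: measurable_fun_ltr.
have mh : measurable_fun [set: measurableTypeR R] h.
  by apply: measurable_fun_ifT => //; [exact: measurable_fun_ltr|exact: measurable_funD].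
have g0 v : 0 <= g v by rewrite /g; case: ifP => // _; exact: powR_ge0.
have h0 v : 0 < h v by rewrite /h; case: ifP => // v0; rewrite addr_gt0.
have := @Gamma_tonelli _ (measurableTypeR R) leb g h b b0 mg mh g0 h0.
have -> : (\int[leb]_z (g z * h z `^ (- b))%:E = \int[leb]_(v in pos) (v `^ (a - 1) * (1 + v) `^ (- b))%:E)%E.
  rewrite integral_pos; apply: eq_integral => x _; rewrite /g /h.
  by case: ifP => // _; rewrite mul0r.
under [X in _ = X -> _]eq_integral => x.
  rewrite inE posE => x0.
  have -> : (\int[leb]_z (x `^ (b - 1) * (g z * expR (- (h z * x))))%:E =
     \int[leb]_(z in pos) ((x `^ (b - 1) * expR (- x)) * (z `^ (a - 1) * expR (- (x * z))))%:E)%E.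
    rewrite integral_pos; apply: eq_integral => z _; rewrite /g /h.
    case: ifP => // _; last by rewrite mul0r mulr0.
    rewrite mulrDl opprD expRD mul1r (mulrC z).
    by congr EFin; move: (z `^ _) (x `^ _) (expR _) (expR (- (x * z))) => A B C D; ring.
  under eq_integral do rewrite EFinM.
  rewrite ge0_integralZl//; last 3 first.
  - apply: measurable_EFin_comp; apply: measurable_funTS; apply: measurable_funM.
      exact: measurable_powR.
    by apply: measurable_expR_comp; apply: measurable_funN; apply: measurable_funM.
  - by move=> z _; rewrite lee_fin mulr_ge0 ?powR_ge0 ?expR_ge0.
  - by rewrite lee_fin mulr_ge0 ?powR_ge0 ?expR_ge0.
  rewrite integral_Gamma_scale// -EFinM.
  rewrite [X in X%:E](_ : _ = Gam a * (x `^ (b - a - 1) * expR (- x))); last first.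
    rewrite (_ : b - a - 1 = (b - 1) + - a); last by ring.
    rewrite (powRDp (b - 1) _ x0).
    by move: (x `^ (b - 1)) (x `^ (- a)) (expR _) => A B C; ring.
  over.
clear mg mh g0 h0 g h.
under [X in _ = X -> _]eq_integral do rewrite EFinM.
rewrite ge0_integralZl//; last 3 first.
- by apply: measurable_EFin_comp; apply: measurable_funTS; exact: measurable_gammaf.
- by move=> z _; rewrite lee_fin mulr_ge0 ?powR_ge0 ?expR_ge0.
- by rewrite lee_fin ltW// Gamma_gt0.
rewrite integral_Gamma// => H.
have : ((Gam b)^-1%:E * ((Gam b)%:E * \int[leb]_(v in pos) (v `^ (a - 1) * (1 + v) `^ (- b))%:E) =
  (Gam b)^-1%:E * ((Gam a)%:E * (Gam (b - a))%:E))%E by rewrite H.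
rewrite muleA -EFinM mulVf ?gt_eqF// mul1e => ->; rewrite -!EFinM; congr EFin.
by rewrite mulrC.
Qed.

(** The substitution [x = y^2] leads to the Gaussian integral. *)
Lemma Gamma_half : Gam (2^-1 : R) = Num.sqrt pi.
Proof.
apply: EFin_inj; rewrite -integral_Gamma//.
have e2 (x : R) : 0 < x -> (x ^+ 2) `^ (2^-1 - 1) * expR (- x ^+ 2) * (2 * x) = 2 * expR (- x ^+ 2).
  move=> x0; rewrite -powR_mulrn ?(ltW x0)// -powRrM (_ : 2%:R * (2^-1 - 1) = - 1); last by field.
  rewrite powR_inv1 ?(ltW x0)// powR_mulrn ?(ltW x0)//.
  by move: (expR _) => E; field; rewrite gt_eqF.
transitivity (\int[leb]_(x in pos) ((x ^+ 2) `^ (2^-1 - 1) * expR (- x ^+ 2) * (2 * x))%:E)%E; last first.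
  under eq_integral => x do (rewrite inE posE => x0; rewrite e2// EFinM).
  rewrite ge0_integralZl//; last first.
    apply: measurable_EFin_comp; apply: measurable_expR_comp; apply: measurable_funN.
    exact: measurable_funX.
  have := @integral0y_gauss R; rewrite -integral_itv_obnd_cbnd; last first.
    by apply: measurable_EFin_comp; apply: measurable_funTS; exact: measurable_gauss_fun.
  by rewrite /gauss_fun => ->; rewrite -EFinM; congr EFin; field.
apply: (@ge0_change_var_incr R (fun x => x ^+ 2) (fun x => 2 * x)
  (fun x => x `^ (2^-1 - 1) * expR (- x)) pos) => //.
- move=> x x0; have := is_derive_mulf (is_derive_id (x : R) (1 : R)) (is_derive_id (x : R) (1 : R)).
  by rewrite mul1r mulr1 -mulr2n mulr_natl.
- by move=> x _; apply: cvgM; [exact: cvg_cst|exact: cvg_id].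
- exact: interval_is_interval.
- by move=> x x0; rewrite posE exprn_gt0.
- move=> y; rewrite posE => y0; exists (Num.sqrt y); first by rewrite sqrtr_gt0.
  by rewrite sqr_sqrtr// ltW.
- move=> y; rewrite posE => y0; apply: cvgM; first exact: powR_continuous.
  by apply: continuous_comp; [exact: opp_continuous|exact: continuous_expR].
- by move=> y _; rewrite mulr_ge0 ?powR_ge0 ?expR_ge0.
- by move=> x x0; rewrite mulr_ge0 ?ltW.
- by move=> x y x0 xy; rewrite ltrXn2r ?nnegrE ?ltW//; exact: lt_trans xy.
Qed.

End gauss_rV.

(** * Rotation invariance and integration over slabs *)

Section rotation.
Context {R : realType}.
Local Notation leb := (@lebesgue_measure R).
Local Notation mu n := (@lebesgue_rV R n).
Local Open Scope ereal_scope.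

Lemma sqn_orth n (Q : 'M[R]_n) (x : 'rV[R]_n) : Q *m Q^T = 1%:M -> sqn (x *m Q) = sqn x.
Proof. by move=> QQ; rewrite /sqn !dotvE trmx_mul mulmxA -(mulmxA x) QQ mulmx1. Qed.

(* Averaging the invariant function [y |-> int f (x Q + y) dx] against a
   rotation-invariant Gaussian weight makes Tonelli exchange the two measures. *)
Lemma integral_rV_orth n (Q : 'M[R]_n) (f : 'rV[R]_n -> \bar R) :
  (Q *m Q^T = 1%:M)%R ->
  measurable_fun [set: 'rV[R]_n] f -> (forall x, 0 <= f x) ->
  \int[mu n]_x f (x *m Q)%R = \int[mu n]_x f x.
Proof.
move=> QQ mf f0.
have QtQ : (Q^T *m Q = 1%:M)%R by exact: mulmx1C.
pose g (y : 'rV[R]_n) := (expR (- (1 * sqn y)))%:E.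
have mg : measurable_fun [set: 'rV[R]_n] g.
  apply: measurable_EFin_comp; apply: measurable_expR_comp; apply: measurable_funN.
  by apply: measurable_funM => //; exact: measurable_dotv.
have g0 y : 0 <= g y by rewrite lee_fin expR_ge0.
have gint : \int[mu n]_y g y = ((pi / 1) `^ (n%:R / 2))%:E by exact: integral_gauss_rV.
have gpos : (0 < (pi / 1) `^ (n%:R / 2) :> R)%R by rewrite powR_gt0// divr_gt0 ?pi_gt0.
have mfQ : measurable_fun [set: 'rV[R]_n] (fun x => f (x *m Q)%R).
  by apply: measurableT_comp => //; exact: measurable_mulmx.
have key : (\int[mu n]_y g y) * \int[mu n]_x f (x *m Q)%R =
           (\int[mu n]_y g y) * \int[mu n]_x f x.
  transitivity (\int[mu n]_y \int[mu n]_x (g y * f (x *m Q + y)%R)).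
    rewrite -ge0_integralZr//; last exact: integral_ge0.
    apply: eq_integral => y _.
    rewrite ge0_integralZl//; last first.
      apply: measurableT_comp => //; apply: measurable_rVD => //; exact: measurable_mulmx.
    congr (_ * _).
    rewrite -[LHS](integral_rV_shift (y *m Q^T)%R mfQ)//.
    by apply: eq_integral => x _; rewrite mulmxDl -mulmxA QtQ mulmx1.
  pose G (z : 'rV[R]_n * 'rV[R]_n) := g z.1 * f (z.2 *m Q + z.1)%R.
  have mG : measurable_fun setT G.
    apply: emeasurable_funM; first by apply: measurableT_comp => //; exact: measurable_fst.
    apply: measurableT_comp => //; apply: measurable_rVD; last exact: measurable_fst.
    by apply: measurable_mulmx; exact: measurable_snd.
  have G0 z : 0 <= G z by rewrite mule_ge0.
  rewrite (@tonelli_swap _ _ _ _ _ (mu n) (mu n) G mG G0) /G/=.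
  pose H (z : 'rV[R]_n * 'rV[R]_n) := g (z.2 - z.1 *m Q)%R * f z.2.
  have mH : measurable_fun setT H.
    apply: emeasurable_funM; last by apply: measurableT_comp => //; exact: measurable_snd.
    apply: measurableT_comp => //; apply: measurable_rVB; first exact: measurable_snd.
    by apply: measurable_mulmx; exact: measurable_fst.
  have H0 z : 0 <= H z by rewrite mule_ge0.
  transitivity (\int[mu n]_x \int[mu n]_y H (x, y)).
    apply: eq_integral => x _.
    have mHx : measurable_fun setT (fun y => H (x, y)).
      exact: (measurableT_comp mH (pair1_measurable x)).
    rewrite -(@integral_rV_shift R n (x *m Q)%R (fun y => H (x, y)) mHx (fun y => H0 (x, y))).
    by apply: eq_integral => y _; rewrite /H/= addrK (addrC y).
  rewrite (@tonelli_swap _ _ _ _ _ (mu n) (mu n) H mH H0) /H/=.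
  rewrite -ge0_integralZl//; last first.
    by apply: integral_ge0.
  apply: eq_integral => y _.
  have mgy : measurable_fun [set: 'rV[R]_n] (fun x => g (y - x *m Q)%R).
    by apply: measurableT_comp => //; apply: measurable_rVB => //; exact: measurable_mulmx.
  have gE : \int[mu n]_x g (y - x *m Q)%R = \int[mu n]_x g x.
    rewrite -(integral_rV_shift (- (y *m Q^T))%R mg g0).
    apply: eq_integral => x _; rewrite /g; congr (expR (- (1 * _)))%:E.
    rewrite -(sqn_orth (x - y *m Q^T)%R QQ) mulmxBl -mulmxA QtQ mulmx1.
    by rewrite -opprB /sqn dotvNl dotvNr opprK.
  by rewrite (ge0_integralZr (mu n) measurableT mgy (fun x _ => g0 _) (f0 y)) gE.
move: key; rewrite gint => /(congr1 (fun z => (((pi / 1) `^ (n%:R / 2))^-1)%:E * z)).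
by rewrite !muleA -!EFinM mulVf ?gt_eqF// !mul1e.
Qed.

Definition e0 n : 'rV[R]_n.+1 := delta_mx ord0 ord0.

Lemma dotv_e0 n (x : 'rV[R]_n.+1) : dotv x (e0 n) = x ord0 ord0.
Proof.
rewrite /dotv (bigD1 ord0)//= mxE !eqxx mulr1 big1 ?addr0// => i i0.
by rewrite mxE eqxx (negbTE i0) mulr0.
Qed.

(** [Q] is the Householder reflection along [w = v - e0], which exchanges [v] and the first basis
    vector. It degenerates when [w = 0], where the identity does. *)
Lemma exists_orth n (v : 'rV[R]_n.+1) : sqn v = 1%R ->
  exists2 Q : 'M[R]_n.+1, (Q *m Q^T = 1%:M)%R &
    forall x, dotv (x *m Q) v = x ord0 ord0.
Proof.
move=> v1; pose w := (v - e0 n)%R.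
have e1 : sqn (e0 n) = 1%R by rewrite /sqn dotv_e0 mxE !eqxx.
have [w0|w0] := eqVneq w 0%R.
  exists 1%:M; first by rewrite trmx1 mulmx1.
  by move=> x; rewrite mulmx1 -dotv_e0; congr dotv; apply/subr0_eq.
have sw : sqn w != 0%R by rewrite sqn_eq0.
pose Q := (1%:M - (2 / sqn w) *: (w^T *m w))%R.
have xQ x : (x *m Q = x - (2 * dotv x w / sqn w) *: w)%R.
  rewrite mulmxBr mulmx1 -scalemxAr mulmxA; congr (_ - _)%R.
  have -> : (x *m w^T = (dotv x w)%:M)%R by rewrite dotvE [LHS]mx11_scalar.
  by rewrite mul_scalar_mx scalerA mulrAC.
have Qt : (Q^T = Q)%R.
  by rewrite /Q linearB/= trmx1 linearZ/= trmx_mul trmxK.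
have xQQ (x : 'rV[R]_n.+1) : (x *m Q *m Q = x)%R.
  rewrite (xQ (x *m Q)%R) xQ; set a := (2 * dotv x w / sqn w)%R.
  rewrite dotvDl dotvNl dotvZl -/(sqn w) -addrA -opprD -scalerDl.
  rewrite [X in X *: w](_ : _ = 0)%R ?scale0r ?subr0// /a.
  by field.
exists Q; first by rewrite Qt; apply/row_matrixP => i; rewrite rowE mulmxA xQQ row1.
move=> x; rewrite xQ dotvDl dotvNl dotvZl.
have swE : (sqn w = 2 - 2 * dotv v (e0 n))%R.
  rewrite /w /sqn !dotv_lin -/(sqn v) -/(sqn (e0 n)) v1 e1 (dotvC (e0 n)).
  by move: (dotv v (e0 n)) => c; ring.
have wv : (dotv w v = 1 - dotv v (e0 n))%R.
  by rewrite /w !dotv_lin -/(sqn v) v1 (dotvC (e0 n)).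
have xw : dotv x w = (dotv x v - x ord0 ord0)%R by rewrite /w !dotv_lin dotv_e0.
have h : (1 - dotv v (e0 n) != 0)%R.
  by apply: contra_neq sw; rewrite swE => h; rewrite -[X in (X - _)%R]mulr1 -mulrBr h mulr0.
rewrite xw wv swE; field.
by rewrite -[X in (X - _)%R]mulr1 -mulrBr mulf_neq0.
Qed.

Lemma integral_coords n (v x : 'rV[R]_n.+1) (f : R * R -> \bar R) :
  sqn v = 1%R -> measurable_fun [set: measurableTypeR R * measurableTypeR R] f -> (forall z, 0 <= f z) ->
  \int[mu n.+1]_y f (dotv (y - x) v, sqn (y - x))%R =
  \int[leb]_s \int[mu n]_z f (s, s ^+ 2 + sqn z)%R.
Proof.
move=> v1 mf f0; have [Q QQ Qv] := exists_orth v1.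
have mF : measurable_fun [set: 'rV[R]_n.+1] (fun y => f (dotv y v, sqn y)).
  apply: measurableT_comp => //; apply/measurable_fun_pairP; split; exact: measurable_dotv.
rewrite (@integral_rV_shift R n.+1 (- x)%R (fun y => f (dotv y v, sqn y)))//.
rewrite -(integral_rV_orth QQ mF)//.
under eq_integral do rewrite Qv sqn_orth//.
have mF' : measurable_fun [set: 'rV[R]_n.+1] (fun y => f (y ord0 ord0, sqn y)).
  apply: measurableT_comp => //; apply/measurable_fun_pairP; split.
    exact: measurable_coord.
  exact: measurable_dotv.
rewrite (integral_rVS mF' (fun=> f0 _)).
by apply: eq_integral => s _; apply: eq_integral => z _; rewrite cons_rV0 sqn_cons.
Qed.

(* [(p - n/2)] is the exponent left after integrating out n transversal variables. *)
Definition Acst n (p : R) : R := (pi `^ (n%:R / 2) * Gam (p - n%:R / 2) / Gam p)%R.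

Lemma Acst_gt0 n (p : R) : (n%:R / 2 < p)%R -> (0 < Acst n p)%R.
Proof.
move=> np; have p0 : (0 < p)%R by apply: le_lt_trans np; rewrite divr_ge0.
by rewrite divr_gt0 ?mulr_gt0 ?powR_gt0 ?pi_gt0 ?Gamma_gt0// subr_gt0.
Qed.

(** [Acst n p] is the integral of [(1 + |z|^2)^(-p)], whose integrand decreases in [p]. This yields
    bounds that are uniform in [t]. *)
Lemma Acst_decr n (p q : R) : (n%:R / 2 < p)%R -> (p <= q)%R -> (Acst n q <= Acst n p)%R.
Proof.
move=> np pq; have nq := lt_le_trans np pq.
have := integral_powR_rV ltr01 np; have := integral_powR_rV ltr01 nq.
rewrite !powR1 !mulr1 -!/(Acst _ _) => hq hp.
rewrite -lee_fin -hp -hq; apply: ge0_le_integral => //.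
- by move=> z _; rewrite lee_fin powR_ge0.
- apply: measurable_EFin_comp; apply: measurable_powR_comp.
  by apply: measurable_funD => //; exact: measurable_dotv.
- apply: measurable_EFin_comp; apply: measurable_powR_comp.
  by apply: measurable_funD => //; exact: measurable_dotv.
by move=> z _; rewrite lee_fin ler_powR ?lerN2// lerDl sqn_ge0.
Qed.

(** Integrating over the hyperplanes orthogonal to [v] leaves a one-dimensional kernel of the same
    shape, with the same [e]. All half-space computations thus become integrals on a line. *)
Lemma integral_slab n (v x : 'rV[R]_n.+1) (g : R -> \bar R) (e p : R) :
  sqn v = 1%R -> measurable_fun [set: R] g -> (forall s, 0 <= g s) -> (0 < e)%R ->
  (n%:R / 2 < p)%R ->
  \int[mu n.+1]_y (g (dotv (y - x) v)%R * ((sqn (y - x) + e) `^ (- p))%:E) =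
  (Acst n p)%:E * \int[leb]_s (g s * ((s ^+ 2 + e) `^ (n%:R / 2 - p))%:E).
Proof.
move=> v1 mg g0 e_gt0 np.
have mf : measurable_fun [set: measurableTypeR R * measurableTypeR R]
    (fun z : R * R => g z.1 * ((z.2 + e) `^ (- p))%:E).
  apply: emeasurable_funM; first by apply: measurableT_comp => //; exact: measurable_fst.
  by apply: measurable_EFin_comp; apply: measurable_powR_comp; apply: measurable_funD => //.
have f0 (z : R * R) : 0 <= g z.1 * ((z.2 + e) `^ (- p))%:E.
  by rewrite mule_ge0// lee_fin powR_ge0.
rewrite (@integral_coords n v x _ v1 mf f0) /=.
rewrite -ge0_integralZl//; last 3 first.
- apply: emeasurable_funM => //; apply: measurable_EFin_comp; apply: measurable_powR_comp.
  by apply: measurable_funD => //; exact: measurable_funX.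
- by move=> s _; rewrite mule_ge0// lee_fin powR_ge0.
- by rewrite lee_fin ltW// Acst_gt0.
apply: eq_integral => s _.
rewrite ge0_integralZl//; last 2 first.
- apply: measurable_EFin_comp; apply: measurable_powR_comp; apply: measurable_funD => //.
  by apply: measurable_funD => //; exact: measurable_dotv.
- by move=> z _; rewrite lee_fin powR_ge0.
rewrite muleCA -EFinM; congr (_ * _).
have se : (0 < s ^+ 2 + e)%R by rewrite ltr_wpDl ?sqr_ge0.
rewrite -(integral_powR_rV se np).
by apply: eq_integral => z _; rewrite addrAC.
Qed.

End rotation.

(** * The one-dimensional Hardy constant *)

Lemma ge0_integrableR d (T : measurableType d) (R : realType) (m : {measure set T -> \bar R})
    (D : set T) (f : T -> R) :
  measurable_fun D f -> (forall x, D x -> 0 <= f x) ->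
  (\int[m]_(x in D) (f x)%:E < +oo)%E -> m.-integrable D (EFin \o f).
Proof.
move=> mf f0 fi; apply/integrableP; split; first exact/measurable_EFinP.
rewrite (eq_integral (EFin \o f))// => x; rewrite inE => Dx.
by rewrite gee0_abs//= lee_fin f0.
Qed.

Section one_dim.
Context {R : realType}.
Local Notation leb := (@lebesgue_measure R).
Local Notation pos := (`]0%R, +oo[%classic : set R).

Lemma majorant_continuous (c x : R) : 0 < x -> {for x, continuous (majorant c)}.
Proof.
move=> x0; have p1 : 0 < 1 + x `^ c by rewrite ltr_pwDl ?powR_ge0.
apply: cvgM; first exact: powR_continuous.
apply: cvgV; first by rewrite expf_neq0// gt_eqF.
by rewrite expr2; apply: cvgM; (apply: cvgD; [exact: cvg_cst|exact: powR_continuous]).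
Qed.

Lemma powR_cvgy0 (p : R) : p < 0 -> x `^ p @[x --> +oo] --> (0 : R).
Proof.
move=> p0; apply/cvgrPdist_le => e e0; near=> x.
have x0 : 0 < x by near: x; exact: nbhs_pinfty_gt.
have xe : e `^ p^-1 <= x by near: x; exact: nbhs_pinfty_ge.
rewrite sub0r normrN ger0_norm ?powR_ge0//.
have -> : e = (e `^ p^-1) `^ p by rewrite -powRrM mulVf ?lt_eqF// powRr1// ltW.
by apply: le0_ler_powR => //; [exact: ltW|exact: powR_gt0].
Unshelve. all: by end_near. Qed.

Lemma mulr_powR (x a : R) : 0 < x -> x `^ a * x = x `^ (a + 1).
Proof. by move=> x0; rewrite powRDp// powRr1// ltW. Qed.

Lemma is_derive_1D (x : R) : is_derive x 1 (fun y : R => 1 + y) 1.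
Proof. by apply: is_derive_addc; exact: is_derive_id. Qed.

Lemma powR_add1_continuous (p x : R) : 0 < x -> {for x, continuous (fun v : R => (1 + v) `^ p)}.
Proof.
move=> x0; apply: (@continuous_comp _ _ _ (fun v : R => 1 + v) (fun v : R => v `^ p)).
  by apply: cvgD; [exact: cvg_cst|exact: cvg_id].
by apply: powR_continuous; rewrite addr_gt0.
Qed.

Lemma powR_add1_sub1 (t v : R) : 0 <= t <= 1 -> 0 <= v -> 0 <= (1 + v) `^ t - 1 <= v.
Proof.
move=> /andP[t0 t1] v0; apply/andP; split.
  by rewrite subr_ge0 -[X in X <= _](powRr0 (1 + v)) ler_powR// lerDl.
by rewrite lerBlDl ler1_powR// lerDl.
Qed.

(** Young's inequality for the product of [(1 + v)^t] and 1, with exponents [1/t] and [1/(1-t)]. *)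
Lemma powR_Bernoulli (t v : R) : 0 < t < 1 -> 0 <= v -> (1 + v) `^ t - 1 <= t * v.
Proof.
move=> /andP[t0 t1] v0; have t1' : 0 < 1 - t by rewrite subr_gt0.
have p0 : 0 < t^-1 by rewrite invr_gt0.
have q0 : 0 < (1 - t)^-1 by rewrite invr_gt0.
have pq : t^-1^-1 + (1 - t)^-1^-1 = 1 by rewrite !invrK; ring.
have := conjugate_powR (powR_ge0 (1 + v) t) (@ler01 R) p0 q0 pq.
rewrite mulr1 powR1 mul1r !invrK -powRrM mulfV ?gt_eqF// powRr1 ?addr_ge0// => h.
by move: h; clear; lra.
Qed.

Lemma Gam1 : Gam (1 : R) = 1.
Proof.
apply: EFin_inj; rewrite -integral_Gamma//.
transitivity (\int[leb]_(x in pos) (expR (- x))%:E)%E.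
  by apply: eq_integral => x _; rewrite subrr powRr0 mul1r.
have := @ge0_FTC0y R (fun x => expR (- x)) (fun x => - expR (- x)) (- 1) 0 _ _ _ _ _.
rewrite sub0r opprK; apply => [x _|x _|x _||].
- exact: expR_ge0.
- by apply: continuous_comp; [exact: opp_continuous|exact: continuous_expR].
- have := is_derive_oppf (is_derive1_comp (is_derive_expR (- x)) (is_deriveNid x (1 : R))).
  by rewrite mulrN1 opprK.
- apply: cvgN; rewrite -[X in _ --> X]expR0 -[X in expR X]oppr0.
  apply: cvg_at_right_filter.
  by apply: continuous_comp; [exact: opp_continuous|exact: continuous_expR].
- rewrite -[X in _ --> X]oppr0; apply: cvgN; exact: cvgr_expR.
Qed.

(** Taken from [Beta] at first parameter 1, where the integral of [(1 + v)^(-1-t)] is elementary. *)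
Lemma GamS (t : R) : 0 < t -> Gam (1 + t) = t * Gam t.
Proof.
move=> t0; have := @Beta R 1 (1 + t) ltr01.
rewrite ltrDl => /(_ t0); rewrite Gam1 mul1r addrAC subrr add0r.
under eq_integral do rewrite powRr0 mul1r.
have -> : (\int[leb]_(v in pos) ((1 + v) `^ (- (1 + t)))%:E = (t^-1)%:E)%E.
  have := @ge0_FTC0y R (fun v => (1 + v) `^ (- (1 + t))) (fun v => - t^-1 * (1 + v) `^ (- t)) (- t^-1) 0 _ _ _ _ _.
  rewrite sub0r opprK; apply => [x _|x x0|x x0||].
  - exact: powR_ge0.
  - exact: powR_add1_continuous.
  - have x1 : 0 < 1 + x by rewrite addr_gt0.
    have := is_derive_mulc (- t^-1) (is_derive_powRf (- t) x1 (is_derive_1D x)).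
    rewrite mulr1 mulrA mulrNN mulVf ?gt_eqF// mul1r.
    by rewrite (_ : - t - 1 = - (1 + t))//; ring.
  - rewrite -[X in _ --> X]mulr1; apply: cvgM; first exact: cvg_cst.
    rewrite -[X in _ --> X](powRr0 1) (_ : 1 `^ 0 = (1 + 0) `^ (- t)); last by rewrite addr0 powRr0 powR1.
    apply: cvg_at_right_filter.
    apply: (@continuous_comp _ _ _ (fun v : R => 1 + v) (fun v : R => v `^ (- t))).
      by apply: cvgD; [exact: cvg_cst|exact: cvg_id].
    by apply: powR_continuous; rewrite addr0.
  - rewrite -[X in _ --> X](mulr0 (- t^-1)); apply: cvgM; first exact: cvg_cst.
    apply: (@cvg_comp _ _ _ (fun v : R => 1 + v) (fun v : R => v `^ (- t))).
      2: by apply: powR_cvgy0; rewrite oppr_lt0.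
    apply/cvgryPge => A; near=> v.
    apply: (@le_trans _ _ v); last by rewrite lerDr.
    by near: v; apply: nbhs_pinfty_ge; exact: num_real.
have G1 : 0 < Gam (1 + t) by rewrite Gamma_gt0// addr_gt0.
move=> [h]; have -> : Gam t = t^-1 * Gam (1 + t) by rewrite h divfK// gt_eqF.
by rewrite mulrA divff ?mul1r// gt_eqF.
Unshelve. all: by end_near. Qed.

(** The substitution [u = v^2 / (4 (1 + v))] gives [1 + u = (v + 2)^2 / (4 (1 + v))], a square up to
    [1 + v]. The factor [v + 2] of the derivative then cancels against [(1 + u)^(-1/2)]. *)
Lemma quadratic_subst (t : R) : 0 < t < 2^-1 ->
  (\int[leb]_(u in pos) (u `^ (2^-1 - t - 1) * (1 + u) `^ (- 2^-1))%:E =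
   \int[leb]_(v in pos) (2 `^ (2 * t) * (v `^ (- (2 * t)) * (1 + v) `^ (t - 1)))%:E)%E.
Proof.
move=> /andP[t0 t1].
pose F (v : R) := v ^+ 2 / (4 * (1 + v)).
pose f (v : R) := (v ^+ 2 + 2 * v) / (4 * (1 + v) ^+ 2).
have h := @ge0_change_var_incr R F f (fun u => u `^ (2^-1 - t - 1) * (1 + u) `^ (- 2^-1)) pos.
transitivity (\int[leb]_(x in pos) (F x `^ (2^-1 - t - 1) * (1 + F x) `^ (- 2^-1) * f x)%:E)%E; last first.
  apply: eq_integral => v; rewrite inE posE => v0; congr EFin.
  have v1 : 0 < 1 + v by rewrite addr_gt0.
  have v2 : 0 < v + 2 by rewrite addr_gt0.
  have -> : F v = v `^ 2 * (2 `^ (- 2) * (1 + v) `^ (- 1)).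
    by rewrite /F powR_inv1 ?ltW// powR_invn// powR_mulrn ?ltW//; field; rewrite gt_eqF.
  have -> : 1 + v `^ 2 * (2 `^ (- 2) * (1 + v) `^ (- 1)) = (v + 2) `^ 2 * (2 `^ (- 2) * (1 + v) `^ (- 1)).
    rewrite powR_inv1 ?ltW// powR_invn// !powR_mulrn ?ltW//; field.
    by rewrite gt_eqF.
  have -> : f v = v * (v + 2) * 2 `^ (- 2) * (1 + v) `^ (- 2).
    by rewrite /f !powR_invn ?ltW//; field; rewrite gt_eqF.
  rewrite !powRM ?mulr_ge0 ?powR_ge0// -!powRrM.
  rewrite [LHS](_ : _ = (v `^ (2 * (2^-1 - t - 1)) * v) * ((v + 2) `^ (2 * - 2^-1) * (v + 2))
    * (2 `^ (- 2 * (2^-1 - t - 1)) * 2 `^ (- 2 * - 2^-1) * 2 `^ (- 2))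
    * ((1 + v) `^ (- 1 * (2^-1 - t - 1)) * (1 + v) `^ (- 1 * - 2^-1) * (1 + v) `^ (- 2))); last by ring.
  rewrite !mulr_powR// -!powRDp//.
  rewrite (_ : 2 * (2^-1 - t - 1) + 1 = - (2 * t)); last by field.
  rewrite (_ : 2 * - 2^-1 + 1 = 0); last by field.
  rewrite (_ : - 2 * (2^-1 - t - 1) + - 2 * - 2^-1 + - 2 = 2 * t); last by field.
  rewrite (_ : - 1 * (2^-1 - t - 1) + - 1 * - 2^-1 + - 2 = t - 1); last by field.
  by rewrite powRr0 mulr1 -mulrA mulrCA.
apply: h => //.
- move=> x x0; have x1 : 4 * (1 + x) != 0 by rewrite mulf_neq0// gt_eqF// addr_gt0.
  have d1 : is_derive x 1 (fun y : R => 4 * (1 + y)) (4 * 1).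
    by apply: is_derive_mulc; exact: is_derive_1D.
  have d2 : is_derive x 1 (fun y : R => y ^+ 2) (1 * x + x * 1).
    exact: (is_derive_mulf (is_derive_id (x : R) (1 : R)) (is_derive_id (x : R) (1 : R))).
  apply: (is_derive_eq (is_derive_mulf d2 (@is_derive_inv R (fun y : R => 4 * (1 + y)) x _ x1 d1))).
  by rewrite /f; field; rewrite gt_eqF// addr_gt0.
- move=> x x0; have x1 : 0 < 1 + x by rewrite addr_gt0.
  apply: cvgM.
    apply: cvgD; first by rewrite expr2; apply: cvgM; exact: cvg_id.
    by apply: cvgM; [exact: cvg_cst|exact: cvg_id].
  apply: cvgV; first by rewrite mulf_neq0// expf_neq0// gt_eqF.
  apply: cvgM; first exact: cvg_cst.
  by rewrite expr2; apply: cvgM; (apply: cvgD; [exact: cvg_cst|exact: cvg_id]).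
- exact: interval_is_interval.
- by move=> x x0; rewrite posE divr_gt0 ?mulr_gt0 ?exprn_gt0 ?addr_gt0.
- move=> y; rewrite posE => y0.
  (* The preimage of [y] is the positive root of [v^2 - 4 y v - 4 y = 0]. *)
  pose r := Num.sqrt (y ^+ 2 + y); have r0 : 0 < r by rewrite sqrtr_gt0 addr_gt0// exprn_gt0.
  have rr : r ^+ 2 = y ^+ 2 + y by rewrite sqr_sqrtr// ltW// addr_gt0// exprn_gt0.
  exists (2 * y + 2 * r); first by rewrite addr_gt0// mulr_gt0.
  have -> : F (2 * y + 2 * r) = y; last by [].
  rewrite /F (_ : (2 * y + 2 * r) ^+ 2 = y * (4 * (1 + (2 * y + 2 * r)))).
    by rewrite mulfK// mulf_neq0// gt_eqF// !addr_gt0// mulr_gt0.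
  rewrite (_ : (2 * y + 2 * r) ^+ 2 = 4 * y ^+ 2 + 8 * y * r + 4 * r ^+ 2); last by ring.
  by rewrite rr; ring.
- move=> y; rewrite posE => y0; apply: cvgM; first exact: powR_continuous.
  exact: powR_add1_continuous.
- by move=> y _; rewrite mulr_ge0 ?powR_ge0.
- by move=> x x0; rewrite divr_ge0 ?mulr_ge0 ?addr_ge0 ?sqr_ge0 ?mulr_ge0 ?ltW.
- move=> x y x0 xy; have y0 := lt_trans x0 xy.
  rewrite /F ltr_pdivrMr ?mulr_gt0 ?addr_gt0// mulrAC ltr_pdivlMr ?mulr_gt0 ?addr_gt0//.
  rewrite -subr_gt0 (_ : _ - _ = 4 * ((y - x) * (x + y + x * y))); last by ring.
  by rewrite !mulr_gt0 ?subr_gt0 ?addr_gt0 ?mulr_gt0.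
Qed.

(** The factor of [kappa] that does not depend on the dimension; see [kappaE]. *)
Definition gam (t : R) : R :=
  (2 `^ (- (2 * t)) / Num.sqrt pi * Gam (2^-1 - t) * Gam (1 + t) - 1) / (1 + 2 * t).

(** The principal value of [(1 - y^t) |1 - y|^(-2-2t)] over [y > 0], folded: [y = 1 + v] and
    [y = 1/(1+v)] contribute [(1 - B) v^(-2-2t)] and [(B^2 - B) v^(-2-2t)] with [B = (1+v)^t], which
    add up to an absolutely integrable square. *)
Definition gamf (t v : R) : R := ((1 + v) `^ t - 1) ^+ 2 * v `^ (- (2 + 2 * t)).

Lemma integral_f2 (t : R) : 0 < t < 2^-1 ->
  (\int[leb]_(v in pos) (t * (v `^ (- (2 * t)) * (1 + v) `^ (t - 1)))%:E =
   (2 `^ (- (2 * t)) / Num.sqrt pi * Gam (2^-1 - t) * Gam (1 + t))%:E)%E.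
Proof.
move=> t01; have /andP[t0 t1] := t01.
have a0 : 0 < 2^-1 - t by rewrite subr_gt0.
have ab : 2^-1 - t < 2^-1 by rewrite ltrBlDr ltrDl.
have := Beta a0 ab; rewrite quadratic_subst// opprB addrCA subrr addr0 Gamma_half.
have two : 0 < (2 : R) `^ (2 * t) by rewrite powR_gt0.
have m1 : measurable_fun pos (fun v => (v `^ (- (2 * t)) * (1 + v) `^ (t - 1))%:E).
  apply: measurable_EFin_comp; apply: measurable_funTS; apply: measurable_funM.
    exact: measurable_powR.
  by apply: measurable_powR_comp; exact: measurable_funD.
have p1 v : pos v -> (0 <= (v `^ (- (2 * t)) * (1 + v) `^ (t - 1))%:E)%E.
  by move=> _; rewrite lee_fin mulr_ge0 ?powR_ge0.
under eq_integral do rewrite EFinM.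
rewrite (ge0_integralZl leb (measurable_itv _) m1 p1); last by rewrite lee_fin ltW.
move=> h; under eq_integral do rewrite EFinM.
rewrite (ge0_integralZl leb (measurable_itv _) m1 p1); last by rewrite lee_fin ltW.
move: h => /(congr1 (fun z => ((2 `^ (2 * t))^-1)%:E * z)%E).
rewrite muleA -EFinM mulVf ?gt_eqF// mul1e => ->; rewrite -!EFinM; congr EFin.
rewrite GamS// powRN; field.
by rewrite gt_eqF ?sqrtr_gt0 ?pi_gt0// gt_eqF.
Qed.

(** The function is the primitive used in [integral_gam]. Its total increment, -1, is the -1 in the
    bracket of [gam]. *)
Lemma Psi_cvg0 (t : R) : 0 < t < 2^-1 ->
  - (1 + v) * ((1 + v) `^ t - 1) ^+ 2 * v `^ (- (1 + 2 * t))
   - ((1 + v) `^ t - 1) * v `^ (- (2 * t)) @[v --> 0^'+] --> (0 : R).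
Proof.
move=> /andP[t0 t1]; have t01 : 0 <= t <= 1 by lra.
apply/cvgrPdist_le => e e0.
have e4 : 0 < e / 4 by rewrite divr_gt0.
have := @powR_cvg0 R (1 - 2 * t); rewrite subr_gt0 => /(_ ltac:(lra))/cvgrPdist_le/(_ _ e4) h.
near=> v.
have v0 : 0 < v by [].
have v1 : v <= 1 by near: v; exact: nbhs_right_le.
have := powR_add1_sub1 t01 (ltW v0).
set A := (1 + v) `^ t - 1 => /andP[A0 Av].
have : `|0 - v `^ (1 - 2 * t)| <= e / 4 by near: v.
rewrite !sub0r !normrN ger0_norm ?powR_ge0// => hv.
have E1 : v `^ (1 - 2 * t) = v ^+ 2 * v `^ (- (1 + 2 * t)).
  by rewrite -powR_mulrn ?(ltW v0)// -powRDp//; congr powR; ring.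
have E2 : v `^ (1 - 2 * t) = v * v `^ (- (2 * t)).
  by rewrite [RHS]mulrC mulr_powR//; congr powR; ring.
have p1 := powR_ge0 v (- (1 + 2 * t)); have p2 := powR_ge0 v (- (2 * t)).
rewrite !mulNr -opprD normrN ger0_norm; last first.
  by rewrite addr_ge0// !mulr_ge0 ?sqr_ge0//; lra.
apply: (@le_trans _ _ (2 * (e / 4) + e / 4)); last lra.
apply: lerD.
  apply: (@le_trans _ _ (2 * v `^ (1 - 2 * t))); last by rewrite ler_pM2l.
  rewrite E1 -mulrA ler_pM ?mulr_ge0 ?sqr_ge0//; [lra|lra|].
  by rewrite ler_wpM2r// ler_pXn2r ?nnegrE ?(ltW v0).
by apply: le_trans hv; rewrite E2 ler_wpM2r.
Unshelve. all: by end_near. Qed.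

(** Factoring [1 + v = v (1 + v^(-1))] expresses everything through [v^(-1)] and [v^(-t)], which
    tend to 0. *)
Lemma Psi_cvgy (t : R) : 0 < t < 2^-1 ->
  - (1 + v) * ((1 + v) `^ t - 1) ^+ 2 * v `^ (- (1 + 2 * t))
   - ((1 + v) `^ t - 1) * v `^ (- (2 * t)) @[v --> +oo] --> (- 1 : R).
Proof.
move=> /andP[t0 t1].
have cv1 : v `^ (- 1) @[v --> +oo] --> (0 : R) by apply: powR_cvgy0; lra.
have cvt : v `^ (- t) @[v --> +oo] --> (0 : R) by apply: powR_cvgy0; lra.
have cw : 1 + v `^ (- 1) @[v --> +oo] --> (1 : R).
  by rewrite -[X in _ --> X]addr0; apply: cvgD => //; exact: cvg_cst.
have cwt : (1 + v `^ (- 1)) `^ t @[v --> +oo] --> (1 : R).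
  rewrite -[X in _ --> X](congr1 (@^~ t) (@powR1 R)).
  by apply: (@cvg_comp _ _ _ (fun v : R => 1 + v `^ (- 1)) (fun v : R => v `^ t) _ _ _ cw); exact: powR_continuous.
have cA : (1 + v `^ (- 1)) `^ t - v `^ (- t) @[v --> +oo] --> (1 : R).
  by rewrite -[X in _ --> X]subr0; apply: cvgB.
have cm : - ((1 + v `^ (- 1)) * (((1 + v `^ (- 1)) `^ t - v `^ (- t)) * ((1 + v `^ (- 1)) `^ t - v `^ (- t))))
   - ((1 + v `^ (- 1)) `^ t - v `^ (- t)) * v `^ (- t) @[v --> +oo] --> (- 1 : R).
  rewrite -[X in _ --> X]subr0; apply: cvgB.
    by apply: cvgN; rewrite -[X in _ --> X]mulr1; apply: cvgM => //; rewrite -[X in _ --> X]mulr1; apply: cvgM.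
  by rewrite -[X in _ --> X](mulr0 1); apply: cvgM.
apply: cvg_trans cm; apply: near_eq_cvg; near=> v.
have v0 : 0 < v by near: v; exact: nbhs_pinfty_gt.
have E1 : 1 + v = v * (1 + v `^ (- 1)).
  by rewrite powR_inv1 ?(ltW v0)//; field; rewrite gt_eqF.
rewrite E1 powRM ?(ltW v0) ?addr_ge0 ?powR_ge0//.
set w := (1 + _) `^ t; set W := 1 + _.
have -> : w - v `^ (- t) = (v `^ t * w - 1) * v `^ (- t).
  by rewrite mulrBl mul1r mulrAC -powRDp// subrr powRr0 mul1r.
have -> : v `^ (- (2 * t)) = v `^ (- t) * v `^ (- t) by rewrite -powRDp//; congr powR; ring.
have -> : v `^ (- (1 + 2 * t)) = v^-1 * (v `^ (- t) * v `^ (- t)).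
  by rewrite -powR_inv1 ?(ltW v0)// -!powRDp//; congr powR; ring.
by field; rewrite gt_eqF.
Unshelve. all: by end_near. Qed.

Lemma inv_add1_powR_cvgy (t : R) : 0 < t -> (1 + v `^ t)^-1 @[v --> +oo] --> (0 : R).
Proof.
move=> t0; have cvt : v `^ (- t) @[v --> +oo] --> (0 : R) by apply: powR_cvgy0; rewrite oppr_lt0.
have cm : v `^ (- t) * (1 + v `^ (- t))^-1 @[v --> +oo] --> (0 : R).
  rewrite -[X in _ --> X](mul0r (1 + 0)^-1); apply: cvgM => //.
  by apply: cvgV; rewrite ?addr0 ?oner_eq0//; rewrite -[X in _ --> X]addr0; apply: cvgD => //; exact: cvg_cst.
apply: cvg_trans cm; apply: near_eq_cvg; near=> v.
have v0 : 0 < v by near: v; exact: nbhs_pinfty_gt.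
have vt := powR_gt0 t v0.
by rewrite powRN; field; rewrite !gt_eqF// addr_gt0.
Unshelve. all: by end_near. Qed.

(** [(1 + 2t) gamf - f2] is the derivative of [Psi], so [(1 + 2t)] times the integral of [gamf] is
    that of [f2] minus 1, and [integral_f2] gives the latter. This derivative need not have a sign.
    Adding [m >= f2], whose primitive [M] is known, makes the integrand nonnegative as [ge0_FTC0y]
    requires, and [m] is subtracted afterwards. *)
Lemma integral_gam (t : R) : 0 < t < 8^-1 ->
  (\int[leb]_(v in pos) (gamf t v)%:E = (gam t)%:E)%E.
Proof.
move=> t8; have /andP[t0 t1] := t8.
have t01 : 0 < t < 2^-1 by rewrite t0; lra.
pose f2 (v : R) := t * (v `^ (- (2 * t)) * (1 + v) `^ (t - 1)).
pose m (v : R) := 4 * 1 * majorant t v.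
have f2_ge0 (v : R) : 0 <= f2 v by rewrite !mulr_ge0 ?powR_ge0// ltW.
have f2m (v : R) : 0 < v -> f2 v <= m v.
  move=> v0; apply: le_majorant => // v1.
    rewrite /f2 ler_pM ?mulr_ge0 ?powR_ge0 ?(ltW t0)//; first lra.
    rewrite -[leRHS]mulr1 ler_pM ?powR_ge0//; first by apply: ger_powR; rewrite ?v0//; lra.
    rewrite -[leRHS](congr1 (@^~ (t - 1)) (@powR1 R)).
    by apply: le0_ler_powR => //; lra.
  rewrite (_ : - t - 1 = - (2 * t) + (t - 1)); last by ring.
  rewrite mul1r powRDp// /f2 -[leRHS]mul1r ler_pM ?(ltW t0) ?mulr_ge0 ?powR_ge0//; first lra.
  rewrite ler_wpM2l ?powR_ge0//; apply: le0_ler_powR; [lra|by []|lra].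
pose Psi (v : R) := - (1 + v) * ((1 + v) `^ t - 1) ^+ 2 * v `^ (- (1 + 2 * t))
   - ((1 + v) `^ t - 1) * v `^ (- (2 * t)).
pose M (v : R) := 4 * (- t^-1 * (1 + v `^ t)^-1).
have gf0 (v : R) : 0 <= gamf t v by rewrite mulr_ge0 ?sqr_ge0 ?powR_ge0.
have mgam : measurable_fun pos (gamf t).
  apply: measurable_funTS; apply: measurable_funM; last exact: measurable_powR.
  apply: measurable_funX; apply: measurable_funB => //.
  by apply: measurable_powR_comp; exact: measurable_funD.
have mf2 : measurable_fun pos f2.
  apply: measurable_funTS; apply: measurable_funM => //; apply: measurable_funM.
    exact: measurable_powR.
  by apply: measurable_powR_comp; exact: measurable_funD.
have mm : measurable_fun pos m.
  by apply: measurable_funTS; apply: measurable_funM => //; exact: measurable_majorant.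
have i2 := integral_f2 t01; rewrite -/(f2 _) in i2.
have im : (\int[leb]_(v in pos) (m v)%:E = (4 / t)%:E)%E.
  rewrite /m mulr1; under eq_integral do rewrite EFinM.
  rewrite ge0_integralZl; [by rewrite integral_majorant// -EFinM|by []| | |by rewrite lee_fin].
    by apply: measurable_EFin_comp; apply: measurable_funTS; exact: measurable_majorant.
  by move=> x _; rewrite lee_fin majorant_ge0.
have key : (\int[leb]_(v in pos) ((1 + 2 * t) * gamf t v + (m v - f2 v))%:E = (- 1 + 4 / t)%:E)%E.
  have := @ge0_FTC0y R (fun v => (1 + 2 * t) * gamf t v + (m v - f2 v)) (fun v => Psi v + M v)
    (0 - 4 / t) (- 1 + 0) _ _ _ _ _.
  rewrite (_ : - 1 + 0 - (0 - 4 / t) = - 1 + 4 / t); last by ring.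
  apply => [x x0|x x0|x x0||].
  - apply: addr_ge0; last by rewrite subr_ge0; exact: f2m.
    by apply: mulr_ge0; [lra|exact: gf0].
  - apply: cvgD; last apply: cvgB.
    + apply: cvgM; first exact: cvg_cst.
      apply: cvgM; last exact: powR_continuous.
      rewrite expr2; under eq_fun do rewrite expr2.
      by apply: cvgM; (apply: cvgB; [exact: powR_add1_continuous|exact: cvg_cst]).
    + by apply: cvgM; [exact: cvg_cst|exact: majorant_continuous].
    + apply: cvgM; first exact: cvg_cst.
      by apply: cvgM; [exact: powR_continuous|exact: powR_add1_continuous].
  - have x1 : 0 < 1 + x by rewrite addr_gt0.
    have p1 : 1 + x `^ t != 0 by rewrite gt_eqF// ltr_pwDl// powR_ge0.
    have dA : is_derive x 1 (fun v : R => - 1 + (1 + v) `^ t) (t * (1 + x) `^ (t - 1) * 1).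
      by apply: is_derive_addc; apply: (is_derive_powRf t x1); exact: is_derive_1D.
    have dq : is_derive x 1 (fun v : R => v `^ (- (1 + 2 * t))) (- (1 + 2 * t) * x `^ (- (1 + 2 * t) - 1)).
      exact: is_derive1_powR.
    have dr : is_derive x 1 (fun v : R => v `^ (- (2 * t))) (- (2 * t) * x `^ (- (2 * t) - 1)).
      exact: is_derive1_powR.
    have d1 := is_derive_mulf (is_derive_mulf (is_derive_1D x) (is_derive_mulf dA dA)) dq.
    have d2 := is_derive_mulf dA dr.
    have dM : is_derive x 1 M (m x).
      have dx : is_derive x 1 (fun v : R => 1 + v `^ t) (t * x `^ (t - 1)).
        by apply: is_derive_addc; exact: is_derive1_powR.
      apply: (is_derive_eq (is_derive_mulc 4 (is_derive_mulc (- t^-1)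
         (@is_derive_inv R (fun v : R => 1 + v `^ t) x _ p1 dx)))).
      by rewrite /m /majorant; field; rewrite p1 gt_eqF.
    have d12 := is_derive_addf (is_derive_oppf (is_derive_addf d1 d2)) dM.
    have -> : (fun v => Psi v + M v) = (fun v : R =>
      - ((1 + v) * ((- 1 + (1 + v) `^ t) * (- 1 + (1 + v) `^ t)) * v `^ (- (1 + 2 * t)) +
         (- 1 + (1 + v) `^ t) * v `^ (- (2 * t))) + M v).
      by apply/funext => v; rewrite /Psi; ring.
    apply: (is_derive_eq d12); rewrite /gamf /f2.
    have -> : - (1 + 2 * t) - 1 = - (2 + 2 * t) by ring.
    have -> : - (2 * t) - 1 = - (1 + 2 * t) by ring.
    have e1 : x `^ (- (1 + 2 * t)) = x `^ (- (2 + 2 * t)) * x.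
      by rewrite mulr_powR//; congr powR; ring.
    have e2 : x `^ (- (2 * t)) = x `^ (- (2 + 2 * t)) * x * x.
      by rewrite -e1 mulr_powR//; congr powR; ring.
    have e3 : (1 + x) `^ t = (1 + x) `^ (t - 1) * (1 + x).
      by rewrite mulr_powR//; congr powR; ring.
    rewrite e1 e2 e3; move: (m x) (x `^ _) ((1 + x) `^ _) => a b c; ring.
  - apply: cvgD; first by apply: Psi_cvg0.
    rewrite -[X in _ --> X]mulrN; apply: cvgM; first exact: cvg_cst.
    rewrite -[X in _ --> X]mulr1; apply: cvgM; first exact: cvg_cst.
    rewrite -[X in _ --> X]invr1; apply: cvgV; rewrite ?oner_eq0//.
    by rewrite -[X in _ --> X]addr0; apply: cvgD; [exact: cvg_cst|exact: powR_cvg0].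
  - apply: cvgD; first by apply: Psi_cvgy.
    rewrite -[X in _ --> X](mulr0 4); apply: cvgM; first exact: cvg_cst.
    rewrite -[X in _ --> X](mulr0 (- t^-1)); apply: cvgM; first exact: cvg_cst.
    exact: inv_add1_powR_cvgy.
have fmf2 : (\int[leb]_(v in pos) (m v - f2 v)%:E =
    (4 / t - 2 `^ (- (2 * t)) / Num.sqrt pi * Gam (2^-1 - t) * Gam (1 + t))%:E)%E.
  under eq_integral do rewrite EFinB.
  rewrite integralB_EFin//.
  - by rewrite im i2.
  - apply: ge0_integrableR => //; first by move=> v _; rewrite /m mulr1 mulr_ge0 ?majorant_ge0.
    by rewrite im ltry.
  - by apply: ge0_integrableR => //; rewrite i2 ltry.
move: key; under eq_integral do rewrite EFinD EFinM.
have t2 : 0 < 1 + 2 * t by rewrite addr_gt0// mulr_gt0.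
rewrite ge0_integralD//; last 4 first.
- by move=> v _; rewrite -EFinM lee_fin mulr_ge0// ltW.
- by apply: measurable_funeM; exact/measurable_EFinP.
- by move=> v; rewrite posE lee_fin subr_ge0; exact: f2m.
- by apply/measurable_EFinP; exact: measurable_funB.
rewrite fmf2 ge0_integralZl//; last 3 first.
- exact/measurable_EFinP.
- by move=> v _; rewrite lee_fin.
- by rewrite lee_fin ltW.
have I0 : (0 <= \int[leb]_(v in pos) (gamf t v)%:E)%E by apply: integral_ge0 => v _; rewrite lee_fin.
move: (\int[leb]_(v in pos) (gamf t v)%:E)%E I0 => [r| |]//= _.
  rewrite -EFinM -EFinD => -[h]; congr EFin.
  apply: (canRL (mulfK (lt0r_neq0 t2))); rewrite mulrC.
  by move: h; move: (4 / t) (_ * Gam (1 + t)) => a b; lra.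
by rewrite gt0_muley// lte_fin.
Qed.

End one_dim.

(** * One-dimensional profile integrals *)

Section profiles.
Context {R : realType}.
Local Notation leb := (@lebesgue_measure R).
Local Notation pos := (`]0%R, +oo[%classic : set R).

Let eqle (x y : R) : x = y -> x <= y. Proof. by move->. Qed.

Lemma measurable_kern (d e q : R) : measurable_fun [set: R] (fun y : R => ((y - d) ^+ 2 + e) `^ q).
Proof.
apply: measurable_powR_comp; apply: measurable_funD => //; apply: measurable_funX.
exact: measurable_funB.
Qed.

Lemma integral_R_split (f : R -> \bar R) : measurable_fun [set: R] f -> (forall x, 0 <= f x)%E ->
  (\int[leb]_x f x = \int[leb]_(x in pos) f x + \int[leb]_(x in pos) f (- x)%R)%E.
Proof.
move=> mf f0; have -> : [set: R] = `]-oo, 0%R] `|` pos.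
  apply/seteqP; split => // x _ /=; rewrite !in_itv/= andbT.
  by have [x0|x0] := ltP 0 x; [right|left].
rewrite ge0_integral_setU//; last 2 first.
- exact: measurable_funTS.
- apply/disj_setPS => x [] /=; rewrite !in_itv/= andbT => x0 x1.
  by have := le_lt_trans x0 x1; rewrite ltxx.
rewrite addeC; congr (_ + _)%E.
have mfN : measurable_fun [set: R] (fun x => f (- x)) by apply: measurableT_comp.
rewrite integral_itv_obnd_cbnd; last exact: measurable_funTS.
rewrite (@ge0_integration_by_substitution0 R (fun x => f (- x)) mfN (fun=> f0 _)).
by apply: eq_integral => x _; rewrite opprK.
Qed.

(** The substitutions [y = 1/(1+v)] and [y = 1 + v] send the singular point [y = 1] of the kernels
    to [v = 0] on both sides, so that the two halves can compensate each other pointwise. *)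
Lemma integral_inversion (g : R -> R) : measurable_fun [set: R] g ->
  (forall y : R, 0 < y -> {for y, continuous g}) -> (forall y : R, 0 < y -> 0 <= g y) ->
  (\int[leb]_(y in pos) (g y)%:E =
   \int[leb]_(v in pos) (g (1 + v)^-1 * (1 + v) `^ (- 2))%:E + \int[leb]_(v in pos) (g (1 + v))%:E)%E.
Proof.
move=> mg cg g0.
pose h (y : R) := if 0 < y then g y else 0.
have mh : measurable_fun [set: R] (fun y => (h y)%:E).
  by apply: measurable_EFin_comp; apply: measurable_fun_ifT => //; exact: measurable_fun_ltr.
have h0 y : (0 <= (h y)%:E)%E by rewrite /h lee_fin; case: ifPn => // /g0.
have -> : (\int[leb]_(y in pos) (g y)%:E = \int[leb]_(y in pos) (h y)%:E)%E.
  by apply: eq_integral => y; rewrite inE posE /h => ->.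
have posU : pos = `]0, 1[ `|` `[1, +oo[.
  apply/seteqP; split => x /=; rewrite !in_itv/= !andbT.
    by have [x0|x0] := ltP x 1; [rewrite andbT; left|right].
  by move=> [/andP[]//|]; exact: lt_le_trans.
transitivity (\int[leb]_(y in `]0%R, 1%R[ `|` `[1%R, +oo[) (h y)%:E)%E; first by rewrite -posU.
rewrite ge0_integral_setU//; last 2 first.
- exact: measurable_funTS.
- apply/disj_setPS => x [] /=; rewrite !in_itv/= andbT => /andP[_ x0] x1.
  by have := lt_le_trans x0 x1; rewrite ltxx.
have -> : (\int[leb]_(y in `]0%R, 1%R[) (h y)%:E =
    \int[leb]_(v in pos) (g (1 + v)^-1 * (1 + v) `^ (- 2))%:E)%E.
  transitivity (\int[leb]_(y in `]0%R, 1%R[) (g y)%:E)%E.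
    by apply: eq_integral => y; rewrite inE/= in_itv/= /h => /andP[-> _].
  have H := @ge0_change_var_decr R (fun v => (1 + v)^-1) (fun v => - (1 + v) `^ (- 2)) g `]0%R, 1%R[%classic.
  transitivity (\int[leb]_(v in pos) (g (1 + v)^-1 * - - (1 + v) `^ (- 2))%:E)%E; last first.
    by apply: eq_integral => v _; rewrite opprK.
  apply: H.
  - move=> x x0; have x1 : 0 < 1 + x by rewrite addr_gt0.
    apply: (is_derive_eq (@is_derive_inv R (fun v : R => 1 + v) x _ (lt0r_neq0 x1) (is_derive_1D x))).
    by rewrite powR_invn ?(ltW x1)// mulN1r.
  - by move=> x x0; apply: cvgN; exact: powR_add1_continuous.
  - exact: interval_is_interval.
  - move=> x x0; have x1 : 0 < 1 + x by rewrite addr_gt0.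
    by rewrite /= in_itv/= invr_gt0 x1 invf_lt1// ltrDl.
  - move=> y; rewrite /= in_itv/= => /andP[y0 y1]; exists (y^-1 - 1).
      by rewrite subr_gt0 invf_gt1.
    by rewrite addrC subrK invrK.
  - by move=> y; rewrite /= in_itv/= => /andP[y0 _]; exact: cg.
  - by move=> y; rewrite /= in_itv/= => /andP[y0 _]; exact: g0.
  - exact: interval_open.
  - by move=> x x0; rewrite oppr_le0 powR_ge0.
  - move=> x y x0 xy; rewrite ltf_pV2 ?posrE ?addr_gt0 ?ltrD2l//.
    exact: lt_trans xy.
congr (_ + _)%E.
rewrite (@ge0_integral_affine _ 1 1 _ (fun y => (h y)%:E))// mul1e.
have -> : (fun t : R => 1 * t + 1) @^-1` `[1, +oo[ = `[0, +oo[%classic.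
  by apply/seteqP; split => x; rewrite /preimage/= !in_itv/= !andbT mul1r lerDr.
rewrite -integral_itv_obnd_cbnd; last first.
  apply: measurable_funTS; apply: (measurableT_comp mh).
  by apply: measurable_funD => //; exact: measurable_funM.
apply: eq_integral => v; rewrite inE posE => v0.
by rewrite /h mul1r (addrC v) addr_gt0.
Qed.

(** By homogeneity depth [d] reduces to depth 1 with [e / d^2] in place of [e]. *)
Lemma integral_scale_kern (f : R -> R) (d e q : R) : measurable_fun [set: R] f ->
  (forall y, 0 <= f y) -> 0 < d -> 0 < e ->
  (\int[leb]_(y in pos) (f y * ((y - d) ^+ 2 + e) `^ (- q))%:E =
   (d `^ (1 - 2 * q))%:E * \int[leb]_(y in pos) (f (d * y) * ((y - 1) ^+ 2 + e / d ^+ 2) `^ (- q))%:E)%E.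
Proof.
move=> mf f0 d0 e0.
have m1 : measurable_fun [set: R] (fun y => (f y * ((y - d) ^+ 2 + e) `^ (- q))%:E).
  by apply: measurable_EFin_comp; apply: measurable_funM => //; exact: measurable_kern.
have p1 y : (0 <= (f y * ((y - d) ^+ 2 + e) `^ (- q))%:E)%E.
  by rewrite lee_fin mulr_ge0 ?powR_ge0.
rewrite (@ge0_integral_affine _ d 0 pos _ d0 (measurable_itv _) m1 p1).
have -> : (fun t : R => d * t + 0) @^-1` pos = pos.
  by apply/seteqP; split => x; rewrite /preimage/= !in_itv/= !andbT addr0 pmulr_rgt0.
have m2 : measurable_fun pos (fun y => (f (d * y) * ((y - 1) ^+ 2 + e / d ^+ 2) `^ (- q))%:E).
  apply: measurable_EFin_comp; apply: measurable_funTS; apply: measurable_funM.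
    by apply: measurableT_comp => //; exact: measurable_funM.
  exact: measurable_kern.
have p2 y : pos y -> (0 <= (f (d * y) * ((y - 1) ^+ 2 + e / d ^+ 2) `^ (- q))%:E)%E.
  by move=> _; rewrite lee_fin mulr_ge0 ?powR_ge0.
transitivity (d%:E * \int[leb]_(y in pos)
    ((d `^ (- (2 * q)))%:E * (f (d * y) * ((y - 1) ^+ 2 + e / d ^+ 2) `^ (- q))%:E))%E.
  congr (_ * _)%E; apply: eq_integral => y _; rewrite addr0 -EFinM; congr EFin.
  have -> : (d * y - d) ^+ 2 + e = d ^+ 2 * ((y - 1) ^+ 2 + e / d ^+ 2).
    by field; rewrite gt_eqF.
  rewrite powRM ?sqr_ge0//; last by rewrite addr_ge0 ?sqr_ge0// divr_ge0 ?sqr_ge0// ltW.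
  rewrite -(@powR_mulrn _ d) ?(ltW d0)// -powRrM mulrN.
  by rewrite mulrCA.
rewrite (ge0_integralZl leb (measurable_itv _) m2 p2); last by rewrite lee_fin powR_ge0.
rewrite muleA -EFinM; congr (_%:E * _)%E.
by rewrite mulrC mulr_powR//; congr powR; ring.
Qed.

Lemma pow_Bernoulli (t q : R) : 0 < t <= 1 -> 0 <= q -> 1 - (1 + q) `^ (- (1 + t)) <= 2 * Num.min 1 q.
Proof.
move=> /andP[t0 t1] q0.
have h : 1 - 2 * q <= (1 + q) `^ (- (1 + t)).
  apply: (@le_trans _ _ ((1 + q) `^ (- 2))).
    have q1 : 0 < (1 + q) ^+ 2 by rewrite exprn_gt0// ltr_pwDl.
    rewrite powR_invn ?addr_ge0// -(ler_pM2r q1) mulVf ?gt_eqF//.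
    by move: q0; clear; nra.
  by rewrite ler_powR; [by []|lra|lra].
have h0 := powR_ge0 (1 + q) (- (1 + t)).
by have [q1|q1] := leP 1 q; lra.
Qed.

(** Trades a small quantity for its power [1/8]. When [q] is about [e / v^2], this extracts the
    small factor [e^(1/8)] at the price of the mild singularity [v^(-1/4)]. *)
Lemma min1_le_pow8 (q m : R) : 0 <= m -> m <= 1 -> m <= q -> m <= q `^ 8^-1.
Proof.
move=> m0 m1 mq; have q0 := le_trans m0 mq; have [q1|q1] := leP q 1.
  have [qE|qn] := eqVneq q 0.
    by rewrite (le_trans _ (powR_ge0 _ _))// -qE.
  apply: le_trans mq _; apply: ger1_powR; last lra.
  by rewrite lt_def qn q0.
apply: le_trans m1 _; rewrite -[leLHS](congr1 (@^~ 8^-1) (@powR1 R)).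
by rewrite ge0_ler_powR ?nnegrE// ltW.
Qed.

(* [Qint t e b] is the integral of [y^b] against the regularized kernel centred
   at [1]; the principal value of [1 - y^b] is the limit of [Qint t e 0 - Qint t e b]. *)
Definition Qint (t e b : R) : \bar R :=
  \int[leb]_(y in pos) (y `^ b * ((y - 1) ^+ 2 + e) `^ (- (1 + t)))%:E.

(** [k1] comes from [y = 1 + v] and [k2] from [y = 1/(1+v)], where [|y - 1| = v/(1+v)]: clearing
    this denominator multiplies [e] by [(1+v)^2]. For [e = 0] the two agree. *)
Definition k1 (t e v : R) : R := (v ^+ 2 + e) `^ (- (1 + t)).
Definition k2 (t e v : R) : R := (v ^+ 2 + e * (1 + v) ^+ 2) `^ (- (1 + t)).

Lemma kern_continuous (d e q y : R) : 0 < e -> {for y, continuous (fun y : R => ((y - d) ^+ 2 + e) `^ q)}.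
Proof.
move=> e0; apply: (@continuous_comp _ _ _ (fun y : R => (y - d) ^+ 2 + e) (fun v : R => v `^ q)).
  apply: cvgD; last exact: cvg_cst.
  by rewrite expr2; apply: cvgM; (apply: cvgB; [exact: cvg_id|exact: cvg_cst]).
by apply: powR_continuous; rewrite ltr_wpDl ?sqr_ge0.
Qed.

Lemma powR_inv_base (x a : R) : 0 < x -> (x^-1) `^ a = x `^ (- a).
Proof. by move=> x0; rewrite -powR_inv1 ?(ltW x0)// -powRrM mulN1r. Qed.

Lemma QintE (t e b : R) : 0 < e ->
  (Qint t e b = \int[leb]_(v in pos) ((1 + v) `^ (2 * t - b) * k2 t e v)%:E +
     \int[leb]_(v in pos) ((1 + v) `^ b * k1 t e v)%:E)%E.
Proof.
move=> e0; pose g (y : R) := y `^ b * ((y - 1) ^+ 2 + e) `^ (- (1 + t)).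
have mg : measurable_fun [set: R] g.
  by apply: measurable_funM; [exact: measurable_powR|exact: measurable_kern].
have cg (y : R) : 0 < y -> {for y, continuous g}.
  by move=> y0; apply: cvgM; [exact: powR_continuous|exact: kern_continuous].
have g0 (y : R) : 0 < y -> 0 <= g y by move=> y0; rewrite mulr_ge0 ?powR_ge0.
rewrite /Qint (integral_inversion mg cg g0); apply: (congr2 adde);
  apply: eq_integral => v; rewrite inE posE /g => v0; congr EFin; last first.
  by rewrite /k1 addrAC subrr add0r.
have v1 : 0 < 1 + v by rewrite addr_gt0.
rewrite powR_inv_base//.
have -> : ((1 + v)^-1 - 1) ^+ 2 + e = (v ^+ 2 + e * (1 + v) ^+ 2) * (1 + v)^-1 ^+ 2.
  by field; rewrite gt_eqF.
rewrite powRM ?addr_ge0 ?sqr_ge0//; last by rewrite mulr_ge0 ?sqr_ge0 ?(ltW e0).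
rewrite -/(k2 _ _ _).
rewrite -(@powR_mulrn _ (1 + v)^-1) ?invr_ge0 ?(ltW v1)// powR_inv_base// -powRrM.
rewrite [LHS](_ : _ = (1 + v) `^ (- b) * (1 + v) `^ (- 2%:R * - (1 + t)) * (1 + v) `^ (- 2) * k2 t e v); last by ring.
by rewrite -!powRDp//; congr (_ `^ _ * _); ring.
Qed.

Lemma k1_ge0 t e v : 0 <= k1 t e v. Proof. exact: powR_ge0. Qed.
Lemma k2_ge0 t e v : 0 <= k2 t e v. Proof. exact: powR_ge0. Qed.

Lemma measurable_k1 t e : measurable_fun [set: R] (k1 t e).
Proof.
by apply: measurable_powR_comp; apply: measurable_funD => //; exact: measurable_funX.
Qed.

Lemma measurable_k2 t e : measurable_fun [set: R] (k2 t e).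
Proof.
apply: measurable_powR_comp; apply: measurable_funD; first exact: measurable_funX.
by apply: measurable_funM => //; apply: measurable_funX; exact: measurable_funD.
Qed.

Lemma measurable_powR1D p : measurable_fun [set: R] (fun v : R => (1 + v) `^ p).
Proof. by apply: measurable_powR_comp; exact: measurable_funD. Qed.

Lemma measurable_Qf t e b : measurable_fun pos
  (fun v => (1 + v) `^ (2 * t - b) * k2 t e v + (1 + v) `^ b * k1 t e v).
Proof.
apply: measurable_funTS; apply: measurable_funD; apply: measurable_funM;
  by [exact: measurable_powR1D|exact: measurable_k2|exact: measurable_k1].
Qed.

Lemma QintE2 (t e b : R) : 0 < e ->
  Qint t e b = (\int[leb]_(v in pos) ((1 + v) `^ (2 * t - b) * k2 t e v + (1 + v) `^ b * k1 t e v)%:E)%E.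
Proof.
move=> e0; rewrite QintE//; under [RHS]eq_integral do rewrite EFinD.
rewrite ge0_integralD//.
- by move=> v _; rewrite lee_fin mulr_ge0 ?powR_ge0.
- apply: measurable_EFin_comp; apply: measurable_funTS; apply: measurable_funM.
    exact: measurable_powR1D.
  exact: measurable_k2.
- by move=> v _; rewrite lee_fin mulr_ge0 ?powR_ge0.
- apply: measurable_EFin_comp; apply: measurable_funTS; apply: measurable_funM.
    exact: measurable_powR1D.
  exact: measurable_k1.
Qed.

Lemma k2_le_k1 t e v : 0 < t -> 0 < e -> 0 < v -> k2 t e v <= k1 t e v.
Proof.
move=> t0 e0 v0; apply: le0_ler_powR; [lra|by rewrite addr_gt0// exprn_gt0|].
rewrite lerD2l -[leLHS]mulr1 ler_pM2l//; nra.
Qed.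

(** With [B = (1+v)^(1/4)] and [r = (1+v)^(2t - 1/4)], the folded difference of the integrands is
    [(B - 1) (k1 - r k2)], at least [(B - 1) (1 - r) k2] and so nonnegative because [1/4 > 2t]. Only
    [1 <= v <= 2] is used for the lower bound, which is uniform in [t] and [e]. *)
Lemma Qint_quarter : exists2 c0 : R, 0 < c0 & forall t e, 0 < t <= 16^-1 -> 0 < e <= 1 ->
  (Qint t e 0 + c0%:E <= Qint t e 4^-1)%E.
Proof.
pose a1 : R := 1 - 2 `^ (- 4^-1); pose a2 : R := 1 - 2 `^ (- 8^-1).
have h2 (p : R) : 0 < p -> 0 < 1 - 2 `^ (- p).
  move=> p0; rewrite subr_gt0 powRN invf_lt1 ?powR_gt0//.
  by rewrite -[ltLHS](congr1 (@^~ p) (@powR1 R)) gt0_ltr_powR// ?nnegrE// ltr1n.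
have a10 : 0 < a1 by apply: h2; rewrite invr_gt0.
have a20 : 0 < a2 by apply: h2; rewrite invr_gt0.
exists (a1 * (a2 * 13^-1 ^+ 2)); first by rewrite !mulr_gt0.
move=> t e /andP[t0 t1] /andP[e0 e1]; set c0 := a1 * _.
have c0_ge0 : 0 <= c0 by rewrite !mulr_ge0 ?(ltW a10) ?(ltW a20).
rewrite !QintE2//.
pose i (v : R) := if (1 <= v) && (v <= 2) then c0 else 0.
have mi : measurable_fun [set: R] i.
  by apply: measurable_fun_ifT => //; apply: measurable_and; exact: measurable_fun_ler.
have i_ge0 v : 0 <= i v by rewrite /i; case: ifP.
have ci : (c0%:E <= \int[leb]_(v in pos) (i v)%:E)%E.
  apply: (@le_trans _ _ (\int[leb]_(v in `[1%R, 2%R]) (i v)%:E)%E); last first.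
    apply: ge0_subset_integral => //.
    - by apply: measurable_EFin_comp; exact: measurable_funTS.
    - by move=> x; rewrite lee_fin.
    - by move=> x; rewrite posE /= in_itv/= => /andP[+ _]; exact: lt_le_trans.
  rewrite (eq_integral (cst c0%:E)); last first.
    by move=> v; rewrite inE/= in_itv/= /i => ->.
  by rewrite integral_cst//= lebesgue_measure_itv/= lte_fin ltr1n -EFinB -EFinM lee_fin; lra.
apply: (@le_trans _ _ (\int[leb]_(v in pos) ((1 + v) `^ (2 * t - 0) * k2 t e v + (1 + v) `^ 0 * k1 t e v)%:E
   + \int[leb]_(v in pos) (i v)%:E)%E); first by rewrite leeD2l.
have mQ0 := measurable_Qf t e 0.
rewrite -ge0_integralD//; last 4 first.
- by move=> v _; rewrite lee_fin addr_ge0// mulr_ge0 ?powR_ge0.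
- exact: measurable_EFin_comp.
- by move=> v _; rewrite lee_fin.
- by apply: measurable_EFin_comp; exact: measurable_funTS.
apply: ge0_le_integral => //.
- by move=> v _; rewrite adde_ge0// lee_fin ?addr_ge0// mulr_ge0 ?powR_ge0.
- apply: emeasurable_funD; first exact: measurable_EFin_comp.
  by apply: measurable_EFin_comp; exact: measurable_funTS.
- by apply: measurable_EFin_comp; exact: measurable_Qf.
move=> v; rewrite posE -EFinD lee_fin => v0.
have v1 : 0 < 1 + v by rewrite addr_gt0.
rewrite subr0 powRr0 mul1r.
have k21 := k2_le_k1 t0 e0 v0; have k20 := k2_ge0 t e v.
set B := (1 + v) `^ 4^-1; have B1 : 1 <= B.
  by rewrite -[leLHS](powRr0 (1 + v)) ler_powR; [by []|lra|lra].
have cE : (1 + v) `^ (2 * t - 4^-1) * B = (1 + v) `^ (2 * t) by rewrite -powRDp//; congr powR; ring.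
rewrite -cE; set r := (1 + v) `^ (2 * t - 4^-1).
have r0 : 0 <= r by exact: powR_ge0.
have r1 : r <= 1 by rewrite -[leRHS](powRr0 (1 + v)) ler_powR; [by []|lra|lra].
have key : i v <= (B - 1) * ((1 - r) * k2 t e v).
  rewrite /i; case: ifPn => [/andP[w1 w2]|_]; last first.
    by rewrite !mulr_ge0 ?subr_ge0.
  have hB : a1 <= B - 1.
    have B2 : 2 `^ 4^-1 <= B by rewrite ge0_ler_powR ?nnegrE ?invr_ge0//; move: v0 w1; clear; lra.
    have z0 : 0 < (2 : R) `^ 4^-1 by rewrite powR_gt0.
    have z1 : 1 <= (2 : R) `^ 4^-1 by rewrite -[leLHS](powRr0 2) ler_powR ?invr_ge0// ler1n.
    have zz : (2 : R) `^ 4^-1 * (2 : R) `^ (- 4^-1) = 1 by rewrite -powRDp// subrr powRr0.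
    by rewrite /a1; nra.
  have hr : a2 <= 1 - r.
    rewrite /a2 lerD2l lerN2; apply: (@le_trans _ _ ((1 + v) `^ (- 8^-1))).
      by apply: ler_powR; move: t1 v0; clear; lra.
    by apply: le0_ler_powR; move: v0 w1; clear; lra.
  (* For [v <= 2] and [e <= 1] the base of [k2] is at most [4 + 9 = 13]. *)
  have hk : 13^-1 ^+ 2 <= k2 t e v.
    apply: (@le_trans _ _ (13 `^ (- (1 + t)))).
      rewrite (_ : 13^-1 ^+ 2 = 13 `^ (- 2)); last by rewrite powR_invn// exprVn.
      by apply: ler_powR; move: t1; clear; lra.
    apply: le0_ler_powR; [by move: t0; clear; lra|by rewrite addr_gt0 ?mulr_gt0 ?exprn_gt0|].
    by move: v0 w2 e0 e1; clear; nra.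
  rewrite /c0 ler_pM ?(ltW a10) ?mulr_ge0 ?(ltW a20) ?exprn_ge0//.
  by rewrite ler_pM ?(ltW a20) ?exprn_ge0.
have : (B - 1) * k2 t e v <= (B - 1) * k1 t e v by rewrite ler_wpM2l// subr_ge0.
by move: key; clear; lra.
Qed.

(** With [B = (1+v)^t] and [k0 = v^(-2-2t)], the folded integrands satisfy the identity behind
    [gamf] up to [(B-1)^2 (k0 - k2) + (B-1) (k1 - k2)]. This error is at most [30 e^(1/8)] in the
    two power regimes of [majorant] for [c = 1/2], and [4 * 30 / (1/2) = 240]. *)
Lemma Qint_t (t e : R) : 0 < t <= 16^-1 -> 0 < e <= 1 ->
  (Qint t e t + (gam t)%:E <= Qint t e 0 + (240 * e `^ 8^-1)%:E)%E.
Proof.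
move=> /andP[t0 t1] /andP[e0 e1].
have e8 := powR_ge0 e 8^-1; have ee8 : e <= e `^ 8^-1 by apply: ger1_powR; rewrite ?e0//; lra.
pose K := 30 * e `^ 8^-1.
have K0 : 0 <= K by rewrite mulr_ge0.
pose m (v : R) := 4 * K * majorant 2^-1 v.
have m_ge0 v : 0 <= m v by rewrite /m mulr_ge0 ?majorant_ge0// mulr_ge0.
have mm : measurable_fun pos m.
  by apply: measurable_funTS; apply: measurable_funM => //; exact: measurable_majorant.
have im : (\int[leb]_(v in pos) (m v)%:E = (240 * e `^ 8^-1)%:E)%E.
  under eq_integral do rewrite EFinM.
  rewrite ge0_integralZl; [|by []| | |by rewrite lee_fin mulr_ge0]; last 2 first.
  - by apply: measurable_EFin_comp; apply: measurable_funTS; exact: measurable_majorant.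
  - by move=> x _; rewrite lee_fin majorant_ge0.
  by rewrite integral_majorant ?invr_gt0// -EFinM invrK; congr EFin; rewrite /K; ring.
have mgam : measurable_fun pos (gamf t).
  apply: measurable_funTS; apply: measurable_funM; last exact: measurable_powR.
  by apply: measurable_funX; apply: measurable_funB => //; exact: measurable_powR1D.
have gf0 (v : R) : 0 <= gamf t v by rewrite mulr_ge0 ?sqr_ge0 ?powR_ge0.
rewrite -im -integral_gam; last by rewrite t0; lra.
rewrite !QintE2//.
have mQ b := measurable_Qf t e b.
have Q0 b v : 0 <= (1 + v) `^ (2 * t - b) * k2 t e v + (1 + v) `^ b * k1 t e v.
  by rewrite addr_ge0// mulr_ge0 ?powR_ge0.
rewrite -!ge0_integralD//; try (by apply: measurable_EFin_comp; first [exact: mQ|exact: mm|exact: mgam]); try by move=> v _; rewrite lee_fin.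
apply: ge0_le_integral => //.
- by move=> v _; rewrite adde_ge0// lee_fin.
- by apply: emeasurable_funD; apply: measurable_EFin_comp; [exact: mQ|exact: mgam].
- by apply: emeasurable_funD; apply: measurable_EFin_comp; [exact: mQ|exact: mm].
move=> v; rewrite posE -!EFinD lee_fin => v0.
have v1 : 0 < 1 + v by rewrite addr_gt0.
rewrite subr0 powRr0 mul1r (_ : 2 * t - t = t); last by ring.
set B := (1 + v) `^ t; have BB : (1 + v) `^ (2 * t) = B ^+ 2.
  by rewrite expr2 -powRDp//; congr powR; ring.
have B1 : 1 <= B by rewrite -[leLHS](powRr0 (1 + v)) ler_powR; [by []|by move: v0; clear; lra|by move: t0; clear; lra].
rewrite BB /gamf -/B; pose k0 := v `^ (- (2 + 2 * t)); rewrite -/k0.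
have k00 : 0 < k0 by exact: powR_gt0.
have k0E : k0 = (v ^+ 2) `^ (- (1 + t)).
  by rewrite -powR_mulrn ?(ltW v0)// -powRrM; congr powR; ring.
have v20 : 0 < v ^+ 2 by rewrite exprn_gt0.
have t01 : 0 < t <= 1 by rewrite t0; lra.
have h02 : k0 - k2 t e v <= k0 * (2 * (e * (1 + v) ^+ 2 / v ^+ 2) `^ 8^-1).
  pose q := e * (1 + v) ^+ 2 / v ^+ 2.
  have q0 : 0 <= q by rewrite /q divr_ge0 ?sqr_ge0// mulr_ge0 ?sqr_ge0 ?(ltW e0).
  have -> : k2 t e v = k0 * (1 + q) `^ (- (1 + t)).
    rewrite k0E -powRM ?(ltW v20) ?addr_ge0//; congr (_ `^ _).
    by rewrite /q; field; rewrite gt_eqF.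
  rewrite -[X in X - _]mulr1 -mulrBr ler_pM2l//; apply: le_trans (pow_Bernoulli t01 q0) _.
  rewrite ler_pM2l//; apply: min1_le_pow8; rewrite ?le_min ?ge_min ?lexx ?orbT ?ler01//.
have ve0 : 0 < v ^+ 2 + e by rewrite addr_gt0.
(* [1 + q'] is the ratio of the bases of [k2] and [k1]. *)
pose q' := e * (v * (2 + v)) / (v ^+ 2 + e).
have q'0 : 0 <= q' by rewrite /q'; pos.
have k10 : k1 t e v <= k0 by rewrite k0E; apply: le0_ler_powR; [by move: t0; clear; lra|exact: v20|rewrite lerDl ltW].
have h12 : k1 t e v - k2 t e v <= k0 * (2 * q').
  have -> : k2 t e v = k1 t e v * (1 + q') `^ (- (1 + t)).
    rewrite /k1 -powRM ?(ltW ve0) ?addr_ge0//; congr (_ `^ _).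
    by rewrite /q'; field; rewrite gt_eqF.
  rewrite -[X in X - _]mulr1 -mulrBr.
  apply: (@le_trans _ _ (k1 t e v * (2 * q'))).
    rewrite ler_wpM2l ?k1_ge0//; apply: le_trans (pow_Bernoulli t01 q'0) _.
    by rewrite ler_pM2l// ge_min lexx orbT.
  by rewrite ler_wpM2r// mulr_ge0.
have B10 : 0 <= B - 1 by rewrite subr_ge0.
have key : (B - 1) ^+ 2 * (k0 * (2 * (e * (1 + v) ^+ 2 / v ^+ 2) `^ 8^-1)) + (B - 1) * (k0 * (2 * q')) <= m v.
  have half : 2^-1 - 1 = - 2^-1 :> R by field.
  apply: le_majorant; rewrite ?invr_gt0// ?half => w.
    have Bv : B - 1 <= v by (have t01' : 0 <= t <= 1 by move: t0 t1; clear; lra); have /andP[] := powR_add1_sub1 t01' (ltW v0).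
    have v4 := powR_ge0 v (- 4^-1).
    have p1 : (e * (1 + v) ^+ 2 / v ^+ 2) `^ 8^-1 <= 2 * (e `^ 8^-1 * v `^ (- 4^-1)).
      rewrite -mulrA powRM; [|pos|pos]; rewrite mulrCA; apply: ler_wpM2l; first pos.
      rewrite powRM; [|pos|pos].
      rewrite powR_inv_base// -(@powR_mulrn _ v) ?(ltW v0)// -powRrM.
      rewrite (_ : 2%:R * - 8^-1 = - 4^-1); last by field.
      rewrite ler_wpM2r// -powR_mulrn ?(ltW v1)// -powRrM (_ : 2%:R * 8^-1 = 4^-1); last by field.
      apply: (@le_trans _ _ (2 `^ 4^-1)).
        by rewrite ge0_ler_powR ?nnegrE ?invr_ge0// ?(ltW v1)//; move: w; clear; lra.
      by apply: ler1_powR; rewrite ?ler1n//; move: t1; clear; lra.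
    have p2 : q' <= 3 * v * (e `^ 8^-1 * v `^ (- 4^-1)).
      have -> : q' = v * (2 + v) * (e / (v ^+ 2 + e)) by rewrite /q'; ring.
      apply: ler_pM; [pos|pos| |].
        by rewrite mulrC ler_wpM2r ?(ltW v0)//; move: w; clear; lra.
      have -> : e `^ 8^-1 * v `^ (- 4^-1) = (e / v ^+ 2) `^ 8^-1.
        rewrite powRM ?(ltW e0) ?invr_ge0 ?(ltW v20)// powR_inv_base// -(@powR_mulrn _ v) ?(ltW v0)// -powRrM.
        by congr (_ * _ `^ _); field.
      apply: min1_le_pow8; rewrite ?divr_ge0 ?(ltW e0) ?(ltW ve0)//.
        by rewrite ler_pdivrMr// mul1r lerDr (ltW v20).
      by rewrite ler_wpM2l ?(ltW e0)// lef_pV2 ?posrE// lerDl (ltW e0).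
    have k0v : k0 * v ^+ 2 * v `^ (- 4^-1) <= v `^ (- 2^-1).
      rewrite /k0 -(@powR_mulrn _ v) ?(ltW v0)// -!powRDp//.
      by apply: ger_powR; rewrite ?v0//; move: t1; clear; lra.
    rewrite /K; set A := e `^ _ in e8 p1 p2 *; set V := v `^ (- 4^-1) in v4 p1 p2 k0v *.
    apply: (@le_trans _ _ (v ^+ 2 * (k0 * (2 * (2 * (A * V)))) + v * (k0 * (2 * (3 * v * (A * V)))))).
      apply: lerD; apply: ler_pM; try first [assumption|by pos].
      - by rewrite ler_pXn2r ?nnegrE ?(ltW v0).
      - by rewrite ler_pM2l// ler_pM2l.
      - by rewrite ler_pM2l// ler_pM2l.
    rewrite [leLHS](_ : _ = 10 * A * (k0 * v ^+ 2 * V)); last by ring.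
    apply: ler_pM; [exact: mulr_ge0 (ler0n _ _) e8| |by move: e8; clear; lra|exact: k0v].
    exact: mulr_ge0 (mulr_ge0 (ltW k00) (sqr_ge0 _)) v4.
  have BL : B <= 2 * v `^ t.
    apply: (@le_trans _ _ ((2 * v) `^ t)); first by rewrite ge0_ler_powR ?nnegrE ?(ltW t0) ?(ltW v1) ?mulr_ge0 ?(ltW v0)//; move: w; clear; lra.
    by rewrite powRM ?(ltW v0)// ler_wpM2r ?powR_ge0//; apply: ler1_powR; rewrite ?ler1n//; move: t1; clear; lra.
  have p1 : (e * (1 + v) ^+ 2 / v ^+ 2) `^ 8^-1 <= 2 * e `^ 8^-1.
    rewrite -mulrA powRM; [|pos|pos]; rewrite mulrC; apply: ler_wpM2r; first pos.
    apply: (@le_trans _ _ (4 `^ 8^-1)).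
      rewrite ge0_ler_powR ?nnegrE ?divr_ge0 ?sqr_ge0//.
      by rewrite ler_pdivrMr//; move: w; clear; nra.
    rewrite (_ : 4 = 2 `^ 2%:R); last by rewrite powR_mulrn// expr2 -natrM.
    by rewrite -powRrM; apply: ler1_powR; rewrite ?ler1n//; move: t1; clear; lra.
  have p2 : q' <= 3 * e `^ 8^-1.
    apply: (@le_trans _ _ (3 * e)); last by rewrite ler_pM2l.
    rewrite /q' ler_pdivrMr//.
    apply: (@le_trans _ _ (e * (3 * v ^+ 2))).
      by rewrite ler_pM2l//; move: w; clear; nra.
    by move: e0 (sqr_ge0 e); clear; nra.
  have k0v : k0 * (v `^ t * v `^ t) <= v `^ (- 2^-1 - 1).
    by rewrite /k0 -!powRDp//; apply: ler_powR => //; move: t0 t1; clear; lra.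
  have V1 : 1 <= v `^ t by rewrite -[leLHS](powRr0 v) ler_powR// ltW.
  rewrite /K; set A := e `^ _ in e8 p1 p2 *; set V := v `^ t in BL k0v V1 *.
  apply: (@le_trans _ _ ((2 * V) ^+ 2 * (k0 * (2 * (2 * A))) + (2 * V) * (k0 * (2 * (3 * A))))).
    apply: lerD; apply: ler_pM; try first [assumption|by pos].
    - by rewrite ler_pXn2r ?nnegrE ?mulr_ge0 ?powR_ge0//; move: B10 BL; clear; lra.
    - by rewrite ler_pM2l// ler_pM2l.
    - by move: BL; clear; lra.
    - by rewrite ler_pM2l// ler_pM2l.
  apply: (@le_trans _ _ (28 * A * (k0 * (V * V)))).
    have : 0 <= A * k0 * (V * (V - 1)) by apply: mulr_ge0; [exact: mulr_ge0 e8 (ltW k00)|apply: mulr_ge0; [exact: powR_ge0|by rewrite subr_ge0]].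
    by clear; lra.
  apply: ler_pM; [exact: mulr_ge0 (ler0n _ _) e8| |by move: e8; clear; lra|exact: k0v].
  exact: mulr_ge0 (ltW k00) (mulr_ge0 (powR_ge0 _ _) (powR_ge0 _ _)).
have s1 : (B - 1) ^+ 2 * (k0 - k2 t e v) <= (B - 1) ^+ 2 * (k0 * (2 * (e * (1 + v) ^+ 2 / v ^+ 2) `^ 8^-1)).
  by rewrite ler_wpM2l ?sqr_ge0.
have s2 : (B - 1) * (k1 t e v - k2 t e v) <= (B - 1) * (k0 * (2 * q')) by rewrite ler_wpM2l.
by move: key s1 s2; clear; lra.
Qed.

(** Error profile in [T = |tau| / d]. The exponents [-3/4], [-5/8] and [-7/8] come from
    [barrier_in_gt0], [barrier_in_lt0] and [barrier_out]. All exceed -1, hence are integrable at 0,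
    and against the remaining kernel, of order [T^(-1/2-2t)], all are integrable at infinity. *)
Definition errg (T : R) : R := T `^ (- (3 / 4)) + T `^ (- (7 / 8)) + T `^ (- (5 / 8)).

Lemma errg_ge0 T : 0 <= errg T. Proof. by rewrite !addr_ge0 ?powR_ge0. Qed.

Lemma measurable_errg : measurable_fun [set: R] errg.
Proof.
by apply: measurable_funD; [apply: measurable_funD|]; exact: measurable_powR.
Qed.

Lemma errg_le1 T : 0 < T -> T <= 1 -> errg T <= 3 * T `^ (- (7 / 8)).
Proof.
move=> T0 T1; have h p : - (7 / 8) <= p -> T `^ p <= T `^ (- (7 / 8)).
  by move=> hp; apply: ger_powR; rewrite ?T0.
have h1 := h (- (3 / 4)) ltac:(lra); have h2 := h (- (5 / 8)) ltac:(lra).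
by rewrite /errg; lra.
Qed.

Lemma errg_ge1 T : 1 <= T -> errg T <= 3 * T `^ (- (5 / 8)).
Proof.
move=> T1; have h p : p <= - (5 / 8) -> T `^ p <= T `^ (- (5 / 8)).
  by move=> hp; apply: ler_powR.
have h1 := h (- (3 / 4)) ltac:(lra); have h2 := h (- (7 / 8)) ltac:(lra).
by rewrite /errg; lra.
Qed.

(** The kernel exponent is [1/4 + t] and no longer [1 + t] because the curvature error carries
    [X^(3/4)]. The singularity at [y = 1] is then integrable uniformly in [e]. *)
Lemma err_pos (t e : R) : 0 < t <= 16^-1 -> 0 < e ->
  (\int[leb]_(y in pos) (errg y * ((y - 1) ^+ 2 + e) `^ (- (4^-1 + t)))%:E <= 192%:E)%E.
Proof.
move=> /andP[t0 t1] e0; rewrite integral_inversion; last 3 first.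
- by apply: measurable_funM; [exact: measurable_errg|exact: measurable_kern].
- move=> y y0; apply: cvgM; last exact: kern_continuous.
  by apply: cvgD; [apply: cvgD|]; exact: powR_continuous.
- by move=> y y0; rewrite mulr_ge0 ?errg_ge0 ?powR_ge0.
have vle (v : R) : 0 < v -> (v ^+ 2 + e) `^ (- (4^-1 + t)) <= v `^ (- (2^-1 + 2 * t)).
  move=> v0; apply: (@le_trans _ _ ((v ^+ 2) `^ (- (4^-1 + t)))).
    by apply: le0_ler_powR; [lra|rewrite exprn_gt0|lra].
  by rewrite -powR_mulrn ?(ltW v0)// -powRrM; apply: eqle; congr powR; field.
have invle (v : R) : 0 < v ->
    errg (1 + v)^-1 * (((1 + v)^-1 - 1) ^+ 2 + e) `^ (- (4^-1 + t)) * (1 + v) `^ (- 2) <=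
    3 * (v `^ (- (2^-1 + 2 * t)) * (1 + v) `^ (- (5 / 8) + 2 * t)).
  move=> v0; have v1 : 0 < 1 + v by rewrite addr_gt0.
  have g1 : errg (1 + v)^-1 <= 3 * (1 + v) `^ (7 / 8).
    rewrite -[7 / 8]opprK -powR_inv_base//; apply: errg_le1; rewrite ?invr_gt0//.
    by rewrite invf_le1//; lra.
  have g2 : (((1 + v)^-1 - 1) ^+ 2 + e) `^ (- (4^-1 + t)) <= v `^ (- (2^-1 + 2 * t)) * (1 + v) `^ (2^-1 + 2 * t).
    have vL : 0 < v / (1 + v) by rewrite divr_gt0.
    rewrite (_ : ((1 + v)^-1 - 1) ^+ 2 = (v / (1 + v)) ^+ 2); last by field; rewrite gt_eqF.
    apply: le_trans (vle _ vL) _; rewrite powRM ?(ltW v0) ?invr_ge0 ?(ltW v1)//.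
    by rewrite powR_inv_base// opprK.
  apply: (@le_trans _ _ (3 * (1 + v) `^ (7 / 8) * (v `^ (- (2^-1 + 2 * t)) * (1 + v) `^ (2^-1 + 2 * t)) * (1 + v) `^ (- 2))).
    by rewrite ler_wpM2r ?powR_ge0// ler_pM ?errg_ge0 ?powR_ge0.
  rewrite (_ : - (5 / 8) + 2 * t = 7 / 8 + (2^-1 + 2 * t) + - 2); last by field.
  by apply: eqle; rewrite !powRDp//; ring.
(* Each half is compared with [majorant] for [c = 1/8] and [K = 3]. *)
rewrite (_ : 192 = 4 * 3 / 8^-1 + 4 * 3 / 8^-1); last by field.
rewrite EFinD; apply: leeD.
- apply: integral_le_majorant => //.
  + have mV : measurable_fun pos (fun v : R => (1 + v)^-1).
      apply: (eq_measurable_fun (fun v : R => (1 + v) `^ (- 1))).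
        by move=> v; rewrite inE posE => v0; rewrite powR_inv1// addr_ge0// ltW.
      by apply: measurable_funTS; exact: measurable_powR1D.
    apply: measurable_funM; last by apply: measurable_funTS; exact: measurable_powR1D.
    apply: measurable_funM; first by apply: measurableT_comp mV; exact: measurable_errg.
    by apply: (measurableT_comp (measurable_kern 1 e (- (4^-1 + t))) mV).
  + by move=> v _; rewrite !mulr_ge0 ?errg_ge0 ?powR_ge0.
  + move=> v v0 v1; rewrite (_ : 8^-1 - 1 = - (7 / 8)); last by field.
    apply: le_trans (invle v v0) _; rewrite ler_pM2l//.
    rewrite -[leRHS]mulr1 ler_pM ?powR_ge0//; first by apply: ger_powR; lra.
    by rewrite -[leRHS](powRr0 (1 + v)); apply: ler_powR; lra.
  + move=> v v1; have v0 : 0 < v by lra.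
    rewrite (_ : - 8^-1 - 1 = - (2^-1 + 2 * t) + (- (5 / 8) + 2 * t)); last by field.
    apply: le_trans (invle v v0) _; rewrite ler_pM2l// [v `^ (_ + _)]powRDp// ler_wpM2l ?powR_ge0//.
    by apply: le0_ler_powR; lra.
- apply: integral_le_majorant => //.
  + apply: measurable_funTS; apply: measurable_funM.
      by apply: measurableT_comp; [exact: measurable_errg|exact: measurable_funD].
    by apply: (measurableT_comp (measurable_kern 1 e (- (4^-1 + t)))); exact: measurable_funD.
  + by move=> v _; rewrite !mulr_ge0 ?errg_ge0 ?powR_ge0.
  + move=> v v0 v1; rewrite (_ : 8^-1 - 1 = - (7 / 8)); last by field.
    rewrite ler_pM ?errg_ge0 ?powR_ge0//.
      apply: le_trans (errg_ge1 _) _; first lra.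
      rewrite -[leRHS]mulr1 ler_pM2l// -[leRHS](powRr0 (1 + v)); apply: ler_powR; lra.
    rewrite addrAC subrr add0r; apply: le_trans (vle _ v0) _; apply: ger_powR; lra.
  + move=> v v1; have v0 : 0 < v by lra.
    rewrite (_ : - 8^-1 - 1 = - (5 / 8) + - 2^-1); last by field.
    rewrite powRDp// mulrA ler_pM ?errg_ge0 ?powR_ge0//.
      apply: le_trans (errg_ge1 _) _; first lra.
      rewrite ler_pM2l//; apply: le0_ler_powR; lra.
    rewrite addrAC subrr add0r; apply: le_trans (vle _ v0) _; apply: ler_powR; lra.
Qed.

(** For [y >= 1] and [d <= 1/2] one has [y - d >= y/2], so the kernel is at most [16 y^(-2)], which
    leaves the integrable power [y^(-7/4)]. *)
Lemma err_far (t d e : R) : 0 < t <= 16^-1 -> 0 <= d <= 2^-1 -> 0 < e ->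
  (\int[leb]_(y in pos) ((if (1 < y)%R then y `^ 4^-1 else 0) * ((y - d) ^+ 2 + e) `^ (- (1 + t)))%:E
    <= 86%:E)%E.
Proof.
move=> /andP[t0 t1] /andP[d0 d1] e0.
have c0 : 0 < (3 / 4 : R) by lra.
apply: (@le_trans _ _ (4 * 16 / (3 / 4))%:E); last by rewrite lee_fin; lra.
apply: integral_le_majorant => //.
- apply: measurable_funTS; apply: measurable_funM; last exact: measurable_kern.
  by apply: measurable_fun_ifT => //; exact: measurable_fun_ltr.
- by move=> x _; rewrite mulr_ge0 ?powR_ge0//; case: ifP; rewrite ?powR_ge0.
- by move=> x x0 x1; rewrite ltNge x1/= mul0r mulr_ge0 ?powR_ge0.
- move=> x x1; have x0 : 0 < x by lra.
  have [_|_] := ltP 1 x; last by rewrite mul0r mulr_ge0 ?powR_ge0.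
  rewrite (_ : - (3 / 4) - 1 = 4^-1 + - 2); last by field.
  rewrite powRDp// mulrCA ler_wpM2l ?powR_ge0//.
  apply: (@le_trans _ _ (((2^-1 * x) ^+ 2) `^ (- (1 + t)))).
    apply: le0_ler_powR; [lra|by rewrite exprn_gt0 ?mulr_gt0|].
    have : 2^-1 * x <= x - d by lra.
    by move: x0 e0; clear; nra.
  rewrite exprMn powRM ?sqr_ge0//; apply: ler_pM; rewrite ?powR_ge0//.
    rewrite exprVn powR_inv_base ?exprn_gt0// opprK.
    apply: (@le_trans _ _ ((2 ^+ 2) `^ 2)); first by apply: ler_powR; rewrite ?expr2; lra.
    by rewrite powR_mulrn ?sqr_ge0//; apply: eqle; rewrite -exprM -natrX.
  by rewrite -powR_mulrn ?(ltW x0)// -powRrM; apply: ler_powR; lra.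
Qed.

(** Bernoulli with exponent [t/th] applied to [(1+v)^th]: a factor [t] is gained while the growth in
    [v] is only that of the power [th]. *)
Lemma powR_add1_sub1_le (t th v : R) : 0 < t <= th -> 0 <= v ->
  (1 + v) `^ t - 1 <= t / th * ((1 + v) `^ th - 1).
Proof.
move=> /andP[t0 tth] v0; have th0 := lt_le_trans t0 tth.
have X1 : 1 <= (1 + v) `^ th by rewrite -[leLHS](powRr0 (1 + v)) ler_powR ?(ltW th0)//; lra.
have -> : (1 + v) `^ t = (1 + ((1 + v) `^ th - 1)) `^ (t / th).
  by rewrite (addrC 1 (_ - 1)) subrK -powRrM mulrC divfK ?gt_eqF.
have w0 : 0 <= (1 + v) `^ th - 1 by rewrite subr_ge0.
have [->|tn] := eqVneq t th.
  by rewrite divff ?gt_eqF// mul1r (addrC 1 (_ - 1)) subrK powRr1 ?powR_ge0.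
apply: powR_Bernoulli => //; rewrite divr_gt0//= ltr_pdivrMr// mul1r.
by rewrite lt_neqAle tn.
Qed.

(** [gamf] contains the square of [(1+v)^t - 1], which is of order [t]. *)
Lemma gam_le (t : R) : 0 < t < 8^-1 -> 0 <= gam t <= 512 * t ^+ 2.
Proof.
move=> /andP[t0 t1]; rewrite -!lee_fin -integral_gam ?t0//.
have gf0 (v : R) : 0 <= gamf t v by rewrite mulr_ge0 ?sqr_ge0 ?powR_ge0.
apply/andP; split; first by apply: integral_ge0 => v _; rewrite lee_fin.
rewrite (_ : 512 * t ^+ 2 = 4 * (64 * t ^+ 2) / 2^-1); last by field.
have half : 2^-1 - 1 = - 2^-1 :> R by field.
have b0 v : 0 <= v -> 0 <= (1 + v) `^ t - 1.
  by move=> v0; rewrite subr_ge0 -[leLHS](powRr0 (1 + v)) ler_powR ?(ltW t0)//; lra.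
apply: integral_le_majorant; rewrite ?invr_gt0//.
- by rewrite mulr_ge0 ?sqr_ge0.
- apply: measurable_funTS; apply: measurable_funM; last exact: measurable_powR.
  by apply: measurable_funX; apply: measurable_funB => //; exact: measurable_powR1D.
- move=> v v0 v1; rewrite half /gamf.
  have h : (1 + v) `^ t - 1 <= t * v.
    by apply: powR_Bernoulli; lra.
  apply: (@le_trans _ _ ((t * v) ^+ 2 * v `^ (- (2 + 2 * t)))).
    by rewrite ler_wpM2r ?powR_ge0// ler_sqr ?nnegrE ?b0 ?mulr_ge0 ?(ltW t0) ?(ltW v0).
  rewrite exprMn -(@powR_mulrn _ v) ?(ltW v0)// -[leLHS]mulrA -powRDp//.
  apply: ler_pM; rewrite ?sqr_ge0 ?powR_ge0//; first by rewrite ler_peMl ?sqr_ge0//; lra.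
  by apply: ger_powR; lra.
- move=> v v1; have v0 : 0 < v by lra.
  rewrite (_ : - 2^-1 - 1 = 2^-1 + - 2); last by field.
  have h : (1 + v) `^ t - 1 <= 8 * t * v `^ 4^-1.
    apply: (@le_trans _ _ (t / 4^-1 * ((1 + v) `^ 4^-1 - 1))).
      by apply: powR_add1_sub1_le; lra.
    rewrite (_ : t / 4^-1 = 4 * t); last by field.
    rewrite (_ : 8 * t = 4 * t * 2); last by ring.
    rewrite -[leRHS]mulrA; apply: ler_wpM2l; first by rewrite mulr_ge0 ?(ltW t0).
    have v4 : 1 <= v `^ 4^-1 by rewrite -[leLHS](powRr0 v) ler_powR.
    suff : (1 + v) `^ 4^-1 <= 2 * v `^ 4^-1 by lra.
    apply: (@le_trans _ _ ((2 * v) `^ 4^-1)); first by rewrite ge0_ler_powR ?nnegrE; lra.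
    rewrite powRM ?(ltW v0)// ler_wpM2r ?powR_ge0//; apply: ler1_powR; rewrite ?ler1n//; lra.
  rewrite /gamf; apply: (@le_trans _ _ ((8 * t * v `^ 4^-1) ^+ 2 * v `^ (- (2 + 2 * t)))).
    by rewrite ler_wpM2r ?powR_ge0// ler_sqr ?nnegrE ?b0 ?mulr_ge0 ?powR_ge0 ?(ltW t0) ?(ltW v0).
  rewrite (_ : (8 * t * v `^ 4^-1) ^+ 2 = 64 * t ^+ 2 * (v `^ 4^-1 * v `^ 4^-1)); last by ring.
  rewrite -powRDp// -[leLHS]mulrA -powRDp//; apply: ler_wpM2l; first by rewrite mulr_ge0 ?sqr_ge0.
  by apply: ler_powR; lra.
Qed.

(** Finiteness is what permits [Qint t e 0] to be cancelled in [barrier_super]; the bound itself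
    degenerates with [e]. *)
Lemma Qint_fin (t e : R) : 0 < t <= 16^-1 -> 0 < e <= 1 -> (Qint t e 0 < +oo)%E.
Proof.
move=> /andP[t0 t1] /andP[e0 e1]; rewrite QintE2//.
have K1 : 1 <= e `^ (- 2) by rewrite powR_invn ?(ltW e0)// invf_ge1 ?exprn_gt0// expr_le1// ltW.
apply: (@le_lt_trans _ _ (4 * (4 * e `^ (- 2)) / t)%:E); last exact: ltry.
have vt v : 0 < v -> (1 + v) `^ (2 * t - 0) <= 1 + v.
  move=> v0; rewrite -[leRHS]powRr1 ?ler_powR//; lra.
have k1le v : 0 < v -> (1 + v) `^ (2 * t - 0) * k2 t e v + (1 + v) `^ 0 * k1 t e v <= (2 + v) * k1 t e v.
  move=> v0; rewrite powRr0; have := k2_le_k1 t0 e0 v0; have := k2_ge0 t e v; have := vt v v0.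
  set c := (1 + v) `^ _; have c_ge0 : 0 <= c by exact: powR_ge0.
  move: (k1 t e v) (k2 t e v) => a b b0 ba ca; clear -v0 c_ge0 b0 ba ca; nra.
apply: integral_le_majorant => //.
- by pos.
- exact: measurable_Qf.
- by move=> v v0; rewrite addr_ge0 ?mulr_ge0 ?powR_ge0.
- move=> v v0 v1; apply: le_trans (k1le v v0) _.
  apply: (@le_trans _ _ (4 * e `^ (- 2) * 1)).
    rewrite mulr1; apply: ler_pM; rewrite ?k1_ge0//; [lra|lra|].
    apply: (@le_trans _ _ (e `^ (- (1 + t)))).
      by apply: le0_ler_powR; [lra|lra|rewrite lerDr sqr_ge0].
    by apply: ger_powR; lra.
  rewrite ler_wpM2l ?mulr_ge0 ?powR_ge0// -[leLHS](powRr0 v); apply: ger_powR; lra.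
- move=> v v1; have v0 : 0 < v by lra.
  apply: le_trans (k1le v v0) _.
  apply: (@le_trans _ _ (4 * v `^ 1 * v `^ (- (2 + 2 * t)))).
    rewrite powRr1 ?(ltW v0)//; apply: ler_pM; rewrite ?k1_ge0//; [lra|lra|].
    apply: (@le_trans _ _ ((v ^+ 2) `^ (- (1 + t)))).
      by apply: le0_ler_powR; [lra|rewrite exprn_gt0|lra].
    by rewrite -powR_mulrn ?(ltW v0)// -powRrM; apply: ler_powR; lra.
  rewrite -mulrA -powRDp// -mulrA ler_pM2l//.
  rewrite -[leLHS]mul1r; apply: (ler_pM ler01 (powR_ge0 _ _) K1); apply: ler_powR; lra.
Qed.

End profiles.

(** * The barrier *)

Section barrier.
Context {R : realType}.

Lemma powR_tangent (t x : R) : 0 < t < 1 -> 0 <= x -> x `^ t <= 1 + t * (x - 1).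
Proof.
move=> /andP[t0 t1] x0; have t1' : 0 < 1 - t by rewrite subr_gt0.
have p0 : 0 < t^-1 by rewrite invr_gt0.
have q0 : 0 < (1 - t)^-1 by rewrite invr_gt0.
have pq : t^-1^-1 + (1 - t)^-1^-1 = 1 by rewrite !invrK; ring.
have := conjugate_powR (powR_ge0 x t) (@ler01 R) p0 q0 pq.
rewrite mulr1 powR1 mul1r !invrK -powRrM mulfV ?gt_eqF// powRr1// => h.
by move: h; clear; lra.
Qed.

(** Split [(1+v)^th] in the proportions [1/(1+v)] and [v/(1+v)]. A ratio in [[0, 1]] is at most its
    power [th], which bounds the two parts by [1] and [v^th]. *)
Lemma powR_subadd (th v : R) : 0 < th <= 1 -> 0 <= v -> (1 + v) `^ th <= 1 + v `^ th.
Proof.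
move=> /andP[th0 th1] v0; have v1 : 0 < 1 + v by pos.
have key (a : R) : 0 <= a -> a <= 1 + v -> (1 + v) `^ th * (a / (1 + v)) <= a `^ th.
  move=> a0 av; have -> : a `^ th = (1 + v) `^ th * (a / (1 + v)) `^ th.
    by rewrite -powRM; [congr powR; field; rewrite gt_eqF|pos|pos].
  apply: ler_wpM2l; first pos.
  have [->|an] := eqVneq a 0; first by rewrite mul0r powR_ge0.
  have a_gt0 : 0 < a by rewrite lt_def an.
  apply: ger1_powR => //; rewrite divr_gt0//= ler_pdivrMr ?mul1r//.
have h1 := key 1 ler01 ltac:(lra); have h2 := key v v0 ltac:(lra); rewrite powR1 in h1.
have -> : (1 + v) `^ th = (1 + v) `^ th * (1 / (1 + v)) + (1 + v) `^ th * (v / (1 + v)).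
  by field; rewrite gt_eqF.
exact: lerD.
Qed.

(** The factor [t] is paid for by the singular ratio [a / p], to a power [th] that each use chooses
    so as to keep the error integrable. *)
Lemma powR_gap (t th p a : R) : 0 < t <= th -> th <= 1 -> 0 < p <= 1 -> 0 <= a ->
  (p + a) `^ t - p `^ t <= t / th * (a / p) `^ th.
Proof.
move=> /andP[t0 tth] th1 /andP[p0 p1] a0; have th0 := lt_le_trans t0 tth.
have ap : 0 <= a / p by pos.
have -> : p + a = p * (1 + a / p) by field; rewrite gt_eqF.
rewrite powRM; [|pos|pos].
have h1 := @powR_add1_sub1_le R t th (a / p) ltac:(lra) ap.
have h2 : (1 + a / p) `^ th - 1 <= (a / p) `^ th.
  by rewrite lerBlDl; apply: powR_subadd; rewrite ?th0.
have h3 : (1 + a / p) `^ t - 1 <= t / th * (a / p) `^ th.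
  by apply: le_trans h1 _; apply: ler_wpM2l; first pos.
have h4 : p `^ t <= 1 by rewrite -[leRHS](powRr0 p); apply: ger_powR; rewrite ?p0 ?(ltW t0).
have h5 : 0 <= p `^ t by pos.
have h6 : 0 <= t / th * (a / p) `^ th by pos.
move: h3 h4 h5 h6; move: (p `^ t) (_ `^ t) (t / th * _) => x y z; clear; nra.
Qed.

Definition barrier (t x : R) : R := x `^ t - t * x `^ 4^-1.

Lemma barrier_ge0 t x : 0 < t <= 4^-1 -> 0 <= x <= 1 -> 0 <= barrier t x.
Proof.
move=> /andP[t0 t1] /andP[x0 x1]; rewrite subr_ge0.
have [->|xn] := eqVneq x 0; first by rewrite !powR0 ?mulr0 ?gt_eqF// invr_gt0.
have x_gt0 : 0 < x by rewrite lt_def xn.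
have h : x `^ 4^-1 <= x `^ t by apply: ger_powR; rewrite ?x_gt0.
apply: le_trans h; rewrite ler_piMl ?powR_ge0//; lra.
Qed.

Lemma barrier_gt0 t x : 0 < t <= 4^-1 -> 0 < x <= 1 -> 0 < barrier t x.
Proof.
move=> /andP[t0 t1] /andP[x0 x1]; rewrite subr_gt0.
have h : x `^ 4^-1 <= x `^ t by apply: ger_powR; rewrite ?x0.
apply: lt_le_trans h; rewrite gtr_pMl ?powR_gt0//; lra.
Qed.

Lemma barrier_le t x : 0 <= t -> barrier t x <= x `^ t.
Proof. by move=> t0; rewrite lerBlDr lerDl; pos. Qed.

Lemma powR_le1 (t x : R) : 0 <= t -> 0 <= x <= 1 -> x `^ t <= 1.
Proof.
move=> t0 /andP[x0 x1]; rewrite -[leRHS](congr1 (@^~ t) (@powR1 R)).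
by rewrite ge0_ler_powR ?nnegrE.
Qed.

Lemma barrier_le1 t x : 0 <= t -> 0 <= x <= 1 -> barrier t x <= 1.
Proof. by move=> t0 x1; apply: le_trans (barrier_le _ t0) _; exact: powR_le1. Qed.

(** With [a = p^(1/4)] and [b = q^(1/4)], concavity of [x^(4t)] gives
    [b^(4t) - a^(4t) >= 4 t (b - a)] below 1. The correction takes back [t (b - a)] and
    [3 t (b - a)] remains. *)
Lemma barrier_increase t p q : 0 < t <= 8^-1 -> 0 < p -> p <= q -> q <= 1 ->
  barrier t p + 3 * t * (q `^ 4^-1 - p `^ 4^-1) <= barrier t q.
Proof.
move=> /andP[t0 t1] p_gt0 pq q1; have q_gt0 : 0 < q by lra.
have p0 := ltW p_gt0; have q0 := ltW q_gt0.
pose a := p `^ 4^-1; pose b := q `^ 4^-1.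
have a0 : 0 < a by rewrite /a; pos.
have ab : a <= b by rewrite /a /b; apply: ge0_ler_powR; rewrite ?nnegrE// invr_ge0.
have b1 : b <= 1 by apply: powR_le1; rewrite ?invr_ge0// q0.
have b0 : 0 < b by lra.
have E (x : R) : x `^ t = (x `^ 4^-1) `^ (4 * t).
  by rewrite -powRrM; congr powR; field.
rewrite /barrier !(E _) -/a -/b.
have t4 : 0 < 4 * t < 1 by lra.
have c0 : 0 <= a / b by pos.
have h := powR_tangent t4 c0.
have -> : a `^ (4 * t) = b `^ (4 * t) * (a / b) `^ (4 * t).
  by rewrite -powRM; [congr powR; field; rewrite gt_eqF|pos|pos].
have bb : b <= b `^ (4 * t) by apply: ger1_powR; [rewrite b0|lra].
have ab' : a = b * (a / b) by field; rewrite gt_eqF.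
have c1 : a / b <= 1 by rewrite ler_pdivrMr ?mul1r.
have h1 : b `^ (4 * t) * (a / b) `^ (4 * t) <= b `^ (4 * t) * (1 + 4 * t * (a / b - 1)).
  by apply: ler_wpM2l => //; pos.
have h2 : b * (4 * t * (1 - a / b)) <= b `^ (4 * t) * (4 * t * (1 - a / b)).
  by apply: ler_wpM2r => //; apply: mulr_ge0; lra.
have ta : t * a = t * (b * (a / b)) by rewrite -ab'.
move: (b `^ (4 * t)) ((a / b) `^ (4 * t)) h1 h2 => x y h1 h2.
by move: (a / b) h1 h2 ta => c; clear; lra.
Qed.

Lemma barrier_mono t p q : 0 < t <= 8^-1 -> 0 <= p -> p <= q -> q <= 1 -> barrier t p <= barrier t q.
Proof.
move=> /andP[t0 t1] p0 pq q1; have q0 := le_trans p0 pq.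
have [p_0|pn] := eqVneq p 0.
  rewrite {1}/barrier p_0 !powR0 ?gt_eqF ?invr_gt0// mulr0 subr0.
  by apply: barrier_ge0; lra.
have p_gt0 : 0 < p by rewrite lt_def pn.
have q_gt0 : 0 < q by lra.
apply: le_trans (barrier_increase _ p_gt0 pq q1); last by rewrite t0.
rewrite lerDl mulr_ge0 ?mulr_ge0 ?(ltW t0)// subr_ge0.
by apply: ge0_ler_powR; rewrite ?nnegrE ?invr_ge0.
Qed.

(* [tau] is the signed distance of [y] to the tangent hyperplane, [X] the squared
   distance between [y] and the point at depth [d], and [dl] the truncated depth of [y]. *)
Lemma barrier_in_gt0 (t r d tau X dl : R) : 0 < t <= 16^-1 -> 0 < r -> 0 < d <= 1 ->
  0 <= dl <= 1 -> 0 < tau -> 0 <= X -> dl <= tau + X / r ->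
  barrier t dl + t * tau `^ 4^-1 <= tau `^ t +
    t * (16 * r `^ (- (3 / 4)) * d `^ (- (3 / 4))) * (X `^ (3 / 4) * errg (`|tau| / d))
    + t * (if 1 < tau then tau `^ 4^-1 else 0).
Proof.
move=> /andP[t0 t1] r0 /andP[d0 d1] /andP[dl0 dl1] tau0 X0 dlX.
have e0 : 0 <= t * (16 * r `^ (- (3 / 4)) * d `^ (- (3 / 4))) * (X `^ (3 / 4) * errg (`|tau| / d)).
  by have h := errg_ge0 (`|tau| / d); pos.
(* Beyond 1, where [barrier_mono] does not apply, [barrier <= 1 <= tau^t] suffices and the last term
   pays for [t * tau^(1/4)]. *)
have [tau1|tau1] := ltP 1 tau.
  have h1 : barrier t dl <= 1 by apply: barrier_le1; rewrite ?(ltW t0)// dl0.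
  have h2 : 1 <= tau `^ t by rewrite -[leLHS](powRr0 tau); apply: ler_powR; rewrite ltW.
  by rewrite -lerBlDr addrK; apply: le_trans h1 _; rewrite -[leLHS]addr0; apply: lerD.
rewrite mulr0 addr0 -lerBrDr addrAC -/(barrier t tau).
have [dt|td] := leP dl tau.
  by apply: le_trans (barrier_mono _ dl0 dt tau1) _; [lra|rewrite lerDl].
rewrite -lerBlDl; apply: (@le_trans _ _ (dl `^ t - tau `^ t)).
  rewrite /barrier; have : tau `^ 4^-1 <= dl `^ 4^-1 by apply: ge0_ler_powR; rewrite ?nnegrE ?invr_ge0 ?(ltW tau0)// ltW.
  by move: (tau `^ 4^-1) (dl `^ 4^-1) => a b ab; nra.
have a0 : 0 <= X / r by pos.
have := @powR_gap t (3 / 4) tau (X / r) ltac:(lra) ltac:(lra) ltac:(lra) a0.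
have : dl `^ t <= (tau + X / r) `^ t by apply: ge0_ler_powR; rewrite ?nnegrE ?(ltW t0) ?addr_ge0 ?(ltW tau0).
move=> h1 h2; apply: le_trans (le_trans (lerB h1 (lexx _)) h2) _.
have -> : (X / r / tau) `^ (3 / 4) = r `^ (- (3 / 4)) * d `^ (- (3 / 4)) * (X `^ (3 / 4) * (`|tau| / d) `^ (- (3 / 4))).
  rewrite (gtr0_norm tau0) !powRM; try by pos.
  rewrite !powR_inv_base//.
  have dd : d `^ (- (3 / 4)) * d `^ (- - (3 / 4)) = 1 by rewrite -powRDp// subrr powRr0.
  move: dd; move: (d `^ _) (d `^ _) (r `^ _) (tau `^ _) (X `^ _) => a b c e f ab.
  by rewrite [RHS](_ : _ = (a * b) * (c * e * f)); [rewrite (mulrC a) ab; ring|ring].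
rewrite (_ : t / (3 / 4) = 4 / 3 * t); last by field.
have : (`|tau| / d) `^ (- (3 / 4)) <= errg (`|tau| / d).
  have := powR_ge0 (`|tau| / d) (- (7 / 8)); have := powR_ge0 (`|tau| / d) (- (5 / 8)).
  by rewrite /errg; lra.
have : 0 <= t * (r `^ (- (3 / 4)) * d `^ (- (3 / 4)) * X `^ (3 / 4)) by pos.
have := powR_ge0 (`|tau| / d) (- (3 / 4)).
move: (_ `^ _) (errg _) (r `^ _) (d `^ _) (X `^ _) => a b c e f a0' h ab.
by move: (ler_wpM2l h ab) (mulr_ge0 h a0') (mulr_ge0 h (le_trans a0' ab)); clear; lra.
Qed.

Lemma sqn_sub_line n (u v : 'rV[R]_n) (a : R) :
  sqn (u - a *: v) = sqn u - 2 * a * dotv u v + a ^+ 2 * sqn v.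
Proof. by rewrite /sqn !dotv_lin (dotvC v u); ring. Qed.

Lemma err_pow (a d T : R) : 0 < d -> 0 <= T ->
  d `^ (- (3 / 4)) * (T / d) `^ (- a) = d `^ (a - 3 / 4) * T `^ (- a).
Proof.
move=> d0 T0; rewrite powRM ?invr_ge0 ?(ltW d0)// powR_inv_base// opprK mulrCA mulrC -powRDp//.
by rewrite [- _ + _]addrC.
Qed.

Lemma barrier_sub_le t p q : 0 < t -> 0 <= p -> p <= q -> barrier t q - barrier t p <= q `^ t - p `^ t.
Proof.
move=> t0 p0 pq; have : p `^ 4^-1 <= q `^ 4^-1.
  by apply: ge0_ler_powR; rewrite ?nnegrE ?invr_ge0// (le_trans p0).
by rewrite /barrier; move: (p `^ 4^-1) (q `^ 4^-1) => a b ab; nra.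
Qed.

Lemma powR_gap8 (t p q : R) : 0 < t <= 16^-1 -> 0 < p <= 1 -> p <= q ->
  q `^ t - p `^ t <= t * 8 * (q / p) `^ 8^-1.
Proof.
move=> t01 /andP[p0 p1] pq; have h0 : 0 <= q - p by lra.
have := @powR_gap t 8^-1 p (q - p) ltac:(lra) ltac:(lra) ltac:(lra) h0.
rewrite [p + _]addrC subrK => /le_trans; apply.
rewrite (_ : t / 8^-1 = t * 8); last by field.
apply: ler_wpM2l; first by move: t01 => /andP[? _]; pos.
have ip : 0 <= p^-1 by rewrite invr_ge0 ltW.
apply: ge0_ler_powR; rewrite ?nnegrE ?invr_ge0//.
- exact: mulr_ge0.
- by apply: mulr_ge0 => //; lra.
- by apply: ler_wpM2r => //; lra.
Qed.

Lemma powR_ge1 (a x : R) : 0 <= a -> 1 <= x -> 1 <= x `^ a.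
Proof. by move=> a0 x1; rewrite -[leLHS](powRr0 x); exact: ler_powR. Qed.

(** A point of the domain beyond the tangent hyperplane lies outside the exterior ball, so
    [X >= 2 r |tau|]. Inserting [(X / (r |tau|))^(5/8) >= 1] completes the [X^(1/8)] of the gap
    estimate to [X^(3/4)] and produces [T^(-5/8)]. *)
Lemma barrier_in_lt0 (t r d tau X dl : R) : 0 < t <= 16^-1 -> 0 < r -> 0 < d <= 1 ->
  0 <= dl <= 1 -> tau < 0 -> 2 * r * `|tau| <= X -> dl <= `|tau| + X / r ->
  barrier t dl <= barrier t d +
    t * (16 * r `^ (- (3 / 4)) * d `^ (- (3 / 4))) * (X `^ (3 / 4) * errg (`|tau| / d)).
Proof.
move=> t01 r0 /andP[d0 d1] /andP[dl0 dl1] tau0 Xtau dlX.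
move: (t01) => /andP[t0 t1].
have T0 : 0 < `|tau| by rewrite normr_gt0 lt_eqF.
move: (`|tau|) T0 Xtau dlX => T T0 XT dlX.
have X0 : 0 < X by apply: lt_le_trans XT; pos.
have e0 : 0 <= t * (16 * r `^ (- (3 / 4)) * d `^ (- (3 / 4))) * (X `^ (3 / 4) * errg (T / d)).
  by have h := errg_ge0 (T / d); pos.
have [dld|ddl] := leP dl d.
  by apply: le_trans (barrier_mono _ dl0 dld d1) _; [lra|rewrite lerDl].
rewrite -lerBlDl; apply: le_trans (barrier_sub_le t0 (ltW d0) (ltW ddl)) _.
apply: le_trans (@powR_gap8 t d dl t01 _ (ltW ddl)) _; first by rewrite d0.
have TX : T <= X / r by rewrite ler_pdivlMr// mulrC; apply: le_trans XT; rewrite -mulrA ler_peMl ?mulr_ge0 ?(ltW r0) ?(ltW T0)//; lra.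
have h1 : (dl / d) `^ 8^-1 <= 2 * (X / r / d) `^ 8^-1.
  apply: (@le_trans _ _ ((2 * (X / r / d)) `^ 8^-1)).
    apply: ge0_ler_powR; rewrite ?nnegrE ?invr_ge0//; [pos|pos|].
    by rewrite mulrA ler_wpM2r ?invr_ge0 ?(ltW d0)//; lra.
  rewrite powRM; [|by []|pos]; apply: ler_wpM2r; first pos.
  by apply: ler1_powR; rewrite ?ler1n//; lra.
have h2 : 1 <= (X / r / T) `^ (5 / 8) by apply: powR_ge1; [lra|rewrite ler_pdivlMr// mul1r].
have h3 : (X / r / d) `^ 8^-1 * (X / r / T) `^ (5 / 8) =
    r `^ (- (3 / 4)) * d `^ (- (3 / 4)) * (X `^ (3 / 4) * (T / d) `^ (- (5 / 8))).
  rewrite [RHS](_ : _ = r `^ (- (3 / 4)) * X `^ (3 / 4) * (d `^ (- (3 / 4)) * (T / d) `^ (- (5 / 8)))); last by ring.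
  rewrite err_pow ?(ltW T0)//.
  rewrite !powRM; try by pos.
  rewrite !powR_inv_base//.
  rewrite (_ : 5 / 8 - 3 / 4 = - 8^-1); last by field.
  rewrite (_ : - (3 / 4) = - 8^-1 + - (5 / 8)); last by field.
  rewrite (_ : 3 / 4 = 8^-1 + 5 / 8); last by field.
  by rewrite !powRDp//; ring.
have h4 : (T / d) `^ (- (5 / 8)) <= errg (T / d).
  have := powR_ge0 (T / d) (- (7 / 8)); have := powR_ge0 (T / d) (- (3 / 4)).
  by rewrite /errg; lra.
have h5 : 0 <= (X / r / d) `^ 8^-1 by pos.
have h6 : 0 <= r `^ (- (3 / 4)) * d `^ (- (3 / 4)) * X `^ (3 / 4) by pos.
have h7 := ler_wpM2l h5 h2; rewrite mulr1 h3 in h7.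
have h8 := ler_wpM2l h6 h4.
rewrite [leRHS](_ : _ = t * 8 * (2 * (r `^ (- (3 / 4)) * d `^ (- (3 / 4)) * X `^ (3 / 4) * errg (T / d)))); last by ring.
apply: ler_wpM2l; first pos.
apply: le_trans h1 _; apply: ler_wpM2l => //; apply: le_trans h7 _.
by rewrite [leLHS]mulrA.
Qed.

(** Here [y] is outside the domain though above the tangent hyperplane. Since the interior ball
    excludes it, [X >= r tau]. Inserting [(X / (r tau))^(3/4) >= 1] gives [X^(3/4)] and the exponent
    [-1/8 - 3/4 = -7/8]. *)
Lemma barrier_out (t r d tau X : R) : 0 < t <= 16^-1 -> 0 < r -> 0 < d <= 1 ->
  0 < tau -> tau < d -> r * tau <= X ->
  barrier t d + t * tau `^ 4^-1 <= tau `^ t +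
    t * (16 * r `^ (- (3 / 4)) * d `^ (- (3 / 4))) * (X `^ (3 / 4) * errg (`|tau| / d)).
Proof.
move=> t01 r0 /andP[d0 d1] tau0 taud Xtau; move: (t01) => /andP[t0 t1].
rewrite (gtr0_norm tau0) -lerBrDr addrAC -/(barrier t tau) -lerBlDl.
apply: le_trans (barrier_sub_le t0 (ltW tau0) (ltW taud)) _.
apply: le_trans (@powR_gap8 t tau d t01 _ (ltW taud)) _; first by lra.
have X0 : 0 < X by apply: lt_le_trans Xtau; pos.
have h2 : 1 <= (X / r / tau) `^ (3 / 4).
  by apply: powR_ge1; [lra|rewrite -mulrA -invfM ler_pdivlMr ?mulr_gt0// mul1r].
have h3 : (d / tau) `^ 8^-1 * (X / r / tau) `^ (3 / 4) =
    r `^ (- (3 / 4)) * d `^ (- (3 / 4)) * (X `^ (3 / 4) * (tau / d) `^ (- (7 / 8))).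
  rewrite [RHS](_ : _ = r `^ (- (3 / 4)) * X `^ (3 / 4) * (d `^ (- (3 / 4)) * (tau / d) `^ (- (7 / 8)))); last by ring.
  rewrite err_pow ?(ltW tau0)//.
  rewrite !powRM; try by pos.
  rewrite !powR_inv_base//.
  rewrite (_ : 7 / 8 - 3 / 4 = 8^-1); last by field.
  rewrite (_ : - (7 / 8) = - 8^-1 + - (3 / 4)); last by field.
  by rewrite !powRDp//; ring.
have h4 : (tau / d) `^ (- (7 / 8)) <= errg (tau / d).
  have := powR_ge0 (tau / d) (- (5 / 8)); have := powR_ge0 (tau / d) (- (3 / 4)).
  by rewrite /errg; lra.
have h5 : 0 <= (d / tau) `^ 8^-1 by pos.
have h6 : 0 <= r `^ (- (3 / 4)) * d `^ (- (3 / 4)) * X `^ (3 / 4) by pos.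
have h7 := ler_wpM2l h5 h2; rewrite mulr1 h3 in h7.
have h8 := ler_wpM2l h6 h4.
have h9 := errg_ge0 (tau / d).
apply: (@le_trans _ _ (t * 8 * (r `^ (- (3 / 4)) * d `^ (- (3 / 4)) * X `^ (3 / 4) * errg (tau / d)))).
  by apply: ler_wpM2l; [pos|apply: le_trans h7 _; rewrite [leLHS]mulrA].
have : 0 <= t * (r `^ (- (3 / 4)) * d `^ (- (3 / 4)) * X `^ (3 / 4) * errg (tau / d)) by pos.
by move: (r `^ _) (d `^ _) (X `^ _) (errg _) => a b c e; clear; lra.
Qed.

(** * Pointwise comparison with the half-space tangent at the foot [b] of [x] *)

Section pointwise.
Variables (m : nat) (Omega : set 'rV[R]_m) (delta : 'rV[R]_m -> R) (r rho t d : R) (b v : 'rV[R]_m).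
Hypotheses (t01 : 0 < t <= 16^-1) (r0 : 0 < r) (rho1 : rho <= 1) (rhor : rho <= r)
  (d0 : 0 < d) (drho : d <= rho) (v1 : sqn v = 1).
Hypotheses (ball_in : forall y, sqn (y - b) < 2 * r * dotv (y - b) v -> Omega y)
  (ball_out : forall y, sqn (y - b) < - (2 * r * dotv (y - b) v) -> ~ Omega y)
  (b_out : ~ Omega b)
  (delta_ge0 : forall y, Omega y -> 0 <= delta y)
  (delta_le : forall y q, Omega y -> ~ Omega q -> delta y <= enorm (y - q)).
Let x := b + d *: v.

(** Let [z] be the tangential part of [y - b]. The point at tangential position [z] and height
    [- |z|^2 / r] lies in the closed exterior ball when [|z| < r], so it is outside the domain and
    bounds the depth of [y]. When [|z| >= r] the truncation at [rho <= r] is enough. *)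
Lemma depth_le y : Omega y ->
  Num.min (delta y) rho <= `|dotv (y - b) v| + (sqn (y - b) - dotv (y - b) v ^+ 2) / r.
Proof.
move=> Oy; set tau := dotv (y - b) v; set z2 := sqn (y - b) - tau ^+ 2.
pose z := (y - b) - tau *: v.
have zz : sqn z = z2.
  by rewrite /z sqn_sub_line v1 -/tau /z2; ring.
have zv : dotv z v = 0 by rewrite /z dotvDl dotvNl dotvZl -/(sqn v) v1 -/tau mulr1 subrr.
have z0 : 0 <= z2 by rewrite -zz sqn_ge0.
have [zr|rz] := ltP z2 (r ^+ 2); last first.
  apply: (@le_trans _ _ rho); first by rewrite ge_min lexx orbT.
  apply: (@le_trans _ _ (z2 / r)); last by rewrite lerDr.
  by apply: le_trans rhor _; rewrite ler_pdivlMr// -expr2.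
pose q := b + z - (z2 / r) *: v.
have qE : q - b = z - (z2 / r) *: v by rewrite /q addrAC [b + z]addrC addrK.
have Oq : ~ Omega q.
  have [z20|z2n] := eqVneq z2 0.
    suff -> : q = b by [].
    have /eqP : sqn z = 0 by rewrite zz.
    by rewrite sqn_eq0 => /eqP z_0; rewrite /q z_0 z20 mul0r scale0r addr0 subr0.
  have z2p : 0 < z2 by rewrite lt_def z2n.
  apply: ball_out; rewrite qE.
  have -> : dotv (z - (z2 / r) *: v) v = - (z2 / r).
    by rewrite dotvDl dotvNl dotvZl zv -/(sqn v) v1 mulr1 add0r.
  have -> : sqn (z - (z2 / r) *: v) = z2 + (z2 / r) ^+ 2.
    by rewrite sqn_sub_line v1 zv zz; ring.
  rewrite mulrN opprK (_ : 2 * r * (z2 / r) = z2 + z2); last by field; rewrite gt_eqF.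
  rewrite ltrD2l expr_div_n ltr_pdivrMr ?exprn_gt0// expr2.
  by rewrite ltr_pM2l.
apply: (@le_trans _ _ (delta y)); first by rewrite ge_min lexx.
apply: le_trans (delta_le Oy Oq) _.
have -> : y - q = (tau + z2 / r) *: v.
  by apply/rowP => i; rewrite /q /z !mxE; ring.
rewrite enormZ enormE v1 sqrtr1 mulr1; apply: le_trans (ler_normD _ _) _.
by rewrite lerD2l ger0_norm// divr_ge0// ltW.
Qed.

(** Read with subtractions: the increment of the weight from [x] to [y] is at most the increment of
    the half-space profile [barrier t], up to errors. All terms are placed so as to be nonnegative,
    which lets the inequality be integrated in the extended reals. The case [tau = 0] is a null
    hyperplane and is absorbed by a crude term. *)
Lemma barrier_pointwise y (tau := dotv (y - x) v + d) :
  (if y \in Omega then barrier t (Num.min (delta y) rho) else 0) +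
    (if 0 < tau then barrier t d + t * tau `^ 4^-1 else 0) <=
  (if y \in Omega then barrier t d else 0) + (if 0 < tau then tau `^ t else 0) +
    t * (16 * r `^ (- (3 / 4)) * d `^ (- (3 / 4))) * (sqn (y - x) `^ (3 / 4) * errg (`|tau| / d)) +
    t * (if 1 < tau then tau `^ 4^-1 else 0) + (if tau == 0 then 1 else 0).
Proof.
have yx : y - x = (y - b) - d *: v by rewrite /x opprD addrA.
have tauE : tau = dotv (y - b) v by rewrite /tau yx dotvDl dotvNl dotvZl -/(sqn v) v1 mulr1 subrK.
have XE : sqn (y - x) = sqn (y - b) - tau ^+ 2 + (tau - d) ^+ 2.
  by rewrite yx sqn_sub_line v1 -tauE; ring.
have z0 : 0 <= sqn (y - b) - tau ^+ 2.
  have := sqn_ge0 ((y - b) - tau *: v).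
  rewrite sqn_sub_line v1 -tauE.
  by move=> h; apply: le_trans h _; rewrite le_eqVlt; apply/orP; left; apply/eqP; ring.
move: (sqn (y - x)) XE => X XE.
have bi := ball_in (y := y); have bo := ball_out (y := y); rewrite -tauE in bi bo.
have dl : Omega y -> Num.min (delta y) rho <= `|tau| + (sqn (y - b) - tau ^+ 2) / r.
  by rewrite tauE; exact: depth_le.
have dl01 : Omega y -> 0 <= Num.min (delta y) rho <= 1.
  move=> Oy; rewrite le_min delta_ge0//= ge_min rho1 orbT andbT.
  by apply: le_trans drho; exact: ltW.
have d01 : 0 < d <= 1 by rewrite d0 (le_trans drho).
move: (sqn (y - b)) z0 XE dl bi bo => Y z0 XE dl bi bo.
have X0 : 0 <= X by rewrite XE addr_ge0 ?sqr_ge0.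
have t0 : 0 < t by case/andP: t01.
have zX : (Y - tau ^+ 2) / r <= X / r by rewrite ler_pM2r ?invr_gt0// XE lerDl sqr_ge0.
have E0 : 0 <= t * (16 * r `^ (- (3 / 4)) * d `^ (- (3 / 4))) * (X `^ (3 / 4) * errg (`|tau| / d)).
  by have h := errg_ge0 (`|tau| / d); pos.
have F0 : 0 <= t * (if 1 < tau then tau `^ 4^-1 else 0).
  by apply: mulr_ge0; [exact: ltW|case: ifP => // _; exact: powR_ge0].
have t1 : t <= 16^-1 by case/andP: t01.
have d1 : d <= 1 by case/andP: d01.
have B0 : 0 <= barrier t d by apply: barrier_ge0; lra.
case: ifPn; rewrite ?inE ?notin_setE => Oy; have [tau0|tau0|tau0] := ltgtP tau 0.
- have h := barrier_in_lt0 t01 r0 d01 (dl01 Oy) tau0 _ (le_trans (dl Oy) _).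
  rewrite !addr0; apply: le_trans (h X _ _) _; last by rewrite lerDl.
    apply: (@le_trans _ _ Y); last by rewrite XE; move: tau0 d0; nra.
    by rewrite (ltr0_norm tau0) mulrN leNgt; apply/negP => /bo.
  by rewrite lerD2l.
- have h := barrier_in_gt0 t01 r0 d01 (dl01 Oy) tau0 X0 _.
  rewrite (gtr0_norm tau0) in dl h *.
  have := h (le_trans (dl Oy) _); rewrite lerD2l => /(_ zX) {}h.
  by move: h; lra.
- rewrite !addr0; apply: (@le_trans _ _ 1); first by apply: barrier_le1; rewrite ?(ltW t0)// dl01.
  by rewrite lerDr; apply: addr_ge0 => //; exact: addr_ge0.
- by rewrite !addr0 add0r; exact: addr_ge0.
- rewrite !add0r addr0; have [td|dt] := ltP tau d.
    (* From [|y - b|^2 >= 2 r tau]: [X = |y - b|^2 - tau^2 + (tau - d)^2 >= tau (2 r - tau) >= r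
       tau], as [tau < d <= r]. *)
    have rX : r * tau <= X.
      have Y2 : 2 * r * tau <= Y by rewrite leNgt; apply/negP => /bi.
      have : tau * (r - tau) >= 0 by apply: mulr_ge0; [exact: ltW|move: td drho rhor; lra].
      by rewrite XE; move: Y2 (sqr_ge0 (tau - d)); lra.
    by apply: le_trans (barrier_out t01 r0 d01 tau0 td rX) _; rewrite lerDl.
  have [tau1|tau1] := ltP 1 tau.
    have h1 : barrier t d <= 1 by apply: barrier_le1; [exact: ltW|lra].
    have h2 : 1 <= tau `^ t by apply: powR_ge1; rewrite ltW.
    by move: h1 h2 E0; lra.
  have := @barrier_mono t d tau ltac:(lra) (ltW d0) dt tau1.
  by rewrite {2}/barrier; move: E0; lra.
- by rewrite !add0r; apply: addr_ge0 => //; exact: addr_ge0.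
Qed.

End pointwise.

End barrier.

(** * Integration of the comparison with the half-space *)

Section barrier_integral.
Context {R : realType}.
Local Notation leb := (@lebesgue_measure R).
Local Notation mu := (@lebesgue_rV R).
Local Notation pos := (`]0%R, +oo[%classic : set R).

Lemma slab_tau n (v x : 'rV[R]_n.+1) (g : R -> R) (d e q : R) : sqn v = 1 ->
  measurable_fun [set: R] g -> (forall s, 0 <= g s) -> 0 < e -> 0 < q ->
  (\int[mu n.+1]_y (g (dotv (y - x) v + d) * (sqn (y - x) + e) `^ (- (n%:R / 2 + q)))%:E =
   (Acst n (n%:R / 2 + q))%:E * \int[leb]_y (g y * ((y - d) ^+ 2 + e) `^ (- q))%:E)%E.
Proof.
move=> v1 mg g0 e0 q0.
pose g' s := (g (s + d))%:E.
have mg' : measurable_fun [set: R] g'.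
  by apply: measurable_EFin_comp; apply: measurableT_comp mg _; exact: measurable_funD.
have g'0 s : (0 <= g' s)%E by rewrite lee_fin.
have nq : n%:R / 2 < n%:R / 2 + q by rewrite ltrDl.
transitivity (\int[mu n.+1]_y (g' (dotv (y - x) v) * ((sqn (y - x) + e) `^ (- (n%:R / 2 + q)))%:E))%E.
  by apply: eq_integral => y _; rewrite -EFinM.
rewrite (integral_slab x v1 mg' g'0 e0 nq).
have mK : measurable_fun [set: R] (fun y => (g y * ((y - d) ^+ 2 + e) `^ (- q))%:E).
  by apply: measurable_EFin_comp; apply: measurable_funM mg _; exact: measurable_kern.
have K0 y : (0 <= (g y * ((y - d) ^+ 2 + e) `^ (- q))%:E)%E.
  by rewrite lee_fin mulr_ge0 ?powR_ge0.
rewrite -(ge0_integral_shift d mK K0).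
by apply: (congr1 (mule _)); apply: eq_integral => s _; rewrite /g' addrK -EFinM opprD addrA subrr add0r.
Qed.

Lemma integral_pow_kern (b d e t : R) : 0 < d -> 0 < e ->
  (\int[leb]_(y in pos) (y `^ b * ((y - d) ^+ 2 + e) `^ (- (1 + t)))%:E =
   (d `^ (b - 1 - 2 * t))%:E * Qint t (e / d ^+ 2) b)%E.
Proof.
move=> d0 e0.
have mb : measurable_fun [set: R] (fun y : R => y `^ b) by exact: measurable_powR.
have b0 (y : R) : 0 <= y `^ b by exact: powR_ge0.
rewrite (integral_scale_kern (1 + t) mb b0 d0 e0).
have mQ : measurable_fun pos (fun y => (y `^ b * ((y - 1) ^+ 2 + e / d ^+ 2) `^ (- (1 + t)))%:E).
  by apply: measurable_EFin_comp; apply: measurable_funTS; apply: measurable_funM mb _; exact: measurable_kern.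
have Q0 y : pos y -> (0 <= (y `^ b * ((y - 1) ^+ 2 + e / d ^+ 2) `^ (- (1 + t)))%:E)%E.
  by move=> _; rewrite lee_fin mulr_ge0 ?powR_ge0.
have db : (0 <= (d `^ b)%:E)%E by rewrite lee_fin powR_ge0.
transitivity ((d `^ (1 - 2 * (1 + t)))%:E * \int[leb]_(y in pos)
   ((d `^ b)%:E * (y `^ b * ((y - 1) ^+ 2 + e / d ^+ 2) `^ (- (1 + t)))%:E))%E.
  apply: (congr1 (mule _)); apply: eq_integral => y; rewrite inE posE => y0.
  by rewrite -EFinM powRM ?(ltW d0) ?(ltW y0)// mulrA.
rewrite (ge0_integralZl leb (measurable_itv _) mQ Q0 db) muleA -EFinM -powRDp//.
by rewrite /Qint; congr (_%:E * _)%E; congr powR; ring.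
Qed.

(** The negative half-line contributes at most as much as the positive one, because [-y] is farther
    from [d] than [y]; hence [384 = 2 * 192]. *)
Lemma integral_err_kern (d e t : R) : 0 < t <= 16^-1 -> 0 < d -> 0 < e ->
  (\int[leb]_y (errg (`|y| / d) * ((y - d) ^+ 2 + e) `^ (- (4^-1 + t)))%:E <=
   (384 * d `^ (2^-1 - 2 * t))%:E)%E.
Proof.
move=> t01 d0 e0; pose f (y : R) := errg (`|y| / d).
have mf : measurable_fun [set: R] f.
  apply: measurableT_comp; first exact: measurable_errg.
  by apply: measurable_funM => //; exact: normr_measurable.
have f0 y : 0 <= f y by exact: errg_ge0.
have mK : measurable_fun [set: R] (fun y => (f y * ((y - d) ^+ 2 + e) `^ (- (4^-1 + t)))%:E).
  by apply: measurable_EFin_comp; apply: measurable_funM mf _; exact: measurable_kern.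
have K0 y : (0 <= (f y * ((y - d) ^+ 2 + e) `^ (- (4^-1 + t)))%:E)%E.
  by rewrite lee_fin mulr_ge0 ?powR_ge0.
rewrite (integral_R_split mK K0).
have h1 : (\int[leb]_(y in pos) (f y * ((y - d) ^+ 2 + e) `^ (- (4^-1 + t)))%:E <=
    (192 * d `^ (2^-1 - 2 * t))%:E)%E.
  rewrite (integral_scale_kern (4^-1 + t) mf f0 d0 e0).
  rewrite (_ : 1 - 2 * (4^-1 + t) = 2^-1 - 2 * t); last by field.
  rewrite (mulrC 192) EFinM; apply: lee_wpmul2l; first by rewrite lee_fin powR_ge0.
  have e'0 : 0 < e / d ^+ 2 by pos.
  apply: le_trans (err_pos t01 e'0).
  rewrite le_eqVlt; apply/orP; left; apply/eqP; apply: eq_integral => y; rewrite inE posE => y0.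
  by rewrite /f normrM !gtr0_norm// mulrAC divff ?gt_eqF// mul1r.
rewrite (_ : 384 * d `^ (2^-1 - 2 * t) = 192 * d `^ (2^-1 - 2 * t) + 192 * d `^ (2^-1 - 2 * t)); last by ring.
rewrite EFinD; apply: (leeD h1); apply: le_trans h1.
apply: ge0_le_integral.
- exact: measurable_itv.
- by move=> y _; exact: K0.
- by apply: measurable_funTS; apply: (measurableT_comp mK); exact: measurable_funN.
- exact: measurable_funTS.
move=> y; rewrite posE => y0; rewrite lee_fin /f normrN; apply: ler_wpM2l; first exact: f0.
have t0 : 0 < t by case/andP: t01.
apply: le0_ler_powR; [lra|pos|]; rewrite lerD2r -subr_ge0.
rewrite (_ : _ - _ = 4 * (y * d)); last by ring.
by pos.
Qed.

Variables (n : nat) (Omega : set 'rV[R]_n.+1) (w : 'rV[R]_n.+1 -> R) (x v : 'rV[R]_n.+1)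
  (t d e C : R).
Hypotheses (t01 : 0 < t <= 16^-1) (d01 : 0 < d <= 2^-1) (e0 : 0 < e) (ed : e <= d ^+ 2)
  (v1 : sqn v = 1) (C0 : 0 <= C) (mO : measurable Omega)
  (mw : measurable_fun [set: 'rV[R]_n.+1] w) (w0 : forall y, 0 <= w y).
Let tau y := dotv (y - x) v + d.
Hypothesis pointwise : forall y, w y + (if 0 < tau y then barrier t d + t * tau y `^ 4^-1 else 0) <=
  (if y \in Omega then barrier t d else 0) + (if 0 < tau y then tau y `^ t else 0) +
    t * C * (sqn (y - x) `^ (3 / 4) * errg (`|tau y| / d)) +
    t * (if 1 < tau y then tau y `^ 4^-1 else 0) + (if tau y == 0 then 1 else 0).

(** Half of [N + 2s] for [N = n + 1] and [s = 1/2 + t]. *)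
Let p := n%:R / 2 + (1 + t).
Let k y := (sqn (y - x) + e) `^ (- p).
Let A0 := Acst n p.
Let A1 := Acst n (n%:R / 2 + (4^-1 + t)).

Let t0 : 0 < t. Proof. by case/andP: t01. Qed.
Let d0 : 0 < d. Proof. by case/andP: d01. Qed.
Let B0 : 0 <= barrier t d.
Proof. by apply: barrier_ge0; move: t01 d01; lra. Qed.
Let k0 y : 0 <= k y. Proof. exact: powR_ge0. Qed.
Let msqn : measurable_fun [set: 'rV[R]_n.+1] (fun y => sqn (y - x)).
Proof. by apply: measurable_dotv; exact: measurable_rVB. Qed.
Let mk : measurable_fun [set: 'rV[R]_n.+1] k.
Proof. by apply: measurable_powR_comp; exact: measurable_funD. Qed.
Let mtau : measurable_fun [set: 'rV[R]_n.+1] tau.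
Proof. by apply: measurable_funD => //; apply: measurable_dotv => //; exact: measurable_rVB. Qed.

(** [gl] and [gr] collect the terms of [pointwise] that depend on [tau] alone, so that slab
    integration applies to them. *)
Let gl (y : R) := if 0 < y then barrier t d + t * y `^ 4^-1 else 0.
Let gr (y : R) := (if 0 < y then y `^ t else 0) + t * (if 1 < y then y `^ 4^-1 else 0) +
  (if y == 0 then 1 else 0).
Let mgl : measurable_fun [set: R] gl.
Proof.
apply: measurable_fun_ifT => //; first exact: measurable_fun_ltr.
by apply: measurable_funD => //; apply: measurable_funM => //; exact: measurable_powR.
Qed.
Let mgr : measurable_fun [set: R] gr.
Proof.
apply: measurable_funD; last by apply: measurable_fun_ifT => //; exact: measurable_fun_eqr.
apply: measurable_funD.
  by apply: measurable_fun_ifT => //; first exact: measurable_fun_ltr.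
apply: measurable_funM => //; apply: measurable_fun_ifT => //; first exact: measurable_fun_ltr.
Qed.
Let gl0 y : 0 <= gl y.
Proof. by rewrite /gl; case: ifP => // _; apply: addr_ge0 => //; apply: mulr_ge0; rewrite ?powR_ge0// ltW. Qed.
Let gr0 y : 0 <= gr y.
Proof.
rewrite /gr; apply: addr_ge0; last by case: ifP.
apply: addr_ge0; first by case: ifP => // _; exact: powR_ge0.
by apply: mulr_ge0; [exact: ltW|case: ifP => // _; exact: powR_ge0].
Qed.

Let bO y := if y \in Omega then barrier t d else 0.
Let mbO : measurable_fun [set: 'rV[R]_n.+1] bO.
Proof.
apply: measurable_fun_ifT => //; apply: (measurable_fun_bool true).
rewrite setTI (_ : _ @^-1` _ = Omega)//; apply/seteqP; split => y /=; [exact: set_mem|exact: mem_set].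
Qed.
Let bO0 y : 0 <= bO y. Proof. by rewrite /bO; case: ifP. Qed.

Let er y := sqn (y - x) `^ (3 / 4) * errg (`|tau y| / d).
Let mer : measurable_fun [set: 'rV[R]_n.+1] er.
Proof.
apply: measurable_funM; first exact: measurable_powR_comp.
apply: measurableT_comp; first exact: measurable_errg.
by apply: measurable_funM => //; apply: measurableT_comp => //; exact: normr_measurable.
Qed.
Let er0 y : 0 <= er y. Proof. by apply: mulr_ge0; [exact: powR_ge0|exact: errg_ge0]. Qed.

Let mkern : measurable_fun [set: R] (fun y : R => ((y - d) ^+ 2 + e) `^ (- (1 + t))).
Proof. exact: measurable_kern. Qed.
Let q0 : 0 < 1 + t. Proof. by move: t0; lra. Qed.

Lemma barrier_left : (\int[mu n.+1]_y (gl (tau y) * k y)%:E = (A0)%:E *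
  ((barrier t d * d `^ (- 1 - 2 * t))%:E * Qint t (e / d ^+ 2) 0
   + (t * d `^ (4^-1 - 1 - 2 * t))%:E * Qint t (e / d ^+ 2) 4^-1))%E.
Proof.
rewrite /k /p (slab_tau x d v1 mgl gl0 e0 q0) -/p -/A0.
have mK : measurable_fun [set: R] (fun y => (gl y * ((y - d) ^+ 2 + e) `^ (- (1 + t)))%:E).
  by apply: measurable_EFin_comp; exact: measurable_funM.
have K0 y : (0 <= (gl y * ((y - d) ^+ 2 + e) `^ (- (1 + t)))%:E)%E.
  by rewrite lee_fin mulr_ge0 ?powR_ge0.
rewrite (integral_R_split mK K0) [X in (_ + X)%E](_ : _ = 0%E) ?adde0; last first.
  apply: integral0_eq => y; rewrite posE => y0.
  by rewrite /gl oppr_gt0 ltNge (ltW y0)/= mul0r.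
have m1 b : measurable_fun pos (fun y => (y `^ b * ((y - d) ^+ 2 + e) `^ (- (1 + t)))%:E).
  by apply: measurable_EFin_comp; apply: measurable_funTS; apply: measurable_funM => //; exact: measurable_powR.
have p1 b y : pos y -> (0 <= (y `^ b * ((y - d) ^+ 2 + e) `^ (- (1 + t)))%:E)%E.
  by move=> _; rewrite lee_fin mulr_ge0 ?powR_ge0.
have mp : measurable pos by exact: measurable_itv.
have b0 : (0 <= (barrier t d)%:E)%E by rewrite lee_fin.
have tt0 : (0 <= t%:E)%E by rewrite lee_fin ltW.
rewrite (EFinM (barrier t d)) (EFinM t) -!(muleA _ _ (Qint _ _ _)).
rewrite (_ : - 1 - 2 * t = 0 - 1 - 2 * t); last by ring.
rewrite -!(integral_pow_kern _ _ d0 e0).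
rewrite -(ge0_integralZl leb mp (m1 0) (p1 0) b0) -(ge0_integralZl leb mp (m1 4^-1) (p1 4^-1) tt0).
have c0 b c : (0 <= c%:E)%E -> forall y, pos y -> (0 <= c%:E * (y `^ b * ((y - d) ^+ 2 + e) `^ (- (1 + t)))%:E)%E.
  by move=> cc y yp; apply: mule_ge0 => //; exact: p1.
have mc b c : measurable_fun pos (fun y => (c%:E * (y `^ b * ((y - d) ^+ 2 + e) `^ (- (1 + t)))%:E)%E).
  by apply: measurable_funeM; exact: m1.
rewrite -(ge0_integralD leb mp (c0 _ _ b0) (mc _ _) (c0 _ _ tt0) (mc _ _)).
apply: (congr1 (mule _)); apply: eq_integral => y; rewrite inE posE => y0.
by rewrite /gl y0 powRr0 mul1r mulrDl EFinD !EFinM muleA.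
Qed.

Lemma barrier_right : (\int[mu n.+1]_y (gr (tau y) * k y)%:E <= (A0)%:E *
  ((d `^ (t - 1 - 2 * t))%:E * Qint t (e / d ^+ 2) t + (t * 86)%:E))%E.
Proof.
rewrite /k /p (slab_tau x d v1 mgr gr0 e0 q0) -/p -/A0.
have A0p : 0 < A0 by apply: Acst_gt0; rewrite /p ltrDl.
apply: lee_wpmul2l; first by rewrite lee_fin ltW.
have mK : measurable_fun [set: R] (fun y => (gr y * ((y - d) ^+ 2 + e) `^ (- (1 + t)))%:E).
  by apply: measurable_EFin_comp; exact: measurable_funM.
have K0 y : (0 <= (gr y * ((y - d) ^+ 2 + e) `^ (- (1 + t)))%:E)%E.
  by rewrite lee_fin mulr_ge0 ?powR_ge0.
(* [gr] vanishes on negative arguments, and the split ignores the value at 0, which disposes of the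
   term for [tau = 0]. *)
rewrite (integral_R_split mK K0) [X in (_ + X)%E](_ : _ = 0%E) ?adde0; last first.
  apply: integral0_eq => y; rewrite posE => y0.
  rewrite /gr oppr_gt0 [1 < _]ltNge oppr_eq0 (gt_eqF y0) ltNge (ltW y0)/=.
  have -> : - y <= 1 by lra.
  by rewrite mulr0 !addr0 mul0r.
have m1 : measurable_fun pos (fun y => (y `^ t * ((y - d) ^+ 2 + e) `^ (- (1 + t)))%:E).
  by apply: measurable_EFin_comp; apply: measurable_funTS; apply: measurable_funM => //; exact: measurable_powR.
have p1 y : pos y -> (0 <= (y `^ t * ((y - d) ^+ 2 + e) `^ (- (1 + t)))%:E)%E.
  by move=> _; rewrite lee_fin mulr_ge0 ?powR_ge0.
pose fa (y : R) := (if (1 < y)%R then y `^ 4^-1 else 0) * ((y - d) ^+ 2 + e) `^ (- (1 + t)).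
have m2 : measurable_fun pos (fun y => (fa y)%:E).
  apply: measurable_EFin_comp; apply: measurable_funTS; apply: measurable_funM => //.
  by apply: measurable_fun_ifT => //; exact: measurable_fun_ltr.
have fa0 y : 0 <= fa y by apply: mulr_ge0; [case: ifP => // _; exact: powR_ge0|exact: powR_ge0].
have p2 y : pos y -> (0 <= (fa y)%:E)%E by rewrite lee_fin.
have mp : measurable pos by exact: measurable_itv.
have tt0 : (0 <= t%:E)%E by rewrite lee_fin ltW.
have d02 : 0 <= d <= 2^-1 by move: d01; lra.
apply: (@le_trans _ _ (\int[leb]_(y in pos) (y `^ t * ((y - d) ^+ 2 + e) `^ (- (1 + t)))%:E +
    t%:E * \int[leb]_(y in pos) (fa y)%:E)%E); last first.
  rewrite (integral_pow_kern t t d0 e0); apply: leeD => //.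
  by rewrite EFinM; apply: lee_wpmul2l => //; exact: (err_far t01 d02 e0).
rewrite -(ge0_integralZl leb mp m2 p2 tt0).
have p3 y : pos y -> (0 <= t%:E * (fa y)%:E)%E by move=> yp; apply: mule_ge0 => //; exact: p2.
have m3 : measurable_fun pos (fun y => t%:E * (fa y)%:E)%E by exact: measurable_funeM.
rewrite -(ge0_integralD leb mp p1 m1 p3 m3).
rewrite le_eqVlt; apply/orP; left; apply/eqP; apply: eq_integral => y; rewrite inE posE => y0.
by rewrite -EFinM -EFinD /gr y0 gt_eqF// addr0 mulrDl mulrA.
Qed.

(** Replacing [X^(3/4)] by [(X + e)^(3/4)] merges it with the kernel and lowers the exponent by
    [3/4]. *)
Lemma barrier_err : (\int[mu n.+1]_y (er y * k y)%:E <= (A1 * (384 * d `^ (2^-1 - 2 * t)))%:E)%E.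
Proof.
pose g (y : R) := errg (`|y| / d).
have mg : measurable_fun [set: R] g.
  apply: measurableT_comp; first exact: measurable_errg.
  by apply: measurable_funM => //; exact: normr_measurable.
have g0 y : 0 <= g y by exact: errg_ge0.
have q1 : 0 < 4^-1 + t by move: t0; lra.
have A1p : 0 < A1 by apply: Acst_gt0; rewrite ltrDl.
apply: (@le_trans _ _ (\int[mu n.+1]_y (g (tau y) * (sqn (y - x) + e) `^ (- (n%:R / 2 + (4^-1 + t))))%:E)%E).
  apply: ge0_le_integral => //.
  - by move=> y _; rewrite lee_fin mulr_ge0.
  - by apply: measurable_EFin_comp; exact: measurable_funM.
  - apply: measurable_EFin_comp; apply: measurable_funM; first exact: (measurableT_comp mg).
    by apply: measurable_powR_comp; exact: measurable_funD.
  move=> y _; rewrite lee_fin /er mulrAC mulrC; apply: ler_wpM2l; first exact: errg_ge0.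
  have X0 := sqn_ge0 (y - x); have Xe : 0 < sqn (y - x) + e by pos.
  rewrite (_ : - (n%:R / 2 + (4^-1 + t)) = 3 / 4 + - p); last by rewrite /p; field.
  rewrite powRDp//; apply: ler_wpM2r => //.
  by apply: ge0_ler_powR; rewrite ?nnegrE ?divr_ge0 ?(ltW Xe)// lerDl ltW.
rewrite (slab_tau x d v1 mg g0 e0 q1) -/A1 (EFinM A1); apply: lee_wpmul2l; first by rewrite lee_fin ltW.
exact: (integral_err_kern t01 d0 e0).
Qed.

Lemma barrier_ineq :
  (\int[mu n.+1]_y (w y * k y)%:E + \int[mu n.+1]_y (gl (tau y) * k y)%:E <=
   \int[mu n.+1]_y (bO y * k y)%:E + \int[mu n.+1]_y (gr (tau y) * k y)%:E +
   (t * C)%:E * \int[mu n.+1]_y (er y * k y)%:E)%E.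
Proof.
have mm (f : 'rV[R]_n.+1 -> R) : measurable_fun [set: 'rV[R]_n.+1] f -> measurable_fun [set: 'rV[R]_n.+1] (fun y : 'rV[R]_n.+1 => (f y * k y)%:E).
  by move=> mf; apply: measurable_EFin_comp; exact: measurable_funM.
have pp (f : 'rV[R]_n.+1 -> R) : (forall y, 0 <= f y) -> forall y : 'rV[R]_n.+1, setT y -> (0 <= (f y * k y)%:E)%E.
  by move=> f0 y _; rewrite lee_fin mulr_ge0.
have mglt : measurable_fun [set: 'rV[R]_n.+1] (fun y => gl (tau y)) by exact: (measurableT_comp mgl).
have mgrt : measurable_fun [set: 'rV[R]_n.+1] (fun y => gr (tau y)) by exact: (measurableT_comp mgr).
have tC : (0 <= (t * C)%:E)%E by rewrite lee_fin mulr_ge0// ltW.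
rewrite -(ge0_integralZl (mu n.+1) measurableT (mm _ mer) (pp _ er0) tC).
have tp y : setT y -> (0 <= (t * C)%:E * (er y * k y)%:E)%E.
  by move=> yT; apply: mule_ge0 => //; exact: (pp _ er0).
have tm : measurable_fun [set: 'rV[R]_n.+1] (fun y : 'rV[R]_n.+1 => (t * C)%:E * (er y * k y)%:E)%E.
  by apply: measurable_funeM; exact: mm.
rewrite -(ge0_integralD (mu n.+1) measurableT (pp _ w0) (mm _ mw) (pp _ (fun y => gl0 (tau y))) (mm _ mglt)).
rewrite -(ge0_integralD (mu n.+1) measurableT (pp _ bO0) (mm _ mbO) (pp _ (fun y => gr0 (tau y))) (mm _ mgrt)).
rewrite -(ge0_integralD (mu n.+1) measurableT _ _ tp tm); last 2 first.
- by move=> y yT; apply: adde_ge0; [exact: (pp _ bO0)|exact: (pp _ (fun y => gr0 (tau y)))].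
- by apply: emeasurable_funD; exact: mm.
apply: ge0_le_integral => //.
- by move=> y yT; apply: adde_ge0; [exact: (pp _ w0)|exact: (pp _ (fun y => gl0 (tau y)))].
- by apply: emeasurable_funD; exact: mm.
- by apply: emeasurable_funD => //; apply: emeasurable_funD; exact: mm.
move=> y _; rewrite -EFinM -!EFinD lee_fin -mulrDl [t * C * _]mulrA -!mulrDl; apply: ler_wpM2r => //.
apply: le_trans (pointwise y) _; rewrite /bO /gr /er.
move: (if y \in Omega then _ else _) (if 0 < tau y then _ else _) (if 1 < tau y then _ else _)
  (if tau y == 0 then _ else _) (_ * errg _) => a1 a2 a3 a4 a5.
by rewrite le_eqVlt; apply/orP; left; apply/eqP; ring.
Qed.

(** Cancels real numbers although [a] and [b] may be infinite. *)
Lemma ereal_absorb (a b : \bar R) (r1 r2 c : R) :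
  (a + r1%:E <= b + r2%:E)%E -> r2 + c <= r1 -> (a + c%:E <= b)%E.
Proof.
case: a b => [a| |] [b| |]//=; rewrite ?leNye ?leey// -?EFinD ?lee_fin; lra.
Qed.

(* The right-hand side is affine in [Qint t e 0], with the same slope on both sides
   of [barrier_ineq]; only the differences [gam t] and [c0] survive. *)
Lemma barrier_super (c0 : R) : (forall t e, 0 < t <= 16^-1 -> 0 < e <= 1 ->
    (Qint t e 0 + c0%:E <= Qint t e 4^-1)%E) ->
  C * (A1 * (384 * d `^ (2^-1 - 2 * t))) + 86 * A0 +
    A0 * d `^ (- 1 - t) * (240 * (e / d ^+ 2) `^ 8^-1) / t <= A0 * c0 * d `^ (- (3 / 4) - 2 * t) ->
  (\int[mu n.+1]_y (w y * k y)%:E + (A0 * gam t * d `^ (- 1 - 2 * t) * barrier t d)%:E <=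
   \int[mu n.+1]_y (bO y * k y)%:E)%E.
Proof.
move=> hc0 hsmall.
have A0p : 0 < A0 by apply: Acst_gt0; rewrite /p ltrDl.
have e'01 : 0 < e / d ^+ 2 <= 1.
  by rewrite divr_gt0 ?exprn_gt0//= ler_pdivrMr ?exprn_gt0// mul1r.
have t8 : 0 < t < 8^-1 by move: t01; lra.
have /andP[g0 _] := gam_le t8.
have Q0fin : Qint t (e / d ^+ 2) 0 \is a fin_num.
  rewrite ge0_fin_numE ?Qint_fin//; apply: integral_ge0 => y _.
  by rewrite lee_fin mulr_ge0 ?powR_ge0.
have := hc0 t _ t01 e'01; have := Qint_t t01 e'01.
have := barrier_ineq; rewrite barrier_left.
have := barrier_err; have := barrier_right.
move: (\int[mu n.+1]_y (gr (tau y) * k y)%:E)%E (\int[mu n.+1]_y (er y * k y)%:E)%E => I1 I2 hI1 hI2.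
rewrite -(fineK Q0fin); set q := fine _.
move: (Qint t (e / d ^+ 2) t) (Qint t (e / d ^+ 2) 4^-1) hI1 => Qt Q4 hI1 hI hQt hQ4.
have tC : (0 <= (t * C)%:E)%E by rewrite lee_fin mulr_ge0// ltW.
have A0E : (0 <= A0%:E)%E by rewrite lee_fin ltW.
(* [r2] bounds the half-space and error integrals on the right of [barrier_ineq] from above, and
   [r1] bounds the one on the left from below. *)
pose r2 := A0 * (d `^ (t - 1 - 2 * t) * (q + 240 * (e / d ^+ 2) `^ 8^-1 - gam t) + t * 86) +
  t * C * (A1 * (384 * d `^ (2^-1 - 2 * t))).
pose r1 := A0 * (barrier t d * d `^ (- 1 - 2 * t) * q + t * d `^ (4^-1 - 1 - 2 * t) * (q + c0)).
apply: (@ereal_absorb _ _ r1 r2).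
  apply: le_trans (le_trans hI _) => {hI}.
    apply: leeD => //; rewrite /r1 EFinM; apply: lee_wpmul2l => //.
    rewrite EFinD (EFinM (t * _)) (EFinM (barrier t d * _)); apply: leeD => //; apply: lee_wpmul2l => //.
    by rewrite lee_fin mulr_ge0 ?powR_ge0// ltW.
  rewrite -addeA; apply: leeD => //; rewrite /r2 EFinD; apply: leeD.
    apply: le_trans hI1 _; rewrite (EFinM A0) EFinD; apply: lee_wpmul2l => //.
    apply: leeD => //; rewrite EFinM; apply: lee_wpmul2l; first by rewrite lee_fin powR_ge0.
    by rewrite EFinB leeBrDr// EFinD.
  by rewrite (EFinM (t * C)); apply: lee_wpmul2l.
rewrite /r1 /r2.
have E1 : d `^ (t - 1 - 2 * t) = d `^ (- 1 - 2 * t) * d `^ t by rewrite -powRDp//; congr powR; ring.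
have E2 : d `^ (4^-1 - 1 - 2 * t) = d `^ (- 1 - 2 * t) * d `^ 4^-1 by rewrite -powRDp//; congr powR; ring.
have E3 : d `^ (- (3 / 4) - 2 * t) = d `^ (- 1 - 2 * t) * d `^ 4^-1 by rewrite -powRDp//; congr powR; field.
have E4 : d `^ (- 1 - t) = d `^ (- 1 - 2 * t) * d `^ t by rewrite -powRDp//; congr powR; ring.
rewrite E3 E4 in hsmall; rewrite E1 E2 /barrier.
have hs := ler_wpM2l (ltW t0) hsmall.
set D := d `^ (- 1 - 2 * t) in hs *; set dt := d `^ t in hs *; set d4 := d `^ 4^-1 in hs *.
set ee := (e / d ^+ 2) `^ 8^-1 in hs *; set d2 := d `^ _ in hs *.
(* The comparison yields [gam t] times [d^t], while the claim asks only for
   [barrier t d = d^t - t d^(1/4)]; this is the surplus. *)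
have gg : 0 <= A0 * gam t * D * (t * d4).
  by repeat (apply: mulr_ge0 => //); rewrite ?powR_ge0 ?(ltW A0p) ?(ltW t0).
have : t * (A0 * (D * dt) * (240 * ee) / t) = A0 * (D * dt) * (240 * ee) by field; rewrite gt_eqF.
move: (A0 * (D * dt) * (240 * ee) / t) hs => Z hs hZ.
rewrite mulrDr hZ in hs.
lra.
Qed.

End barrier_integral.

(** * The distance to the boundary *)

Section topology.
Context {R : realType}.

Lemma nbhs_enorm n (A : set 'rV[R]_n) (x : 'rV[R]_n) :
  nbhs x A <-> exists2 r : R, 0 < r & forall y, enorm (y - x) < r -> A y.
Proof.
split=> [/nbhs_ballP[e /= e0 h]|[r r0 h]].
  exists e => // y xy; apply: h; rewrite -ball_normE /=.
  by apply: le_lt_trans (normrV_le_enorm _) _; rewrite enormB.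
apply/nbhs_ballP; exists (r / n.+1%:R) => /=; first by rewrite divr_gt0.
move=> y; rewrite -ball_normE /= => xy; apply: h; rewrite enormB.
apply: le_lt_trans (enorm_le_normrV _) _.
rewrite ltr_pdivlMr// mulrC in xy; apply: le_lt_trans xy.
by rewrite ler_wpM2r// ler_nat.
Qed.

Lemma open_enorm n (A : set 'rV[R]_n) :
  open A <-> forall x, A x -> exists2 r : R, 0 < r & forall y, enorm (y - x) < r -> A y.
Proof.
rewrite openE; split=> h x Ax; first by apply/nbhs_enorm; exact: h.
by rewrite /interior/=; apply/nbhs_enorm; exact: h.
Qed.

Lemma closure_enorm n (A : set 'rV[R]_n) (x : 'rV[R]_n) :
  closure A x <-> forall r : R, 0 < r -> exists2 y, A y & enorm (y - x) < r.
Proof.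
split=> [h r r0|h B /nbhs_enorm[r r0 hB]].
  have [|y [Ay yr]] := h [set y | enorm (y - x) < r]; last by exists y.
  by apply/nbhs_enorm; exists r.
by have [y Ay yr] := h r r0; exists y; split => //; exact: hB.
Qed.

(** The sigma-algebra is generated by coordinates, so an open set is exhibited as the countable
    union of the boxes with rational centre and side [2/(k+1)] that it contains. *)
Lemma open_measurable_rV n (A : set 'rV[R]_n) : open A -> measurable A.
Proof.
move=> /open_enorm oA.
pose B (q : {ffun 'I_n -> rat} * nat) : set 'rV[R]_n :=
  [set x | forall i, `|x ord0 i - ratr (q.1 i)| < q.2.+1%:R^-1].
have mB q : measurable (B q).
  rewrite (_ : B q = \bigcap_(i in [set` 'I_n]) [set x | `|x ord0 i - ratr (q.1 i)| < q.2.+1%:R^-1]); last first.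
    by apply/seteqP; split => x h i; [move=> _|]; exact: h.
  apply: fin_bigcap_measurable => // i _.
  have m : measurable_fun [set: 'rV[R]_n] (fun x : 'rV[R]_n => `|x ord0 i - ratr (q.1 i)|).
    apply: measurableT_comp => //; apply: measurable_funB => //; exact: measurable_coord.
  have := m measurableT _ (measurable_itv `]-oo, q.2.+1%:R^-1[).
  by rewrite setTI; congr measurable; apply/seteqP; split => x; rewrite /= in_itv.
rewrite (_ : A = \bigcup_(q in [set q | B q `<=` A]) B q); last first.
  apply/seteqP; split => [x Ax|x [q qA]]; last exact: qA.
  have [r r0 hr] := oA x Ax.
  have n1 : 0 < (n.+1%:R : R) by [].
  have [k hk] : exists k : nat, n.+1%:R * (2 * k.+1%:R^-1) < r.
    exists (Num.truncn (2 * n.+1%:R / r)).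
    have h := truncnS_gt (2 * n.+1%:R / r).
    rewrite ltr_pdivrMr// in h; rewrite mulrA ltr_pdivrMr// mulrC.
    by rewrite (mulrC r).
  have [q hq] : exists q : {ffun 'I_n -> rat}, forall i, `|x ord0 i - ratr (q i)| < k.+1%:R^-1.
    have h i : exists q : rat, `|x ord0 i - ratr q| < k.+1%:R^-1.
      have xk : x ord0 i - k.+1%:R^-1 < x ord0 i + k.+1%:R^-1.
        by rewrite ltrD2l gtrN// invr_gt0.
      have [q] := rat_in_itvoo xk; rewrite in_itv/= => /andP[h1 h2]; exists q.
      by rewrite distrC ltr_distl h1 h2.
    by exists [ffun i => projT1 (cid (h i))] => i; rewrite ffunE; case: cid.
  exists (q, k) => //= y hy; apply: hr; apply: le_lt_trans (enorm_le_normrV _) _.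
  apply: le_lt_trans hk; apply: ler_pM => //; first by rewrite ler_nat.
  apply/normrV_leP => [|i]; first by rewrite mulr_ge0.
  rewrite !mxE (_ : _ - _ = (y ord0 i - ratr (q i)) - (x ord0 i - ratr (q i))); last by ring.
  apply: le_trans (ler_normB _ _) _; rewrite mulr_natl mulr2n.
  by apply: lerD; apply: ltW; [exact: hy|exact: hq].
rewrite bigcup_mkcond; apply: countable_bigcupT_measurable => [|q]; first exact: countableP.
by case: ifP.
Qed.

Lemma lipschitz_measurable n (f : 'rV[R]_n -> R) (L : R) : 0 <= L ->
  (forall x y, `|f x - f y| <= L * enorm (x - y)) -> measurable_fun [set: 'rV[R]_n] f.
Proof.
move=> L0 hf; apply: (measurability _ (RGenOInfty.measurableE R)).
move=> /= _ [_ [a ->]] <-; rewrite setTI; apply: open_measurable_rV.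
apply/open_enorm => x; rewrite /= in_itv/= andbT => ax.
have L1 : 0 < L + 1 by rewrite ltr_wpDl.
exists ((f x - a) / (L + 1)); first by rewrite divr_gt0// subr_gt0.
move=> y; rewrite ltr_pdivlMr// => hy; rewrite /= in_itv/= andbT.
have := hf y x; have := ler_norm (f x - f y); rewrite distrC.
have := enorm_ge0 (y - x).
by move: hy; move: (enorm _) `|_| => e b; lra.
Qed.

Lemma lipschitz_continuous n (f : 'rV[R]_n -> R) (L : R) : 0 <= L ->
  (forall x y, `|f x - f y| <= L * enorm (x - y)) -> continuous f.
Proof.
move=> L0 hf x B /nbhs_ballP[e /= e0 hB]; apply/nbhs_enorm.
have L1 : 0 < L + 1 by rewrite ltr_wpDl.
exists (e / (L + 1)); first by rewrite divr_gt0.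
move=> y; rewrite ltr_pdivlMr// => hy; apply: hB; rewrite /ball/= enormB in hy *.
apply: le_lt_trans (hf x y) _; apply: le_lt_trans hy; rewrite mulrC.
by apply: ler_wpM2l; rewrite ?enorm_ge0// lerDl.
Qed.

Section boundary.
Variables (N : nat) (Omega : set 'rV[R]_N).
Hypothesis oO : open Omega.
Let iO : interior Omega = Omega. Proof. exact/interior_id. Qed.

Lemma boundary_not_in b : boundary Omega b -> ~ Omega b.
Proof. by move=> [_ h] Ob; apply: h; rewrite iO. Qed.

Lemma closed_boundary : closed (boundary Omega).
Proof.
rewrite /boundary setDE; apply: closedI; first exact: closed_closure.
by apply: open_closedC; exact: open_interior.
Qed.

(** [b] is the point of the segment at the least parameter outside the domain: it is outside because
    the domain is open, and it is a limit of earlier points, which are inside. *)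
Lemma segment_boundary x y : Omega x -> ~ Omega y ->
  exists2 b, boundary Omega b & enorm (x - b) <= enorm (x - y).
Proof.
move=> Ox Oy; have /open_enorm h := oO.
pose p (s : R) := x + s *: (y - x).
pose T := [set s : R | 0 <= s /\ ~ Omega (p s)].
have pp s s' : enorm (p s - p s') = `|s - s'| * enorm (y - x).
  by rewrite /p opprD addrACA subrr add0r -scalerBl enormZ.
have T1 : T 1 by split => //; rewrite /p scale1r addrCA subrr addr0.
have lT : has_lbound T by exists 0 => s [].
have iT : has_inf T by split => //; exists 1.
pose s0 := inf T.
have s01 : s0 <= 1 by exact: ge_inf.
have s00 : 0 <= s0 by apply: lb_le_inf; [exists 1|move=> s []].
have Os0 : ~ Omega (p s0).
  move=> /h[r r0 hr].
  have e1 : 0 < enorm (y - x) + 1 by rewrite ltr_wpDl ?enorm_ge0.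
  have dr : 0 < r / (enorm (y - x) + 1) by rewrite divr_gt0.
  have [s Ts ss] := inf_adherent dr iT.
  apply: Ts.2; apply: hr; rewrite pp.
  have s0s : s0 <= s by exact: ge_inf.
  rewrite ger0_norm ?subr_ge0//.
  rewrite -ltrBlDl -/s0 ltr_pdivlMr// in ss; apply: le_lt_trans ss.
  by rewrite ler_wpM2l ?subr_ge0// lerDl.
exists (p s0); last first.
  rewrite /p opprD addrA subrr add0r enormN enormZ ger0_norm// enormB.
  by rewrite ler_piMl ?enorm_ge0.
split; last by rewrite iO.
apply/closure_enorm => r r0.
have s0p : 0 < s0.
  by rewrite lt_def s00 andbT; apply/eqP => s0E; apply: Os0; rewrite s0E /p scale0r addr0.
have e1 : 0 < enorm (y - x) + 1 by rewrite ltr_wpDl ?enorm_ge0.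
pose e := Num.min s0 (r / (enorm (y - x) + 1)) / 2.
have e0 : 0 < e by rewrite divr_gt0// lt_min s0p divr_gt0.
have es0 : e < s0 by rewrite ltr_pdivrMr// gt_min; apply/orP; left; lra.
exists (p (s0 - e)).
  apply: contrapT => Op; have : T (s0 - e) by split => //; rewrite subr_ge0 ltW.
  by move=> /(ge_inf lT); rewrite -/s0 lerBrDr gerDl leNgt e0.
rewrite pp (_ : s0 - e - s0 = - e); last by ring.
rewrite normrN gtr0_norm//.
have : e < r / (enorm (y - x) + 1).
  have : 0 < r / (enorm (y - x) + 1) by rewrite divr_gt0.
  by rewrite /e ltr_pdivrMr// gt_min => ?; apply/orP; right; lra.
rewrite ltr_pdivlMr// => hh; apply: le_lt_trans hh; apply: ler_wpM2l; first exact: ltW.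
by rewrite lerDl.
Qed.

Hypothesis b0 : boundary Omega !=set0.

Let lbd x : has_lbound [set enorm (x - y) | y in boundary Omega].
Proof. by exists 0 => _ [y _ <-]; exact: enorm_ge0. Qed.

Lemma bdist_ge0 x : 0 <= bdist Omega x.
Proof.
apply: lb_le_inf; first by case: b0 => b bb; exists (enorm (x - b)); exists b.
by move=> _ [y _ <-]; exact: enorm_ge0.
Qed.

Lemma bdist_le x b : boundary Omega b -> bdist Omega x <= enorm (x - b).
Proof. by move=> bb; apply: ge_inf => //; exists b. Qed.

Lemma bdist_le_out x y : Omega x -> ~ Omega y -> bdist Omega x <= enorm (x - y).
Proof.
by move=> Ox Oy; have [b bb h] := segment_boundary Ox Oy; apply: le_trans h; exact: bdist_le.
Qed.

Lemma bdist_ball x y : Omega x -> enorm (y - x) < bdist Omega x -> Omega y.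
Proof.
move=> Ox xy; apply: contrapT => Oy; have := bdist_le_out Ox Oy.
by rewrite enormB leNgt xy.
Qed.

Lemma bdist_lipschitz x y : `|bdist Omega x - bdist Omega y| <= 1 * enorm (x - y).
Proof.
have key u v : bdist Omega u <= bdist Omega v + enorm (u - v).
  rewrite -lerBlDr; apply: lb_le_inf; first by case: b0 => b bb; exists (enorm (v - b)); exists b.
  move=> _ [b bb <-]; rewrite lerBlDr addrC; apply: le_trans (bdist_le u bb) _.
  exact: enorm_trans.
rewrite mul1r ler_norml; have := key x y; have := key y x; rewrite (enormB y x).
by move: (bdist Omega x) (bdist Omega y) (enorm _) => a b c; lra.
Qed.

Lemma bdist_gt0 x : Omega x -> 0 < bdist Omega x.
Proof.
move=> Ox; have /open_enorm/(_ x Ox)[r r0 hr] := oO.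
apply: lt_le_trans r0 _; apply: lb_le_inf; first by case: b0 => b bb; exists (enorm (x - b)); exists b.
move=> _ [b bb <-]; rewrite leNgt; apply/negP => xb; apply: (boundary_not_in bb).
by apply: hr; rewrite enormB.
Qed.

Hypothesis bO : bounded_set Omega.

Lemma bounded_enorm : exists2 M : R, 0 < M & forall x, Omega x -> enorm x <= M.
Proof.
have [M [_ hM]] := bO; exists (N%:R * (`|M| + 1) + 1).
  by rewrite ltr_wpDl// mulr_ge0// addr_ge0.
move=> x Ox; apply: le_trans (enorm_le_normrV _) _.
rewrite ler_wpDr// ler_wpM2l//; apply: (hM (`|M| + 1)) => //.
by rewrite (le_lt_trans (ler_norm M))// ltrDl.
Qed.

Lemma compact_boundary : compact (boundary Omega).
Proof.
apply: bounded_closed_compact; last exact: closed_boundary.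
have [M M0 hM] := bounded_enorm; exists (M + 1); split; first exact: num_real.
move=> z Mz x [/closure_enorm/(_ 1 ltr01)[y Oy yx] _].
apply: le_trans (normrV_le_enorm _) _; apply: le_trans (ltW Mz).
rewrite -[x](subrK y); apply: le_trans (enormD _ _) _; rewrite addrC; apply: lerD; first exact: hM.
by rewrite enormB ltW.
Qed.

Lemma bdist_attained x : exists2 b, boundary Omega b & bdist Omega x = enorm (x - b).
Proof.
have cf : {within boundary Omega, continuous (fun b => enorm (x - b))}.
  apply: continuous_subspaceT; apply: (@lipschitz_continuous _ _ 1) => // y z.
  have := enorm_trans z x y; have := enorm_trans y x z; have := enormB y z.
  by rewrite mul1r ler_norml; lra.
have [b + hb] := compact_EVT_min b0 compact_boundary cf.
rewrite inE => bb; exists b => //; apply/eqP; rewrite eq_le bdist_le//=.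
apply: lb_le_inf; first by case: b0 => c cc; exists (enorm (x - c)); exists c.
by move=> _ [c cc <-]; apply: hb; rewrite inE.
Qed.

End boundary.

(** A segment from a point of the domain to a point beyond its bound meets the boundary. *)
Lemma boundary_nonempty n (Omega : set 'rV[R]_n.+1) : open Omega -> bounded_set Omega ->
  Omega !=set0 -> boundary Omega !=set0.
Proof.
move=> oO bO [x Ox]; have [M M0 hM] := bounded_enorm bO.
suff h : ~ Omega ((M + 1) *: e0 n) by have [b bb _] := segment_boundary oO Ox h; exists b.
move=> /hM; rewrite enormZ ger0_norm ?addr_ge0 ?(ltW M0)//.
rewrite enormE /sqn dotv_e0 mxE !eqxx sqrtr1 mulr1; lra.
Qed.

End topology.

(** * Boundary charts and the uniform ball condition *)

Section charts.
Context {R : realType}.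

Definition grad n (g : 'rV[R]_n -> R) (a : 'rV[R]_n) : 'rV[R]_n := \row_i partial i g a.

Lemma derive_grad n (g : 'rV[R]_n -> R) (a v : 'rV[R]_n) : differentiable g a ->
  'D_v g a = dotv v (grad g a).
Proof.
move=> dg; rewrite deriveE//.
have {1}-> : v = \sum_i v ord0 i *: delta_mx ord0 i by exact: row_sum_delta.
rewrite linear_sum; apply: eq_bigr => i _; rewrite linearZ/= mxE /partial deriveE//.
Qed.

Lemma is_derive_line n (g : 'rV[R]_n -> R) (a v : 'rV[R]_n) (s : R) :
  differentiable g (a + s *: v) ->
  is_derive s 1 (fun s : R => g (a + s *: v)) (dotv v (grad g (a + s *: v))).
Proof.
move=> dg; have E : (fun h : R => h^-1 *: (g (a + (h *: 1 + s) *: v) - g (a + s *: v))) =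
    (fun h : R => h^-1 *: (g (h *: v + (a + s *: v)) - g (a + s *: v))).
  apply/funext => h; congr (_ *: (g _ - _)).
  by rewrite scalerDl addrCA [h *: 1]mulr1.
have dv := @diff_derivable _ _ _ g (a + s *: v) v dg.
apply: DeriveDef; first by rewrite /derivable /= E.
by rewrite /derive /= E -derive_grad.
Qed.

(** Mean value theorem along the segment, then the Lipschitz bounds of the partial derivatives, with
    a common constant [M]; summing over coordinates costs the factor [n]. *)
Lemma C11_taylor n (g : 'rV[R]_n -> R) : C11_fun g ->
  exists2 L : R, 0 <= L & forall a b : 'rV[R]_n,
    `|g b - g a - dotv (b - a) (grad g a)| <= L * sqn (b - a) /\
    enorm (grad g a - grad g b) <= L * enorm (a - b).
Proof.
move=> [dg lg].
have [M M0 hM] : exists2 M : R, 0 <= M & forall i a b, `|partial i g a - partial i g b| <= M * enorm (a - b).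
  have h i : exists2 M : R, 0 <= M & forall a b, `|partial i g a - partial i g b| <= M * enorm (a - b).
    have [M0 [_ hM0]] := lg i; exists (`|M0| + 1); first by rewrite addr_ge0.
    have M01 : M0 < `|M0| + 1 by rewrite (le_lt_trans (ler_norm M0))// ltrDl.
    move=> a b; have /= h := hM0 _ M01 (a, b) (conj I I); apply: le_trans h _.
    by rewrite ler_wpM2l ?addr_ge0// normrV_le_enorm.
  exists (\sum_i projT1 (cid2 (h i))); first by apply: sumr_ge0 => i _; case: cid2.
  move=> i a b; have hi := (projT2 (cid2 (h i))).2 a b; apply: le_trans hi _.
  rewrite ler_wpM2r ?enorm_ge0// (bigD1 i)//= lerDl sumr_ge0// => j _; by case: cid2.
exists (n%:R * M); first by rewrite mulr_ge0.
have gE z i : grad g z ord0 i = partial i g z by rewrite mxE.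
move=> a b; split; last first.
  apply: le_trans (enorm_le_normrV _) _; rewrite -mulrA; apply: ler_wpM2l => //.
  apply/normrV_leP => [|i]; first by rewrite mulr_ge0 ?enorm_ge0.
  by rewrite mxE [X in `|_ + X|]mxE !gE; exact: hM.
set v := b - a; pose phi (s : R) := g (a + s *: v).
have dphi (s : R) : is_derive s 1 phi (dotv v (grad g (a + s *: v))).
  by apply: is_derive_line; exact: dg.
have cphi : {within `[0, 1], continuous phi}.
  apply: continuous_subspaceT => s; apply: differentiable_continuous.
  by apply/derivable1_diffP; exact: (@ex_derive _ _ _ _ _ _ _ (dphi s)).
have [c c01] := MVT ltr01 (fun s _ => dphi s) cphi.
rewrite subr0 mulr1 /phi scale0r addr0 scale1r /v addrCA subrr addr0 -/v => ->.
rewrite /dotv -sumrB; apply: le_trans (ler_norm_sum _ _ _) _.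
apply: (@le_trans _ _ (\sum_(i < n) M * sqn v)); last first.
  by rewrite sumr_const card_ord -[leLHS]mulr_natl mulrA.
apply: ler_sum => i _; rewrite -mulrBr normrM !gE.
have c1 : 0 <= c <= 1 by move: c01; rewrite in_itv/= => /andP[/ltW -> /ltW ->].
have vi : `|v ord0 i| <= enorm v by apply: le_trans (normrV_coord v i) (normrV_le_enorm v).
apply: (@le_trans _ _ (enorm v * (M * enorm v))); last by rewrite -enorm_sqr le_eqVlt; apply/orP; left; apply/eqP; ring.
apply: ler_pM => //; apply: le_trans (hM i _ _) _; apply: ler_wpM2l => //.
rewrite addrAC subrr add0r enormZ ger0_norm; last by case/andP: c1.
by rewrite ler_piMl ?enorm_ge0//; case/andP: c1.
Qed.

Section one_chart.
Variables (n : nat) (P : 'M[R]_(n.+1, n)) (nu : 'cV[R]_n.+1).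
Hypothesis orth : (row_mx P nu)^T *m row_mx P nu = 1%:M.

Lemma chart_orth : [/\ P^T *m P = 1%:M, nu^T *m P = 0 & nu^T *m nu = 1%:M].
Proof.
move: orth; rewrite tr_row_mx mul_col_row scalar_mx_block => /eq_block_mx[-> _ -> ->].
by [].
Qed.

Lemma sqn_mulP (z : 'rV[R]_n.+1) : sqn (z *m P) <= sqn z.
Proof.
have [PP _ _] := chart_orth.
have := sqn_ge0 (z - z *m P *m P^T).
have e1 : dotv z (z *m P *m P^T) = sqn (z *m P).
  by rewrite /sqn !dotvE !trmx_mul trmxK !mulmxA.
have e2 : sqn (z *m P *m P^T) = sqn (z *m P).
  by rewrite /sqn !dotvE !trmx_mul trmxK !mulmxA -(mulmxA _ P^T P) PP mulmx1.
rewrite {1}/sqn !dotv_lin (dotvC _ z) -!/(sqn _) e1 e2; lra.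
Qed.

Lemma enorm_mulP (z : 'rV[R]_n.+1) : enorm (z *m P) <= enorm z.
Proof. by rewrite !enormE ler_wsqrtr// sqn_mulP. Qed.

Definition height (z : 'rV[R]_n.+1) : R := (z *m nu) ord0 ord0.

Lemma heightE z : height z = dotv z nu^T.
Proof. by rewrite dotvE trmxK. Qed.

Lemma sqn_nu : sqn nu^T = 1.
Proof. by have [_ _ h] := chart_orth; rewrite /sqn dotvE trmxK h mxE eqxx. Qed.

Lemma heightB y z : height (y - z) = height y - height z.
Proof. by rewrite !heightE !dotv_lin. Qed.

Lemma height_le z : `|height z| <= enorm z.
Proof.
have h := cauchy_schwarz z nu^T; have h' := cauchy_schwarz (- z) nu^T.
have e1 : enorm nu^T = 1 by rewrite enormE sqn_nu sqrtr1.
by move: h h'; rewrite e1 enormN dotvNl -heightE !mulr1 ler_norml => h h'; lra.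
Qed.

(** With [q = grad g], the gradient of the defining function [height z - g (z *m P)]: an inner
    normal, not normalized. *)
Definition chart_normal (q : 'rV[R]_n) : 'rV[R]_n.+1 := nu^T - q *m P^T.

Lemma dotv_chart_normal z q : dotv z (chart_normal q) = height z - dotv (z *m P) q.
Proof.
rewrite /chart_normal dotvDr dotvNr -heightE; congr (_ - _).
by rewrite !dotvE trmx_mul trmxK mulmxA.
Qed.

Lemma chart_normal_ge1 q : 1 <= enorm (chart_normal q).
Proof.
have [PP nP _] := chart_orth.
rewrite -(@ler_pXn2r _ 2) ?nnegrE ?enorm_ge0// expr1n enorm_sqr.
have h1 : height (chart_normal q) = 1.
  rewrite heightE /chart_normal dotvDl dotvNl -/(sqn _) sqn_nu.
  rewrite (_ : dotv _ _ = 0) ?subr0// dotvC dotvE trmx_mul trmxK mulmxA nP mul0mx.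
  by rewrite mxE.
have := height_le (chart_normal q); rewrite h1 normr1 => h.
by rewrite -enorm_sqr -[leLHS](expr1n _ 2) ler_pXn2r ?nnegrE// enorm_ge0.
Qed.

Variables (Omega : set 'rV[R]_n.+1) (g : 'rV[R]_n -> R) (L r : R) (x0 : 'rV[R]_n.+1).
Hypotheses (oO : open Omega) (L0 : 0 <= L)
  (taylor : forall a b : 'rV[R]_n, `|g b - g a - dotv (b - a) (grad g a)| <= L * sqn (b - a))
  (chart : forall x, enorm (x - x0) < r -> (Omega x <-> g (x *m P) < height x)).

(** One inequality holds because [b] is outside the domain, the other because points of the domain,
    where [g < height], come arbitrarily close to [b]. *)
Lemma chart_boundary b : boundary Omega b -> enorm (b - x0) < r -> g (b *m P) = height b.
Proof.
move=> bb bx; apply/eqP; rewrite eq_le; apply/andP; split; last first.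
  by rewrite leNgt; apply/negP => /(chart bx); exact: boundary_not_in.
set q := enorm (grad g (b *m P)); have q0 : 0 <= q by exact: enorm_ge0.
have [/closure_enorm cb _] := bb.
apply/ler_addgt0Pr => e e0.
(* Within distance 1 of [b] the defining function varies at rate at most [q + L + 1]. *)
pose d := Num.min 1 (Num.min (r - enorm (b - x0)) (e / (q + L + 1))).
have q1 : 0 < q + L + 1 by pos.
have d0 : 0 < d by rewrite !lt_min ltr01 subr_gt0 bx divr_gt0.
have [y Oy yb] := cb d d0; move: yb; rewrite !lt_min => /and3P[y1 y2 y3].
have yx : enorm (y - x0) < r.
  by apply: le_lt_trans (enorm_trans b y x0) _; rewrite -ltrBrDr.
have /(chart yx) gy := Oy.
have hz := height_le (y - b); rewrite heightB in hz.
have zP := enorm_mulP (y - b).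
have := taylor (b *m P) (y *m P); rewrite -mulmxBl -enorm_sqr.
have := cauchy_schwarz ((y - b) *m P) (- grad g (b *m P)); rewrite dotvNr enormN -/q.
rewrite ltr_pdivlMr// in y3.
have z0 := enorm_ge0 (y - b); have zP0 := enorm_ge0 ((y - b) *m P).
move: (dotv _ _) => D; rewrite !ler_norml in hz *; move: hz zP zP0 z0 y1 y3 gy.
move: (enorm (y - b)) (enorm ((y - b) *m P)) (height y) (height b) (g (y *m P)) (g (b *m P)) => z zp hy hb gy gb.
move=> /andP[h1 h2] h3 h4 h5 h6 h7 h8 h9 /andP[h10 h11].
have h12 : zp * q <= z * q by rewrite ler_wpM2r.
have h13 : zp ^+ 2 <= z by nra.
have h14 : L * zp ^+ 2 <= L * z by rewrite ler_wpM2l.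
lra.
Qed.

(** By Taylor, the defining function at [y] is [dotv (y - b) m] up to [L |y - b|^2]. In either ball
    [|y - b|^2] is below [2 rho] times the absolute value of the normal component, so with
    [2 L rho < 1] and [enorm m >= 1] the linear part decides the sign. *)
Lemma chart_ball b rho : boundary Omega b -> enorm (b - x0) < r / 2 ->
  0 < rho -> rho <= r / 4 -> 2 * L * rho < 1 ->
  exists v : 'rV[R]_n.+1, [/\ sqn v = 1,
    forall y, sqn (y - b) < 2 * rho * dotv (y - b) v -> Omega y &
    forall y, sqn (y - b) < - (2 * rho * dotv (y - b) v) -> ~ Omega y].
Proof.
move=> bb bx rho0 rhor rhoL.
have gb : g (b *m P) = height b by apply: chart_boundary => //; lra.
pose m := chart_normal (grad g (b *m P)).
have m1 : 1 <= enorm m by exact: chart_normal_ge1.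
have m0 : 0 < enorm m by lra.
pose v := (enorm m)^-1 *: m.
have v1 : sqn v = 1.
  by rewrite -enorm_sqr enormZ gtr0_norm ?invr_gt0// mulVf ?gt_eqF// expr1n.
have ev : enorm v = 1 by rewrite enormE v1 sqrtr1.
have mv z : dotv z m = enorm m * dotv z v by rewrite /v dotvZr mulrA divff ?gt_eqF// mul1r.
have key y : sqn (y - b) < 2 * rho * `|dotv (y - b) v| ->
    (enorm (y - x0) < r) /\ L * sqn ((y - b) *m P) < `|dotv (y - b) m|.
  move=> h; have z0 := enorm_ge0 (y - b).
  have dz : `|dotv (y - b) v| <= enorm (y - b).
    have := cauchy_schwarz (y - b) v; have := cauchy_schwarz (- (y - b)) v.
    by rewrite enormN dotvNl ev !mulr1 ler_norml => ? ?; lra.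
  have zr : enorm (y - b) < 2 * rho.
    rewrite -enorm_sqr in h.
    by rewrite ltNge; apply/negP => h'; move: h; rewrite ltNge => /negP; apply; nra.
  split.
    by apply: le_lt_trans (enorm_trans b y x0) _; lra.
  have zP := sqn_mulP (y - b).
  rewrite mv normrM gtr0_norm//.
  have d0 : 0 < `|dotv (y - b) v|.
    rewrite normr_gt0; apply/eqP => dE; move: h; rewrite dE normr0 mulr0 ltNge => /negP; apply.
    exact: sqn_ge0.
  have h1 : L * sqn ((y - b) *m P) <= L * (2 * rho * `|dotv (y - b) v|).
    by apply: ler_wpM2l => //; apply: le_trans zP (ltW h).
  apply: le_lt_trans h1 _; apply: (@lt_le_trans _ _ (1 * `|dotv (y - b) v|)); last by rewrite ler_pM2r.
  by rewrite mulrA ltr_pM2r//; lra.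
have ty y : `|g (y *m P) - height y + dotv (y - b) m| <= L * sqn ((y - b) *m P).
  have := taylor (b *m P) (y *m P); rewrite -mulmxBl gb.
  rewrite dotv_chart_normal heightB.
  rewrite [X in `|X| <= _ -> _](_ : _ = g (y *m P) - height y + (height y - height b - dotv ((y - b) *m P) (grad g (b *m P)))) //.
  by ring.
exists v; split => // y h.
  have d0 : 0 < dotv (y - b) v.
    have := le_lt_trans (sqn_ge0 _) h; rewrite pmulr_rgt0//; lra.
  have [yx yk] := key y ltac:(by rewrite gtr0_norm).
  apply/(chart yx); have := ty y; rewrite ler_norml => /andP[_ hh].
  by rewrite gtr0_norm in yk; [lra|rewrite mv mulr_gt0].
have d0 : dotv (y - b) v < 0.
  have := le_lt_trans (sqn_ge0 _) h; rewrite oppr_gt0 pmulr_rlt0//; lra.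
have [yx yk] := key y ltac:(by rewrite ltr0_norm// mulrN).
move=> /(chart yx); have := ty y; rewrite ler_norml => /andP[hh _].
have dm : dotv (y - b) m < 0 by rewrite mv pmulr_rlt0.
rewrite ltr0_norm// in yk; lra.
Qed.

End one_chart.

(** Each boundary point has a neighbourhood on which every small radius works; compactness of the
    boundary selects one radius for all. *)
Lemma uniform_ball n (Omega : set 'rV[R]_n.+1) : open Omega -> bounded_set Omega ->
  boundary Omega !=set0 -> class_C11 Omega ->
  exists2 rho : R, 0 < rho & forall b, boundary Omega b ->
    exists v : 'rV[R]_n.+1, [/\ sqn v = 1,
      forall y, sqn (y - b) < 2 * rho * dotv (y - b) v -> Omega y &
      forall y, sqn (y - b) < - (2 * rho * dotv (y - b) v) -> ~ Omega y].
Proof.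
move=> oO bO b0 cO.
have /compact_near_coveringP nc := compact_boundary bO.
pose Q (rho : R) (b : 'rV[R]_n.+1) := boundary Omega b ->
    exists v : 'rV[R]_n.+1, [/\ sqn v = 1,
      forall y, sqn (y - b) < 2 * rho * dotv (y - b) v -> Omega y &
      forall y, sqn (y - b) < - (2 * rho * dotv (y - b) v) -> ~ Omega y].
have h : forall x, boundary Omega x -> \forall x' \near x & rho \near (0 : R)^'+, Q rho x'.
  move=> x bx; have [P [nu [g [r [orth Cg r0 ch]]]]] := cO x bx.
  have [L L0 ty] := C11_taylor Cg.
  exists ([set y | enorm (y - x) < r / 2], [set rho : R | 0 < rho /\ rho < Num.min (r / 4) (2 * L + 1)^-1]).
    split => /=.
      by apply/nbhs_enorm; exists (r / 2); rewrite ?divr_gt0.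
    have m0 : 0 < Num.min (r / 4) (2 * L + 1)^-1 by rewrite lt_min; apply/andP; split; pos.
    by near=> rho; split; [near: rho; exact: nbhs_right_gt|near: rho; exact: nbhs_right_lt].
  move=> [y rho] /= [yx [rho0]]; rewrite lt_min => /andP[rhor rhoL] bb.
  apply: (chart_ball orth oO L0 (fun a b => (ty a b).1) ch bb yx rho0 (ltW rhor)).
  have L1 : 0 < 2 * L + 1 by pos.
  by rewrite -(ltr_pM2r L1) mulVf ?gt_eqF// in rhoL; lra.
have := nc _ _ Q (at_right_proper_filter (0 : R)) h.
move=> /(filterI (nbhs_right_gt (0 : R))) /filter_ex[rho [rho0 hrho]].
by exists rho => // b bb; apply: hrho.
Unshelve. all: by end_near.
Qed.

End charts.

(** * Measure of boxes, bounded sets and open sets *)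

Section measure_rV.
Context {R : realType}.
Local Notation mu := (@lebesgue_rV R).

Definition box n (x : 'rV[R]_n) (r : R) : set 'rV[R]_n := [set y | forall i, `|y ord0 i - x ord0 i| < r].

Lemma measurable_box n (x : 'rV[R]_n) r : measurable (box x r).
Proof.
apply: open_measurable_rV; apply/open_enorm => y yr.
exists (\big[Num.min/1]_i (r - `|y ord0 i - x ord0 i|)).
  by elim/big_ind : _ => // [a b a0 b0|i _]; [rewrite lt_min a0|rewrite subr_gt0; exact: yr].
move=> z hz i; have h : \big[Num.min/1]_i (r - `|y ord0 i - x ord0 i|) <= r - `|y ord0 i - x ord0 i|.
  by rewrite (bigD1 i)//= ge_min lexx.
have zi : `|(z - y) ord0 i| <= enorm (z - y).
  by apply: le_trans (normrV_coord _ i) (normrV_le_enorm _).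
rewrite (_ : z ord0 i - x ord0 i = (z - y) ord0 i + (y ord0 i - x ord0 i)); last by rewrite !mxE; ring.
by apply: le_lt_trans (ler_normD _ _) _; lra.
Qed.

Lemma lebesgue_box n (x : 'rV[R]_n) (r : R) : 0 < r -> mu n (box x r) = ((2 * r) ^+ n)%:E.
Proof.
move=> r0; elim: n x => [|n IH] x.
  by rewrite /= diracE mem_set// => -[].
pose x' : 'rV[R]_n := \row_j x ord0 (lift ord0 j).
have E : @cons_rV R n @^-1` box x r = `]x ord0 ord0 - r, x ord0 ord0 + r[ `*` box x' r.
  apply/seteqP; split => [[t z] h|[t z] [/= ht hz] i].
    split => [|j] /=.
      by have := h ord0; rewrite cons_rV0 in_itv/= ltr_distl.
    by have := h (lift ord0 j); rewrite cons_rVS mxE.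
  have [j ->|->] := unliftP ord0 i.
    by have := hz j; rewrite mxE cons_rVS.
  by rewrite cons_rV0 ltr_distl; move: ht; rewrite in_itv.
rewrite /= /lebesgue_rV_succ /pushforward E.
rewrite product_measure1E; [|exact: measurable_itv|exact: measurable_box].
change (lebesgue_measure `](x ord0 ord0 - r)%R, (x ord0 ord0 + r)%R[%classic * mu n (box x' r) =
  ((2 * r) ^+ n.+1)%:E)%E.
rewrite IH lebesgue_measure_itv/= lte_fin ltrD2l gtrN//.
by rewrite -EFinB -EFinM exprS; congr (_ * _)%:E; ring.
Qed.

Lemma lebesgue_bounded n (A : set 'rV[R]_n) : measurable A -> bounded_set A -> (mu n A < +oo)%E.
Proof.
move=> mA bA; have [M M0 hM] := bounded_enorm bA.
have M1 : 0 < M + 1 by pos.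
apply: (@le_lt_trans _ _ (mu n (box 0 (M + 1)))); last by rewrite lebesgue_box// ltry.
apply: le_measure; rewrite ?inE//; first exact: measurable_box.
move=> x Ax i; rewrite mxE subr0; apply: (@le_lt_trans _ _ M); last by rewrite ltrDl.
by apply: le_trans (hM x Ax); apply: le_trans (normrV_coord x i) (normrV_le_enorm x).
Qed.

Lemma lebesgue_open_gt0 n (A : set 'rV[R]_n) : open A -> A !=set0 -> (0 < mu n A)%E.
Proof.
move=> oA [x Ax]; have /open_enorm/(_ x Ax)[r r0 hr] := oA.
have rn : 0 < r / n.+1%:R by rewrite divr_gt0.
apply: (@lt_le_trans _ _ (mu n (box x (r / n.+1%:R)))).
  by rewrite lebesgue_box// lte_fin exprn_gt0// mulr_gt0.
apply: le_measure; rewrite ?inE; [exact: measurable_box|exact: open_measurable_rV|].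
move=> y hy; apply: hr; apply: le_lt_trans (enorm_le_normrV _) _.
apply: (@le_lt_trans _ _ (n%:R * (r / n.+1%:R))).
  apply: ler_wpM2l => //; apply/normrV_leP => [|i]; first exact: ltW.
  by rewrite !mxE ltW//; exact: hy.
by rewrite mulrCA gtr_pMr// ltr_pdivrMr// mul1r ltr_nat.
Qed.

End measure_rV.

(** * The nearest boundary point lies along the normal *)

Section nearest.
Context {R : realType} (n : nat) (Omega : set 'rV[R]_n.+1).
Hypotheses (oO : open Omega) (b0 : boundary Omega !=set0).

(** If [x - b] were not along [v], then moving from [b] by a small multiple of [u = (x - b)/d - v]
    would enter the exterior ball, since [dotv u v < 0], and come closer to [x], since
    [dotv (x - b) u > 0]. That contradicts [d] being the distance. *)
Lemma nearest_normal x b (v : 'rV[R]_n.+1) (rho : R) : Omega x -> boundary Omega b ->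
  bdist Omega x = enorm (x - b) -> 0 < rho -> sqn v = 1 ->
  (forall y, sqn (y - b) < - (2 * rho * dotv (y - b) v) -> ~ Omega y) ->
  x = b + bdist Omega x *: v.
Proof.
move=> Ox bb dE rho0 v1 out; set d := bdist Omega x.
have d0 : 0 < d by exact: bdist_gt0.
set z := x - b; have zd : sqn z = d ^+ 2 by rewrite -enorm_sqr -dE.
have vE : enorm v = 1 by rewrite enormE v1 sqrtr1.
have zv : dotv z v <= d by have := cauchy_schwarz z v; rewrite -dE vE mulr1.
have [a_lt|a_ge] := ltP (dotv z v) d; last first.
  have aE : dotv z v = d by apply/eqP; rewrite eq_le zv.
  have : sqn (z - d *: v) = 0 by rewrite sqn_sub_line zd aE v1; ring.
  by move/eqP; rewrite sqn_eq0 subr_eq0 => /eqP zE; rewrite -zE addrC subrK.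
exfalso; set a := dotv z v in zv a_lt.
pose s := Num.min rho d / 2.
have m0 : 0 < Num.min rho d by rewrite lt_min rho0.
have s0 : 0 < s by rewrite divr_gt0.
have srho : s < rho.
  by have : Num.min rho d <= rho; [rewrite ge_min lexx|rewrite ltr_pdivrMr//; lra].
have sd : s < d.
  by have : Num.min rho d <= d; [rewrite ge_min lexx orbT|rewrite ltr_pdivrMr//; lra].
pose u := d^-1 *: z - v; pose m := 1 - a / d.
have m_gt0 : 0 < m by rewrite subr_gt0 ltr_pdivrMr// mul1r.
have uu : sqn u = 2 * m.
  have -> : u = d^-1 *: z - 1 *: v by rewrite scale1r.
  rewrite sqn_sub_line v1 dotvZl -/a.
  by rewrite /sqn dotvZl dotvZr -/(sqn z) zd /m; field; rewrite gt_eqF.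
have uv : dotv u v = - m by rewrite /u dotvDl dotvNl dotvZl -/(sqn v) v1 -/a /m; ring.
have zu : dotv z u = d * m.
  by rewrite /u dotvDr dotvNr dotvZr -/(sqn z) zd -/a /m; field; rewrite gt_eqF.
have out_y : ~ Omega (b + s *: u).
  apply: out; rewrite addrAC subrr add0r.
  have -> : sqn (s *: u) = s ^+ 2 * (2 * m) by rewrite /sqn dotvZl dotvZr -/(sqn u) uu; ring.
  rewrite dotvZl uv; have : 0 < s * m * (rho - s) by rewrite !mulr_gt0// subr_gt0.
  by lra.
have := bdist_le_out oO Ox out_y; rewrite -/d.
have -> : x - (b + s *: u) = z - s *: u by rewrite opprD addrA.
rewrite leNgt => /negP; apply.
rewrite -(@ltr_pXn2r _ 2) ?nnegrE ?enorm_ge0 ?(ltW d0)// enorm_sqr sqn_sub_line zd zu uu.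
have : 0 < s * m * (d - s) by rewrite !mulr_gt0// subr_gt0.
by lra.
Qed.

End nearest.

(** * The supersolution *)

(* Hides large numerals, which unification would otherwise unfold. *)
Lemma opaque_numeral {R : realType} (k : nat) : (0 < k)%N -> exists2 c : R, 0 < c & c = k%:R.
Proof. by exists k%:R => //; rewrite ltr0n. Qed.

(** Each of the three terms on the left is at most a third of the right-hand side: the first two by
    smallness of [d^(1/2)], the third by smallness of [e]. The constants [a0] and [a1] replace [A0]
    and [A1] so that the conditions on [d] are free of [t]. *)
Lemma barrier_small {R : realType} (c1 c2 c3 c4 A0 A1 a0 a1 c0 r d t e : R) :
  0 < c1 -> 0 < c2 -> 0 < c3 -> 0 < c4 ->
  0 < t <= 16^-1 -> 0 < d <= 1 -> 0 < r -> 0 < c0 -> 0 < a0 -> a0 <= A0 -> 0 <= A1 -> A1 <= a1 ->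
  3 * (c1 * c2) * r `^ (- (3 / 4)) * a1 * d `^ 2^-1 <= a0 * c0 -> 3 * c3 * d `^ 2^-1 <= c0 ->
  (e / d ^+ 2) `^ 8^-1 <= t * c0 * d / (3 * c4) ->
  c1 * r `^ (- (3 / 4)) * d `^ (- (3 / 4)) * (A1 * (c2 * d `^ (2^-1 - 2 * t))) + c3 * A0 +
    A0 * d `^ (- 1 - t) * (c4 * (e / d ^+ 2) `^ 8^-1) / t <= A0 * c0 * d `^ (- (3 / 4) - 2 * t).
Proof.
move=> c10 c20 c30 c40 /andP[t0 t1] /andP[d0 d1] r0 c00 a00 aA A10 Aa h1 h2 h3.
have A00 : 0 < A0 by exact: lt_le_trans aA.
set D := d `^ (- (3 / 4) - 2 * t); have D0 : 0 < D by rewrite /D; pos.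
have t1' : c1 * r `^ (- (3 / 4)) * d `^ (- (3 / 4)) * (A1 * (c2 * d `^ (2^-1 - 2 * t))) <= A0 * c0 * D / 3.
  have E : d `^ (- (3 / 4)) * d `^ (2^-1 - 2 * t) = D * d `^ 2^-1.
    by rewrite /D -!powRDp//; congr powR; field.
  rewrite [leLHS](_ : _ = c1 * c2 * r `^ (- (3 / 4)) * A1 * (d `^ (- (3 / 4)) * d `^ (2^-1 - 2 * t))); last by ring.
  rewrite E; have r'0 : 0 <= c1 * c2 * r `^ (- (3 / 4)) by pos.
  have d20 : 0 <= d `^ 2^-1 by pos.
  have h4 : c1 * c2 * r `^ (- (3 / 4)) * A1 * d `^ 2^-1 <= A0 * c0 / 3.
    apply: (@le_trans _ _ (c1 * c2 * r `^ (- (3 / 4)) * a1 * d `^ 2^-1)).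
      by apply: ler_wpM2r => //; apply: ler_wpM2l.
    have : a0 * c0 <= A0 * c0 by rewrite ler_pM2r.
    by move: h1; move: (r `^ _) (d `^ _) => x y; clear; lra.
  have := ler_wpM2r (ltW D0) h4.
  by move: (r `^ _) (d `^ _) => x y; clear; lra.
have t2' : c3 * A0 <= A0 * c0 * D / 3.
  have h5 : 1 <= D * d `^ 2^-1.
    by rewrite /D -powRDp// -[leLHS](powRr0 d); apply: ger_powR; rewrite ?d0//; lra.
  have h6 : 3 * c3 * (D * d `^ 2^-1) <= c0 * D.
    by have := ler_wpM2r (ltW D0) h2; move: (d `^ _) => x; clear; lra.
  have h7 : 3 * c3 <= c0 * D.
    by apply: le_trans h6; rewrite -[leLHS]mulr1; apply: ler_wpM2l => //; pos.
  by have := ler_wpM2l (ltW A00) h7; clear; lra.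
have t3' : A0 * d `^ (- 1 - t) * (c4 * (e / d ^+ 2) `^ 8^-1) / t <= A0 * c0 * D / 3.
  rewrite ler_pdivrMr//.
  have Ad : 0 <= A0 * d `^ (- 1 - t) by pos.
  have h8 : c4 * (e / d ^+ 2) `^ 8^-1 <= t * c0 * d / 3.
    rewrite mulrC -ler_pdivlMr// (_ : t * c0 * d / 3 / c4 = t * c0 * d / (3 * c4))//.
    by field; rewrite gt_eqF.
  apply: le_trans (ler_wpM2l Ad h8) _.
  have h9 : d `^ (- 1 - t) * d <= D.
    by rewrite mulr_powR// /D; apply: ger_powR; rewrite ?d0//; lra.
  have p0 : 0 <= A0 * c0 * t / 3 by pos.
  by have := ler_wpM2l p0 h9; move: (d `^ (- 1 - t)) => x; clear; lra.
by move: t1' t2' t3'; clear; lra.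
Qed.

Section supersolution.
Context {R : realType}.
Local Notation mu := (@lebesgue_rV R).

(* The Gagliardo kernel in dimension [n.+1] with [s = 1/2 + t], regularized. *)
Definition rkern n (t e : R) (x y : 'rV[R]_n.+1) : R :=
  (sqn (y - x) + e) `^ (- (n%:R / 2 + (1 + t))).

Definition kap n (t : R) : R := Acst n (n%:R / 2 + (1 + t)) * gam t.

Definition weight n (Omega : set 'rV[R]_n) (t rho : R) (y : 'rV[R]_n) : R :=
  if y \in Omega then barrier t (Num.min (bdist Omega y) rho) else 0.

(** States [L w >= kap n t * dist^(-1-2t) * w] at [x] for the regularized kernel, with the two parts
    of the difference [w x - w y] on opposite sides to avoid subtracting integrals. *)
Definition supersolution n (Omega : set 'rV[R]_n.+1) (t rho e : R) x :=
  (\int[mu n.+1]_y (weight Omega t rho y * rkern t e x y)%:E +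
    (kap n t * bdist Omega x `^ (- 1 - 2 * t) * weight Omega t rho x)%:E <=
   \int[mu n.+1]_y ((if y \in Omega then weight Omega t rho x else 0) * rkern t e x y)%:E)%E.

Lemma rkern_ge0 n t e x y : 0 <= @rkern n t e x y. Proof. exact: powR_ge0. Qed.

Lemma measurable_rkern n (t e : R) x : measurable_fun [set: 'rV[R]_n.+1] (rkern t e x).
Proof.
apply: measurable_powR_comp; apply: measurable_funD => //.
by apply: measurable_dotv; exact: measurable_rVB.
Qed.

Lemma measurable_if_in n (A : set 'rV[R]_n) (f g : 'rV[R]_n -> R) : measurable A ->
  measurable_fun [set: 'rV[R]_n] f -> measurable_fun [set: 'rV[R]_n] g ->
  measurable_fun [set: 'rV[R]_n] (fun y => if y \in A then f y else g y).
Proof.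
move=> mA mf mg; apply: measurable_fun_ifT => //; apply: (measurable_fun_bool true).
by rewrite setTI (_ : _ @^-1` _ = A)//; apply/seteqP; split => y /=; [exact: set_mem|exact: mem_set].
Qed.

Lemma Acst_shift_gt0 n (a : R) : 0 < a -> 0 < Acst n (n%:R / 2 + a).
Proof. by move=> a0; apply: Acst_gt0; rewrite ltrDl. Qed.

Lemma Acst_shift_decr n (a b : R) : 0 < a -> a <= b ->
  Acst n (n%:R / 2 + b) <= Acst n (n%:R / 2 + a).
Proof. by move=> a0 ab; apply: Acst_decr; rewrite ?ltrDl ?lerD2l. Qed.

Lemma le_inv16 (t : R) : 0 < t <= 16^-1 ->
  [/\ 0 < t <= 4^-1, 0 < t <= 8^-1, 0 < 1 + t <= 2, 1 <= 1 + t & 4^-1 <= 4^-1 + t].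
Proof. by move=> t01; split; lra. Qed.

Section domain.
Variables (n : nat) (Omega : set 'rV[R]_n.+1).
Hypotheses (oO : open Omega) (bO : bounded_set Omega) (neO : Omega !=set0).

Let b0 : boundary Omega !=set0. Proof. exact: boundary_nonempty. Qed.

Lemma measurable_bdist : measurable_fun [set: 'rV[R]_n.+1] (bdist Omega).
Proof. by apply: (@lipschitz_measurable _ _ _ 1) => //; exact: bdist_lipschitz. Qed.

Lemma measurable_weight t rho : measurable_fun [set: 'rV[R]_n.+1] (weight Omega t rho).
Proof.
have mm : measurable_fun [set: 'rV[R]_n.+1] (fun y => Num.min (bdist Omega y) rho).
  by apply: measurable_minr => //; exact: measurable_bdist.
apply: measurable_if_in => //; first exact: open_measurable_rV.
apply: measurable_funB; first exact: measurable_powR_comp.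
by apply: measurable_funM => //; exact: measurable_powR_comp.
Qed.

Lemma minb01 rho y : 0 < rho <= 1 -> Omega y -> 0 < Num.min (bdist Omega y) rho <= 1.
Proof.
move=> /andP[rho0 rho1] Oy; rewrite lt_min rho0 bdist_gt0//= ge_min rho1 orbT.
by [].
Qed.

Lemma weight_ge0 t rho y : 0 < t <= 4^-1 -> 0 < rho <= 1 -> 0 <= weight Omega t rho y.
Proof.
move=> t01 rho01; rewrite /weight; case: ifPn => //; rewrite inE => Oy.
by apply: barrier_ge0 => //; have /andP[/ltW -> ->] := minb01 rho01 Oy.
Qed.

Lemma weight_gt0 t rho y : 0 < t <= 4^-1 -> 0 < rho <= 1 -> Omega y -> 0 < weight Omega t rho y.
Proof.
move=> t01 rho01 Oy; rewrite /weight mem_set//.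
by apply: barrier_gt0 => //; exact: minb01.
Qed.

Lemma weight_le1 t rho y : 0 < t -> 0 < rho <= 1 -> weight Omega t rho y <= 1.
Proof.
move=> t0 rho01; rewrite /weight; case: ifPn => // /set_mem Oy.
by apply: barrier_le1; [exact: ltW|have /andP[/ltW -> ->] := minb01 rho01 Oy].
Qed.

Hypothesis cO : class_C11 Omega.

(** [rho] must not depend on [t], since the threshold for [t] in [super_far] depends on [rho]. Only
    [e0] may depend on [t] and on the depth [eps]. *)
Lemma super_near : exists2 rho : R, 0 < rho <= 2^-1 &
  forall t eps, 0 < t <= 16^-1 -> 0 < eps -> exists2 e0 : R, 0 < e0 &
  forall e x, 0 < e < e0 -> Omega x -> eps <= bdist Omega x -> bdist Omega x <= rho ->
  supersolution Omega t rho e x.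
Proof.
have [r r0 hr] := uniform_ball oO bO b0 cO.
have [c0 c00 hc0] := @Qint_quarter R.
pose a0 := Acst n (n%:R / 2 + 2) : R; pose a1 := Acst n (n%:R / 2 + 4^-1) : R.
have a00 : 0 < a0 by apply: Acst_gt0; rewrite ltrDl.
have a10 : 0 < a1 by apply: Acst_gt0; rewrite ltrDl invr_gt0.
have [c1 c10 c1E] := @opaque_numeral R 16 isT; have [c2 c20 c2E] := @opaque_numeral R 384 isT.
have [c3 c30 c3E] := @opaque_numeral R 86 isT; have [c4 c40 c4E] := @opaque_numeral R 240 isT.
pose K := 3 * (c1 * c2) * r `^ (- (3 / 4)) * a1.
have K0 : 0 < K by rewrite /K; pos.
(* Both conditions of [barrier_small] on the depth read [d^(1/2) <= m], which [rho <= m^2]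
   ensures. *)
pose m := Num.min (a0 * c0 / K) (c0 / (3 * c3)).
have m0 : 0 < m by rewrite lt_min; apply/andP; split; pos.
pose rho := Num.min 2^-1 (Num.min r (m ^+ 2)).
have rho0 : 0 < rho by rewrite !lt_min invr_gt0 r0 exprn_gt0// ltr0n.
have rho2 : rho <= 2^-1 by rewrite ge_min lexx.
have rhor : rho <= r by rewrite !ge_min lexx orbT.
have rhom : rho <= m ^+ 2 by rewrite !ge_min lexx !orbT.
have rho1 : rho <= 1 by apply: le_trans rho2 _; rewrite invf_le1 ?ler1n.
exists rho; first by rewrite rho0.
move=> t eps t01 eps0; move: (t01) => /andP[t0 t1].
have [t4 _ /andP[t1p t1l] t1g t4g] := le_inv16 t01.
(* For depth at least [eps], [e < eps^2 q^8] gives [(e / d^2)^(1/8) <= q]; the cap at 1 gives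
   [e <= d^2]. *)
pose q := Num.min 1 (t * c0 * eps / (3 * c4)).
have q0 : 0 < q by rewrite lt_min; apply/andP; split; pos.
exists (eps ^+ 2 * q ^+ 8); first by rewrite mulr_gt0 ?exprn_gt0.
move=> e x /andP[e0 ee] Ox epsd drho; set d := bdist Omega x in epsd drho *.
have d0 : 0 < d by exact: bdist_gt0.
have [b bb dE] := bdist_attained b0 bO x.
have [v [v1 vin vout]] := hr b bb.
have xE : x = b + d *: v by exact: nearest_normal r0 v1 vout.
have d2 : d <= 2^-1 := le_trans drho rho2.
have ed : e / d ^+ 2 <= q ^+ 8.
  rewrite ler_pdivrMr ?exprn_gt0//; apply: le_trans (ltW ee) _; rewrite mulrC.
  by rewrite ler_pM2l ?exprn_gt0// ler_sqr ?nnegrE// ltW.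
have q81 : q ^+ 8 <= 1 by rewrite expr_le1 ?(ltW q0)// ge_min lexx.
have ed2 : e <= d ^+ 2.
  by have := le_trans ed q81; rewrite ler_pdivrMr ?exprn_gt0// mul1r.
pose C := c1 * r `^ (- (3 / 4)) * d `^ (- (3 / 4)).
have C0 : 0 <= C by rewrite /C; pos.
have d01 : 0 < d <= 2^-1 by rewrite d0.
have wx : weight Omega t rho x = barrier t d by rewrite /weight mem_set// (min_idPl drho).
have w0 y : 0 <= weight Omega t rho y by apply: weight_ge0; rewrite ?rho0.
have pw := @barrier_pointwise R n.+1 Omega (bdist Omega) r rho t d b v t01 r0 rho1 rhor d0
  drho v1 vin vout (boundary_not_in oO bb) (fun y _ => bdist_ge0 b0 y) (bdist_le_out oO).
rewrite /= -xE -c1E -/C in pw.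
have small : C * (Acst n (n%:R / 2 + (4^-1 + t)) * (c2 * d `^ (2^-1 - 2 * t))) +
       c3 * Acst n (n%:R / 2 + (1 + t)) +
       Acst n (n%:R / 2 + (1 + t)) * d `^ (-1 - t) *
       (c4 * (e / d ^+ 2) `^ 8^-1) / t <=
       Acst n (n%:R / 2 + (1 + t)) * c0 * d `^ (- (3 / 4) - 2 * t).
  have d201 : d `^ 2^-1 <= m.
    apply: (@le_trans _ _ ((m ^+ 2) `^ 2^-1)).
      by apply: ge0_ler_powR; rewrite ?nnegrE ?invr_ge0 ?(ltW d0) ?sqr_ge0 ?(le_trans drho rhom).
    by rewrite -powR_mulrn ?(ltW m0)// -powRrM mulfV// powRr1// ltW.
  have [dm1 dm2] : d `^ 2^-1 <= a0 * c0 / K /\ d `^ 2^-1 <= c0 / (3 * c3).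
    by move: d201; rewrite le_min => /andP[].
  apply: (@barrier_small _ c1 c2 c3 c4 _ _ a0 a1) => //.
  - by rewrite d0 (le_trans drho rho1).
  - exact: Acst_shift_decr.
  - by apply: ltW; apply: Acst_shift_gt0; exact: lt_le_trans t4g.
  - exact: Acst_shift_decr.
  - by rewrite ler_pdivlMr// mulrC in dm1.
  - by rewrite ler_pdivlMr ?mulr_gt0// mulrC in dm2.
  - apply: (@le_trans _ _ q).
      apply: (@le_trans _ _ ((q ^+ 8) `^ 8^-1)).
        by apply: ge0_ler_powR; rewrite ?nnegrE ?invr_ge0 ?divr_ge0 ?exprn_ge0 ?(ltW e0) ?(ltW d0) ?(ltW q0).
      by rewrite -powR_mulrn ?(ltW q0)// -powRrM mulfV// powRr1// ltW.
    apply: (@le_trans _ _ (t * c0 * eps / (3 * c4))); first by rewrite ge_min lexx orbT.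
    by apply: ler_wpM2r; [pos|apply: ler_wpM2l => //; pos].
have mO : measurable Omega by exact: open_measurable_rV.
have := @barrier_super R n Omega (weight Omega t rho) x v t d e C t01 d01 e0 ed2 v1 C0 mO
  (measurable_weight t rho) w0 pw c0 hc0; rewrite -c2E -c3E -c4E => /(_ small).
by rewrite /supersolution wx -/d /kap.
Qed.

(** At depth at least [rho] the weight is maximal. On the set [A] of points of depth below [rho/2]
    it falls short by at least [3 t h], which contributes a gain of order [t], while [kap] is of
    order [t^2]. *)
Lemma super_far (rho : R) : 0 < rho <= 2^-1 -> exists2 t0 : R, 0 < t0 &
  forall t, 0 < t <= 16^-1 -> t < t0 ->
  forall e x, 0 < e < 1 -> Omega x -> rho <= bdist Omega x ->
  supersolution Omega t rho e x.
Proof.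
move=> /andP[rho0 rho2].
have rho01 : 0 < rho <= 1 by lra.
pose A := Omega `&` [set y | bdist Omega y < rho / 2].
have oA : open A.
  apply: openI => //; apply/open_enorm => y /= yr.
  exists (rho / 2 - bdist Omega y); first by rewrite subr_gt0.
  move=> z; have := bdist_lipschitz b0 z y; rewrite mul1r ler_norml.
  by move: (bdist Omega z) (bdist Omega y) (enorm _) => p q s; lra.
have neA : A !=set0.
  have [b bb] := b0; have [/closure_enorm cb _] := bb.
  have r2 : 0 < rho / 2 by rewrite divr_gt0.
  have [y Oy yb] := cb _ r2; exists y; split => //=.
  by apply: le_lt_trans (bdist_le y bb) _; rewrite enormB enormB.
have mA : measurable A by exact: open_measurable_rV.
have [mA0 mA0_gt0 hmA] : exists2 m : R, 0 < m & (m%:E <= mu n.+1 A)%E.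
  have := lebesgue_open_gt0 oA neA; case: (mu n.+1 A) => [m| |]//; last by exists 1 => //; exact: leey.
  by rewrite lte_fin => m0; exists m.
have [M M0 hM] := bounded_enorm bO.
(* Bounds [|y - x|^2 + e] on the domain for [e < 1], so that the kernel is at least [kmin]. *)
pose D := (2 * M) ^+ 2 + 1.
have D1 : 1 <= D by rewrite lerDr sqr_ge0.
pose kmin := D `^ (- (n%:R / 2 + 2)).
have kmin0 : 0 < kmin by apply: powR_gt0; lra.
pose h := rho `^ 4^-1 - (rho / 2) `^ 4^-1.
have h0 : 0 < h.
  by rewrite subr_gt0; apply: gt0_ltr_powR; rewrite ?nnegrE ?invr_gt0//; lra.
pose a2 := Acst n (n%:R / 2 + 1) : R.
have a20 : 0 < a2 by apply: Acst_gt0; rewrite ltrDl.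
have [c5 c50 c5E] := @opaque_numeral R 512 isT.
(* The value at which [3 t h kmin mA0] equals the bound [512 t^2 a2 rho^(-2)] of the Hardy term. *)
pose t0 := 3 * h * kmin * mA0 / (c5 * a2 * rho `^ (- 2)).
have r20 : 0 < c5 * a2 * rho `^ (- 2) by pos.
exists t0; first by rewrite divr_gt0// !mulr_gt0.
move=> t t01 tt0 e x /andP[e0 e1] Ox rhod; move: (t01) => /andP[t_gt0 t1].
have [t4 t8 /andP[t1p t1l] t1g _] := le_inv16 t01; have rho1 : rho <= 1 by case/andP: rho01.
have wx : weight Omega t rho x = barrier t rho by rewrite /weight mem_set// (min_idPr rhod).
have B0 : 0 < barrier t rho by exact: barrier_gt0.
have B1 : barrier t rho <= 1 by apply: barrier_le1; rewrite ?(ltW rho0)// ltW.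
set B := barrier t rho in B0 B1 wx.
pose i y : R := if y \in A then 3 * t * h else 0.
have i0 y : 0 <= i y by rewrite /i; case: ifP => // _; rewrite !mulr_ge0// ltW.
have mi : measurable_fun [set: 'rV[R]_n.+1] i by exact: measurable_if_in.
have w0 y : 0 <= weight Omega t rho y by exact: weight_ge0.
have mk := measurable_rkern t e x.
have k0 y := rkern_ge0 t e x y.
have pw y : weight Omega t rho y + i y <= (if y \in Omega then B else 0).
  rewrite /weight /i; have [/set_mem Oy|Oy] := boolP (y \in Omega); last first.
    by rewrite memNset ?addr0// => -[]; move/negP : Oy; rewrite inE.
  have /andP[m0 m1] := minb01 rho01 Oy.
  have mr : Num.min (bdist Omega y) rho <= rho by rewrite ge_min lexx orbT.
  have inc := barrier_increase t8 m0 mr rho1.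
  case: ifPn => [/set_mem[_ /= yr]|_]; last first.
    by rewrite addr0; exact: (barrier_mono t8 (ltW m0) mr rho1).
  apply: le_trans inc; rewrite lerD2l ler_pM2l ?mulr_gt0// lerD2l lerN2.
  apply: ge0_ler_powR; rewrite ?nnegrE ?invr_ge0 ?(ltW m0)//; first by rewrite divr_ge0// ltW.
  by rewrite ge_min (ltW yr).
have key : (\int[mu n.+1]_y (weight Omega t rho y * rkern t e x y)%:E +
    \int[mu n.+1]_y (i y * rkern t e x y)%:E <=
   \int[mu n.+1]_y ((if y \in Omega then B else 0) * rkern t e x y)%:E)%E.
  have mw : measurable_fun [set: 'rV[R]_n.+1] (fun y => (weight Omega t rho y * rkern t e x y)%:E).
    by apply: measurable_EFin_comp; apply: measurable_funM => //; exact: measurable_weight.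
  have mik : measurable_fun [set: 'rV[R]_n.+1] (fun y => (i y * rkern t e x y)%:E).
    by apply: measurable_EFin_comp; exact: measurable_funM.
  rewrite -(ge0_integralD (mu n.+1) measurableT _ mw _ mik); last 2 first.
  - by move=> y _; rewrite lee_fin mulr_ge0.
  - by move=> y _; rewrite lee_fin mulr_ge0.
  apply: ge0_le_integral => //.
  - by move=> y _; rewrite -EFinD lee_fin addr_ge0// mulr_ge0.
  - exact: emeasurable_funD.
  - apply: measurable_EFin_comp; apply: measurable_funM => //; apply: measurable_if_in => //.
    exact: open_measurable_rV.
  - by move=> y _; rewrite -EFinD lee_fin -mulrDl ler_wpM2r.
rewrite /supersolution wx; apply: le_trans key; apply: leeD => //.
apply: (@le_trans _ _ (3 * t * h * kmin * mA0)%:E).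
  rewrite lee_fin /kap.
  have /andP[g0 g1] : 0 <= gam t <= c5 * t ^+ 2 by rewrite c5E; apply: gam_le; lra.
  have hA : Acst n (n%:R / 2 + (1 + t)) <= a2.
    exact: Acst_shift_decr.
  have A0p : 0 < Acst n (n%:R / 2 + (1 + t)) by exact: Acst_shift_gt0.
  have hd : bdist Omega x `^ (- 1 - 2 * t) <= rho `^ (- 2).
    apply: (@le_trans _ _ (rho `^ (- 1 - 2 * t))).
      apply: le0_ler_powR => //; rewrite -opprD oppr_le0; by rewrite addr_ge0// mulr_ge0// ltW.
    apply: ger_powR; first by rewrite rho0.
    by lra.
  have dp := powR_ge0 (bdist Omega x) (- 1 - 2 * t).
  have rp := powR_ge0 rho (- 2).
  apply: (@le_trans _ _ (a2 * (c5 * t ^+ 2) * rho `^ (- 2) * 1)).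
    by apply: ler_pM => //; [pos|exact: ltW|apply: ler_pM => //; [pos|apply: ler_pM => //; exact: ltW]].
  have : t * t <= t * t0 by rewrite ler_pM2l// ltW.
  rewrite -(ler_pM2l r20) [X in _ <= X -> _](_ : _ = 3 * t * h * kmin * mA0).
    by apply: le_trans; rewrite le_eqVlt; apply/orP; left; apply/eqP; ring.
  by rewrite /t0 mulrCA (mulrC (c5 * a2 * _)) divfK ?gt_eqF//; ring.
rewrite EFinM; apply: (@le_trans _ _ ((3 * t * h * kmin)%:E * mu n.+1 A)%E).
  by apply: lee_wpmul2l => //; rewrite lee_fin; pos.
have -> : ((3 * t * h * kmin)%:E * mu n.+1 A = \int[mu n.+1]_(y in A) (3 * t * h * kmin)%:E)%E.
  by rewrite integral_cst.
rewrite integral_mkcond; apply: ge0_le_integral => //.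
- by move=> y _; rewrite /patch; case: ifP => // _; rewrite lee_fin; pos.
- by apply/(measurable_restrictT _ mA).
- by apply: measurable_EFin_comp; exact: measurable_funM.
move=> y _; rewrite /patch /i; case: ifPn => [/set_mem[Oy _]|_]; last by rewrite mul0r.
rewrite lee_fin; apply: ler_wpM2l; first by pos.
have xy : enorm (y - x) <= 2 * M.
  by apply: le_trans (enormD _ _) _; rewrite enormN mulr_natl mulr2n; apply: lerD; [exact: hM|exact: hM].
have X1 : sqn (y - x) <= (2 * M) ^+ 2.
  by rewrite -enorm_sqr ler_sqr ?nnegrE ?enorm_ge0// mulr_ge0// ltW.
have X0 := sqn_ge0 (y - x).
have n0 : 0 <= (n%:R : R) by [].
apply: (@le_trans _ _ (D `^ (- (n%:R / 2 + (1 + t))))).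
  by apply: ler_powR => //; rewrite lerN2 lerD2l.
apply: le0_ler_powR.
- by rewrite oppr_le0 addr_ge0 ?divr_ge0// ltW.
- by rewrite ltr_wpDl.
- by rewrite /D; apply: lerD => //; exact: ltW.
Qed.

End domain.
End supersolution.

(** * The ground state representation *)

(* AM-GM: [4 f^2 g^2] is at most [(a q + b p)^2]. *)
Lemma ground_state_pointwise {R : realType} (f g a b p q : R) : 0 < p -> 0 < q -> 0 <= a -> 0 <= b ->
  f ^+ 2 = a * p -> g ^+ 2 = b * q -> p * a + q * b <= (f - g) ^+ 2 + a * q + b * p.
Proof.
move=> p0 q0 a0 b0 fE gE.
have h0 : 0 <= a * q + b * p by rewrite addr_ge0// mulr_ge0// ltW.
have key : 2 * (f * g) <= a * q + b * p.
  apply: le_trans (ler_norm _) _; rewrite -(@ler_pXn2r _ 2) ?nnegrE// real_normK ?num_real//.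
  rewrite !exprMn fE gE; have := sqr_ge0 (a * q - b * p); lra.
lra.
Qed.

Section ground_state.
Context {R : realType} d (T : measurableType d) (m : {sigma_finite_measure set T -> \bar R}).
Variables (D : set T) (k : T * T -> R) (w psi phi V : T -> R).
Hypotheses (mD : measurable D) (mk : measurable_fun [set: T * T] k) (k0 : forall z, 0 <= k z)
  (ksym : forall x y, k (x, y) = k (y, x))
  (mw : measurable_fun [set: T] w) (w0 : forall x, 0 <= w x)
  (wD : forall x, D x -> 0 < w x) (wN : forall x, ~ D x -> w x = 0)
  (mpsi : measurable_fun [set: T] psi) (psi0 : forall x, 0 <= psi x)
  (psiN : forall x, ~ D x -> psi x = 0)
  (psiE : forall x, D x -> phi x ^+ 2 = psi x * w x)
  (mphi : measurable_fun [set: T] phi)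
  (mV : measurable_fun [set: T] V) (V0 : forall x, 0 <= V x).
Hypothesis super : forall x, psi x != 0 ->
  (\int[m]_y (w y * k (x, y))%:E + (V x * w x)%:E <=
   \int[m]_y ((if y \in D then w x else 0) * k (x, y))%:E)%E.
Hypothesis fin : (\int[m \x m]_z (psi z.1 * w z.2 * k z)%:E < +oo)%E.

Let ind x : R := if x \in D then 1 else 0.
Let mind : measurable_fun [set: T] ind.
Proof.
apply: measurable_fun_ifT => //; apply: (measurable_fun_bool true).
by rewrite setTI (_ : _ @^-1` _ = D)//; apply/seteqP; split => y /=; [exact: set_mem|exact: mem_set].
Qed.
Let ind0 x : 0 <= ind x. Proof. by rewrite /ind; case: ifP. Qed.
Let m1 (f : T -> R) : measurable_fun [set: T] f -> measurable_fun [set: T * T] (fun z => f z.1).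
Proof. by move=> mf; apply: measurableT_comp. Qed.
Let m2 (f : T -> R) : measurable_fun [set: T] f -> measurable_fun [set: T * T] (fun z => f z.2).
Proof. by move=> mf; apply: measurableT_comp. Qed.

Let swap (f : T * T -> R) : measurable_fun [set: T * T] f -> (forall z, 0 <= f z) ->
  (\int[m \x m]_z (f (z.2, z.1))%:E = \int[m \x m]_z (f z)%:E)%E.
Proof.
move=> mf f0.
have ms : measurable_fun [set: T * T] (fun z : T * T => (f (z.2, z.1))%:E).
  apply: measurable_EFin_comp; apply: (measurableT_comp mf).
  by apply: measurable_fun_pair; [exact: measurable_snd|exact: measurable_fst].
have mfE : measurable_fun [set: T * T] (fun z => (f z)%:E) by exact: measurable_EFin_comp.
rewrite (@fubini_tonelli1 _ _ _ _ _ m m _ ms (fun z => f0 _)).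
by rewrite (@fubini_tonelli2 _ _ _ _ _ m m _ mfE (fun z => f0 _)).
Qed.

Let A z := ind z.2 * w z.1 * psi z.1 * k z.
Let A' z := ind z.1 * w z.2 * psi z.2 * k z.
Let J z := psi z.1 * w z.2 * k z.
Let J' z := psi z.2 * w z.1 * k z.
Let G z := ind z.1 * ind z.2 * (phi z.1 - phi z.2) ^+ 2 * k z.
Let mA : measurable_fun [set: T * T] A.
Proof. by repeat apply: measurable_funM => //; [exact: m2|exact: m1|exact: m1]. Qed.
Let mA' : measurable_fun [set: T * T] A'.
Proof. by repeat apply: measurable_funM => //; [exact: m1|exact: m2|exact: m2]. Qed.
Let mJ : measurable_fun [set: T * T] J.
Proof. by repeat apply: measurable_funM => //; [exact: m1|exact: m2]. Qed.
Let mJ' : measurable_fun [set: T * T] J'.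
Proof. by repeat apply: measurable_funM => //; [exact: m2|exact: m1]. Qed.
Let mG : measurable_fun [set: T * T] G.
Proof.
apply: measurable_funM => //; apply: measurable_funM.
  by apply: measurable_funM; [exact: m1|exact: m2].
by apply: measurable_funX; apply: measurable_funB; [exact: m1|exact: m2].
Qed.
Let A0 z : 0 <= A z. Proof. by rewrite /A !mulr_ge0. Qed.
Let A'0 z : 0 <= A' z. Proof. by rewrite /A' !mulr_ge0. Qed.
Let J0 z : 0 <= J z. Proof. by rewrite /J !mulr_ge0. Qed.
Let J'0 z : 0 <= J' z. Proof. by rewrite /J' !mulr_ge0. Qed.
Let G0 z : 0 <= G z. Proof. by rewrite /G; apply: mulr_ge0 => //; apply: mulr_ge0; [exact: mulr_ge0|exact: sqr_ge0]. Qed.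

Let pointwise z : A z + A' z <= G z + J z + J' z.
Proof.
rewrite /A /A' /G /J /J' -!mulrDl; apply: ler_wpM2r => //.
case: z => x y /=; rewrite /ind.
have [/set_mem Dx|/negP Dx] := boolP (x \in D); last first.
  have nx : ~ D x by move=> h; apply: Dx; exact: mem_set.
  by rewrite (psiN nx) (wN nx) !(mul0r, mulr0, addr0).
have [/set_mem Dy|/negP Dy] := boolP (y \in D); last first.
  have ny : ~ D y by move=> h; apply: Dy; exact: mem_set.
  by rewrite (psiN ny) (wN ny) !(mul0r, mulr0, addr0).
rewrite !mul1r.
have ex := psiE Dx; have ey := psiE Dy; have wx := wD Dx; have wy := wD Dy.
have px := psi0 x; have py := psi0 y.
exact: (ground_state_pointwise wx wy px py ex ey).
Qed.

(** Here [psi = phi^2 / w]. Integrating [super] against [psi] gives [J + H <= A], and the pointwise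
    AM-GM inequality, symmetrized, gives [2 A <= G + 2 J]. As [J] is finite it cancels and
    [2 H <= G] remains. Since [super] is only asked where [psi] is nonzero, the regularization may
    depend on the support of [phi]. *)
Lemma ground_state :
  (2%:E * \int[m]_(x in D) (V x * phi x ^+ 2)%:E <=
   \int[m \x m]_(z in D `*` D) ((phi z.1 - phi z.2) ^+ 2 * k z)%:E)%E.
Proof.
have mE (f : T * T -> R) : measurable_fun [set: T * T] f -> measurable_fun [set: T * T] (fun z => (f z)%:E).
  exact: measurable_EFin_comp.
have pE (f : T * T -> R) : (forall z, 0 <= f z) -> forall z, [set: T * T] z -> (0 <= (f z)%:E)%E.
  by move=> f0 z _; rewrite lee_fin.
have -> : (\int[m \x m]_(z in D `*` D) ((phi z.1 - phi z.2) ^+ 2 * k z)%:E =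
    \int[m \x m]_z (G z)%:E)%E.
  rewrite integral_mkcond; apply: eq_integral => -[x y] _; rewrite /patch /G /ind /=.
  have -> : ((x, y) \in D `*` D) = (x \in D) && (y \in D) by rewrite in_setX.
  by case: (x \in D); case: (y \in D); rewrite /= ?(mul1r, mul0r).
have intA : (\int[m \x m]_z (A z)%:E + \int[m \x m]_z (A z)%:E <=
    \int[m \x m]_z (G z)%:E + \int[m \x m]_z (J z)%:E + \int[m \x m]_z (J z)%:E)%E.
  rewrite -[X in (X + _ <= _)%E](swap mA A0) -[X in (_ <= _ + X)%E](swap mJ J0) addeC.
  have eA : (\int[m \x m]_z (A (z.2, z.1))%:E = \int[m \x m]_z (A' z)%:E)%E.
    by apply: eq_integral => -[x y] _; rewrite /A /A' /= (ksym y x).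
  have eJ : (\int[m \x m]_z (J (z.2, z.1))%:E = \int[m \x m]_z (J' z)%:E)%E.
    by apply: eq_integral => -[x y] _; rewrite /J /J' /= (ksym y x).
  rewrite eA eJ.
  rewrite -(ge0_integralD (m \x m)%E measurableT (pE _ A0) (mE _ mA) (pE _ A'0) (mE _ mA')).
  rewrite -(ge0_integralD (m \x m)%E measurableT (pE _ G0) (mE _ mG) (pE _ J0) (mE _ mJ)).
  rewrite -(ge0_integralD (m \x m)%E measurableT _ _ (pE _ J'0) (mE _ mJ')); last 2 first.
  - by move=> z _; rewrite -EFinD lee_fin addr_ge0.
  - by apply: emeasurable_funD; exact: mE.
  apply: ge0_le_integral => //.
  - by move=> z _; rewrite -EFinD lee_fin addr_ge0.
  - by apply: emeasurable_funD; exact: mE.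
  - by apply: emeasurable_funD; [apply: emeasurable_funD|]; exact: mE.
  - by move=> z _; rewrite -!EFinD lee_fin; exact: pointwise.
pose H := (\int[m]_(x in D) (V x * phi x ^+ 2)%:E)%E.
have H0 : (0 <= H)%E by apply: integral_ge0 => x _; rewrite lee_fin mulr_ge0 ?sqr_ge0.
have JH : (\int[m \x m]_z (J z)%:E + H <= \int[m \x m]_z (A z)%:E)%E.
  have HE : H = (\int[m]_x (psi x * (V x * w x))%:E)%E.
    rewrite /H integral_mkcond; apply: eq_integral => x _; rewrite /patch.
    case: ifPn => [/set_mem Dx|/negP Dx]; first by rewrite (psiE Dx); congr EFin; ring.
    by rewrite psiN ?mul0r// => h; apply: Dx; exact: mem_set.
  have mkx x : measurable_fun [set: T] (fun y => k (x, y)).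
    by apply: (measurableT_comp mk); apply: measurable_fun_pair.
  have mH : measurable_fun [set: T] (fun x => (psi x * (V x * w x))%:E).
    by apply: measurable_EFin_comp; apply: measurable_funM => //; exact: measurable_funM.
  have pH x : [set: T] x -> (0 <= (psi x * (V x * w x))%:E)%E.
    by move=> _; rewrite lee_fin !mulr_ge0.
  rewrite (@fubini_tonelli1 _ _ _ _ _ m m _ (mE _ mJ) (fun z => pE _ J0 z I)).
  rewrite (@fubini_tonelli1 _ _ _ _ _ m m _ (mE _ mA) (fun z => pE _ A0 z I)).
  have mFJ := @measurable_fun_fubini_tonelli_F _ _ _ _ _ m _ (mE _ mJ) (fun z => pE _ J0 z I).
  have mFA := @measurable_fun_fubini_tonelli_F _ _ _ _ _ m _ (mE _ mA) (fun z => pE _ A0 z I).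
  have pFJ x : [set: T] x -> (0 <= fubini_F m (fun z => (J z)%:E) x)%E.
    by move=> _; apply: integral_ge0 => y _; rewrite lee_fin.
  rewrite HE -(ge0_integralD m measurableT pFJ mFJ pH mH).
  apply: ge0_le_integral => //.
  - by move=> x xT; apply: adde_ge0; [exact: pFJ|exact: pH].
  - exact: emeasurable_funD.
  move=> x _; rewrite /fubini_F.
  have [px|px] := eqVneq (psi x) 0.
    rewrite px mul0r adde0 (eq_integral (cst 0%E)) ?integral0; last first.
      by move=> y _; rewrite /J/= px !mul0r.
    by apply: integral_ge0 => y _; rewrite lee_fin.
  have px0 : (0 <= (psi x)%:E)%E by rewrite lee_fin.
  have -> : (\int[m]_y (J (x, y))%:E = (psi x)%:E * \int[m]_y (w y * k (x, y))%:E)%E.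
    rewrite -(ge0_integralZl m measurableT _ _ px0).
    - by apply: eq_integral => y _; rewrite /J/= -mulrA.
    - by apply: measurable_EFin_comp; exact: measurable_funM.
    - by move=> y _; rewrite lee_fin mulr_ge0.
  have -> : (\int[m]_y (A (x, y))%:E =
      (psi x)%:E * \int[m]_y ((if y \in D then w x else 0) * k (x, y))%:E)%E.
    rewrite -(ge0_integralZl m measurableT _ _ px0).
    - apply: eq_integral => y _; rewrite -EFinM /A /ind/=; congr EFin.
      by case: ifP => _; ring.
    - apply: measurable_EFin_comp; apply: measurable_funM => //.
      rewrite (_ : (fun y => _) = (fun y => ind y * w x)); first exact: measurable_funM.
      by apply/funext => y; rewrite /ind; case: ifP; rewrite ?mul1r ?mul0r.
    - by move=> y _; rewrite lee_fin mulr_ge0//; case: ifP.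
  by rewrite (EFinM (psi x)) -ge0_muleDr ?lee_fin ?mulr_ge0//;
    [apply: lee_wpmul2l => //; exact: super|apply: integral_ge0 => y _; rewrite lee_fin mulr_ge0].
have Jfin : (\int[m \x m]_z (J z)%:E)%E \is a fin_num.
  by rewrite ge0_fin_numE//; apply: integral_ge0 => z _; rewrite lee_fin.
have G_ge0 : (0 <= \int[m \x m]_z (G z)%:E)%E by apply: integral_ge0 => z _; rewrite lee_fin.
move: intA JH Jfin H0 G_ge0; rewrite -/H.
move: (\int[m \x m]_z (G z)%:E)%E (\int[m \x m]_z (A z)%:E)%E (\int[m \x m]_z (J z)%:E)%E H.
move=> [g| |] [a| |] [j| |] [h| |]//=; rewrite -?EFinM -?EFinD ?lee_fin ?leey//; lra.
Qed.

End ground_state.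

(** * Density of test functions *)

Section approximation.
Context {R : realType}.

(** Weighted Young inequality: the coefficient of [b^2] can be arbitrarily close to 1, so the
    approximation argument does not spoil the constant. *)
Lemma sqr_split (eta a b : R) : 0 < eta -> a ^+ 2 <= (1 + eta) * b ^+ 2 + (1 + eta^-1) * (a - b) ^+ 2.
Proof.
move=> e0; pose c := a - b; have -> : a = b + c by rewrite /c addrC subrK.
rewrite (_ : b + c - b = c); last by ring.
have : 0 <= eta * (b - eta^-1 * c) ^+ 2 by rewrite mulr_ge0 ?sqr_ge0// ltW.
have -> : eta * (b - eta^-1 * c) ^+ 2 = eta * b ^+ 2 - 2 * (b * c) + eta^-1 * c ^+ 2.
  by field; rewrite gt_eqF.
lra.
Qed.

Lemma integral_sqr_split d (T : measurableType d) (m : {measure set T -> \bar R}) (D : set T)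
    (f g W : T -> R) (eta : R) : measurable D -> 0 < eta ->
  measurable_fun D f -> measurable_fun D g -> measurable_fun D W -> (forall x, D x -> 0 <= W x) ->
  (\int[m]_(x in D) (f x ^+ 2 * W x)%:E <= (1 + eta)%:E * \int[m]_(x in D) (g x ^+ 2 * W x)%:E +
    (1 + eta^-1)%:E * \int[m]_(x in D) ((g x - f x) ^+ 2 * W x)%:E)%E.
Proof.
move=> mD e0 mf mg mW W0.
have mm (v : T -> R) : measurable_fun D v -> measurable_fun D (fun x => (v x ^+ 2 * W x)%:E).
  by move=> mv; apply: measurable_EFin_comp; apply: measurable_funM => //; exact: measurable_funX.
have pp (v : T -> R) x : D x -> (0 <= (v x ^+ 2 * W x)%:E)%E.
  by move=> Dx; rewrite lee_fin mulr_ge0 ?sqr_ge0 ?W0.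
have mgf : measurable_fun D (fun x => g x - f x) by exact: measurable_funB.
have c1 : (0 <= (1 + eta)%:E)%E by rewrite lee_fin addr_ge0// ltW.
have c2 : (0 <= (1 + eta^-1)%:E)%E by rewrite lee_fin addr_ge0// invr_ge0 ltW.
rewrite -(ge0_integralZl m mD (mm _ mg) (pp g) c1).
rewrite -(ge0_integralZl m mD (mm _ mgf) (pp (fun x => g x - f x)) c2).
rewrite -(ge0_integralD m mD); last 4 first.
- by move=> x Dx; apply: mule_ge0 => //; exact: (pp g).
- by apply: measurable_funeM; exact: mm.
- by move=> x Dx; apply: mule_ge0 => //; exact: (pp (fun x => g x - f x)).
- by apply: measurable_funeM; exact: mm.
apply: ge0_le_integral => //.
- exact: pp.
- exact: mm.
- by apply: emeasurable_funD; apply: measurable_funeM; exact: mm.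
move=> x Dx; rewrite -!EFinM -EFinD lee_fin [X in _ <= X + _]mulrA [X in _ <= _ + X]mulrA -mulrDl; apply: ler_wpM2r; first exact: W0.
apply: le_trans (sqr_split (f x) (g x) e0) _; rewrite lerD2l.
by rewrite (_ : (f x - g x) ^+ 2 = (g x - f x) ^+ 2)//; ring.
Qed.

Section density.
Variables (N : nat) (s h : R) (Omega : set 'rV[R]_N).
Hypotheses (mO : measurable Omega) (h0 : 0 <= h) (c0 : 0 <= c_const N s)
  (mb : measurable_fun [set: 'rV[R]_N] (bdist Omega)).
Hypothesis test_ineq : forall phi, test_fun Omega phi -> measurable_fun [set: 'rV[R]_N] phi /\
  (h%:E * hardy_term s Omega phi <= seminorm s Omega phi)%E.
Local Notation mu := (@lebesgue_rV R N).

(** Closeness in the [H^s] norm does not by itself control the singular Hardy weight. Truncated at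
    [M], the weighted term is controlled by the [L^2] norm, and [M] tends to infinity by monotone
    convergence in [hardy_H0s]. *)
Let Wt (M : nat) (x : 'rV[R]_N) : R := Num.min (bdist Omega x `^ (- (2 * s))) M%:R.
Let mWt M : measurable_fun Omega (Wt M).
Proof.
by apply: measurable_funTS; apply: measurable_minr => //; exact: measurable_powR_comp.
Qed.
Let Wt0 M x : 0 <= Wt M x. Proof. by rewrite /Wt le_min powR_ge0 ler0n. Qed.
Let WtM M x : Wt M x <= M%:R. Proof. by rewrite /Wt ge_min lexx orbT. Qed.
Let Ht M u := (\int[mu]_(x in Omega) ((u x) ^+ 2 * Wt M x)%:E)%E.

Lemma seminormE u : (seminorm s Omega u = (c_const N s / 2)%:E *
  \int[mu \x mu]_(z in Omega `*` Omega) ((u z.1 - u z.2) ^+ 2 * enorm (z.1 - z.2) `^ (- (N%:R + 2 * s)))%:E)%E.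
Proof. by congr (_ * _)%E; apply: eq_integral => z _; rewrite powRN. Qed.

Lemma seminorm_ge0 u : (0 <= seminorm s Omega u)%E.
Proof.
rewrite seminormE mule_ge0//; first by rewrite lee_fin divr_ge0.
by apply: integral_ge0 => z _; rewrite lee_fin mulr_ge0 ?sqr_ge0 ?powR_ge0.
Qed.

Lemma hardy_ge0 u : (0 <= hardy_term s Omega u)%E.
Proof. by apply: integral_ge0 => x _; rewrite lee_fin mulr_ge0 ?sqr_ge0 ?powR_ge0. Qed.

Lemma sqnorm_L2_ge0 (u : 'rV[R]_N -> R) : (0 <= sqnorm_L2 Omega u)%E.
Proof. by apply: integral_ge0 => x _; rewrite lee_fin sqr_ge0. Qed.

Lemma measurable_diff (u : 'rV[R]_N -> R) : measurable_fun Omega u ->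
  measurable_fun (Omega `*` Omega) (fun z => u z.1 - u z.2).
Proof.
move=> mu_; apply: measurable_funB.
- by apply: (measurable_comp mO _ mu_) => //; [move=> _ [z [Oz _] <-]|exact: measurable_funTS].
- by apply: (measurable_comp mO _ mu_) => //; [move=> _ [z [_ Oz] <-]|exact: measurable_funTS].
Qed.

Lemma measurable_inv_dist a : measurable_fun (Omega `*` Omega) (fun z => enorm (z.1 - z.2) `^ a).
Proof.
apply: measurable_funTS; apply: measurable_powR_comp; apply: measurable_enorm.
by apply: measurable_rVB; [exact: measurable_fst|exact: measurable_snd].
Qed.

Lemma in_Hs_seminorm u : in_Hs s Omega u -> (seminorm s Omega u < +oo)%E.
Proof.
move=> [_ [_ fin]]; rewrite seminormE.
rewrite (_ : (\int[_]_(z in _) _ = \int[(mu \x mu)%E]_(z in Omega `*` Omega) (((u z.1 - u z.2) * enorm (z.1 - z.2) `^ (- ((N%:R + 2 * s) / 2))) ^+ 2)%:E)%E).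
  by rewrite lte_mul_pinfty// lee_fin divr_ge0.
apply: eq_integral => z _; rewrite exprMn -(@powR_mulrn _ (enorm _ `^ _)) ?powR_ge0//.
by rewrite -powRrM; congr (_ * _ `^ _)%:E; field.
Qed.

Lemma truncated_hardy M u : in_H0s s Omega u -> (h%:E * Ht M u <= seminorm s Omega u)%E.
Proof.
move=> [Hsu approx]; have Sfin := in_Hs_seminorm Hsu; have S0 := seminorm_ge0 u.
have mu_ : measurable_fun Omega u by case: Hsu => -[].
have [sg sgE] : exists sg, seminorm s Omega u = sg%:E.
  by exists (fine (seminorm s Omega u)); rewrite fineK// ge0_fin_numE.
rewrite sgE in S0 *; rewrite lee_fin in S0.
apply/lee_addgt0Pr => zeta z0; rewrite -EFinD.
(* Makes [(1 + eta)^2 sg] exceed [sg] by at most [zeta/2]. *)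
pose eta := Num.min 1 (zeta / (6 * (sg + 1))).
have e0 : 0 < eta by rewrite lt_min ltr01/=; pos.
have e1 : eta <= 1 by rewrite ge_min lexx.
have ez : 3 * eta * sg <= zeta / 2.
  have : eta <= zeta / (6 * (sg + 1)) by rewrite ge_min lexx orbT.
  have s1 : 0 < 6 * (sg + 1) by pos.
  by rewrite ler_pdivlMr// => hh; nra.
(* [K] is the total coefficient of [eps^2] in the final bound; [eps] is then tuned to
   [K eps^2 = zeta/2]. *)
pose K := (1 + eta) * (1 + eta^-1) + h * (1 + eta^-1) * M%:R.
have ei : 0 < eta^-1 by rewrite invr_gt0.
have K0 : 0 < K by rewrite ltr_pwDl//; [pos|pos].
pose eps := Num.sqrt (zeta / (2 * K)).
have eps0 : 0 < eps by rewrite sqrtr_gt0; pos.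
have Keps : K * eps ^+ 2 = zeta / 2 by rewrite sqr_sqrtr; [field; rewrite gt_eqF|pos].
have [phi tphi hphi] := approx eps eps0.
have [mphi ineq] := test_ineq tphi.
have mphiO : measurable_fun Omega phi by exact: measurable_funTS.
have [L2e Se] : (sqnorm_L2 Omega (u \- phi)%R <= (eps ^+ 2)%:E)%E /\ (seminorm s Omega (u \- phi)%R <= (eps ^+ 2)%:E)%E.
  split; apply: le_trans (ltW hphi); rewrite /sqnorm_Hs.
    by rewrite leeDl// seminorm_ge0.
  by rewrite leeDr// sqnorm_L2_ge0.
have Sphi : (seminorm s Omega phi <= ((1 + eta) * sg + (1 + eta^-1) * eps ^+ 2)%:E)%E.
  have := @integral_sqr_split _ _ (mu \x mu)%E (Omega `*` Omega) (fun z => phi z.1 - phi z.2)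
    (fun z => u z.1 - u z.2) (fun z => enorm (z.1 - z.2) `^ (- (N%:R + 2 * s))) eta
    (measurableX mO mO) e0 (measurable_diff mphiO) (measurable_diff mu_) (measurable_inv_dist _)
    (fun z _ => powR_ge0 _ _).
  have c2 : (0 <= (c_const N s / 2)%:E)%E by rewrite lee_fin divr_ge0.
  move=> /(lee_wpmul2l c2); rewrite -seminormE => /le_trans; apply.
  have i0 v : (0 <= \int[mu \x mu]_(z in Omega `*` Omega) ((v z) ^+ 2 * enorm (z.1 - z.2) `^ (- (N%:R + 2 * s)))%:E)%E.
    by apply: integral_ge0 => z _; rewrite lee_fin mulr_ge0 ?sqr_ge0 ?powR_ge0.
  have a0 : (0 <= (1 + eta)%:E)%E by rewrite lee_fin addr_ge0// ltW.
  have a1 : (0 <= (1 + eta^-1)%:E)%E by rewrite lee_fin addr_ge0// ltW.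
  rewrite ge0_muleDr; [|by apply: mule_ge0|by apply: mule_ge0].
  rewrite (EFinD ((1 + eta) * sg)) (EFinM (1 + eta)) (EFinM (1 + eta^-1)); apply: leeD; rewrite muleCA; apply: lee_wpmul2l => //.
    by rewrite -seminormE sgE.
  apply: le_trans Se; rewrite seminormE; apply: lee_wpmul2l => //.
  rewrite le_eqVlt; apply/orP; left; apply/eqP; apply: eq_integral => z _ /=.
  by congr (_ * _)%:E; ring.
have Htphi : (h%:E * Ht M phi <= seminorm s Omega phi)%E.
  apply: le_trans ineq; apply: lee_wpmul2l; first by rewrite lee_fin.
  apply: ge0_le_integral => //.
  - by move=> x _; rewrite lee_fin mulr_ge0 ?sqr_ge0.
  - by apply: measurable_EFin_comp; apply: measurable_funM => //; exact: measurable_funX.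
  - apply: measurable_EFin_comp; apply: measurable_funM; first exact: measurable_funX.
    by apply: measurable_funTS; exact: measurable_powR_comp.
  - by move=> x _; rewrite lee_fin ler_wpM2l ?sqr_ge0// ge_min lexx.
have err : (\int[mu]_(x in Omega) ((phi x - u x) ^+ 2 * Wt M x)%:E <= (M%:R * eps ^+ 2)%:E)%E.
  rewrite EFinM; apply: (@le_trans _ _ (M%:R%:E * sqnorm_L2 Omega (u \- phi)%R)%E); last first.
    by apply: lee_wpmul2l; rewrite ?lee_fin.
  have mup : measurable_fun Omega (u \- phi) by exact: measurable_funB.
  have M0 : (0 <= (M%:R : R)%:E)%E by rewrite lee_fin.
  rewrite /sqnorm_L2 -(ge0_integralZl mu mO _ _ M0); last 2 first.
  - by apply: measurable_EFin_comp; exact: measurable_funX.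
  - by move=> x _; rewrite lee_fin sqr_ge0.
  apply: ge0_le_integral => //.
  - by move=> x _; rewrite lee_fin mulr_ge0 ?sqr_ge0.
  - apply: measurable_EFin_comp; apply: measurable_funM => //; apply: measurable_funX.
    exact: measurable_funB.
  - by apply: measurable_funeM; apply: measurable_EFin_comp; exact: measurable_funX.
  - move=> x _; rewrite -EFinM lee_fin mulrC; apply: ler_pM => //; first exact: sqr_ge0.
    by rewrite /= le_eqVlt; apply/orP; left; apply/eqP; ring.
have split := @integral_sqr_split _ _ mu Omega u phi (Wt M) eta mO e0 mu_ mphiO (mWt M) (fun x _ => Wt0 M x).
have hE0 : (0 <= h%:E)%E by rewrite lee_fin.
apply: le_trans (lee_wpmul2l hE0 split) _.
have Hp0 : (0 <= Ht M phi)%E by apply: integral_ge0 => x _; rewrite lee_fin mulr_ge0 ?sqr_ge0.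
have I0 : (0 <= \int[mu]_(x in Omega) ((phi x - u x) ^+ 2 * Wt M x)%:E)%E.
  by apply: integral_ge0 => x _; rewrite lee_fin mulr_ge0 ?sqr_ge0.
have a0 : (0 <= (1 + eta)%:E)%E by rewrite lee_fin addr_ge0// ltW.
have a1 : (0 <= (1 + eta^-1)%:E)%E by rewrite lee_fin addr_ge0// ltW.
rewrite ge0_muleDr; [|by apply: mule_ge0|by apply: mule_ge0].
apply: (@le_trans _ _ (((1 + eta) * ((1 + eta) * sg + (1 + eta^-1) * eps ^+ 2))%:E +
   (h * ((1 + eta^-1) * (M%:R * eps ^+ 2)))%:E)%E).
  apply: leeD.
    by rewrite muleCA (EFinM (1 + eta)); apply: lee_wpmul2l => //; exact: le_trans Htphi Sphi.
  by rewrite (EFinM h) (EFinM (1 + eta^-1)); do 2 apply: lee_wpmul2l => //.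
rewrite -EFinD lee_fin.
rewrite [leLHS](_ : _ = (1 + eta) ^+ 2 * sg + K * eps ^+ 2); last by rewrite /K; ring.
have e2 : eta ^+ 2 <= eta by rewrite expr2 ler_piMl// ltW.
have : (1 + eta) ^+ 2 * sg <= (1 + 3 * eta) * sg.
  by apply: ler_wpM2r => //; lra.
by rewrite Keps; lra.
Qed.

Lemma hardy_H0s u : in_H0s s Omega u -> (h%:E * hardy_term s Omega u <= seminorm s Omega u)%E.
Proof.
move=> Hu; have [hE|hn] := eqVneq h 0; first by rewrite hE mul0e seminorm_ge0.
have h_gt0 : 0 < h by rewrite lt_def hn.
have mu_ : measurable_fun Omega u by case: Hu => -[[]].
rewrite -lee_pdivlMl//.
have hM M : (Ht M u <= (h^-1)%:E * seminorm s Omega u)%E by rewrite lee_pdivlMl//; exact: truncated_hardy.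
have mg M : measurable_fun Omega (fun x => ((u x) ^+ 2 * Wt M x)%:E).
  by apply: measurable_EFin_comp; apply: measurable_funM => //; exact: measurable_funX.
have g0 M x : Omega x -> (0 <= ((u x) ^+ 2 * Wt M x)%:E)%E.
  by move=> _; rewrite lee_fin mulr_ge0 ?sqr_ge0.
have nd x : Omega x -> {homo (fun M : nat => ((u x) ^+ 2 * Wt M x)%:E) : a b / (a <= b)%N >-> (a <= b)%E}.
  move=> _ a b ab; rewrite lee_fin ler_wpM2l ?sqr_ge0// le_min ge_min lexx/=.
  by rewrite ge_min ler_nat ab orbT.
have := @cvg_monotone_convergence _ _ _ mu Omega mO _ mg g0 nd.
have -> : (\int[mu]_(x in Omega) limn (fun M => ((u x) ^+ 2 * Wt M x)%:E) = hardy_term s Omega u)%E.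
  apply: eq_integral => x _; apply/cvg_lim => //.
  apply: cvg_near_cst; near=> M; congr EFin; congr (_ * _); apply/min_idPl.
  near: M; exists (Num.truncn (bdist Omega x `^ (- (2 * s)))).+1 => // M /= hM'.
  by apply: (le_trans (ltW (truncnS_gt _))); rewrite ler_nat.
move=> hc; rewrite -(cvg_lim _ hc)//; apply: lime_le; first by apply/cvg_ex; exists (hardy_term s Omega u).
by apply: nearW => M; exact: hM.
Unshelve. all: by end_near.
Qed.

(** The Hardy inequality also shows that the subtracted term is finite, which makes the sign of the
    extended-real difference meaningful. *)
Lemma lambda_star_ge0 : h = hardy_const N s -> (0 <= lambda_star s Omega)%E.
Proof.
move=> hE; apply: le_ereal_inf_tmp => _ [u [Hu _] <-]; rewrite /rayleigh -hE.
apply: mule_ge0; last by rewrite inve_ge0 sqnorm_L2_ge0.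
have Hs := Hu.1; have Sfin := in_Hs_seminorm Hs.
have hh := hardy_H0s Hu.
rewrite sube_ge0//.
rewrite ge0_fin_numE ?(le_lt_trans hh)//.
by apply: mule_ge0; rewrite ?lee_fin// hardy_ge0.
Qed.

End density.
End approximation.

(** * The Hardy inequality for small t *)

Section hardy.
Context {R : realType}.

Lemma continuous_measurable_rV n (f : 'rV[R]_n -> R) : continuous f -> measurable_fun [set: 'rV[R]_n] f.
Proof.
move=> cf; apply: (measurability _ (RGenOInfty.measurableE R)).
move=> /= _ [_ [a ->]] <-; rewrite setTI; apply: open_measurable_rV.
by apply: open_comp => [x _|]; [exact: cf|exact: interval_open].
Qed.

Lemma test_fun_continuous n (Omega : set 'rV[R]_n) phi : test_fun Omega phi -> continuous phi.
Proof. by move=> [sm _ _] x; apply: differentiable_continuous; exact: (sm [::] x). Qed.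

Lemma test_fun_bounded n (Omega : set 'rV[R]_n) phi : test_fun Omega phi ->
  exists2 M : R, 0 < M & forall x, `|phi x| <= M.
Proof.
move=> tphi; have cphi := test_fun_continuous tphi; have [_ cs _] := tphi.
set S := closure _ in cs.
have phiN x : ~ S x -> phi x = 0.
  by move=> nS; apply: contrapT => /eqP nz; apply: nS; exact: subset_closure.
have [S0|/set0P/negP/negPn/eqP S0] := pselect (S !=set0); last first.
  by exists 1 => // x; rewrite phiN ?normr0// S0.
have cf : {within S, continuous (fun x => `|phi x|)}.
  by apply: continuous_subspaceT => x; apply: continuous_comp; [exact: cphi|exact: norm_continuous].
have [c _ hc] := compact_EVT_max S0 cs cf.
exists (`|phi c| + 1); first by rewrite ltr_wpDl.
move=> x; have [Sx|nS] := pselect (S x); last by rewrite phiN// normr0 addr_ge0.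
by rewrite ler_wpDr//; apply: hc; rewrite inE.
Qed.

Lemma test_fun_depth n (Omega : set 'rV[R]_n.+1) phi : open Omega -> bounded_set Omega ->
  Omega !=set0 -> test_fun Omega phi ->
  exists2 eps : R, 0 < eps & forall x, phi x != 0 -> Omega x /\ eps <= bdist Omega x.
Proof.
move=> oO bO neO [_ cs sO]; set S := closure _ in cs sO.
have b0 := boundary_nonempty oO bO neO.
have inS x : phi x != 0 -> S x by move=> h; exact: subset_closure.
have [S0|/set0P/negP/negPn/eqP S0] := pselect (S !=set0); last first.
  by exists 1 => // x /inS; rewrite S0.
have cf : {within S, continuous (bdist Omega)}.
  by apply: continuous_subspaceT; apply: (@lipschitz_continuous _ _ _ 1) => //; exact: bdist_lipschitz.
have [c + hc] := compact_EVT_min S0 cs cf; rewrite inE => Sc.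
exists (bdist Omega c); first by apply: bdist_gt0 => //; exact: sO.
by move=> x /inS Sx; split; [exact: sO|apply: hc; rewrite inE].
Qed.

(** Identifies the constant produced by the integrals with the closed form of the statement. *)
Lemma kappaE n (t : R) : kappa n.+1 (2^-1 + t) = kap n t.
Proof.
have e1 : (1 + 2 * (2^-1 + t)) / 2 = 1 + t by field.
have e2 : (n.+1%:R + 2 * (2^-1 + t)) / 2 = n%:R / 2 + (1 + t) by rewrite -natr1; field.
have e3 : 1 - (2^-1 + t) = 2^-1 - t by field.
have e4 : 2 * (2^-1 + t) = 1 + 2 * t by field.
have e5 : (n.+1%:R - 1) / 2 = n%:R / 2 :> R by rewrite -natr1 addrK.
rewrite /kappa e1 e2 e3 e5 e4 (_ : 1 - (1 + 2 * t) = - (2 * t)); last by ring.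
rewrite -!GamE /kap /Acst /gam (_ : n%:R / 2 + (1 + t) - n%:R / 2 = 1 + t); last by ring.
by rewrite [pi `^ _ * (_ / _)]mulrA [RHS]mulrA [RHS]mulrAC.
Qed.

Lemma c_const_gt0 n (t : R) : 0 < t < 2^-1 -> 0 < c_const n.+1 (2^-1 + t).
Proof.
move=> t01; rewrite /c_const -!GamE; have n0 : 0 < n.+1%:R :> R by rewrite ltr0n.
apply: mulr_gt0; last by apply: divr_gt0; apply: Gamma_gt0; lra.
by apply: mulr_gt0; [apply: mulr_gt0; apply: powR_gt0; rewrite ?pi_gt0|lra].
Qed.

Section test.
Variables (n : nat) (Omega : set 'rV[R]_n.+1) (t rho : R) (phi : 'rV[R]_n.+1 -> R).
Hypotheses (oO : open Omega) (bO : bounded_set Omega) (neO : Omega !=set0)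
  (t01 : 0 < t <= 16^-1) (rho01 : 0 < rho <= 1) (tphi : test_fun Omega phi).
Hypothesis super : forall eps, 0 < eps -> exists2 e : R, 0 < e &
  forall x, Omega x -> eps <= bdist Omega x -> supersolution Omega t rho e x.
Local Notation mu := (@lebesgue_rV R n.+1).

Lemma test_hardy_aux :
  (2%:E * \int[mu]_(x in Omega) (kap n t * bdist Omega x `^ (- 1 - 2 * t) * phi x ^+ 2)%:E <=
   \int[mu \x mu]_(z in Omega `*` Omega)
     ((phi z.1 - phi z.2) ^+ 2 * enorm (z.1 - z.2) `^ (- (n.+1%:R + 2 * (2^-1 + t))))%:E)%E.
Proof.
have b0 := boundary_nonempty oO bO neO.
have mO : measurable Omega by exact: open_measurable_rV.
have t4 : 0 < t <= 4^-1 by move: t01; lra.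
have t8 : 0 < t < 8^-1 by move: t01; lra.
have mphi : measurable_fun [set: 'rV[R]_n.+1] phi.
  by apply: continuous_measurable_rV; exact: (test_fun_continuous tphi).
have [M M0 phiM] := test_fun_bounded tphi.
have [eps eps0 heps] := test_fun_depth oO bO neO tphi.
have [e e0 he] := super eps0.
pose w := weight Omega t rho.
have w0 x : 0 <= w x by exact: weight_ge0.
have mw : measurable_fun [set: 'rV[R]_n.+1] w by exact: measurable_weight.
(* The inverse of [w] is written as a power, so that measurability comes from that of [powR]. *)
pose psi x := if x \in Omega then phi x ^+ 2 * w x `^ (- 1) else 0.
have mpsi : measurable_fun [set: 'rV[R]_n.+1] psi.
  apply: measurable_if_in => //; apply: measurable_funM; first exact: measurable_funX.
  exact: measurable_powR_comp.
have psi0 x : 0 <= psi x by rewrite /psi; case: ifP => // _; rewrite mulr_ge0 ?sqr_ge0 ?powR_ge0.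
have psiN x : ~ Omega x -> psi x = 0 by move=> nO; rewrite /psi memNset.
have wN x : ~ Omega x -> w x = 0 by move=> nO; rewrite /w /weight memNset.
have wD x : Omega x -> 0 < w x by exact: weight_gt0.
have psiE x : Omega x -> phi x ^+ 2 = psi x * w x.
  move=> Ox; rewrite /psi mem_set// powR_inv1// mulfVK// gt_eqF//; exact: wD.
have psiZ x : psi x != 0 -> phi x != 0.
  by rewrite /psi; apply: contra_neq => ->; rewrite expr0n mul0r; case: ifP.
pose p := n%:R / 2 + (1 + t).
have p0 : 0 < p by rewrite /p; move: t4 => /andP[? _]; pos.
pose k (z : 'rV[R]_n.+1 * 'rV[R]_n.+1) := rkern t e z.1 z.2.
have mk : measurable_fun [set: 'rV[R]_n.+1 * 'rV[R]_n.+1] k.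
  apply: measurable_powR_comp; apply: measurable_funD => //.
  by apply: measurable_dotv; apply: measurable_rVB; [exact: measurable_snd|exact: measurable_fst|exact: measurable_snd|exact: measurable_fst].
have k0 z : 0 <= k z by exact: powR_ge0.
have ksym x y : k (x, y) = k (y, x).
  by rewrite /k /rkern/= -enorm_sqr enormB enorm_sqr.
pose V x := kap n t * bdist Omega x `^ (- 1 - 2 * t).
have kap0 : 0 <= kap n t.
  by apply: mulr_ge0; [apply: ltW; apply: Acst_gt0; rewrite -/p ltrDl; move: t4; lra|have /andP[] := gam_le t8].
have mV : measurable_fun [set: 'rV[R]_n.+1] V.
  by apply: measurable_funM => //; apply: measurable_powR_comp; exact: measurable_bdist.
have V0 x : 0 <= V x by rewrite mulr_ge0 ?powR_ge0.
have hsuper x : psi x != 0 -> (\int[mu]_y (w y * k (x, y))%:E + (V x * w x)%:E <=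
     \int[mu]_y ((if y \in Omega then w x else 0) * k (x, y))%:E)%E.
  by move=> /psiZ /heps[Ox ex]; exact: he.
have wmin0 : 0 < barrier t (Num.min eps rho).
  by apply: barrier_gt0; rewrite // lt_min eps0 ge_min; move: rho01 => /andP[-> ->]; rewrite orbT.
(* Bounds [psi z.1 * w z.2 * k z]: on the support of [phi] the weight is bounded below, and the
   regularized kernel never exceeds [e^(-p)]. This gives the finiteness that [ground_state]
   needs. *)
pose C := M ^+ 2 * (barrier t (Num.min eps rho))^-1 * e `^ (- p).
have C0 : 0 <= C by rewrite /C; pos.
have wb x : phi x != 0 -> Omega x /\ barrier t (Num.min eps rho) <= w x.
  move=> /heps[Ox ex]; split => //; rewrite /w /weight mem_set//.
  have /andP[r0 r1] := rho01.
  apply: barrier_mono; first by move: t01; lra.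
  - by rewrite le_min !ltW.
  - by rewrite le_min !ge_min ex lexx orbT.
  - by rewrite ge_min r1 orbT.
have fin : (\int[mu \x mu]_z (psi z.1 * w z.2 * k z)%:E < +oo)%E.
  have mOO : measurable (Omega `*` Omega) by exact: measurableX.
  apply: (@le_lt_trans _ _ (\int[mu \x mu]_(z in Omega `*` Omega) C%:E)%E); last first.
    rewrite integral_cst//= (product_measure1E mu mu mO mO); have := lebesgue_bounded mO bO => hfin.
    rewrite lte_mul_pinfty//; rewrite lte_mul_pinfty//.
    by rewrite ge0_fin_numE.
  rewrite [leRHS]integral_mkcond; apply: ge0_le_integral => //.
  - by move=> z _; rewrite lee_fin !mulr_ge0.
  - apply: measurable_EFin_comp; apply: measurable_funM => //.
    by apply: measurable_funM; apply: measurableT_comp.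
  - by apply/(measurable_restrictT _ mOO).
  move=> [x y] _; rewrite /patch /= in_setX.
  have [/set_mem Ox|/negP nx] := boolP (x \in Omega); last first.
    by rewrite psiN ?mul0r// => h; apply: nx; exact: mem_set.
  have [/set_mem Oy|/negP ny] := boolP (y \in Omega); last first.
    by rewrite (wN y) ?mulr0 ?mul0r//= => h; apply: ny; exact: mem_set.
  rewrite /= lee_fin.
  have [pz|pz] := eqVneq (phi x) 0.
    have -> : psi x = 0 by rewrite /psi pz expr0n mul0r; case: ifP.
    by rewrite !mul0r.
  have [_ wx] := wb x pz.
  have t_gt0 : 0 < t by case/andP: t01.
  have h1 : psi x * w y <= M ^+ 2 * (barrier t (Num.min eps rho))^-1.
    rewrite -[leRHS]mulr1; apply: ler_pM; [exact: psi0|exact: w0| |exact: weight_le1].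
    rewrite /psi (mem_set Ox) (powR_inv1 (w0 x)).
    apply: ler_pM; [exact: sqr_ge0|by rewrite invr_ge0| |].
      by rewrite -(real_normK (num_real _)) ler_sqr ?nnegrE// ltW.
    by rewrite lef_pV2 ?posrE// wD.
  rewrite /C; apply: (ler_pM (mulr_ge0 (psi0 x) (w0 y)) (k0 (x, y)) h1).
  rewrite /k /rkern -/p/=; apply: le0_ler_powR => //; first by rewrite oppr_le0 ltW.
  by rewrite lerDr sqn_ge0.
have gs := @ground_state R _ _ mu Omega k w psi phi V mO mk k0 ksym mw w0 wD wN mpsi psi0 psiN psiE
  mphi mV V0 hsuper fin.
apply: le_trans gs _.
have mphiO : measurable_fun Omega phi by exact: measurable_funTS.
have mdiff := measurable_diff mO mphiO.
apply: ge0_le_integral => //.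
- exact: measurableX.
- by move=> z _; rewrite lee_fin mulr_ge0 ?sqr_ge0.
- apply: measurable_EFin_comp; apply: measurable_funM; first exact: measurable_funX.
  exact: measurable_funTS.
- apply: measurable_EFin_comp; apply: measurable_funM; first exact: measurable_funX.
  exact: measurable_inv_dist.
move=> [x y] _ /=; rewrite lee_fin.
(* On the diagonal both sides vanish. Off it the regularized kernel is below the Gagliardo kernel,
   so [e] need not tend to 0. *)
have [->|xy] := eqVneq x y; first by rewrite subrr expr0n/= !mul0r.
apply: ler_wpM2l; first exact: sqr_ge0.
have en0 : 0 < enorm (x - y) by rewrite enorm_gt0 subr_eq0.
have -> : - (n.+1%:R + 2 * (2^-1 + t)) = 2%:R * - p by rewrite /p -natr1; field.
rewrite powRrM powR_mulrn ?enorm_ge0// enormB enorm_sqr /k /rkern -/p /=.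
have X0 : 0 < sqn (y - x) by rewrite -enorm_sqr enormB exprn_gt0.
by apply: le0_ler_powR => //; [rewrite oppr_le0 ltW|rewrite lerDl ltW].
Qed.

Lemma test_hardy : ((hardy_const n.+1 (2^-1 + t))%:E * hardy_term (2^-1 + t) Omega phi <=
  seminorm (2^-1 + t) Omega phi)%E.
Proof.
have mO : measurable Omega by exact: open_measurable_rV.
have t8 : 0 < t < 8^-1 by move: t01; lra.
have t2 : 0 < t < 2^-1 by move: t01; lra.
have c0 := c_const_gt0 n t2.
have kap0 : 0 <= kap n t.
  by apply: mulr_ge0; [apply: ltW; apply: Acst_gt0; rewrite ltrDl; move: t2; lra|have /andP[] := gam_le t8].
rewrite seminormE /hardy_const kappaE.
have c2 : (0 <= (c_const n.+1 (2^-1 + t) / 2)%:E)%E by rewrite lee_fin divr_ge0// ltW.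
apply: le_trans (lee_wpmul2l c2 test_hardy_aux).
rewrite muleA -EFinM divfK//.
have mphi : measurable_fun Omega phi.
  by apply: measurable_funTS; apply: continuous_measurable_rV; exact: (test_fun_continuous tphi).
rewrite EFinM -muleA; apply: lee_wpmul2l; first by rewrite lee_fin ltW.
have k0 : (0 <= (kap n t)%:E)%E by rewrite lee_fin.
rewrite /hardy_term -(ge0_integralZl mu mO _ _ k0); last 2 first.
- apply: measurable_EFin_comp; apply: measurable_funM; first exact: measurable_funX.
  by apply: measurable_funTS; apply: measurable_powR_comp; exact: measurable_bdist.
- by move=> x _; rewrite lee_fin mulr_ge0 ?sqr_ge0 ?powR_ge0.
rewrite le_eqVlt; apply/orP; left; apply/eqP; apply: eq_integral => x _.
rewrite -EFinM (_ : - (2 * (2^-1 + t)) = - 1 - 2 * t); last by field.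
by congr EFin; ring.
Qed.

End test.

Lemma lambda_star_nonneg n (Omega : set 'rV[R]_n.+1) : open Omega -> bounded_set Omega ->
  Omega !=set0 -> class_C11 Omega ->
  exists2 t0 : R, 0 < t0 <= 16^-1 & forall t, 0 < t < t0 -> (0 <= lambda_star (2^-1 + t) Omega)%E.
Proof.
move=> oO bO neO cO.
have [rho rho2 near] := super_near oO bO neO cO.
have [t1 t10 far] := super_far oO bO neO rho2.
exists (Num.min t1 16^-1); first by rewrite lt_min t10 invr_gt0 ltr0n ge_min lexx orbT.
move=> t /andP[t0]; rewrite lt_min => /andP[tt1 t16].
have t01 : 0 < t <= 16^-1 by rewrite t0 ltW.
have rho01 : 0 < rho <= 1 by lra.
have t2 : 0 < t < 2^-1 by lra.
have t8 : 0 < t < 8^-1 by lra.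
have mO : measurable Omega by exact: open_measurable_rV.
have c0 := c_const_gt0 n t2.
have h0 : 0 <= hardy_const n.+1 (2^-1 + t).
  rewrite /hardy_const kappaE; apply: mulr_ge0; first exact: ltW.
  by apply: mulr_ge0; [apply: ltW; apply: Acst_gt0; rewrite ltrDl; lra|have /andP[] := gam_le t8].
apply: (lambda_star_ge0 mO h0 (ltW c0) (measurable_bdist oO bO neO) _ erefl) => phi tphi.
split; first by apply: continuous_measurable_rV; exact: (test_fun_continuous tphi).
apply: (@test_hardy _ _ _ rho) => // eps eps0.
have [e0 e00 hnear] := near t eps t01 eps0.
have m0 : 0 < Num.min 1 e0 by rewrite lt_min ltr01.
(* Below 1 for the deep points and below [e0] for those near the boundary. *)
exists (Num.min 1 e0 / 2); first by rewrite divr_gt0.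
have hm : Num.min 1 e0 / 2 < Num.min 1 e0 by rewrite ltr_pdivrMr//; lra.
set e := _ / 2 in hm *; have e_gt0 : 0 < e by rewrite divr_gt0.
have ee0 : 0 < e < e0 by rewrite e_gt0 (lt_le_trans hm)// ge_min lexx orbT.
have e1 : 0 < e < 1 by rewrite e_gt0 (lt_le_trans hm)// ge_min lexx.
move=> x Ox ex; have [xr|rx] := leP (bdist Omega x) rho; first exact: hnear.
exact: (far t t01 tt1 e x e1 Ox (ltW rx)).
Qed.

End hardy.

(** * Measure of boundary strips *)

Section strip.
Context {R : realType}.
Local Notation mu := (@lebesgue_rV R).
Local Notation leb := (@lebesgue_measure R).

(** Tonelli with the vertical variable inside: over each point of the box the slice is an interval
    of length [h]. *)
Lemma lebesgue_graph_strip n (g : 'rV[R]_n -> R) (z0 : 'rV[R]_n) (h r : R) :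
  measurable_fun [set: 'rV[R]_n] g -> 0 <= h -> 0 < r ->
  (\int[mu n.+1]_u (if (0 < u ord0 ord0 - g (\row_j u ord0 (lift ord0 j)) <= h) &&
      ((\row_j u ord0 (lift ord0 j)) \in box z0 r) then 1 else 0)%:E <= (h * (2 * r) ^+ n)%:E)%E.
Proof.
move=> mg h0 r0.
pose rest (u : 'rV[R]_n.+1) : 'rV[R]_n := \row_j u ord0 (lift ord0 j).
have mrest : measurable_fun [set: 'rV[R]_n.+1] rest.
  apply: measurable_fun_rV => j; rewrite (_ : (fun _ => _) = (fun u : 'rV[R]_n.+1 => u ord0 (lift ord0 j))).
    exact: measurable_coord.
  by apply/funext => u; rewrite mxE.
pose f (u : 'rV[R]_n.+1) : R := if (0 < u ord0 ord0 - g (rest u) <= h) && (rest u \in box z0 r) then 1 else 0.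
have mf : measurable_fun [set: 'rV[R]_n.+1] (fun u => (f u)%:E).
  apply: measurable_EFin_comp; apply: measurable_fun_ifT => //.
  have mh : measurable_fun [set: 'rV[R]_n.+1] (fun u => u ord0 ord0 - g (rest u)).
    by apply: measurable_funB; [exact: measurable_coord|exact: (measurableT_comp mg)].
  apply: measurable_and.
    by apply: measurable_and; [exact: measurable_fun_ltr|exact: measurable_fun_ler].
  apply: (measurable_fun_bool true); rewrite setTI (_ : _ @^-1` _ = rest @^-1` box z0 r).
    by rewrite -[X in measurable X]setTI; apply: mrest => //; exact: measurable_box.
  by apply/seteqP; split => y /=; [exact: set_mem|exact: mem_set].
have f0 u : (0 <= (f u)%:E)%E by rewrite /f lee_fin; case: ifP.
have restE t z : rest (cons_rV (t, z)) = z by apply/rowP => j; rewrite mxE cons_rVS.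
change (\int[mu n.+1]_u (f u)%:E <= (h * (2 * r) ^+ n)%:E)%E.
rewrite integral_rVS//.
have mfp : measurable_fun [set: measurableTypeR R * 'rV[R]_n] (fun p => (f (cons_rV (p.1, p.2)))%:E).
  by apply: (measurableT_comp mf); apply: measurable_cons; [exact: measurable_fst|exact: measurable_snd].
rewrite (tonelli_swap leb (mu n) mfp (fun p => f0 _)).
apply: (@le_trans _ _ (\int[mu n]_(z in box z0 r) (h%:E))%E); last first.
  have -> : (\int[mu n]_(z in box z0 r) h%:E = h%:E * mu n (box z0 r))%E.
    by rewrite integral_cst//; exact: measurable_box.
  by rewrite lebesgue_box// -EFinM.
rewrite [leRHS]integral_mkcond; apply: ge0_le_integral => //.
- by move=> z _; apply: integral_ge0.
- by apply: (@measurable_fun_fubini_tonelli_G _ _ _ _ _ leb _ mfp) => p; exact: f0.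
- by apply/(measurable_restrictT _ (measurable_box _ _)); exact: measurable_cst.
move=> z _; rewrite /patch.
case: ifPn => zb; last first.
  rewrite integral0_eq// => t _ /=.
  by rewrite /f cons_rV0 restE (negbTE zb) andbF.
pose I : set (measurableTypeR R) := `]g z, g z + h]%classic.
have mI : measurable I by exact: measurable_itv.
apply: (@le_trans _ _ (\int[leb]_(t in I) cst 1%E t)%E); last first.
  rewrite integral_cst//= mul1e lebesgue_measure_itv/= lte_fin.
  by case: ifP => _; rewrite -?EFinB ?lee_fin//; lra.
rewrite [leRHS]integral_mkcond; apply: ge0_le_integral => //.
- apply: (measurableT_comp mf); apply: measurable_cons; [exact: measurable_id|exact: measurable_cst].
- by apply/(measurable_restrictT _ mI).
move=> t _; rewrite /patch /f cons_rV0 restE zb andbT.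
case: ifPn => [/andP[t1 t2]|_]; last by case: ifP.
rewrite mem_set//=.
rewrite /= in t1 t2.
by rewrite /I /= in_itv/=; apply/andP; split; lra.
Qed.

Definition eball n (x : 'rV[R]_n) (r : R) : set 'rV[R]_n := [set y | enorm (y - x) < r].

Lemma measurable_eball n (x : 'rV[R]_n) r : measurable (eball x r).
Proof.
apply: open_measurable_rV; apply/open_enorm => y yr; exists (r - enorm (y - x)).
  by rewrite subr_gt0.
move=> z zy; rewrite /eball /=; have := enorm_trans y z x; move: yr; rewrite /eball /=; lra.
Qed.

Lemma open_eball n (x : 'rV[R]_n) r : open (eball x r).
Proof.
apply/open_enorm => y yr; exists (r - enorm (y - x)).
  by rewrite subr_gt0.
move=> z zy; rewrite /eball /=; have := enorm_trans y z x; move: yr; rewrite /eball /=; lra.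
Qed.

Definition strip n (Omega : set 'rV[R]_n) (eps : R) := Omega `&` [set x | bdist Omega x <= eps].

Lemma measurable_strip n (Omega : set 'rV[R]_n) eps : open Omega -> boundary Omega !=set0 ->
  measurable (strip Omega eps).
Proof.
move=> oO b0; apply: measurableI; first exact: open_measurable_rV.
have := lipschitz_measurable ler01 (bdist_lipschitz b0) measurableT (measurable_itv `]-oo, eps]).
by rewrite setTI; congr measurable; apply/seteqP; split => x; rewrite /= in_itv.
Qed.

(** A point of depth at most [eps] is within [eps] of a boundary point, which lies on the graph, so
    its height above the graph is at most [D eps]. Rotation invariance then reduces to
    [lebesgue_graph_strip]. *)
Lemma chart_strip n (Omega : set 'rV[R]_n.+1) (P : 'M[R]_(n.+1, n)) (nu : 'cV[R]_n.+1)
    (g : 'rV[R]_n -> R) (r : R) (x0 : 'rV[R]_n.+1) : open Omega -> bounded_set Omega ->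
  boundary Omega !=set0 ->
  (row_mx P nu)^T *m row_mx P nu = 1%:M -> C11_fun g -> 0 < r ->
  (forall x, enorm (x - x0) < r -> (Omega x <-> g (x *m P) < height nu x)) ->
  exists2 C : R, 0 <= C & forall eps, 0 < eps -> eps <= r / 4 ->
    (mu n.+1 (strip Omega eps `&` eball x0 (r / 2)) <=
     (C * eps)%:E)%E.
Proof.
move=> oO bO b0 orth Cg r0 ch; have [L L0 ty] := C11_taylor Cg.
(* Bound on the rate of change of [height - g] in the ball: 1 for the height, then the gradient of
   [g] and the Taylor remainder. *)
pose D := 1 + (enorm (grad g (x0 *m P)) + L * r) + L * r.
have D0 : 0 <= D by have h := enorm_ge0 (grad g (x0 *m P)); rewrite /D; pos.
exists (D * (2 * (r / 2)) ^+ n); first by pos.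
move=> eps e0 er; set E := _ `&` _.
have mO : measurable Omega by exact: open_measurable_rV.
have mE : measurable E.
  apply: measurableI; first apply: measurableI => //.
    have := lipschitz_measurable ler01 (bdist_lipschitz b0) measurableT (measurable_itv `]-oo, eps]).
    by rewrite setTI; congr measurable; apply/seteqP; split => x; rewrite /= in_itv.
  apply: open_measurable_rV; apply/open_enorm => x /= xr.
  exists (r / 2 - enorm (x - x0)); first by rewrite subr_gt0.
  by move=> y yx; apply: le_lt_trans (enorm_trans x y x0) _; lra.
(* The normal column is put first because the measure splits off the first coordinate. *)
pose Q : 'M[R]_n.+1 := row_mx nu P.
have QQ : Q *m Q^T = 1%:M.
  apply: mulmx1C; have [PP nP nn] := chart_orth orth.
  have -> : Q^T = col_mx nu^T P^T by exact: (tr_row_mx nu P).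
  rewrite /Q (mul_col_row nu^T P^T nu P) nn nP PP.
  have -> : P^T *m nu = 0 by apply: trmx_inj; rewrite trmx_mul trmxK nP trmx0.
  by rewrite -(scalar_mx_block 1 n 1).
have Q0 (x : 'rV[R]_n.+1) : (x *m Q) ord0 ord0 = height nu x.
  have -> : x *m Q = row_mx (x *m nu) (x *m P) by exact: (mul_mx_row x nu P).
  have h : lshift n (ord0 : 'I_1) = ord0 by apply: val_inj.
  by have := row_mxEl (x *m nu) (x *m P) ord0 ord0; rewrite h.
have QS (x : 'rV[R]_n.+1) : (\row_j (x *m Q) ord0 (lift ord0 j)) = x *m P.
  apply/rowP => j; rewrite mxE.
  have -> : x *m Q = row_mx (x *m nu) (x *m P) by exact: (mul_mx_row x nu P).
  have h : rshift 1 j = lift ord0 j by apply: val_inj.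
  by have := row_mxEr (x *m nu) (x *m P) ord0 j; rewrite h.
have mg : measurable_fun [set: 'rV[R]_n] g.
  by apply: continuous_measurable_rV => x; apply: differentiable_continuous; exact: Cg.1.
have r2 : 0 < r / 2 by rewrite divr_gt0.
have De : 0 <= D * eps by apply: mulr_ge0 => //; exact: ltW.
have := lebesgue_graph_strip (x0 *m P) mg De r2.
rewrite mulrAC; apply: le_trans.
pose F (u : 'rV[R]_n.+1) : \bar R := (if (0 < u ord0 ord0 - g (\row_j u ord0 (lift ord0 j)) <= D * eps) &&
      ((\row_j u ord0 (lift ord0 j)) \in box (x0 *m P) (r / 2)) then 1 else 0)%:E.
have mF : measurable_fun [set: 'rV[R]_n.+1] F.
  pose rest (u : 'rV[R]_n.+1) : 'rV[R]_n := \row_j u ord0 (lift ord0 j).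
  have mrest : measurable_fun [set: 'rV[R]_n.+1] rest.
    apply: measurable_fun_rV => j; rewrite (_ : (fun _ => _) = (fun u : 'rV[R]_n.+1 => u ord0 (lift ord0 j))).
      exact: measurable_coord.
    by apply/funext => u; rewrite mxE.
  apply: measurable_EFin_comp; apply: measurable_fun_ifT => //.
  have mh : measurable_fun [set: 'rV[R]_n.+1] (fun u => u ord0 ord0 - g (rest u)).
    by apply: measurable_funB; [exact: measurable_coord|exact: (measurableT_comp mg)].
  apply: measurable_and.
    by apply: measurable_and; [exact: measurable_fun_ltr|exact: measurable_fun_ler].
  apply: (measurable_fun_bool true); rewrite setTI (_ : _ @^-1` _ = rest @^-1` box (x0 *m P) (r / 2)).
    by rewrite -[X in measurable X]setTI; apply: mrest => //; exact: measurable_box.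
  by apply/seteqP; split => y /=; [exact: set_mem|exact: mem_set].
have F0 u : (0 <= F u)%E by rewrite /F lee_fin; case: ifP.
rewrite -[leRHS](integral_rV_orth QQ mF F0).
rewrite -[mu n.+1 E]mul1e -integral_cst// integral_mkcond; apply: ge0_le_integral => //.
- by move=> x _; rewrite /patch; case: ifP.
- by apply/(measurable_restrictT _ mE).
- by apply: (measurableT_comp mF); exact: measurable_mulmx.
move=> x _; rewrite /patch; case: ifPn => // /set_mem[[Ox /= xe] xr].
rewrite /F Q0 QS /=.
rewrite /eball /= in xr.
have xr' : enorm (x - x0) < r by lra.
have /(ch x xr') gx := Ox.
have [b bb dE] := bdist_attained b0 bO x.
have bx : enorm (b - x0) < r.
  apply: le_lt_trans (enorm_trans x b x0) _; rewrite (enormB b x) -dE; lra.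
have gb := chart_boundary orth oO L0 (fun a b => (ty a b).1) ch bb bx.
have inb : (x *m P) \in box (x0 *m P) (r / 2).
  apply: mem_set => i; apply: le_lt_trans xr.
  apply: le_trans (enorm_mulP orth (x - x0)); rewrite mulmxBl.
  rewrite (_ : _ - _ = (x *m P - x0 *m P) ord0 i); last by rewrite [RHS]mxE [X in _ = _ + X]mxE.
  by apply: le_trans (normrV_coord _ i) (normrV_le_enorm _).
rewrite inb andbT subr_gt0 gx /=.
suff -> : height nu x - g (x *m P) <= D * eps by [].
set q := grad g (b *m P); have q0 : 0 <= enorm q by exact: enorm_ge0.
have zP := enorm_mulP orth (x - b).
have zb := height_le orth (x - b); rewrite heightB in zb.
have [t1 _] := ty (b *m P) (x *m P).
have [_ t2] := ty (b *m P) (x0 *m P).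
have qb : enorm q <= enorm (grad g (x0 *m P)) + L * r.
  have := enorm_trans (grad g (x0 *m P)) q 0; rewrite !subr0 addrC => h; apply: le_trans h _.
  rewrite lerD2l; apply: le_trans t2 _; apply: ler_wpM2l => //; rewrite -mulmxBl.
  by apply: le_trans (enorm_mulP orth (b - x0)) _; exact: ltW.
have cs := cauchy_schwarz ((x - b) *m P) (- q); rewrite dotvNr enormN in cs.
rewrite -mulmxBl -/q -enorm_sqr gb in t1.
rewrite dE in xe.
set z := enorm (x - b) in xe zP zb; set w := enorm ((x - b) *m P) in zP cs t1.
have w0 : 0 <= w by exact: enorm_ge0.
have zr : z <= r by lra.
rewrite ler_norml in t1; case/andP: t1 => t1 _.
have zb' : height nu x - height nu b <= z by apply: le_trans (ler_norm _) zb.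
have h1 : w * enorm q <= z * (enorm (grad g (x0 *m P)) + L * r) by apply: ler_pM.
have h2 : L * w ^+ 2 <= L * r * z.
  rewrite -mulrA; apply: ler_wpM2l => //; rewrite expr2 mulrC; apply: ler_pM => //.
  by apply: le_trans zP zr.
have h3 : D * z <= D * eps by apply: ler_wpM2l.
move: h1 h2 h3 t1 zb' cs; rewrite /D.
move: (enorm (grad g (x0 *m P)) + L * r) (L * r) (L * w ^+ 2) (w * enorm q) (dotv _ _) => a1 a2 a3 a4 a5.
by clear; lra.
Qed.

(** The quarter-radius balls of finitely many charts cover the boundary. A strip narrower than a
    quarter of each radius lies in the half-radius balls, where [chart_strip] applies. *)
Lemma strip_measure n (Omega : set 'rV[R]_n.+1) : open Omega -> bounded_set Omega ->
  Omega !=set0 -> class_C11 Omega ->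
  exists2 C : R, 0 < C & forall eps, 0 < eps ->
    (mu n.+1 (strip Omega eps) <= (C * eps)%:E)%E.
Proof.
move=> oO bO neO cO; have b0 := boundary_nonempty oO bO neO.
have mO : measurable Omega by exact: open_measurable_rV.
have mS eps : measurable (strip Omega eps) by exact: measurable_strip.
have loc x0 : exists p : R * R, boundary Omega x0 -> [/\ 0 < p.1, 0 <= p.2 &
    forall eps, 0 < eps -> eps <= p.1 / 4 ->
    (mu n.+1 (strip Omega eps `&` eball x0 (p.1 / 2)) <=
     (p.2 * eps)%:E)%E].
  have [bx|nb] := pselect (boundary Omega x0); last by exists (0, 0).
  have [P [nu [g [r [orth Cg r0 ch]]]]] := cO x0 bx.
  have [C C0 hC] := chart_strip oO bO b0 orth Cg r0 ch.
  by exists (r, C).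
pose rad x := (projT1 (cid (loc x))).1.
pose cst x := (projT1 (cid (loc x))).2.
have prop x (bx : boundary Omega x) := projT2 (cid (loc x)) bx.
pose eballs (s : seq 'rV[R]_n.+1) := [set x | has (fun c => enorm (x - c) < rad c / 2) s].
have mH s : measurable (eballs s).
  elim: s => [|a s IH] /=; first by rewrite (_ : eballs _ = set0)//; apply/seteqP; split.
  rewrite (_ : eballs _ = eball a (rad a / 2) `|` eballs s).
    by apply: measurableU => //; exact: measurable_eball.
  by apply/seteqP; split => x /=; [move=> /orP[]; [left|right]|move=> [] h; apply/orP; [left|right]].
have mB x a : measurable (eball x a) by exact: measurable_eball.
have := compact_boundary bO; rewrite compact_cover => cc.
have [S SD Scov] : finite_subset_cover (boundary Omega) (fun x => eball x (rad x / 4)) (boundary Omega).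
  apply: cc => [x bx|x bx].
    exact: open_eball.
  by exists x => //=; rewrite /eball /= subrr enorm0 divr_gt0//; have [] := prop x bx.
have key : forall s : seq 'rV[R]_n.+1, {subset s <= boundary Omega} -> exists e0 C : R,
    [/\ 0 < e0, 0 <= C, forall x, x \in s -> e0 <= rad x / 4 & forall eps, 0 < eps -> eps <= e0 ->
    (mu n.+1 (strip Omega eps `&` eballs s) <=
     (C * eps)%:E)%E].
  elim=> [|c s IH] sb.
    exists 1, 0; split => // eps _ _; rewrite (_ : _ `&` _ = set0) ?measure0 ?mul0r//.
    by apply/seteqP; split => x // -[].
  have [|e0 [C [e00 C0 er hC]]] := IH; first by move=> x xs; apply: sb; rewrite inE xs orbT.
  have bc : boundary Omega c by apply/set_mem; apply: sb; rewrite inE eqxx.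
  have [r0 D0 hD] := prop c bc.
  exists (Num.min e0 (rad c / 4)), (C + cst c); split.
  - by rewrite lt_min e00 divr_gt0.
  - exact: addr_ge0.
  - by move=> x; rewrite inE => /orP[/eqP ->|/er h]; rewrite ge_min ?lexx ?orbT// h.
  move=> eps eps0; rewrite le_min => /andP[ee1 ee2].
  apply: (@le_trans _ _ (mu n.+1 ((strip Omega eps `&` eballs s) `|`
     (strip Omega eps `&` eball c (rad c / 2))))%E).
    apply: le_measure; rewrite ?inE.
    - exact: measurableI.
    - apply: measurableU; apply: measurableI.
      + exact: mS.
      + exact: mH.
      + exact: mS.
      + exact: mB.
    by move=> x [h /= /orP[hc|hs]]; [right|left].
  apply: le_trans (measureU2 _ _ _) _.
  - by apply: measurableI; [exact: mS|exact: mH].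
  - by apply: measurableI; [exact: mS|exact: mB].
  by rewrite mulrDl EFinD; apply: leeD; [exact: hC|exact: hD].
have [e0 [C [e00 C0 er hC]]] := key (finmap.enum_fset S) SD.
pose V := fine (mu n.+1 Omega).
have VE : mu n.+1 Omega = V%:E by rewrite fineK// ge0_fin_numE// lebesgue_bounded.
have V0 : 0 <= V by rewrite fine_ge0.
exists (C + V / e0 + 1); first by rewrite ltr_wpDl// addr_ge0// divr_ge0// ltW.
(* For wide strips the volume of the whole domain, at most [V / e0 * eps], is enough. *)
move=> eps eps0; have [ee|ee] := leP eps e0; last first.
  apply: (@le_trans _ _ (mu n.+1 Omega)).
    by apply: le_measure; rewrite ?inE// => x [].
  rewrite VE lee_fin; have : V / e0 * e0 <= V / e0 * eps.
    by apply: ler_wpM2l; [rewrite divr_ge0// ltW|exact: ltW].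
  rewrite divfK ?gt_eqF//.
  have : 0 <= C * eps by rewrite mulr_ge0// ltW.
  by lra.
apply: (@le_trans _ _ (C * eps)%:E); last first.
  rewrite lee_fin; apply: ler_wpM2r; first exact: ltW.
  by rewrite -addrA lerDl addr_ge0// divr_ge0// ltW.
apply: le_trans (hC eps eps0 ee); apply: le_measure; rewrite ?inE//.
  exact: measurableI.
move=> x [Ox /= xe]; split => //=.
have [b bb dE] := bdist_attained b0 bO x.
have [c Sc /= bc] := Scov b bb.
apply/hasP; exists c => //.
rewrite /eball /= in bc.
have := er c Sc; have := enorm_trans b x c; move: xe; rewrite dE; lra.
Qed.

End strip.

(** * Energy density of a cutoff at scale [l] *)

Section kernel.
Context {R : realType}.
Local Notation mu := (@lebesgue_rV R).
Local Notation leb := (@lebesgue_measure R).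
Local Notation pos := (`]0, +oo[%classic : set R).

(** With [r = C |x - y| / l], a cutoff difference is at most [Num.min 1 r], and [sqr_sum_geometric]
    replaces its square by its product with [r^(1/2)]. The result behaves like [r^(3/2)] at 0 and
    [r^(1/2)] at infinity, both integrable against the kernel. *)
Definition gcut (r : R) : R := Num.min 1 r * r `^ 2^-1.

Lemma gcut_ge0 r : 0 <= r -> 0 <= gcut r.
Proof. by move=> r0; rewrite mulr_ge0 ?powR_ge0// le_min ler01. Qed.

Lemma gcut_le (r c : R) : 0 <= r -> 2^-1 <= c <= 3 / 2 -> gcut r <= r `^ c.
Proof.
move=> r0 /andP[c1 c2]; rewrite /gcut; have [r1|r1] := leP 1 r.
  by rewrite mul1r ler_powR.
have [->|rn] := eqVneq r 0; first by rewrite mul0r powR_ge0.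
have rp : 0 < r by rewrite lt_def rn.
have -> : r * r `^ 2^-1 = r `^ (3 / 2).
  by rewrite mulrC mulr_powR//; congr (_ `^ _); lra.
by apply: ger_powR => //; apply/andP; split => //; exact: ltW.
Qed.

Lemma measurable_gcut : measurable_fun [set: R] gcut.
Proof.
apply: measurable_funM; first by apply: measurable_minr => //.
by apply: measurable_powR_comp.
Qed.

Lemma enorm_powR n (w : 'rV[R]_n) (a : R) : enorm w `^ a = sqn w `^ (a / 2).
Proof. by rewrite enormE -powR12_sqrt ?sqn_ge0// -powRrM mulrC. Qed.

Let kern n (t C l : R) (z : 'rV[R]_n.+1) : R :=
  gcut (C / l * enorm z) * enorm z `^ (- (n.+1%:R + 2 * (2^-1 + t))).

Let kern_ge0 n t C l z : 0 <= C -> 0 < l -> 0 <= @kern n t C l z.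
Proof.
move=> C0 l0; rewrite mulr_ge0 ?powR_ge0 ?gcut_ge0// mulr_ge0 ?enorm_ge0//.
by rewrite divr_ge0// ltW.
Qed.

Let measurable_kern n t C l : measurable_fun [set: 'rV[R]_n.+1] (@kern n t C l).
Proof.
apply: measurable_funM.
  apply: (measurableT_comp measurable_gcut); apply: measurable_funM => //.
  by apply: measurable_enorm.
by apply: measurable_powR_comp; apply: measurable_enorm.
Qed.

(** Bounding [gcut r] by the single power [r^c] makes the slice an instance of [integral_powR_rV].
    The constant is evaluated at the least possible exponent, which frees it from [c] and [t]. *)
Let kern_slice n (t C l s c : R) : 0 < t <= 16^-1 -> 0 < C -> 0 < l -> s != 0 -> 2^-1 <= c <= 3 / 2 ->
  (\int[mu n]_z (kern t C l (cons_rV (s, z)))%:E <=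
   (Acst n ((n%:R + 2^-1) / 2) * (C / l) `^ c * `|s| `^ (c - 2 - 2 * t))%:E)%E.
Proof.
move=> /andP[t0 t1] C0 l0 s0 c12; have /andP[c1 c2] := c12.
pose q := (n%:R + 2 + 2 * t - c) / 2.
have n0 : 0 <= n%:R :> R by [].
have nq0 : n%:R / 2 < (n%:R + 2^-1) / 2 :> R by lra.
have q0q : (n%:R + 2^-1) / 2 <= q by rewrite /q; lra.
have nq := lt_le_trans nq0 q0q.
have s2 : 0 < s ^+ 2 by rewrite exprn_even_gt0.
have Cl : 0 <= C / l by rewrite divr_ge0// ltW.
apply: (@le_trans _ _ (\int[mu n]_z (((C / l) `^ c)%:E * ((s ^+ 2 + sqn z) `^ (- q))%:E))%E).
  apply: ge0_le_integral => //.
  - by move=> z _; rewrite lee_fin kern_ge0// ltW.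
  - apply: measurable_EFin_comp; apply: (measurableT_comp (measurable_kern _ _ _)).
    by apply: measurable_cons.
  - apply: measurable_EFin_comp; apply: measurable_funM => //; apply: measurable_powR_comp.
    by apply: measurable_funD => //; exact: measurable_dotv.
  move=> z _; rewrite -EFinM lee_fin /kern; set w := cons_rV _.
  have w0 : 0 < sqn w by rewrite sqn_cons ltr_pwDl// sqn_ge0.
  apply: le_trans (_ : (C / l * enorm w) `^ c * enorm w `^ (- (n.+1%:R + 2 * (2^-1 + t))) <= _).
    by apply: ler_wpM2r; [exact: powR_ge0|apply: gcut_le => //; rewrite mulr_ge0// enorm_ge0].
  rewrite powRM ?enorm_ge0// -mulrA !enorm_powR -powRDp// -sqn_cons -/w.
  apply: ler_wpM2l; first exact: powR_ge0.
  have -> : c / 2 + - (n.+1%:R + 2 * (2^-1 + t)) / 2 = - q by rewrite /q -natr1; field.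
  exact: lexx.
rewrite ge0_integralZl//; last 3 first.
- apply: measurable_EFin_comp; apply: measurable_powR_comp.
  by apply: measurable_funD => //; exact: measurable_dotv.
- by move=> z _; rewrite lee_fin powR_ge0.
- by rewrite lee_fin powR_ge0.
rewrite (integral_powR_rV s2 nq) -/(Acst n q) -EFinM lee_fin mulrA [_ * Acst _ _]mulrC.
have -> : (s ^+ 2) `^ (n%:R / 2 - q) = `|s| `^ (c - 2 - 2 * t).
  have -> : s ^+ 2 = `|s| `^ 2%:R by rewrite powR_mulrn ?normr_ge0// real_normK ?num_real.
  by rewrite -powRrM; congr (_ `^ _); rewrite /q; lra.
apply: ler_wpM2r; first exact: powR_ge0.
by apply: ler_wpM2r; [exact: powR_ge0|exact: Acst_decr].
Qed.

(** The slice bound in the rescaled variable: [c = 3/2] below 1, where it is integrable at 0, and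
    [c = 1/2] above 1, where it is integrable at infinity. *)
Let prof (t C s : R) : R :=
  if s <= 1 then C `^ (3 / 2) * s `^ (- 2^-1 - 2 * t) else C `^ 2^-1 * s `^ (- (3 / 2) - 2 * t).

Let prof_ge0 t C s : 0 <= prof t C s.
Proof. by rewrite /prof; case: ifP => _; rewrite mulr_ge0 ?powR_ge0. Qed.

Let measurable_prof t C : measurable_fun [set: R] (prof t C).
Proof.
apply: measurable_fun_ifT; first by apply: measurable_fun_ler.
- by apply: measurable_funM => //; apply: measurable_powR.
- by apply: measurable_funM => //; apply: measurable_powR.
Qed.

Let integral_prof (t C l : R) : 0 < t <= 16^-1 -> 0 < l ->
  (\int[leb]_(s in pos) (prof t C (l^-1 * s))%:E <= (16 * (C `^ (3 / 2) + C `^ 2^-1) * l)%:E)%E.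
Proof.
move=> /andP[t0 t1] l0; have li0 : 0 < l^-1 by rewrite invr_gt0.
pose G (s : R) : \bar R := if (0 < s)%R then (prof t C s)%:E else 0%E.
have mG : measurable_fun [set: R] G.
  apply: measurable_fun_ifT => //; first exact: measurable_fun_ltr.
  exact: measurable_EFin_comp.
have G0 s : (0 <= G s)%E by rewrite /G; case: ifP => // _; rewrite lee_fin prof_ge0.
rewrite integral_pos (_ : (\int[leb]_x _ = \int[leb]_x G (l^-1 * x)%R)%E); last first.
  by apply: eq_integral => s _; rewrite /G pmulr_rgt0.
rewrite (ge0_integral_scale li0 mG G0) invrK.
rewrite -/(\int[leb]_x (if (0 < x)%R then (prof t C x)%:E else 0%E))%E.
rewrite -integral_pos mulrC EFinM; apply: lee_wpmul2l; first by rewrite lee_fin ltW.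
have := @integral_le_majorant R 4^-1 (C `^ (3 / 2) + C `^ 2^-1) (prof t C).
rewrite invrK (_ : 4 * _ * 4 = 16 * (C `^ (3 / 2) + C `^ 2^-1)); last by ring.
apply => //.
- by rewrite addr_ge0// powR_ge0.
- exact: measurable_funTS.
- move=> x x0 x1; rewrite /prof x1; apply: ler_pM; rewrite ?powR_ge0 ?lerDl ?powR_ge0//.
  by apply: ger_powR; [apply/andP|lra].
- move=> x x1; rewrite /prof; case: ifPn => [x1'|_].
    have -> : x = 1 by apply/eqP; rewrite eq_le x1 x1'.
    by rewrite !powR1 !mulr1 lerDl powR_ge0.
  apply: ler_pM; rewrite ?powR_ge0 ?lerDr ?powR_ge0//.
  by apply: ler_powR => //; lra.
Qed.

(** In the power of [l], [-2 - 2t] comes from scaling the slices and [+1] from scaling the line.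
    That [K] is independent of [t] and [l] is essential for [log_cutoff]. *)
Lemma kernel_integral n (C : R) : 0 < C -> exists2 K : R, 0 < K &
  forall (t l : R) (x : 'rV[R]_n.+1), 0 < t <= 16^-1 -> 0 < l ->
  (\int[mu n.+1]_y (gcut (C / l * enorm (x - y)) *
     enorm (x - y) `^ (- (n.+1%:R + 2 * (2^-1 + t))))%:E <= (K * l `^ (- (1 + 2 * t)))%:E)%E.
Proof.
move=> C0; pose A := Acst n ((n%:R + 2^-1) / 2) : R.
have A0 : 0 < A by apply: Acst_gt0; have : 0 <= n%:R :> R by []; lra.
exists (2 * (A * (16 * (C `^ (3 / 2) + C `^ 2^-1)))).
  by have := powR_gt0 (3 / 2) C0; have := powR_gt0 2^-1 C0 => h1 h2; pos.
move=> t l x t01 l0; have /andP[t0 t1] := t01.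
have k0 z : (0 <= (@kern n t C l z)%:E)%E by rewrite lee_fin; apply: kern_ge0 => //; exact: ltW.
have mk : measurable_fun [set: 'rV[R]_n.+1] (fun z => (@kern n t C l z)%:E).
  by apply: measurable_EFin_comp; exact: measurable_kern.
rewrite (_ : (\int[mu n.+1]_y _ = \int[mu n.+1]_y (kern t C l (y + - x))%:E)%E); last first.
  by apply: eq_integral => y _; rewrite /kern enormB.
rewrite (integral_rV_shift (- x) mk k0) (integral_rVS mk k0).
have mF := measurable_integral_rV mk k0.
have F0 s : (0 <= \int[mu n]_z (kern t C l (cons_rV (s, z)))%:E)%E by apply: integral_ge0.
rewrite (integral_R_split mF F0).
pose h (s : R) := A * l `^ (- 2 - 2 * t) * prof t C (l^-1 * s).
have mh : measurable_fun [set: R] (fun s => (prof t C (l^-1 * s))%:E).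
  apply: measurable_EFin_comp; apply: (measurableT_comp (measurable_prof _ _)).
  by apply: measurable_funM.
have Al : 0 <= A * l `^ (- 2 - 2 * t) by rewrite mulr_ge0 ?powR_ge0// ltW.
have bd (s : R) : s != 0 -> (\int[mu n]_z (kern t C l (cons_rV (s, z)))%:E <= (h `|s|)%:E)%E.
  move=> s0; have sp : 0 < `|s| by rewrite normr_gt0.
  have scale c : (C / l) `^ c * `|s| `^ (c - 2 - 2 * t) =
      l `^ (- 2 - 2 * t) * (C `^ c * (l^-1 * `|s|) `^ (c - 2 - 2 * t)).
    rewrite powRM ?invr_ge0 ?ltW// [in RHS]powRM ?invr_ge0 ?ltW//.
    rewrite !powR_inv_base//.
    have -> : l `^ (- c) = l `^ (- 2 - 2 * t) * l `^ (- (c - 2 - 2 * t)).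
      by rewrite -powRDp//; congr (_ `^ _); ring.
    ring.
  have sl (c : R) : 2^-1 <= c -> c <= 3 / 2 -> (\int[mu n]_z (kern t C l (cons_rV (s, z)))%:E <=
      (A * l `^ (- 2 - 2 * t) * (C `^ c * (l^-1 * `|s|) `^ (c - 2 - 2 * t)))%:E)%E.
    move=> c1 c2; have c12 : 2^-1 <= c <= 3 / 2 by rewrite c1 c2.
    by have := kern_slice n t01 C0 l0 s0 c12; rewrite -/A -!mulrA scale.
  rewrite /h /prof; case: ifPn => _.
  - by have -> : - 2^-1 - 2 * t = 3 / 2 - 2 - 2 * t; [|apply: sl]; lra.
  - by have -> : - (3 / 2) - 2 * t = 2^-1 - 2 - 2 * t; [|apply: sl]; lra.
have tot : (\int[leb]_(s in pos) (h s)%:E <=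
    (A * (16 * (C `^ (3 / 2) + C `^ 2^-1)) * l `^ (- (1 + 2 * t)))%:E)%E.
  rewrite (_ : (\int[leb]_(s in pos) _ = (A * l `^ (- 2 - 2 * t))%:E *
     \int[leb]_(s in pos) (prof t C (l^-1 * s))%:E)%E); last first.
    have mhp : measurable_fun pos (fun s => (prof t C (l^-1 * s))%:E) by exact: measurable_funTS.
    have hp (s : R) : pos s -> (0 <= (prof t C (l^-1 * s))%:E)%E by move=> _; rewrite lee_fin prof_ge0.
    have Al' : (0 <= (A * l `^ (- 2 - 2 * t))%:E)%E by rewrite lee_fin.
    by rewrite -(ge0_integralZl leb (measurable_itv _) mhp hp Al').
  have Al' : (0 <= (A * l `^ (- 2 - 2 * t))%:E)%E by rewrite lee_fin.
  apply: (le_trans (lee_wpmul2l Al' (integral_prof C t01 l0))).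
  rewrite -EFinM lee_fin (_ : - (1 + 2 * t) = - 2 - 2 * t + 1); last by ring.
  rewrite -mulr_powR// le_eqVlt; apply/orP; left; apply/eqP; ring.
have mhp : measurable_fun pos (fun s => (h s)%:E).
  by apply: measurable_funTS; apply: measurable_EFin_comp; apply: measurable_funM => //; exact/measurable_EFinP.
move: tot; set V := A * _ * _ => tot.
have -> : 2 * (A * (16 * (C `^ (3 / 2) + C `^ 2^-1))) * l `^ (- (1 + 2 * t)) = V + V.
  by rewrite /V -!mulrA mulr_natl mulr2n.
rewrite (EFinD V V); apply: leeD; apply: le_trans tot; apply: ge0_le_integral.
- exact: measurable_itv.
- by move=> s _; exact: F0.
- exact: measurable_funTS.
- exact: mhp.
- by move=> s; rewrite posE => s0; have := bd s; rewrite (gtr0_norm s0); apply; rewrite gt_eqF.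
- exact: measurable_itv.
- by move=> s _; exact: F0.
- by apply: measurable_funTS; apply: (measurableT_comp mF); exact: measurable_funN.
- exact: mhp.
- move=> s; rewrite posE => s0; have := bd (- s); rewrite normrN (gtr0_norm s0).
  by apply; rewrite oppr_eq0 gt_eqF.
Qed.

End kernel.

(** * Smooth cutoffs *)

Section step.
Context {R : realType}.
Local Notation leb := (@lebesgue_measure R).

Lemma is_derive_derivable (f : R -> R) (x d : R) : is_derive x 1 f d -> derivable f x 1.
Proof. by move=> h; exact: ex_derive. Qed.

Lemma is_derive_derive1 (f : R -> R) (x d : R) : is_derive x 1 f d -> derive1 f x = d.
Proof. by move=> h; rewrite derive1E derive_val. Qed.

Lemma is_derive_continuous (f : R -> R) (x d : R) : is_derive x 1 f d -> {for x, continuous f}.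
Proof. by move=> h; apply: differentiable_continuous; apply/derivable1_diffP; exact: ex_derive. Qed.

Lemma is_derive_comp1 (f g : R -> R) (x df dg : R) : is_derive (f x) 1 g dg -> is_derive x 1 f df ->
  is_derive x 1 (fun y => g (f y)) (dg * df).
Proof.
by move=> hg hf; have h := is_derive1_comp hg hf; exact: h.
Qed.

Lemma is_derive_expf k (f : R -> R) (x df : R) : is_derive x 1 f df ->
  is_derive x 1 (fun y => f y ^+ k) (k%:R * f x ^+ k.-1 * df).
Proof.
move=> hf; elim: k => [|k IH].
  by rewrite mul0r mul0r (_ : (fun y => _) = cst 1)//; exact: is_derive_cst.
rewrite (_ : (fun y => _) = (fun y => f y * f y ^+ k)); last by apply/funext => y; rewrite exprS.
apply: (is_derive_eq (is_derive_mulf hf IH)) => /=.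
by case: k {IH} => [|k]; rewrite ?expr0 ?exprS -?natr1 /=; ring.
Qed.

Definition smooth1 (f : R -> R) := forall m (x : R), derivable (derive1n m f) x 1.

Lemma smooth1_derivable (f : R -> R) (x : R) : smooth1 f -> derivable f x 1.
Proof. by move=> /(_ 0%N x). Qed.

Lemma derive1n_shift m (f : R -> R) : derive1n m (derive1 f) = derive1n m.+1 f.
Proof. by rewrite /derive1n -iterSr. Qed.

Lemma smooth1_derive1 (f : R -> R) : smooth1 f -> smooth1 (derive1 f).
Proof. by move=> sf m x; rewrite derive1n_shift; exact: sf. Qed.

Lemma smooth1_of_derive (f g : R -> R) : (forall x : R, is_derive x 1 f (g x)) -> smooth1 g -> smooth1 f.
Proof.
move=> fg sg [|m] x; first exact: is_derive_derivable (fg x).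
rewrite -derive1n_shift (_ : derive1 f = g); first exact: sg.
by apply/funext => y; exact: is_derive_derive1 (fg y).
Qed.

Lemma smooth1B (f g : R -> R) : smooth1 f -> smooth1 g -> smooth1 (fun x => f x - g x).
Proof.
move=> sf sg m.
have -> : derive1n m (fun x => f x - g x) = (fun x => derive1n m f x - derive1n m g x).
  elim: m => // m IH; rewrite /derive1n !iterS -!/(derive1n m _) IH; apply/funext => x.
  by rewrite !derive1E deriveB.
by move=> x; apply: derivableB.
Qed.

Lemma smooth1_affine (a b : R) (f : R -> R) : smooth1 f -> smooth1 (fun x => f (a * x + b)).
Proof.
move=> sf m.
have aff (x : R) : is_derive x 1 (fun x : R => a * x + b) a.
  have := is_derive_addf (is_derive_mulc a (is_derive_id x (1 : R))) (is_derive_cst b x (1 : R)).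
  by rewrite mulr1 addr0.
have comp (g : R -> R) (x : R) : derivable g (a * x + b) 1 ->
    is_derive x 1 (fun x => g (a * x + b)) (a * derive1 g (a * x + b)).
  move=> /derivableP dg; have := @is_derive_comp1 (fun x => a * x + b) g x a _ dg (aff x).
  by rewrite derive1E mulrC.
have E : derive1n m (fun x => f (a * x + b)) = (fun x => a ^+ m * derive1n m f (a * x + b)).
  elim: m => [|m IH]; first by apply/funext => x; rewrite mul1r.
  rewrite /derive1n !iterS -!/(derive1n m _) IH; apply/funext => x.
  by rewrite (is_derive_derive1 (is_derive_mulc (a ^+ m) (comp _ _ (sf m (a * x + b))))) mulrA -exprSr.
move=> x; rewrite E; exact: is_derive_derivable (is_derive_mulc (a ^+ m) (comp _ _ (sf m (a * x + b)))).
Qed.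

(** This family is closed under differentiation, whence smoothness by induction on the order. *)
Definition bump (P : {poly R}) k (x : R) : R :=
  if 0 < x < 1 then P.[x] * ((x * (1 - x))^-1) ^+ k * expR (- (x * (1 - x))^-1) else 0.

Let bump_identity (a b c d e : R) k : a != 0 ->
  (d * a^-1 ^+ k + c * (k%:R * a^-1 ^+ k.-1 * (- b / a ^+ 2))) * e + c * a^-1 ^+ k * (e * - (- b / a ^+ 2)) =
  (d * a ^+ 2 - (c * b * a) *+ k + c * b) * a^-1 ^+ k.+2 * e.
Proof.
move=> a0; case: k => [|k]; first by rewrite mulr0n /= !exprS !expr0; field.
rewrite /= !exprVn !exprS -mulr_natr.
have ak : a ^+ k != 0 by rewrite expf_neq0.
by move: (a ^+ k) ak => f f0; field; rewrite f0 a0.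
Qed.

(* With [q = 'X * (1 - 'X)], the derivative of [P q^-k exp (- q^-1)] is
   [(P' q^2 - k P q' q + P q') q^-(k+2) exp (- q^-1)]. *)
Lemma bump_derive (P : {poly R}) k : exists P', forall x : R, is_derive x 1 (bump P k) (bump P' k.+2 x).
Proof.
have [q qE] : exists q : {poly R}, forall y, q.[y] = y * (1 - y).
  by exists ('X * (1 - 'X)) => y; rewrite !hornerE.
pose P' := P^`() * q ^+ 2 - (P * q^`() * q) *+ k + P * q^`().
exists P' => x.
have [x01|xn] := boolP (0 < x < 1).
  have q0 : q.[x] != 0 by move: x01; rewrite qE => /andP[h1 h2]; rewrite mulf_neq0// gt_eqF// subr_gt0.
  pose G y := P.[y] * (q.[y])^-1 ^+ k * expR (- (q.[y])^-1).
  have dq : is_derive x 1 (horner q) (q^`().[x]) by exact: is_derive_poly.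
  have dqi := is_derive_inv q0 dq.
  have dqk : is_derive x 1 (fun y => (q.[y])^-1 ^+ k) (k%:R * (q.[x])^-1 ^+ k.-1 * (- q^`().[x] / q.[x] ^+ 2)).
    exact: is_derive_expf.
  have de : is_derive x 1 (fun y => expR (- (q.[y])^-1)) (expR (- (q.[x])^-1) * - (- q^`().[x] / q.[x] ^+ 2)).
    exact: (@is_derive_comp1 (fun y => - (q.[y])^-1) expR x _ _ (is_derive_expR _) (is_derive_oppf dqi)).
  have dP : is_derive x 1 (horner P) (P^`().[x]) by exact: is_derive_poly.
  have dG := is_derive_mulf (is_derive_mulf dP dqk) de.
  have GE : {near x, G =1 bump P k}.
    have /andP[h1 h2] := x01.
    near=> y; rewrite /bump /G qE ifT//; apply/andP; split; near: y.
      exact: lt_nbhsr.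
    exact: lt_nbhsl.
  apply: (near_eq_is_derive GE); apply: (is_derive_eq dG).
  rewrite /bump x01 -qE.
  have -> : P'.[x] = P^`().[x] * q.[x] ^+ 2 - (P.[x] * q^`().[x] * q.[x]) *+ k + P.[x] * q^`().[x].
    by rewrite /P' !(hornerD, hornerN, hornerMn, hornerM, horner_exp).
  exact: bump_identity.
have -> : bump P' k.+2 x = 0 by rewrite /bump (negbTE xn).
(* At points outside []0, 1[] the derivative is 0 because the function is [O((y - x)^2)]: the
   exponential beats [q0^(-k)] with two powers to spare, by [u^(k+2) / (k+2)! <= expR u] for
   [u = 1/q0]. *)
pose M := (\sum_(i < size P) `|P`_i|) * k.+2`!%:R.
have M0 : 0 <= M by rewrite mulr_ge0// sumr_ge0.
have bd y : `|bump P k y| <= M * (y - x) ^+ 2.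
  rewrite /bump; case: ifPn => [/andP[y0 y1]|_]; last by rewrite normr0 mulr_ge0// sqr_ge0.
  set q0 := y * (1 - y); have q0p : 0 < q0 by rewrite mulr_gt0// subr_gt0.
  have qyx : q0 <= `|y - x|.
    have : x <= 0 \/ 1 <= x.
      by move: xn; rewrite negb_and -!leNgt => /orP[]; [left|right].
    case=> hx; rewrite /q0.
      by apply: le_trans (ler_norm _); nra.
    by rewrite distrC; apply: le_trans (ler_norm _); nra.
  have Pb : `|P.[y]| <= \sum_(i < size P) `|P`_i|.
    rewrite horner_coef; apply: le_trans (ler_norm_sum _ _ _) _; apply: ler_sum => i _.
    rewrite normrM normrX ler_piMr// exprn_ile1// ger0_norm// ltW//.
  have eb : q0^-1 ^+ k * expR (- q0^-1) <= k.+2`!%:R * q0 ^+ 2.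
    rewrite expRN ler_pdivrMr ?expR_gt0//.
    have := @expR_ge1Dxn R q0^-1 k.+1; rewrite invr_ge0 => /(_ (ltW q0p)) h.
    have {}h : q0^-1 ^+ k.+2 / k.+2`!%:R <= expR q0^-1 by apply: le_trans h; rewrite lerDr.
    rewrite -ler_pdivrMl; last by rewrite mulr_gt0 ?exprn_gt0// ltr0n fact_gt0.
    apply: le_trans h; rewrite le_eqVlt; apply/orP; left; apply/eqP.
    rewrite invfM -!exprVn !exprS; ring.
  have qi0 : 0 <= q0^-1 by rewrite invr_ge0 ltW.
  rewrite !normrM -mulrA (ger0_norm (exprn_ge0 k qi0)) (gtr0_norm (expR_gt0 _)).
  rewrite /M -mulrA; apply: ler_pM => //; first by rewrite mulr_ge0 ?expR_ge0// exprn_ge0// invr_ge0 ltW.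
  apply: le_trans eb _; apply: ler_wpM2l => //.
  by rewrite -(real_normK (num_real (y - x))); apply: lerXn2r; rewrite ?nnegrE// ltW.
have bx : bump P k x = 0 by rewrite /bump (negbTE xn).
suff cv : h^-1 *: (bump P k (h *: 1 + x) - bump P k x) @[h --> (0 : R)^'] --> (0 : R).
  split; first by apply/cvg_ex; exists 0.
  exact: (cvg_lim (@Rhausdorff R) cv).
apply/cvgrPdist_le => e e0; near=> h.
have h0 : h != 0 by near: h; exact: nbhs_dnbhs_neq.
rewrite sub0r normrN bx subr0 /GRing.scale /= mulr1 normrM normfV.
rewrite ler_pdivrMl ?normr_gt0//; apply: le_trans (bd _) _.
rewrite addrK -real_normK ?num_real// expr2 mulrA mulrC ler_wpM2l//.
have hM : `|h| <= e / (M + 1).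
  near: h; apply: dnbhs0_le; by rewrite divr_gt0// ltr_wpDl.
apply: (@le_trans _ _ ((M + 1) * `|h|)); first by rewrite ler_wpM2r// lerDl.
by rewrite mulrC -ler_pdivlMr// ltr_wpDl.
Unshelve. all: by end_near.
Qed.

Lemma smooth1_bump (P : {poly R}) k : smooth1 (bump P k).
Proof.
move=> m; elim: m P k => [|m IH] P k x; have [P' dP'] := bump_derive P k.
  exact: is_derive_derivable (dP' x).
rewrite -derive1n_shift (_ : derive1 (bump P k) = bump P' k.+2); first exact: IH.
by apply/funext => y; exact: is_derive_derive1 (dP' y).
Qed.

Lemma bump1_bounds (x : R) : 0 <= bump 1 0 x <= 1.
Proof.
rewrite /bump; case: ifPn => [/andP[x0 x1]|_]; last by rewrite lexx ler01.
rewrite hornerC expr0 !mul1r expR_ge0 expR_le1 oppr_le0 invr_ge0.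
by rewrite mulr_ge0// ?ltW// subr_gt0.
Qed.

Lemma bump_out (P : {poly R}) k (x : R) : x <= 0 \/ 1 <= x -> bump P k x = 0.
Proof. by rewrite /bump => -[] h; rewrite ifF//; apply/negbTE; rewrite negb_and -!leNgt h ?orbT. Qed.

(* The antiderivative of [bump 1 0], normalised to increase from 0 to 1. *)
Lemma smooth_step : exists (theta beta : R -> R) (B : R),
  [/\ smooth1 theta, forall x : R, is_derive x 1 theta (beta x),
      forall x, 0 <= beta x <= B, forall x, x <= 0 \/ 1 <= x -> beta x = 0 &
      (forall x, x <= 0 -> theta x = 0) /\ (forall x, 1 <= x -> theta x = 1)].
Proof.
pose b := bump 1 0; have b01 x := bump1_bounds x.
have sb : smooth1 b by exact: smooth1_bump.
have cb : continuous b.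
  by move=> x; have /derivableP h := @smooth1_derivable b x sb; exact: (is_derive_continuous h).
have mb : measurable_fun [set: R] b by exact: continuous_measurable_fun.
have ib (u : R) : leb.-integrable `]-oo, u] (EFin \o b).
  apply: ge0_integrableR; first exact: measurable_funTS.
    by move=> x _; have /andP[] := b01 x.
  apply: (@le_lt_trans _ _ (\int[leb]_(x in `[0%R, 1%R]) (cst 1%E x))%E); last first.
    by rewrite integral_cst//= lebesgue_measure_itv/= lte_fin ltr01 oppr0 adde0 mul1e ltry.
  rewrite integral_mkcond [leRHS]integral_mkcond; apply: ge0_le_integral => //.
  - by move=> x _; rewrite /patch; case: ifP => // _; rewrite lee_fin; have /andP[] := b01 x.
  - apply/(measurable_restrictT _ (measurable_itv _)); apply: measurable_funTS.
    exact/measurable_EFinP.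
  - by apply/(measurable_restrictT _ (measurable_itv _)).
  move=> x _; rewrite /patch; case: ifPn => _; last by case: ifP.
  case: ifPn => [_|]; first by rewrite lee_fin; have /andP[] := b01 x.
  rewrite notin_setE /= in_itv /= => h; rewrite lee_fin /b bump_out ?lexx//.
  by have [x0|x0] := leP x 0; [left|right; rewrite leNgt; apply/negP => x1; apply: h; rewrite !ltW].
pose F (x : R) := (\int[leb]_(t in `]-oo, x]) b t)%R.
have dF (x : R) : is_derive x 1 F (b x).
  have xu : x < x + 1 by rewrite ltrDl.
  have [d1 d2] := @continuous_FTC1 R b -oo%O x (x + 1) xu (ib _) (ltNyr x) (cb x).
  by split; [exact: d1|rewrite -derive1E; exact: d2].
have F0 (x : R) : x <= 0 -> F x = 0.
  move=> x0; rewrite /F /Rintegral integral0_eq// => y /=; rewrite in_itv/= => yx.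
  by rewrite /b bump_out//; left; exact: le_trans yx x0.
have cF : continuous F.
  by move=> x; exact: is_derive_continuous (dF x).
have Fmvt (x y : R) : x < y -> exists2 c, x < c < y & F y - F x = b c * (y - x).
  move=> xy; have [|c + E] := @MVT R F b x y xy (fun z _ => dF z).
    exact: continuous_subspaceT.
  by rewrite in_itv/= => cxy; exists c.
have Fnd (x y : R) : x <= y -> F x <= F y.
  rewrite le_eqVlt => /orP[/eqP ->//|xy]; have [c _ E] := Fmvt _ _ xy.
  by rewrite -subr_ge0 E; apply: mulr_ge0; [have /andP[] := b01 c|rewrite subr_ge0 ltW].
have F1 (x : R) : 1 <= x -> F x = F 1.
  rewrite le_eqVlt => /orP[/eqP ->//|x1]; have [c /andP[c1 _] E] := Fmvt _ _ x1.
  by apply/eqP; rewrite -subr_eq0 E /b bump_out ?mul0r//; right; exact: ltW.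
have I0 : 0 < F 1.
  have [|c /andP[c0 c1] E] := @Fmvt 0 1; first exact: ltr01.
  rewrite (F0 0 (lexx _)) !subr0 mulr1 in E; rewrite E /b /bump c0 c1 /=.
  by rewrite hornerC expr0 !mul1r expR_gt0.
exists (fun x => (F 1)^-1 * F x), (fun x => (F 1)^-1 * b x), (F 1)^-1; split.
- have dth (x : R) : is_derive x 1 (fun x => (F 1)^-1 * F x) ((F 1)^-1 * b x) by exact: is_derive_mulc.
  apply: (smooth1_of_derive dth).
  have -> : (fun x => (F 1)^-1 * b x) = bump ((F 1)^-1 *: 1) 0.
    by apply/funext => x; rewrite /b /bump; case: ifP => _; rewrite ?mulr0// hornerZ !mulrA.
  exact: smooth1_bump.
- by move=> x; exact: is_derive_mulc.
- move=> x; have /andP[h0 h1] := b01 x; have Fi : 0 <= (F 1)^-1 by rewrite invr_ge0 ltW.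
  by rewrite mulr_ge0//= ler_piMr.
- by move=> x h; rewrite /b bump_out// mulr0.
- split=> x hx; first by rewrite (F0 x hx) mulr0.
  by rewrite (F1 x hx) mulVf// gt_eqF.
Qed.

End step.

(** * Smoothness of sums of products of one-variable functions *)

Section products.
Context {R : realType}.

Lemma differentiable_prodV (V : normedModType R) n (f : 'I_n -> V -> R) (x : V) :
  (forall i, differentiable (f i) x) -> differentiable (fun y => \prod_(i < n) f i y) x.
Proof.
move=> df; elim: n f df => [|n IH] f df.
  by rewrite (_ : (fun y => _) = cst 1)//; apply/funext => y; rewrite big_ord0.
rewrite (_ : (fun y => _) = f ord0 * (fun y => \prod_(i < n) f (lift ord0 i) y)).
  by apply: differentiableM => //; apply: IH => i; exact: df.
by apply/funext => y; rewrite big_ord_recl.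
Qed.

Lemma partial_prod n (f : 'I_n -> R -> R) k (x : 'rV[R]_n) : (forall i, smooth1 (f i)) ->
  differentiable (fun y : 'rV[R]_n => \prod_i f i (y ord0 i)) x /\
  partial k (fun y : 'rV[R]_n => \prod_i f i (y ord0 i)) x =
  \prod_i (if i == k then derive1 (f i) else f i) (x ord0 i).
Proof.
move=> sf; have dg (y : 'rV[R]_n) : differentiable (fun y : 'rV[R]_n => \prod_i f i (y ord0 i)) y.
  apply: differentiable_prodV => i.
  apply: (@differentiable_comp _ _ _ _ (fun z : 'rV[R]_n => z ord0 i) (f i)).
    exact: differentiable_coord.
  by apply/derivable1_diffP; exact: smooth1_derivable.
split=> //; set g := fun y : 'rV[R]_n => _.
pose c := \prod_(i | i != k) f i (x ord0 i).
pose v : 'rV[R]_n := delta_mx ord0 k.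
have gE (s : R) : g (x + s *: v) = c * f k (1 * s + x ord0 k).
  rewrite /g (bigD1 k)//= mulrC; congr (_ * f k _).
    apply: eq_bigr => i ik; rewrite !mxE (negbTE ik) andbF mulr0 addr0 //.
  by rewrite !mxE !eqxx mulr1 mul1r addrC.
have h1 := @is_derive_line R n g x v 0 (dg _).
have h2 : is_derive (0 : R) 1 (fun s : R => c * f k (1 * s + x ord0 k)) (c * (1 * derive1 (f k) (1 * 0 + x ord0 k))).
  apply: is_derive_mulc.
  have /derivableP dk := @smooth1_derivable R (f k) (1 * 0 + x ord0 k) (sf k).
  have := is_derive_addf (is_derive_mulc 1 (is_derive_id (0 : R) (1 : R))) (is_derive_cst (x ord0 k) (0 : R) (1 : R)).
  rewrite addr0 mulr1 => da.
  by have := @is_derive_comp1 R (fun s => 1 * s + x ord0 k) (f k) 0 1 _ dk da; rewrite derive1E mulrC.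
move: h1; rewrite (_ : (fun s : R => g (x + s *: v)) = (fun s : R => c * f k (1 * s + x ord0 k))); last by apply/funext.
move=> /is_derive_derive1; rewrite (is_derive_derive1 h2) scale0r addr0 mulr0 add0r mul1r.
rewrite -derive_grad// => E; rewrite /partial -/v -E (bigD1 k)//= eqxx mulrC; congr (_ * _).
by apply: eq_bigr => i /negbTE ->.
Qed.

(** A class stable under partial derivatives, hence made of smooth functions. The cutoffs belong to
    it by construction. *)
Definition sum_of_products n (g : 'rV[R]_n -> R) := exists m (f : 'I_m -> 'I_n -> R -> R),
  (forall j i, smooth1 (f j i)) /\ g = (fun x => \sum_j \prod_i f j i (x ord0 i)).

Lemma sum_of_products_partial n (g : 'rV[R]_n -> R) k : sum_of_products g ->
  (forall x, differentiable g x) /\ sum_of_products (partial k g).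
Proof.
move=> [m [f [sf ->]]].
pose h j (y : 'rV[R]_n) := \prod_i f j i (y ord0 i).
have dh j x : differentiable (h j) x by have [] := partial_prod k x (sf j).
have E : (fun x => \sum_j h j x) = \sum_j h j by apply/funext => x; rewrite fct_sumE.
split; first by move=> x; rewrite -/(fun x => \sum_j h j x) E; apply: differentiable_sum.
exists m, (fun j i => if i == k then derive1 (f j i) else f j i); split.
  by move=> j i; case: ifP => // _; exact: smooth1_derive1.
apply/funext => x; rewrite /partial -/(fun x => \sum_j h j x) E derive_sum; last first.
  by move=> j; exact: diff_derivable.
by apply: eq_bigr => j _; have [_] := partial_prod k x (sf j).
Qed.

Lemma sum_of_products_smooth n (g : 'rV[R]_n.+1 -> R) : sum_of_products g -> smooth g.
Proof.
move=> sg l x; suff : sum_of_products (foldr (@partial R n.+1) g l).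
  by move=> /(sum_of_products_partial ord0)[].
elim: l => //= k l IH; exact: (sum_of_products_partial k IH).2.
Qed.

End products.

(** * Partitions of unity and cutoffs *)

Section cutoffs.
Context {R : realType}.
Implicit Types (n m : nat).

(** Pass from [F] to [G] one factor at a time. Each exchange costs [d], because summing over the
    other indices gives factors at most 1. The bound is independent of [m], the number of grid
    points per direction. *)
Lemma sum_prod_diff_le n m (F G : 'I_n -> 'I_m -> R) (d : R) :
  (forall i j, 0 <= F i j) -> (forall i j, 0 <= G i j) ->
  (forall i, \sum_j F i j <= 1) -> (forall i, \sum_j G i j <= 1) ->
  (forall i, \sum_j `|F i j - G i j| <= d) ->
  \sum_(k : {ffun 'I_n -> 'I_m}) `|\prod_i F i (k i) - \prod_i G i (k i)| <= n%:R * d.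
Proof.
move=> F0 G0 F1 G1 dFG.
pose H (r : nat) (i : 'I_n) (j : 'I_m) := if (i < r)%N then F i j else G i j.
have H0 r i j : 0 <= H r i j by rewrite /H; case: ifP.
pose Q r (k : {ffun 'I_n -> 'I_m}) := \prod_i H r i (k i).
have QF (k : {ffun 'I_n -> 'I_m}) : \prod_i F i (k i) = Q n k by apply: eq_bigr => i _; rewrite /H ltn_ord.
have QG (k : {ffun 'I_n -> 'I_m}) : \prod_i G i (k i) = Q 0%N k by apply: eq_bigr => i _; rewrite /H ltn0.
have step (r : 'I_n) : \sum_k `|Q r.+1 k - Q r k| <= d.
  pose E (i : 'I_n) (j : 'I_m) := if (i == r) then `|F i j - G i j| else H r i j.
  have -> : \sum_k `|Q r.+1 k - Q r k| = \sum_(k : {ffun 'I_n -> 'I_m}) \prod_i E i (k i).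
    apply: eq_bigr => k _; rewrite /Q (bigD1 r)//= [X in _ - X](bigD1 r)//= [RHS](bigD1 r)//= /E eqxx.
    rewrite /H ltnSn ltnn.
    rewrite (_ : \prod_(i < n | i != r) _ = \prod_(i < n | i != r) H r i (k i)); last first.
      by apply: eq_bigr => i ir; rewrite /H ltnS leq_eqVlt; move: ir; rewrite -val_eqE /= => /negbTE ->.
    rewrite -mulrBl normrM; congr (_ * _).
    rewrite ger0_norm ?prodr_ge0//; apply: eq_bigr => i /negbTE -> //.
  rewrite -(bigA_distr_bigA E) (bigD1 r)//= -[leRHS]mulr1; apply: ler_pM.
  - by apply: sumr_ge0 => j _; rewrite /E eqxx.
  - by apply: prodr_ge0 => i _; apply: sumr_ge0 => j _; rewrite /E; case: ifP.
  - by under eq_bigr do rewrite /E eqxx; exact: dFG.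
  apply: prodr_ile1 => i /negbTE ir; rewrite /E ir sumr_ge0//=.
  by rewrite /H; case: (i < r)%N; [exact: F1|exact: G1].
have tel (k : {ffun 'I_n -> 'I_m}) : `|\prod_i F i (k i) - \prod_i G i (k i)| <= \sum_(r < n) `|Q r.+1 k - Q r k|.
  rewrite QF QG -(telescope_sumr (fun r => Q r k) (leq0n n)) big_mkord.
  exact: ler_norm_sum.
apply: (@le_trans _ _ (\sum_(k : {ffun 'I_n -> 'I_m}) \sum_(r < n) `|Q r.+1 k - Q r k|)).
  by apply: ler_sum => k _; exact: tel.
rewrite exchange_big /=; apply: (@le_trans _ _ (\sum_(r < n) d)).
  by apply: ler_sum => r _; exact: step.
by rewrite sumr_const card_ord mulr_natl.
Qed.

(** [eta] is the increment over length 1 of a smooth step, so its integer translates telescope to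
    1. *)
Lemma partition_of_unity : exists (eta : R -> R) (B : R), [/\ 0 <= B,
  smooth1 eta, forall x, 0 <= eta x, forall x, 1 <= `|x| -> eta x = 0 &
  forall m, [/\ forall x, \sum_(k < m) eta (x - k%:R) <= 1,
    forall x, 0 <= x -> x + 1 <= m%:R -> \sum_(k < m) eta (x - k%:R) = 1 &
    forall x y, \sum_(k < m) `|eta (x - k%:R) - eta (y - k%:R)| <= B * `|x - y|]].
Proof.
have [th [be [B [sth dth be0 beo [th0 th1]]]]] := @smooth_step R.
have B0 : 0 <= B by have /andP[h1 h2] := be0 0; exact: le_trans h1 h2.
have thmvt (g dg : R -> R) (M x y : R) : (forall x : R, is_derive x 1 g (dg x)) ->
    (forall x, 0 <= dg x <= M) -> x <= y -> 0 <= g y - g x <= M * (y - x).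
  move=> hg hd; rewrite le_eqVlt => /orP[/eqP ->|xy]; first by rewrite !subrr mulr0 lexx.
  have [|c _ ->] := @MVT R g dg x y xy (fun z _ => hg z).
    by apply: continuous_subspaceT => z; exact: is_derive_continuous (hg z).
  have /andP[h1 h2] := hd c; have yx : 0 <= y - x by rewrite subr_ge0 ltW.
  by rewrite mulr_ge0//= ler_wpM2r.
have thnd x y : x <= y -> th x <= th y.
  by move=> xy; have /andP[] := thmvt th be B x y dth be0 xy; rewrite subr_ge0.
have th_ge0 x : 0 <= th x.
  have [x0|x0] := leP x 0; first by rewrite th0.
  by rewrite -(th0 0 (lexx _)); apply: thnd; exact: ltW.
have th_le1 x : th x <= 1.
  have [x1|x1] := leP 1 x; first by rewrite th1.
  by rewrite -(th1 1 (lexx _)); apply: thnd; exact: ltW.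
(* The translates of [be] live on disjoint unit intervals, so at most one term is nonzero. *)
have sumbe m x : 0 <= \sum_(k < m) be (x - k%:R) <= B /\ (m%:R <= x -> \sum_(k < m) be (x - k%:R) = 0).
  elim: m => [|m [IH1 IH2]]; first by rewrite big_ord0 lexx B0.
  rewrite big_ord_recr /=; split; last first.
    move=> mx; rewrite IH2; last by apply: le_trans mx; rewrite ler_nat.
    by rewrite beo ?addr0//; right; rewrite lerBrDr -natr1 addrC in mx *.
  have [xm|xm] := leP x m%:R; last by rewrite IH2 ?(ltW xm)// add0r.
  by rewrite (beo (x - m%:R)) ?addr0//; left; rewrite subr_le0.
have shift (a x : R) : is_derive x 1 (fun x => th (x - a)) (be (x - a)).
  have da : is_derive x 1 (fun x : R => x - a) 1.
    by have := is_derive_addf (is_derive_id x (1 : R)) (is_derive_cst (- a) x (1 : R)); rewrite addr0.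
  by have := @is_derive_comp1 R (fun x => x - a) th x 1 _ (dth _) da; rewrite mulr1.
(* As [th] is nondecreasing, the absolute values drop for [y <= x]. The sum becomes the increment of
   one function whose derivative is at most [B], whatever [m] is. *)
have lipth m x y : \sum_(k < m) `|th (x - k%:R) - th (y - k%:R)| <= B * `|x - y|.
  wlog xy : x y / y <= x.
    move=> H; have [xy|/ltW xy] := leP y x; first exact: H.
    by rewrite distrC; under eq_bigr do rewrite distrC; exact: H.
  under eq_bigr => k _ do rewrite ger0_norm ?subr_ge0 ?thnd ?lerD2r//.
  rewrite sumrB ger0_norm ?subr_ge0//.
  pose g (x : R) := \sum_(k < m) th (x - k%:R); pose dg (x : R) := \sum_(k < m) be (x - k%:R).
  have dgg (z : R) : is_derive z 1 g (dg z).
    rewrite /g /dg; elim: m {g dg} => [|m IH].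
      rewrite big_ord0; have -> : (fun x : R => \sum_(k < 0) th (x - k%:R)) = cst 0.
        by apply/funext => w; rewrite big_ord0.
      exact: is_derive_cst.
    rewrite big_ord_recr /=.
    have -> : (fun x : R => \sum_(k < m.+1) th (x - k%:R)) = (fun x => (\sum_(k < m) th (x - k%:R)) + th (x - m%:R)).
      by apply/funext => w; rewrite big_ord_recr.
    exact: is_derive_addf.
  by have /andP[] := thmvt g dg B y x dgg (fun z => (sumbe m z).1) xy.
pose eta x := th (x + 1) - th x.
have etaE x k : eta (x - k%:R) = th (x + 1 - k%:R) - th (x - k%:R) by rewrite /eta addrAC.
have tel m x : \sum_(k < m) eta (x - k%:R) = th (x + 1) - th (x + 1 - m%:R).
  elim: m => [|m IH]; first by rewrite big_ord0 subr0 subrr.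
  rewrite big_ord_recr /= IH etaE addrA addrNK -natr1.
  by congr (_ - th _); ring.
exists eta, (B + B); split.
- exact: addr_ge0.
- apply: smooth1B; last exact: sth.
  have := @smooth1_affine R 1 1 th sth.
  by under eq_fun do rewrite mul1r.
- by move=> x; rewrite subr_ge0 thnd// lerDl.
- move=> x; rewrite ler_normr => /orP[x1|x1].
    by rewrite /eta !th1 ?subrr//; lra.
  by rewrite /eta !th0 ?subrr//; lra.
move=> m; split.
- by move=> x; rewrite tel; have := th_le1 (x + 1); have := th_ge0 (x + 1 - m%:R); lra.
- move=> x x0 xm; rewrite tel (th1 (x + 1)) ?th0 ?subr0//; lra.
move=> x y; rewrite mulrDl.
apply: le_trans (_ : \sum_(k < m) (`|th (x + 1 - k%:R) - th (y + 1 - k%:R)| + `|th (x - k%:R) - th (y - k%:R)|) <= _).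
  apply: ler_sum => k _; rewrite !etaE.
  have -> : th (x + 1 - k%:R) - th (x - k%:R) - (th (y + 1 - k%:R) - th (y - k%:R)) =
    (th (x + 1 - k%:R) - th (y + 1 - k%:R)) - (th (x - k%:R) - th (y - k%:R)) by ring.
  exact: ler_normB.
rewrite big_split /=; apply: lerD; last exact: lipth.
by have := lipth m (x + 1) (y + 1); rewrite (_ : x + 1 - (y + 1) = x - y)//; ring.
Qed.

(** Sum the functions of a partition of unity on a grid of mesh [l] over those cubes that are
    contained in the domain. This stays within the domain, and at depth above [C l] no cube is
    missed. *)
Lemma cutoff n (Omega : set 'rV[R]_n.+1) : open Omega -> bounded_set Omega ->
  exists2 C : R, 0 < C & forall l, 0 < l -> exists psi : 'rV[R]_n.+1 -> R,
    [/\ test_fun Omega psi, forall x, 0 <= psi x <= 1,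
        forall x, Omega x -> C * l < bdist Omega x -> psi x = 1 &
        forall x y, `|psi x - psi y| <= C / l * enorm (x - y)].
Proof.
move=> oO bO; have [a a0 ha] := bounded_enorm bO.
have [eta [B [B0 seta eta0 etao part]]] := partition_of_unity.
exists (n.+1%:R * 2 + n.+1%:R * B); first by rewrite ltr_wpDr ?mulr_ge0// mulr_gt0.
move=> l l0.
(* The rescaled coordinates lie in [[0, 2a/l]], and the partition sums to 1 only up to [m - 1],
   hence the extra unit. *)
pose m := (Num.truncn (2 * a / l)).+2.
have mE : 2 * a / l + 1 <= m%:R.
  have h : 0 <= 2 * a / l by rewrite divr_ge0 ?mulr_ge0 ?ltW.
  have /andP[_ /ltW] := truncn_itv h.
  by rewrite -[m%:R]natr1 lerD2r.
have [sum_le1 sum_eq1 sum_lip] := part m.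
pose u (x : 'rV[R]_n.+1) i := l^-1 * x ord0 i + a / l.
have uE x i : u x i = (x ord0 i + a) / l by rewrite /u mulrDl mulrC.
pose c (k : {ffun 'I_n.+1 -> 'I_m}) : 'rV[R]_n.+1 := \row_i (l * (k i)%:R - a).
pose cube k : set 'rV[R]_n.+1 := [set y | `|y - c k| <= l].
pose K : pred {ffun 'I_n.+1 -> 'I_m} := fun k => `[< cube k `<=` Omega >].
pose P (k : {ffun 'I_n.+1 -> 'I_m}) (x : 'rV[R]_n.+1) := \prod_i eta (u x i - (k i)%:R).
pose psi x := \sum_(k | K k) P k x.
have P0 k x : 0 <= P k x by apply: prodr_ge0.
have inc (k : {ffun 'I_n.+1 -> 'I_m}) x : P k x != 0 -> cube k x.
  move=> Pn; apply/normrV_leP => [|i]; first exact: ltW.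
  have : ~~ (1 <= `|u x i - (k i)%:R|).
    apply: contra Pn => h; rewrite /P (bigD1 i)//= etao ?mul0r//.
  rewrite -ltNge !mxE uE => /ltW h.
  have -> : x ord0 i - (l * (k i)%:R - a) = l * ((x ord0 i + a) / l - (k i)%:R).
    by field; rewrite gt_eqF.
  by rewrite normrM gtr0_norm// -[leRHS]mulr1 ler_wpM2l// ltW.
have ccube k : closed (cube k).
  rewrite (_ : cube k = (fun y => `|y - c k|) @^-1` [set r | r <= l])//.
  apply: closed_comp; last exact: closed_le.
  move=> y _; apply: (@lipschitz_continuous R _ (fun y : 'rV[R]_n.+1 => `|y - c k|) 1) => // z w.
  rewrite mul1r; apply: le_trans (ler_dist_dist _ _) _.
  by rewrite opprB addrA subrK normrV_le_enorm.
pose S : set 'rV[R]_n.+1 := \bigcup_(k in [set k | K k]) cube k.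
have cS : closed S by apply: closed_bigcup => //; exact: finite_finset.
have SO : S `<=` Omega by move=> x [k /asboolP]; apply.
have psiS : [set x | psi x != 0] `<=` S.
  move=> x /= px; apply: contrapT => nS; move/negP: px; apply; apply/eqP.
  by apply: big1 => k Kk; apply/eqP/negPn/negP => /inc xk; apply: nS; exists k.
have clS : closure [set x | psi x != 0] `<=` S by rewrite (closure_id S).1//; exact: closure_subset.
have tot x : \sum_k P k x = \prod_i \sum_(j < m) eta (u x i - j%:R).
  by rewrite (bigA_distr_bigA (fun i (j : 'I_m) => eta (u x i - j%:R))).
exists psi; split.
- split.
  + apply: sum_of_products_smooth.
    exists #|{ffun 'I_n.+1 -> 'I_m}|, (fun j i t => let k := enum_val j in
      if K k then eta (l^-1 * t + (a / l - (k i)%:R)) else cst 0 t); split.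
      move=> j i /=; case: (K (enum_val j)); first exact: smooth1_affine.
      by have := smooth1B seta seta; under eq_fun do rewrite subrr.
    apply/funext => x; rewrite /psi big_mkcond/= (reindex_onto enum_val enum_rank)/=; last first.
      by move=> k _; rewrite enum_rankK.
    apply: eq_big => [j|j _]; first by rewrite enum_valK eqxx.
    case: ifP => Kj; last by rewrite big_ord_recl mul0r.
    by apply: eq_bigr => i _; rewrite /u addrA.
  + apply: bounded_closed_compact; last exact: closed_closure.
    have [M [Mr hM]] := bO; exists M; split => // r Mr' x /clS/SO; exact: hM.
  + by move=> x /clS/SO.
- move=> x; rewrite sumr_ge0//=; apply: (@le_trans _ _ (\sum_k P k x)).
    by rewrite /psi big_mkcond; apply: ler_sum => k _; case: ifP.
  rewrite tot; apply: prodr_ile1 => i _; rewrite sum_le1 andbT.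
  by apply: sumr_ge0.
- move=> x Ox xd.
  (* A cube with [P k x != 0] contains [x], and its other points are closer to [x] than the boundary
     is, so it is one of those selected. *)
  transitivity (\sum_k P k x).
    rewrite /psi big_mkcond; apply: eq_bigr => k _; case: ifPn => // Kk.
    apply/esym/eqP/negPn/negP => /inc xk; move/negP: Kk; apply; apply/asboolP => y yk.
    apply: (bdist_ball oO Ox); apply: le_lt_trans xd.
    apply: le_trans (enorm_le_normrV _) _; rewrite mulrDl -mulrA.
    apply: ler_wpDr; first by rewrite !mulr_ge0// ltW.
    rewrite ler_wpM2l// mulr_natl mulr2n.
    have -> : y - x = (y - c k) - (x - c k) by rewrite opprB addrA subrK.
    by apply: le_trans (ler_normB _ _) _; exact: lerD.
  rewrite tot big1// => i _; apply: sum_eq1.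
    have := le_trans (normrV_coord x i) (le_trans (normrV_le_enorm x) (ha x Ox)).
    by rewrite uE ler_norml => /andP[h _]; apply: divr_ge0; [lra|exact: ltW].
  have := le_trans (normrV_coord x i) (le_trans (normrV_le_enorm x) (ha x Ox)).
  rewrite uE ler_norml => /andP[_ h]; apply: le_trans mE; rewrite lerD2r.
  by rewrite ler_pM2r ?invr_gt0//; lra.
- move=> x y.
  apply: (@le_trans _ _ (\sum_k `|P k x - P k y|)).
    rewrite /psi -sumrB; apply: le_trans (ler_norm_sum _ _ _) _.
    by rewrite big_mkcond; apply: ler_sum => k _; case: ifP.
  have h := @sum_prod_diff_le n.+1 m (fun i j => eta (u x i - j%:R)) (fun i j => eta (u y i - j%:R))
    (B / l * enorm (x - y)).
  apply: le_trans (h _ _ _ _ _) _ => //.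
    move=> i; apply: le_trans (sum_lip _ _) _; rewrite -mulrA; apply: ler_wpM2l => //.
    have -> : u x i - u y i = l^-1 * (x - y) ord0 i by rewrite /u !mxE; ring.
    rewrite normrM gtr0_norm ?invr_gt0//; apply: ler_wpM2l; first by rewrite invr_ge0 ltW.
    exact: le_trans (normrV_coord _ i) (normrV_le_enorm _).
  rewrite mulrA; apply: ler_wpM2r; first exact: enorm_ge0.
  rewrite mulrA; apply: ler_wpM2r; first by rewrite invr_ge0 ltW.
  by rewrite lerDr mulr_ge0.
Qed.

End cutoffs.

(** * Logarithmic cutoffs *)

Section energy.
Context {R : realType}.
Local Notation mu := (@lebesgue_rV R).
Local Notation leb := (@lebesgue_measure R).
Local Notation pos := (`]0, +oo[%classic : set R).

(** The first claim feeds the induction for the second: the cross terms [2 a_i a_j] with [i < j] add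
    up to at most [2 a_j q 2^j], a multiple of the diagonal bound. *)
Lemma sqr_sum_geometric (a : nat -> R) (q : R) (m : nat) :
  (forall j, 0 <= a j <= q * 2 ^+ j) ->
  \sum_(j < m) a j <= q * 2 ^+ m /\
  (\sum_(j < m) a j) ^+ 2 <= 4 * \sum_(j < m) a j * (q * 2 ^+ j).
Proof.
move=> h; have q0 : 0 <= q by have /andP[h1 h2] := h 0%N; move: (le_trans h1 h2); rewrite mulr1.
elim: m => [|m [IH1 IH2]]; first by rewrite !big_ord0 expr0 mulr1 expr0n mulr0.
rewrite !big_ord_recr /=; have /andP[a0 a1] := h m; split; first by rewrite exprS; lra.
have s0 : 0 <= \sum_(j < m) a j by apply: sumr_ge0 => j _; have /andP[] := h j.
rewrite mulrDr; move: IH1 IH2 s0 a0 a1; move: (\sum_(j < m) a j) (\sum_(j < m) a j * _) (a m) (q * 2 ^+ m) => s S b c.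
move=> h1 h2 h3 h4 h5.
have k1 : s * b <= c * b by apply: ler_wpM2r.
have k2 : b * b <= c * b by apply: ler_wpM2r.
nra.
Qed.

(** The two indicator terms have equal integrals by symmetry of [k], and each is at most [M] times
    the measure of [S] by Tonelli. *)
Lemma strip_energy n (S : set 'rV[R]_n.+1) (k : 'rV[R]_n.+1 -> R) (M : R) : measurable S ->
  measurable_fun [set: 'rV[R]_n.+1] k -> (forall z, 0 <= k z) -> (forall z, k (- z) = k z) ->
  (forall x, \int[mu n.+1]_y (k (x - y))%:E <= M%:E)%E ->
  (\int[mu n.+1 \x mu n.+1]_z ((\1_S z.1 + \1_S z.2) * k (z.1 - z.2))%:E <=
   (2 * M)%:E * mu n.+1 S)%E.
Proof.
move=> mS mk k0 ksym kM.
have mT := @measurableT _ ('rV[R]_n.+1 * 'rV[R]_n.+1)%type.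
have mkd : measurable_fun [set: 'rV[R]_n.+1 * 'rV[R]_n.+1] (fun z => k (z.1 - z.2)).
  by apply: (measurableT_comp mk); apply: measurable_rVB; [exact: measurable_fst|exact: measurable_snd].
have mi : measurable_fun [set: 'rV[R]_n.+1] (\1_S : 'rV[R]_n.+1 -> R) by exact: measurable_indic.
have i0 x : 0 <= \1_S x :> R by rewrite indicE.
have M0 : (0 <= M%:E)%E by apply: le_trans (kM 0); apply: integral_ge0 => y _; rewrite lee_fin.
pose f (z : 'rV[R]_n.+1 * 'rV[R]_n.+1) : \bar R := (\1_S z.1 * k (z.1 - z.2))%:E.
pose g (z : 'rV[R]_n.+1 * 'rV[R]_n.+1) : \bar R := (\1_S z.2 * k (z.1 - z.2))%:E.
have mf : measurable_fun [set: 'rV[R]_n.+1 * 'rV[R]_n.+1] f.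
  apply: measurable_EFin_comp; apply: measurable_funM => //.
  by apply: (measurableT_comp mi); exact: measurable_fst.
have mg : measurable_fun [set: 'rV[R]_n.+1 * 'rV[R]_n.+1] g.
  apply: measurable_EFin_comp; apply: measurable_funM => //.
  by apply: (measurableT_comp mi); exact: measurable_snd.
have f0 z : (0 <= f z)%E by rewrite lee_fin mulr_ge0.
have g0 z : (0 <= g z)%E by rewrite lee_fin mulr_ge0.
have half : (\int[mu n.+1]_x \int[mu n.+1]_y f (x, y) <= M%:E * mu n.+1 S)%E.
  apply: (@le_trans _ _ (\int[mu n.+1]_x (M%:E * (\1_S x)%:E))%E); last first.
    rewrite ge0_integralZl//; last by apply: measurable_EFin_comp.
    by rewrite integral_indic// setIT.
  apply: ge0_le_integral => //.
  - by move=> x _; apply: integral_ge0.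
  - by apply: (@measurable_fun_fubini_tonelli_F _ _ _ _ _ (mu n.+1) _ mf) => z; exact: f0.
  - by apply: measurable_EFin_comp; apply: measurable_funM.
  move=> x _.
  rewrite (_ : (\int[mu n.+1]_y _ = (\1_S x)%:E * \int[mu n.+1]_y (k (x - y))%:E)%E); last first.
    rewrite -ge0_integralZl//.
    - apply: measurable_EFin_comp; apply: (measurableT_comp mk).
      by apply: measurable_rVB.
    - by move=> y _; rewrite lee_fin.
  by rewrite muleC; apply: lee_wpmul2r => //; rewrite lee_fin.
rewrite (_ : (\int[_]_z _ = \int[mu n.+1 \x mu n.+1]_z (f z + g z))%E); last first.
  by apply: eq_integral => z _; rewrite mulrDl EFinD.
rewrite (ge0_integralD _ mT (fun z _ => f0 z) mf (fun z _ => g0 z) mg).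
rewrite (_ : 2 * M = M + M); last by rewrite mulr_natl.
rewrite EFinD ge0_muleDl//; apply: leeD.
  by rewrite (@fubini_tonelli1 _ _ _ _ _ (mu n.+1) (mu n.+1) _ mf f0).
rewrite (@fubini_tonelli1 _ _ _ _ _ (mu n.+1) (mu n.+1) _ mg g0).
rewrite /fubini_F (tonelli_swap (mu n.+1) (mu n.+1) mg g0).
apply: le_trans half; rewrite le_eqVlt; apply/orP; left; apply/eqP.
apply: eq_integral => x _; apply: eq_integral => y _; rewrite /f /g /=.
by rewrite -ksym opprB.
Qed.

(** In the integrand [x^(p-1)] is at most [x^(a-1)] below 1 and at most [x^(b-1)] above. *)
Lemma Gam_le_add (a b p : R) : 0 < a -> a <= p <= b -> Gam p <= Gam a + Gam b.
Proof.
move=> a0 /andP[ap pb]; have p0 := lt_le_trans a0 ap; have b0 := lt_le_trans p0 pb.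
have mG q : measurable_fun pos (fun x : R => (x `^ (q - 1) * expR (- x))%:E).
  by apply: measurable_funTS; apply: measurable_EFin_comp; exact: measurable_gammaf.
have G0 q (x : R) : pos x -> (0 <= (x `^ (q - 1) * expR (- x))%:E)%E.
  by move=> _; rewrite lee_fin mulr_ge0 ?powR_ge0 ?expR_ge0.
rewrite -lee_fin EFinD -!integral_Gamma//.
have mpos : measurable pos by exact: measurable_itv.
rewrite -(ge0_integralD leb mpos (G0 a) (mG a) (G0 b) (mG b)).
apply: ge0_le_integral => //; [exact: G0|exact: mG| | ].
- by apply: emeasurable_funD; [exact: mG|exact: mG].
- move=> x; rewrite posE => x0; rewrite -EFinD lee_fin -mulrDl; apply: ler_wpM2r; first exact: expR_ge0.
  have [x1|x1] := leP x 1.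
    by apply: ler_wpDr; [exact: powR_ge0|apply: ger_powR; [rewrite x0 x1|lra]].
  by apply: ler_wpDl; [exact: powR_ge0|apply: ler_powR; [exact: ltW|lra]].
Qed.

Lemma c_const_bounded n : exists2 B : R, 0 < B &
  forall t, 0 < t <= 16^-1 -> c_const n.+1 (2^-1 + t) <= B.
Proof.
pose A : R := pi `^ (- (n.+1%:R / 2)); pose G : R := Gam (n%:R / 2 + 1) + Gam (n%:R / 2 + 2).
pose H : R := Gam 1 + Gam 2.
have n0 : 0 <= n%:R :> R by [].
have A0 : 0 < A by rewrite powR_gt0 ?pi_gt0.
have G0 : 0 < G by rewrite addr_gt0 ?Gamma_gt0//; lra.
have H0 : 0 < H by rewrite addr_gt0 ?Gamma_gt0.
exists (4 * A * (G * H)); first by pos.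
move=> t /andP[t0 t1]; have t8 : 0 < t < 8^-1 by lra.
rewrite /c_const -!GamE.
have -> : (n.+1%:R + 2 * (2^-1 + t)) / 2 = n%:R / 2 + (1 + t) by rewrite -natr1; field.
have -> : 1 - (2^-1 + t) = 2^-1 - t by field.
have g1 : Gam (n%:R / 2 + (1 + t)) <= G by apply: Gam_le_add; lra.
have g2 : Gam (1 + t) <= H by apply: Gam_le_add; lra.
have gp : 0 < Gam (2^-1 - t) by apply: Gamma_gt0; lra.
have gp1 : 0 < Gam (1 + t) by apply: Gamma_gt0; lra.
have gp2 : 0 < Gam (n%:R / 2 + (1 + t)) by apply: Gamma_gt0; lra.
(* Nonnegativity of [gam t] says that [2^(-2t) / sqrt pi * Gam (1/2 - t) * Gam (1 + t) >= 1], which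
   bounds the reciprocal by [Gam (1 + t)]. *)
have g3 : (Gam (2^-1 - t))^-1 <= H.
  have /andP[+ _] := gam_le t8; rewrite /gam ler_pdivlMr ?mul0r; last lra.
  rewrite subr_ge0 => h.
  have p1 : 1 <= Num.sqrt (pi : R).
    by rewrite -[leLHS]sqrtr1 ler_sqrt ?pi_ge0//; have := @pi_ge2 R; lra.
  have p2 : 2 `^ (- (2 * t)) / Num.sqrt pi <= 1 :> R.
    rewrite ler_pdivrMr ?(lt_le_trans ltr01 p1)// mul1r; apply: le_trans p1.
    by rewrite -[leRHS](powRr0 2); apply: ler_powR; lra.
  rewrite -[leLHS]mul1r ler_pdivrMr//; apply: le_trans h _.
  rewrite -mulrA; apply: le_trans (_ : 1 * (Gam (2^-1 - t) * Gam (1 + t)) <= _).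
    by apply: ler_wpM2r p2; rewrite mulr_ge0 ?ltW.
  by rewrite mul1r mulrC; apply: (ler_wpM2r (ltW gp)).
have q1 : 2 `^ (2 * (2^-1 + t)) <= 4 :> R.
  have -> : 4 = 2 `^ 2 :> R by rewrite (powR_mulrn 2) //; ring.
  by apply: ler_powR; lra.
have e1 : 2 `^ (2 * (2^-1 + t)) * A * (2^-1 + t) <= 4 * A.
  rewrite -[leRHS]mulr1; apply: ler_pM; [|lra| |lra].
    by rewrite mulr_ge0 ?powR_ge0// ltW.
  by apply: ler_wpM2r q1; exact: ltW.
apply: ler_pM => //.
- by apply: mulr_ge0; [rewrite mulr_ge0 ?powR_ge0|lra].
- by rewrite divr_ge0 ?ltW.
- by apply: ler_pM => //; rewrite ?invr_ge0 ltW.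
Qed.

End energy.

Section log_cutoff.
Context {R : realType}.
Local Notation mu := (@lebesgue_rV R).

Lemma smooth_lin n (a : R) (f g : 'rV[R]_n -> R) : smooth f -> smooth g ->
  smooth (fun x => a * f x + g x).
Proof.
move=> sf sg l.
have E : foldr (@partial R n) (fun x => a * f x + g x) l =
    (fun x => a * foldr (@partial R n) f l x + foldr (@partial R n) g l x).
  elim: l => //= k l ->; apply/funext => x; rewrite /partial.
  set F := foldr _ f l; set G := foldr _ g l.
  have dF : is_derive x (delta_mx ord0 k) F ('D_(delta_mx ord0 k) F x).
    by apply: derivableP; apply: diff_derivable; exact: sf.
  have dG : is_derive x (delta_mx ord0 k) G ('D_(delta_mx ord0 k) G x).
    by apply: derivableP; apply: diff_derivable; exact: sg.
  exact: (@derive_val _ _ _ _ _ _ _ (is_deriveD (is_deriveZ a dF) dG)).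
move=> x; rewrite E; apply: (@differentiableD _ _ _ (fun x => a * _) _); last exact: sg.
exact: differentiableZ (sf l x).
Qed.

Lemma test_fun_lin n (Omega : set 'rV[R]_n) (a : R) f g : test_fun Omega f -> test_fun Omega g ->
  test_fun Omega (fun x => a * f x + g x).
Proof.
move=> [sf cf fO] [sg cg gO]; set F := fun x => _.
have sub : closure [set x | F x != 0] `<=` closure [set x | f x != 0] `|` closure [set x | g x != 0].
  rewrite -closureU; apply: closure_subset => x /= Fx.
  have [f0|fn] := eqVneq (f x) 0; last by left.
  by right; move: Fx; rewrite /F f0 mulr0 add0r.
split; first exact: smooth_lin.
- apply: (subclosed_compact _ (compactU cf cg)) sub; exact: closed_closure.
- by move=> x /sub[/fO|/gO].
Qed.

Lemma test_fun0 n (Omega : set 'rV[R]_n) : test_fun Omega (fun=> 0).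
Proof.
have e0 : [set x : 'rV[R]_n | (0 : R) != 0] = set0 by apply/seteqP; split => x //=; rewrite eqxx.
split; rewrite ?e0 ?closure0 => //; last exact: compact0.
move=> l x; have -> : foldr (@partial R n) (fun=> 0) l = (fun=> 0).
  by elim: l => //= k l ->; apply/funext => y; exact: derive_cst.
exact: differentiable_cst.
Qed.

Lemma test_fun_sum n (Omega : set 'rV[R]_n) (a : R) (f : nat -> 'rV[R]_n -> R) m :
  (forall j, test_fun Omega (f j)) -> test_fun Omega (fun x => a * \sum_(j < m) f j x).
Proof.
move=> tf; elim: m => [|m IH].
  rewrite (_ : (fun x => _) = fun=> 0); first exact: test_fun0.
  by apply/funext => x; rewrite big_ord0 mulr0.
rewrite (_ : (fun x => _) = fun x => a * f m x + a * \sum_(j < m) f j x).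
  exact: test_fun_lin.
by apply/funext => x; rewrite big_ord_recr /= mulrDr addrC.
Qed.

(** Scales shrinking by the factor 4 make the square roots grow by the factor 2 that
    [sqr_sum_geometric] expects. *)
Let powR_pow4 (j : nat) (r : R) : 0 <= r -> (4 ^+ j * r) `^ 2^-1 = r `^ 2^-1 * 2 ^+ j.
Proof.
move=> r0; rewrite powRM ?exprn_ge0// mulrC; congr (_ * _).
have -> : 4 ^+ j = (2 ^+ j) `^ 2 :> R.
  by rewrite (@powR_mulrn _ _ 2) ?exprn_ge0// -exprM mulnC exprM; congr (_ ^+ _); ring.
by rewrite -powRrM mulfV// powRr1// exprn_ge0.
Qed.

Let min1_le_sqrt (r : R) : 0 <= r -> Num.min 1 r <= r `^ 2^-1.
Proof.
move=> r0; have [r1|r1] := leP 1 r.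
  by rewrite -[leLHS](powRr0 r); apply: ler_powR => //; lra.
have [->|rn] := eqVneq r 0; first exact: powR_ge0.
by apply: ger1_powR; [rewrite lt_def rn r0 ltW|lra].
Qed.

(* Averaging cutoffs at the scales [4^-j l0], [j < m], makes the energy [O(1/m)]:
   the square of the sum of the differences is controlled by its diagonal because
   the differences grow geometrically in [j] as long as they are below 1. *)
Lemma log_cutoff n (Omega : set 'rV[R]_n.+1) : open Omega -> bounded_set Omega ->
  Omega !=set0 -> class_C11 Omega ->
  exists C m0 : R, [/\ 0 < C, 0 < m0 & forall m, (0 < m)%N -> exists (phi : 'rV[R]_n.+1 -> R) (l : R),
    [/\ 0 < l, test_fun Omega phi, (m0%:E <= sqnorm_L2 Omega phi)%E &
      forall t, 0 < t <= 16^-1 ->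
      (\int[mu n.+1 \x mu n.+1]_(z in Omega `*` Omega) ((phi z.1 - phi z.2) ^+ 2 *
         enorm (z.1 - z.2) `^ (- (n.+1%:R + 2 * (2^-1 + t))))%:E <= (C / m%:R * l `^ (- (2 * t)))%:E)%E]].
Proof.
move=> oO bO neO cO; have b0 := boundary_nonempty oO bO neO.
have mO : measurable Omega by exact: open_measurable_rV.
have [C C0 hC] := cutoff oO bO.
have [Cs Cs0 hCs] := strip_measure oO bO neO cO.
have [K K0 hK] := kernel_integral n C0.
have [x0 Ox0] := neO; have d0 := bdist_gt0 oO b0 Ox0.
(* Then [C l0] is half the depth of [x0], so every cutoff equals 1 on the open set [U] around [x0],
   and the norm stays bounded below whatever [m] is. *)
pose l0 := bdist Omega x0 / (2 * C); have l00 : 0 < l0 by rewrite divr_gt0 ?mulr_gt0.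
pose ls (j : nat) := l0 / 4 ^+ j; have ls0 j : 0 < ls j by rewrite divr_gt0 ?exprn_gt0.
have ls_decr i j : (i <= j)%N -> ls j <= ls i.
  move=> ij; apply: ler_wpM2l; first exact: ltW.
  by rewrite lef_pV2 ?posrE ?exprn_gt0// ler_eXn2l//; lra.
have [psi psiP] := choice (fun j => hC (ls j) (ls0 j)).
pose U := Omega `&` [set x | C * l0 < bdist Omega x].
have oU : open U.
  apply: openI => //; apply: (@open_comp _ _ (bdist Omega) [set r : R | C * l0 < r]); last exact: open_gt.
  by move=> x _; exact: (lipschitz_continuous ler01 (bdist_lipschitz b0)).
have mU : measurable U by exact: open_measurable_rV.
have Ux0 : U x0.
  split=> //=; have -> : C * l0 = bdist Omega x0 / 2 by rewrite /l0; field; rewrite gt_eqF.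
  by rewrite ltr_pdivrMr//; lra.
have muU : (mu n.+1 U < +oo)%E.
  by apply: le_lt_trans (lebesgue_bounded mO bO); apply: le_measure; rewrite ?inE// => x [].
have muU0 : (0 < mu n.+1 U)%E by apply: lebesgue_open_gt0 => //; exists x0.
have muUE : mu n.+1 U = (fine (mu n.+1 U))%:E by rewrite fineK// ge0_fin_numE.
exists (8 * (K * (Cs * C))), (fine (mu n.+1 U)); split.
- by pos.
- by rewrite -lte_fin -muUE.
move=> m m_gt0; pose phi x := m%:R^-1 * \sum_(j < m) psi j x.
have m0 : 0 < m%:R :> R by rewrite ltr0n.
have tphi : test_fun Omega phi by apply: test_fun_sum => j; have [] := psiP j.
have mphi : measurable_fun [set: 'rV[R]_n.+1] phi.
  by apply: continuous_measurable_rV; exact: (test_fun_continuous tphi).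
exists phi, (ls m); split => //.
  rewrite -muUE /sqnorm_L2 -[leLHS]mul1e -integral_cst// [leLHS]integral_mkcond [leRHS]integral_mkcond.
  apply: ge0_le_integral => //.
  - by move=> x _; rewrite /patch; case: ifP.
  - by apply/(measurable_restrictT _ mU).
  - apply/(measurable_restrictT _ mO); apply: measurable_EFin_comp.
    by apply: measurable_funTS; apply: measurable_funX.
  move=> x _; rewrite /patch; case: ifPn => [/set_mem[Ox /= xd]|_]; last first.
    by case: ifP => // _; rewrite lee_fin sqr_ge0.
  rewrite mem_set// lee_fin (_ : phi x = 1) ?expr1n// /phi.
  rewrite (eq_bigr (fun=> 1)) => [|j _].
    by rewrite sumr_const card_ord mulVf// gt_eqF.
  have [_ _ p1 _] := psiP j; apply: p1 => //; apply: le_lt_trans xd.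
  by apply: ler_wpM2l; [exact: ltW|have := ls_decr 0%N j isT; rewrite /ls expr0 divr1].
move=> t t01; have /andP[t0 t1] := t01.
pose p : R := - (n.+1%:R + 2 * (2^-1 + t)).
pose k j (z : 'rV[R]_n.+1) := gcut (C / ls j * enorm z) * enorm z `^ p.
pose S j := strip Omega (C * ls j).
have mS j : measurable (S j) by exact: measurable_strip.
have Cl j : 0 <= C / ls j by rewrite divr_ge0// ltW.
have k0 j z : 0 <= k j z by rewrite mulr_ge0 ?powR_ge0 ?gcut_ge0// mulr_ge0 ?enorm_ge0.
have mk j : measurable_fun [set: 'rV[R]_n.+1] (k j).
  apply: measurable_funM; last by apply: measurable_powR_comp; exact: measurable_enorm.
  apply: (measurableT_comp measurable_gcut); apply: measurable_funM => //.
  exact: measurable_enorm.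
pose G j (z : 'rV[R]_n.+1 * 'rV[R]_n.+1) : R := (\1_(S j) z.1 + \1_(S j) z.2) * k j (z.1 - z.2).
have G0 j z : 0 <= G j z by rewrite mulr_ge0// addr_ge0// indicE.
have mG j : measurable_fun [set: 'rV[R]_n.+1 * 'rV[R]_n.+1] (fun z => (G j z)%:E).
  apply: measurable_EFin_comp; apply: measurable_funM.
    apply: measurable_funD.
      by apply: (measurableT_comp (measurable_indic (mS j))); exact: measurable_fst.
    by apply: (measurableT_comp (measurable_indic (mS j))); exact: measurable_snd.
  by apply: (measurableT_comp (mk j)); apply: measurable_rVB; [exact: measurable_fst|exact: measurable_snd].
(* The measure of the strip, of order [ls j], cancels [l^(-1)] in the kernel bound. What remains is
   [ls j^(-2t)], at most [ls m^(-2t)]: each scale costs the same. *)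
have EG j : (j < m)%N -> (\int[mu n.+1 \x mu n.+1]_z (G j z)%:E <= (2 * (K * (Cs * C)) * ls m `^ (- (2 * t)))%:E)%E.
  move=> jm; have ksym z : k j (- z) = k j z by rewrite /k enormN.
  apply: le_trans (strip_energy (mS j) (mk j) (k0 j) ksym (fun x => hK t (ls j) x t01 (ls0 j))) _.
  have M0 : (0 <= (2 * (K * ls j `^ (- (1 + 2 * t))))%:E)%E.
    by rewrite lee_fin; apply: mulr_ge0 => //; apply: mulr_ge0; [exact: ltW|exact: powR_ge0].
  have Cl0 : 0 < C * ls j by rewrite mulr_gt0.
  apply: le_trans (lee_wpmul2l M0 (hCs _ Cl0)) _; rewrite -EFinM lee_fin.
  have -> : 2 * (K * ls j `^ (- (1 + 2 * t))) * (Cs * (C * ls j)) =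
      2 * (K * (Cs * C)) * (ls j `^ (- (1 + 2 * t)) * ls j) by ring.
  rewrite mulr_powR// (_ : - (1 + 2 * t) + 1 = - (2 * t)); last by ring.
  apply: ler_wpM2l; first by rewrite mulr_ge0// !mulr_ge0// ltW.
  by apply: le0_ler_powR => //; [lra|apply: ls_decr; exact: ltnW].
have pt x y : Omega x -> Omega y ->
    (phi x - phi y) ^+ 2 * enorm (x - y) `^ p <= 4 / m%:R ^+ 2 * \sum_(j < m) G j (x, y).
  move=> Ox Oy; pose a (j : nat) := `|psi j x - psi j y|.
  pose r j := C / ls j * enorm (x - y).
  have r0 j : 0 <= r j by rewrite mulr_ge0 ?enorm_ge0.
  have rE j : r j = 4 ^+ j * r 0%N.
    by rewrite /r /ls expr0 divr1; field; rewrite !gt_eqF// exprn_gt0.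
  have amin j : a j <= Num.min 1 (r j).
    have [_ p01 _ lip] := psiP j; rewrite le_min lip andbT ler_norml.
    have /andP[h1 h2] := p01 x; have /andP[h3 h4] := p01 y; lra.
  have a0 j : 0 <= a j by exact: normr_ge0.
  have rq j : r j `^ 2^-1 = r 0%N `^ 2^-1 * 2 ^+ j by rewrite rE powR_pow4.
  have aq j : 0 <= a j <= r 0%N `^ 2^-1 * 2 ^+ j.
    by rewrite a0 -rq; apply: le_trans (amin j) _; exact: min1_le_sqrt.
  have [_ sq] := sqr_sum_geometric m aq.
  (* The difference of the [j]-th cutoff vanishes when both points are outside the strip of scale
     [j], which is where the indicators come from. *)
  have aG (j : nat) : a j * (r 0%N `^ 2^-1 * 2 ^+ j) <= (\1_(S j) x + \1_(S j) y) * gcut (r j).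
    rewrite -rq /gcut mulrA; apply: ler_wpM2r; first exact: powR_ge0.
    have mn : 0 <= Num.min 1 (r j) by rewrite le_min ler01 r0.
    have [_ _ p1 _] := psiP j.
    have far w : Omega w -> w \notin S j -> psi j w = 1.
      move=> Ow nS; apply: p1 => //; rewrite ltNge; apply/negP => h; move/negP: nS; apply.
      by apply/mem_set; split.
    rewrite !indicE; have [xS|xS] := boolP (x \in S j).
      rewrite mulrDl mul1r; apply: ler_wpDr; last exact: amin.
      by rewrite mulr_ge0.
    have [yS|yS] := boolP (y \in S j); first by rewrite add0r mul1r.
    by rewrite /a !far// subrr normr0 add0r mul0r.
  have norm_le : `|phi x - phi y| <= m%:R^-1 * \sum_(j < m) a j.
    rewrite /phi -mulrBr -sumrB normrM ger0_norm ?invr_ge0 ?(ltW m0)//.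
    by apply: ler_wpM2l; [rewrite invr_ge0 ltW|exact: ler_norm_sum].
  have -> : 4 / m%:R ^+ 2 * \sum_(j < m) G j (x, y) =
      (4 / m%:R ^+ 2 * \sum_(j < m) ((\1_(S j) x + \1_(S j) y) * gcut (r j))) * enorm (x - y) `^ p.
    by rewrite -[RHS]mulrA mulr_suml; congr (_ * _); apply: eq_bigr => j _; rewrite /G /k /= mulrA.
  apply: ler_wpM2r; first exact: powR_ge0.
  rewrite -(real_normK (num_real (phi x - phi y))).
  apply: (@le_trans _ _ ((m%:R^-1 * \sum_(j < m) a j) ^+ 2)).
    by apply: lerXn2r => //; rewrite nnegrE ?normr_ge0// mulr_ge0 ?invr_ge0 ?sumr_ge0 ?(ltW m0).
  rewrite exprMn exprVn [4 / _]mulrC -mulrA; apply: ler_wpM2l; first by rewrite invr_ge0 sqr_ge0.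
  apply: le_trans sq _; apply: ler_wpM2l => //; apply: ler_sum => j _; exact: aG.
have mOO : measurable (Omega `*` Omega) by exact: measurableX.
have m4 : 0 <= 4 / m%:R ^+ 2 :> R by rewrite divr_ge0 ?sqr_ge0.
have m4E : (0 <= (4 / m%:R ^+ 2 : R)%:E)%E by rewrite lee_fin.
have sG z : (0 <= \sum_(j < m) (G j z)%:E)%E by apply: sume_ge0 => j _; rewrite lee_fin.
have msG : measurable_fun [set: 'rV[R]_n.+1 * 'rV[R]_n.+1] (fun z => \sum_(j < m) (G j z)%:E)%E.
  by apply: emeasurable_sum => j; exact: mG.
apply: (@le_trans _ _ (\int[mu n.+1 \x mu n.+1]_z ((4 / m%:R ^+ 2)%:E * \sum_(j < m) (G j z)%:E))%E).
  rewrite integral_mkcond; apply: ge0_le_integral => //.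
  - move=> z _; rewrite /patch; case: ifP => // _.
    by rewrite lee_fin mulr_ge0 ?sqr_ge0 ?powR_ge0.
  - apply/(measurable_restrictT _ mOO); apply: measurable_EFin_comp; apply: measurable_funM.
      by apply: measurable_funX; apply: measurable_diff => //; exact: measurable_funTS.
    exact: measurable_inv_dist.
  - exact: measurable_funeM.
  move=> z _; rewrite /patch; case: ifPn => [/set_mem[/= O1 O2]|_].
    by rewrite sumEFin -EFinM lee_fin; case: z O1 O2 => x y /=; exact: pt.
  by apply: mule_ge0.
rewrite ge0_integralZl// ge0_integral_sum//; last by move=> j z _; rewrite lee_fin.
apply: le_trans (lee_wpmul2l m4E (_ : _ <= \sum_(j < m) (2 * (K * (Cs * C)) * ls m `^ (- (2 * t)))%:E)%E) _.
  by apply: lee_sum => j _; exact: EG.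
rewrite sumEFin sumr_const card_ord -EFinM lee_fin -mulr_natr le_eqVlt; apply/orP; left; apply/eqP.
by field; rewrite gt_eqF.
Qed.

End log_cutoff.

(** * The limit *)

Section conclusion.
Context {R : realType}.
Local Notation mu := (@lebesgue_rV R).

(** In the closure condition the test function approximates itself, with zero error. *)
Lemma test_fun_H0s n (Omega : set 'rV[R]_n.+1) (s : R) phi : open Omega -> bounded_set Omega ->
  test_fun Omega phi ->
  (\int[mu n.+1 \x mu n.+1]_(z in Omega `*` Omega) ((phi z.1 - phi z.2) ^+ 2 *
     enorm (z.1 - z.2) `^ (- (n.+1%:R + 2 * s)))%:E < +oo)%E ->
  (sqnorm_L2 Omega phi < +oo)%E /\ in_H0s s Omega phi.
Proof.
move=> oO bO tphi fin; have mO : measurable Omega by exact: open_measurable_rV.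
have mOO : measurable (Omega `*` Omega) by exact: measurableX.
have mphi : measurable_fun Omega phi.
  by apply: measurable_funTS; apply: continuous_measurable_rV; exact: (test_fun_continuous tphi).
have [M M0 hM] := test_fun_bounded tphi.
have L2fin : (sqnorm_L2 Omega phi < +oo)%E.
  apply: (@le_lt_trans _ _ ((M ^+ 2)%:E * mu n.+1 Omega)%E); last first.
    by rewrite lte_mul_pinfty ?lee_fin ?sqr_ge0// lebesgue_bounded.
  rewrite -(integral_cst (mu n.+1) mO); apply: ge0_le_integral => //.
  - by move=> x _; rewrite lee_fin sqr_ge0.
  - by apply: measurable_EFin_comp; exact: measurable_funX.
  move=> x _; rewrite lee_fin -(real_normK (num_real (phi x))).
  by apply: lerXn2r; rewrite ?nnegrE ?normr_ge0 ?(ltW M0).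
split=> //; split; first split; first by split.
- split.
    by apply: measurable_funM; [exact: measurable_diff|exact: measurable_inv_dist].
  apply: le_lt_trans fin; rewrite le_eqVlt; apply/orP; left; apply/eqP.
  apply: eq_integral => z _; rewrite exprMn -(@powR_mulrn _ (enorm _ `^ _)) ?powR_ge0//.
  by rewrite -powRrM; congr (_ * _ `^ _)%:E; field.
- move=> eps e0; exists phi => //; rewrite /sqnorm_Hs /sqnorm_L2 seminormE.
  rewrite integral0_eq => [|x _]; last by rewrite /= subrr expr0n.
  rewrite integral0_eq => [|z _]; last by rewrite /= !subrr expr0n mul0r.
  by rewrite mule0 adde0 lte_fin exprn_gt0.
Qed.

Lemma not_ae0 n (Omega : set 'rV[R]_n.+1) (phi : 'rV[R]_n.+1 -> R) : measurable Omega ->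
  measurable_fun Omega phi -> (0 < sqnorm_L2 Omega phi)%E ->
  ~ {ae mu n.+1, forall x, Omega x -> phi x = 0}.
Proof.
move=> mO mphi; rewrite ltNge => /negP + ae0; apply; rewrite /sqnorm_L2.
rewrite (ae_eq_integral (cst 0%E))//.
- by rewrite integral_cst// mul0e.
- by apply: measurable_EFin_comp; exact: measurable_funX.
- by apply: filterS ae0 => x h Ox /=; rewrite h// expr0n.
Qed.

(** The competitor depends on [eta] but not on [t]. Dropping the Hardy term, whose coefficient is
    nonnegative, only raises the quotient, and the energy bound [B * C / m] remains. *)
Lemma lambda_star_le n (Omega : set 'rV[R]_n.+1) (eta : R) : open Omega -> bounded_set Omega ->
  Omega !=set0 -> class_C11 Omega -> 0 < eta ->
  exists2 t1 : R, 0 < t1 & forall t, 0 < t < t1 -> (lambda_star (2^-1 + t) Omega <= eta%:E)%E.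
Proof.
move=> oO bO neO cO eta0; have mO : measurable Omega by exact: open_measurable_rV.
have [C [m0 [C0 m00 hlog]]] := log_cutoff oO bO neO cO.
have [B B0 hB] := c_const_bounded (R := R) n.
(* Enough scales for the quotient of the energy bound by the lower bound [m0] of the norm to be at
   most [eta]. *)
pose m := (Num.truncn (B * C / (m0 * eta))).+1.
have m_gt0 : 0 < m%:R :> R by rewrite ltr0n.
have mE : B * C / m%:R / m0 <= eta.
  have h : 0 <= B * C / (m0 * eta) by rewrite divr_ge0 ?mulr_ge0 ?ltW.
  have /andP[_ /ltW] := truncn_itv h; rewrite -/m ler_pdivrMr ?mulr_gt0// => h1.
  by rewrite ler_pdivrMr// ler_pdivrMr//; apply: le_trans h1 _; rewrite le_eqVlt; apply/orP; left; apply/eqP; ring.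
have [phi [l [l0 tphi L2_ge en]]] := hlog m isT.
(* For [t < l/2] Bernoulli gives [l^(-2t) <= 1 + 2t/l <= 2]. *)
exists (Num.min 16^-1 (l / 2)); first by rewrite lt_min divr_gt0// invr_gt0 ltr0n.
move=> t /andP[t0]; rewrite lt_min => /andP[t16 tl].
have t01 : 0 < t <= 16^-1 by rewrite t0 ltW.
have t2 : 0 < t < 2^-1 by rewrite t0; lra.
have t8 : 0 < t < 8^-1 by rewrite t0; lra.
have c0 := c_const_gt0 n t2.
have l2 : l `^ (- (2 * t)) <= 2.
  rewrite -powR_inv_base//; have li : 0 < l^-1 by rewrite invr_gt0.
  apply: (@le_trans _ _ ((1 + l^-1) `^ (2 * t))).
    by apply: ge0_ler_powR; rewrite ?nnegrE ?lerDr ?addr_ge0 ?mulr_ge0 ?(ltW li) ?(ltW t0).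
  have h : 0 < 2 * t < 1 by lra.
  have := powR_Bernoulli h (ltW li).
  have : 2 * t * l^-1 <= 1 by rewrite ler_pdivrMr//; lra.
  lra.
have Cm : 0 <= C / m%:R by rewrite divr_ge0 ?ltW.
have en2 := en t t01.
have [L2fin H0] : (sqnorm_L2 Omega phi < +oo)%E /\ in_H0s (2^-1 + t) Omega phi.
  by apply: test_fun_H0s => //; apply: le_lt_trans en2 _; exact: ltry.
have mphi : measurable_fun Omega phi.
  by apply: measurable_funTS; apply: continuous_measurable_rV; exact: (test_fun_continuous tphi).
have L2_gt0 : (0 < sqnorm_L2 Omega phi)%E by apply: lt_le_trans L2_ge; rewrite lte_fin.
pose q := fine (sqnorm_L2 Omega phi).
have qE : sqnorm_L2 Omega phi = q%:E by rewrite fineK// ge0_fin_numE// ltW.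
have q0 : 0 < q by rewrite -lte_fin -qE.
have m0q : m0 <= q by rewrite -lee_fin -qE.
have semi_le : (seminorm (2^-1 + t) Omega phi <= (B * C / m%:R)%:E)%E.
  rewrite seminormE.
  have c2 : (0 <= (c_const n.+1 (2^-1 + t) / 2)%:E)%E by rewrite lee_fin divr_ge0// ltW.
  apply: le_trans (lee_wpmul2l c2 en2) _; rewrite -EFinM lee_fin.
  have -> : B * C / m%:R = B / 2 * (C / m%:R * 2) by field; rewrite gt_eqF.
  apply: ler_pM.
  - by rewrite divr_ge0// ltW.
  - by rewrite mulr_ge0 ?powR_ge0.
  - by apply: ler_wpM2r; [rewrite invr_ge0|exact: hB].
  - exact: ler_wpM2l.
have h0 : 0 <= hardy_const n.+1 (2^-1 + t).
  rewrite /hardy_const kappaE; apply: mulr_ge0; first exact: ltW.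
  by apply: mulr_ge0; [apply: ltW; apply: Acst_gt0; rewrite ltrDl addr_gt0|have /andP[] := gam_le t8].
apply: (@le_trans _ _ (rayleigh (2^-1 + t) Omega phi)).
  by apply: ereal_inf_lbound; exists phi => //; split=> //; exact: not_ae0.
rewrite /rayleigh qE inver gt_eqF//.
apply: (@le_trans _ _ ((B * C / m%:R)%:E * (q^-1)%:E)%E).
  apply: lee_wpmul2r; first by rewrite lee_fin invr_ge0 ltW.
  apply: le_trans semi_le; apply: geeDl; rewrite oppe_le0.
  by apply: mule_ge0; [rewrite lee_fin|exact: hardy_ge0].
rewrite -EFinM lee_fin; apply: le_trans mE; apply: ler_wpM2l; last by rewrite lef_pV2.
by rewrite divr_ge0 ?mulr_ge0 ?ltW.
Qed.

End conclusion.

Theorem theorem1p9 (R : realType) (N : nat) (Omega : set 'rV[R]_N)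
    (N_ge2 : (2 <= N)%N) (Omega_domain : domain Omega)
    (Omega_bounded : bounded_set Omega) (Omega_C11 : class_C11 Omega) :
  (exists2 s_star : R, 2^-1 < s_star <= 1 &
     forall s : R, 2^-1 < s < s_star -> (0 <= lambda_star s Omega)%E) /\
  lambda_star s Omega @[s --> (2^-1 : R)^'+] --> 0%E.
Proof.
case: N Omega N_ge2 Omega_domain Omega_bounded Omega_C11 => // n Omega _ [neO oO _] bO cO.
have [t0 /andP[t00 t0_le] nonneg] := lambda_star_nonneg oO bO neO cO.
have sE (s : R) : s = 2^-1 + (s - 2^-1) by rewrite addrC subrK.
have ge0 (s : R) : 2^-1 < s < 2^-1 + t0 -> (0 <= lambda_star s Omega)%E.
  by move=> /andP[s1 s2]; rewrite (sE s); apply: nonneg; apply/andP; split; lra.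
split; first by exists (2^-1 + t0) => //; apply/andP; split; lra.
have bounds (e : R) : 0 < e ->
    \forall s \near (2^-1 : R)^'+, (0 <= lambda_star s Omega)%E /\ (lambda_star s Omega <= e%:E)%E.
  move=> e0; have [t1 t10 le_e] := lambda_star_le oO bO neO cO e0.
  have m0 : 2^-1 < 2^-1 + Num.min t0 t1 by rewrite ltrDl lt_min t00.
  near=> s.
  have s1 : 2^-1 < s by near: s; exact: nbhs_right_gt.
  have : s < 2^-1 + Num.min t0 t1 by near: s; exact: nbhs_right_lt.
  rewrite -ltrBlDl lt_min => /andP[s2 s3]; split.
    by apply: ge0; apply/andP; split; lra.
  by rewrite (sE s); apply: le_e; apply/andP; split; lra.
(* Convergence in the extended reals: the values are eventually finite, and then converge as
   reals. *)
apply/fine_cvgP; split.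
  near=> s.
  have [h1 h2] : (0 <= lambda_star s Omega)%E /\ (lambda_star s Omega <= 1%:E)%E.
    by near: s; apply: bounds.
  by rewrite ge0_fin_numE// (le_lt_trans h2)// ltry.
apply/cvgrPdist_le => e e0; near=> s.
have [h1 h2] : (0 <= lambda_star s Omega)%E /\ (lambda_star s Omega <= e%:E)%E.
  by near: s; apply: bounds.
rewrite sub0r normrN /= ger0_norm ?fine_ge0// -lee_fin fineK//.
by rewrite ge0_fin_numE// (le_lt_trans h2)// ltry.
Unshelve. all: by end_near.
Qed.
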